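(* Let $\tau\in(0,1]$, let $\rho_0\ge0$ be a finite Radon measure on $\mathbb{R}$ and $u_0\in L^\infty_{\rho_0}(\mathbb{R})$. Assume that $(m_1,u_1)$ and $(m_2,u_2)$ are two entropy solutions (in the sense defined in the context) of $$\rho_t+(\rho u)_x=0,\qquad (\rho u)_t+(\rho u^2)_x=-\rho\Phi_x-\frac{\rho u}{\tau},\qquad \Phi_{xx}=\rho\qquad\text{on }\mathbb{R}\times(0,\infty)$$ with the same initial data $(\rho_0,u_0)$, where $\rho_i=(m_i)_x$. Then $m_1=m_2$ almost everywhere, and $u_1=u_2$ almost everywhere with respect to the measure $m_{1x}=m_{2x}$.
   Context: $M=\rho_0(\mathbb{R})<\infty$; $m(x,t)=\int_{-\infty}^{x-}\rho(\eta,t)\,\mathrm{d}\eta=\rho(\cdot,t)((-\infty,x))$ is the cumulative distribution function of the measure $\rho(\cdot,t)$, and $\widetilde m(x,t)=\frac12(m(x-,t)+m(x+,t)-M)$ plays the role of $\Phi_x$. **Weak solution.** Let $m(x,t)\in[0,M]$ be nondecreasing in $x$, $u(x,t)$ bounded and measurable with respect to $m_x$, with the measures $m_x$ and $um_x$ weakly continuous in $t$. $(\rho,u)=(m_x,u)$ (equivalently $(m,u)$) is a weak solution with initial data $(\rho_0,u_0)$ if for all $\varphi,\psi\in C_c^\infty(\mathbb{R}\times(0,\infty))$ $$\iint\varphi_t m\,\mathrm{d}x\mathrm{d}t-\iint\varphi u\,\mathrm{d}m\,\mathrm{d}t=0,\qquad \iint(\psi_tu+\psi_xu^2)\,\mathrm{d}m\,\mathrm{d}t=\iint\Big(\widetilde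 m+\frac u\tau\Big)\psi\,\mathrm{d}m\,\mathrm{d}t$$ (Lebesgue–Stieltjes integrals in $x$), and as $t\to0+$ the measures $m_x$, $um_x$ converge weakly to $\rho_0$, $\rho_0u_0$. **Entropy solution.** A weak solution such that (i) for any $x_1<x_2$ and a.e. $t>0$, $\frac{u(x_2,t)-u(x_1,t)}{x_2-x_1}\le\frac1t$; (ii) the measure $\rho u^2=u^2m_x$ converges weakly to $\rho_0u_0^2$ as $t\to0+$. *)

(* Defs.v *)
From HB Require Import structures.
From mathcomp Require Import all_boot all_order all_algebra.
From mathcomp Require Import all_classical all_reals all_analysis.

Set Implicit Arguments.
Unset Strict Implicit.
Unset Printing Implicit Defensive.

Import Order.TTheory GRing.Theory Num.Theory.
Import numFieldNormedType.Exports.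

Local Open Scope classical_set_scope.
Local Open Scope ring_scope.

(* A finite Radon measure on the line is the same thing as a finite Borel
   measure. *)
Notation finmeas R := {finite_measure set (measurableTypeR R) -> \bar R}.

Section test_functions.
Context {R : realType}.

Definition tsupport (T : topologicalType) (f : T -> R) : set T :=
  closure [set x | f x != 0].

Definition Cc (phi : R -> R) : Prop :=
  continuous phi /\ compact (tsupport phi).

(* Points of R * R are pairs (x, t). *)
Definition d_x (f : R * R -> R) : R * R -> R := 'D_((1, 0) : R * R) f.
Definition d_t (f : R * R -> R) : R * R -> R := 'D_((0, 1) : R * R) f.

Fixpoint Ck (k : nat) (f : R * R -> R) : Prop :=
  continuous f /\
  if k is j.+1 then
    [/\ forall p, derivable f p (1, 0) /\ derivable f p (0, 1),
        Ck j (d_x f) & Ck j (d_t f)]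
  else True.

(* C_c^oo(R x (0, +oo)), each function being extended by zero to R * R. *)
Definition Cc_smooth (f : R * R -> R) : Prop :=
  [/\ forall k, Ck k f, compact (tsupport f) &
      tsupport f `<=` [set p | 0 < p.2]].

End test_functions.

(* Measurability with respect to the mu-completion of the sigma-algebra. *)
Definition measurable_wrt d (T : measurableType d) (R : realType)
    (mu : set T -> \bar R) (f : T -> R) : Prop :=
  exists g : T -> R, measurable_fun setT g /\ {ae mu, forall x, f x = g x}.

(* A family of measures rho t is only meaningful for t > 0; nothing below
   depends on its values at t <= 0. *)
Section pressureless_euler_poisson.
Context {R : realType}.

Definition m_of (rho : R -> finmeas R) (x t : R) : R := fine (rho t `]-oo, x[%classic).

Definition total_mass (rho0 : finmeas R) : R := fine (rho0 setT).

Definition m_tilde (rho0 : finmeas R) (rho : R -> finmeas R) (x t : R) : R :=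
  2^-1 * (lim (m_of rho y t @[y --> x^'-]) + lim (m_of rho y t @[y --> x^'+])
          - total_mass rho0).

(* The space-time measure m_x = rho_t(dx) dt on R x (0, +oo). *)
Definition m_x (rho : R -> finmeas R)
    (A : set (measurableTypeR R * measurableTypeR R)) : \bar R :=
  (\int[lebesgue_measure]_(t in `]0%R, +oo[) rho t (ysection A t))%E.

(* The measure w mu tested against phi. *)
Definition pairing (mu : finmeas R) (w phi : R -> R) : R :=
  \int[mu]_x (phi x * w x).

(* Weak continuity on (0, +oo) of the measures w(., t) rho_t, tested against
   C_c(R).  For solutions this is equivalent to testing against bounded
   continuous functions: rho_t(R) <= rho0(R), u is bounded and mass moves at
   bounded speed, so no mass escapes to infinity. *)
Definition weakly_continuous (rho : R -> finmeas R)
    (w : R -> R -> R) : Prop :=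
  forall phi : R -> R, Cc phi -> forall t : R, 0 < t ->
    {for t, continuous (fun s => pairing (rho s) (w ^~ s) phi)}.

(* w(., t) rho_t converges weakly to w0 rho0 as t -> 0+. *)
Definition weakly_initial (rho : R -> finmeas R) (w : R -> R -> R)
    (rho0 : finmeas R) (w0 : R -> R) : Prop :=
  forall phi : R -> R, Cc phi ->
    pairing (rho t) (w ^~ t) phi @[t --> 0^'+] --> pairing rho0 w0 phi.

(* m_of rho is automatically nondecreasing in x.  The condition ws_slice is
   what makes u(., t) rho_t a measure for every t. *)
Record weak_solution (tau : R) (rho0 : finmeas R) (u0 : R -> R)
    (rho : R -> finmeas R) (u : R -> R -> R) : Prop := WeakSolution {
  ws_range : forall x t, 0 < t -> 0 <= m_of rho x t <= total_mass rho0;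
  ws_bounded : exists C : R, forall x t, 0 < t -> `|u x t| <= C;
  ws_measurable : measurable_wrt (m_x rho) (fun p => u p.1 p.2);
  ws_slice : forall t, 0 < t -> measurable_wrt (rho t) (u ^~ t);
  ws_cont_rho : weakly_continuous rho (fun _ _ => 1);
  ws_cont_rhou : weakly_continuous rho u;
  ws_mass : forall phi : R * R -> R, Cc_smooth phi ->
    \int[lebesgue_measure]_(t in `]0, +oo[)
       (\int[lebesgue_measure]_x (d_t phi (x, t) * m_of rho x t))
    - \int[lebesgue_measure]_(t in `]0, +oo[)
       (\int[rho t]_x (phi (x, t) * u x t)) = 0;
  ws_momentum : forall psi : R * R -> R, Cc_smooth psi ->
    \int[lebesgue_measure]_(t in `]0, +oo[)
       (\int[rho t]_x (d_t psi (x, t) * u x t + d_x psi (x, t) * u x t ^+ 2))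
    = \int[lebesgue_measure]_(t in `]0, +oo[)
       (\int[rho t]_x ((m_tilde rho0 rho x t + u x t / tau) * psi (x, t)));
  ws_init_rho : weakly_initial rho (fun _ _ => 1) rho0 (fun=> 1);
  ws_init_rhou : weakly_initial rho u rho0 u0
}.

(* In es_oleinik the exceptional null set of times does not depend on
   (x1, x2); otherwise the condition would say nothing along moving curves,
   which can carry all the mass. *)
Record entropy_solution (tau : R) (rho0 : finmeas R) (u0 : R -> R)
    (rho : R -> finmeas R) (u : R -> R -> R) : Prop := EntropySolution {
  es_weak : weak_solution tau rho0 u0 rho u;
  es_oleinik : {ae lebesgue_measure, forall t : R, 0 < t ->
    forall x1 x2 : R, x1 < x2 -> (u x2 t - u x1 t) / (x2 - x1) <= 1 / t};
  es_init_rhou2 :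
    weakly_initial rho (fun x t => u x t ^+ 2) rho0 (fun x => u0 x ^+ 2)
}.

End pressureless_euler_poisson.

(* Main.v *)
Require Import Defs.
From HB Require Import structures.
From mathcomp Require Import all_boot all_order all_algebra.
From mathcomp Require Import all_classical all_reals all_analysis.
From mathcomp Require Import measurable_realfun ring lra.

Set Implicit Arguments.
Unset Strict Implicit.
Unset Printing Implicit Defensive.

Import Order.TTheory GRing.Theory Num.Theory.
Import numFieldNormedType.Exports.

Local Open Scope classical_set_scope.
Local Open Scope ring_scope.

(* Label the mass by w in ]0, M[, M = rho0(R): let X(., t) be the quantile
   function of rho_t and V = u(X, t), so that rho_t is the image of Lebesgue
   measure under X(., t).  In these labels m_tilde is w - M / 2, and particles
   that never collide would satisfy
     e^(t/tau) V(w, t) = V0(w) + tau (e^(t/tau) - 1) (M / 2 - w);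
   the deficit is the right-hand side minus the left-hand side.

   1. Let v' = - (w0 - M / 2) e^(r/tau) and y' = e^(- r/tau) v.  Testing the
      equations with a smoothed indicator of {x < y(r)} shows that
        e^(r/tau) int_{X < y} V - v m(y, r) + v w0 - tau e^(r/tau) w0 (M - w0) / 2
      is nonincreasing in r.  Taking w0 = m(x, t), y(t) = x, and minimising over
      the starting point y(0) gives int_{X < x} deficit >= 0 for every x.
   2. Let a be the logistic function and J = - int a(X) deficit >= 0.  Then
      J' = - int a'(X) V deficit.  Since |a''| <= a', the one-sided Lipschitz
      bound makes a' u - (1/t + C) a nonincreasing in x, so step 1 yields
      J' <= (1/t + C) J.  The convergence of rho u^2 at t = 0 makes J' tend to 0,
      hence J = o(t), and Gronwall's inequality gives J = 0.  Therefore
      int_{X < x} deficit = 0 for every x: the momentum at time t is a function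
      of m(., t) and of the initial data.
   3. For two solutions take w0 = m1(x, t) and an almost minimising path of
      step 1 ending at (x, t).  By step 2 the monotone quantity of the first
      solution stays above the minimum, while that of the second starts almost at
      the minimum.  Their difference is e^(r/tau) times the derivative of
        int (min(X1 - y, 0) - min(X2 - y, 0)) dw,
      so this integral is nonnegative at time t, and by symmetry it vanishes for
      all x.  Hence m1 = m2, and step 2 then gives u1 = u2. *)

(** * Bounded measurable functions *)

(** Mass may concentrate on moving curves, and u is fixed only rho_t-almost everywhere. The factor
    e^(t/tau) is the integrating factor of the damping, and the y of step 1 moves like a particle of
    label w0 that never collides. For this choice the derivative of the quantity of step 1 is a sum
    of two nonpositive terms, one from a' (V - y')^2 and one from w0 - w. The obstacle in step 2 is
    that the deficit contains V0(w), a function of the label, whereas the weak equations test only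
    with functions of (x, t). A weight th(w) is therefore encoded as P(m(x, t)) with P' = th; this
    is mollified, transported, and passed to the limit. The rate 1/t is borderline for Gronwall:
    e^(- C t) J / t is nonincreasing, so J -> 0 would not suffice, and J = o(t) does. In step 3 only
    the difference of the two negative parts is integrated, because rho0 need not have a first
    moment. *)

Section bounded_measurable.
Context d (T : measurableType d) (R : realType).
Implicit Types (D : set T) (f g : T -> R).

(** Integrands are kept bounded on sets of finite measure, so integrability reduces to this
    predicate, which is stable under the algebraic operations. *)
Definition bm D f :=
  measurable_fun D f /\ exists K, forall x, D x -> `|f x| <= K.

Lemma bm_cst D c : bm D (fun=> c).
Proof. by split; [exact: measurable_cst|exists `|c|]. Qed.

Lemma bmD D f g : bm D f -> bm D g -> bm D (fun x => f x + g x).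
Proof.
move=> [mf [K fK]] [mg [L gL]]; split; first exact: measurable_funD.
by exists (K + L) => x Dx; rewrite (le_trans (ler_normD _ _))// lerD ?fK ?gL.
Qed.

Lemma bmN D f : bm D f -> bm D (fun x => - f x).
Proof.
move=> [mf [K fK]]; split; first exact: measurableT_comp.
by exists K => x Dx; rewrite normrN fK.
Qed.

Lemma bmB D f g : bm D f -> bm D g -> bm D (fun x => f x - g x).
Proof. by move=> bf bg; apply: bmD => //; exact: bmN. Qed.

Lemma bmM D f g : bm D f -> bm D g -> bm D (fun x => f x * g x).
Proof.
move=> [mf [K fK]] [mg [L gL]]; split; first exact: measurable_funM.
by exists (K * L) => x Dx; rewrite normrM ler_pM ?fK ?gL.
Qed.

Lemma bmZ D c f : bm D f -> bm D (fun x => c * f x).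
Proof. by apply: bmM; exact: bm_cst. Qed.

Lemma bmX D n f : bm D f -> bm D (fun x => f x ^+ n).
Proof.
move=> bf; elim: n => [|n ih].
  by under eq_fun do rewrite expr0; exact: bm_cst.
by under eq_fun do rewrite exprS; exact: bmM.
Qed.

Lemma bm_norm D f : bm D f -> bm D (fun x => `|f x|).
Proof.
move=> [mf [K fK]]; split; first exact: measurableT_comp.
by exists K => x Dx; rewrite normr_id fK.
Qed.

Lemma bm_sub D E f : measurable E -> D `<=` E -> bm E f -> bm D f.
Proof.
move=> mE DE [mf [K fK]]; split; first exact: measurable_funS mf.
by exists K => x /DE; exact: fK.
Qed.

Lemma bm_eq D f g : {in D, f =1 g} -> bm D f -> bm D g.
Proof.
move=> fg [mf [K fK]]; split; first exact: eq_measurable_fun mf.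
by exists K => x Dx; rewrite -fg ?inE//; exact: fK.
Qed.

End bounded_measurable.

Lemma bm_comp d (T : measurableType d) d' (T' : measurableType d')
    (R : realType) (D : set T) (X : T -> T') (g : T' -> R) :
  measurable_fun D X -> bm setT g -> bm D (fun x => g (X x)).
Proof.
move=> mX [mg [K gK]]; split; first exact: (measurableT_comp mg).
by exists K => x _; exact: gK.
Qed.

Section bounded_integral.
Context d (T : measurableType d) (R : realType).
Variables (mu : {measure set T -> \bar R}) (D : set T).
Hypotheses (mD : measurable D) (finD : (mu D < +oo)%E).
Implicit Types (f g : T -> R).

Lemma bm_integrable f : bm D f -> mu.-integrable D (EFin \o f).
Proof.
move=> [mf [K fK]]; apply: measurable_bounded_integrable => //.
exists K; split; first exact: num_real.
by move=> L KL x /= Dx; rewrite (le_trans (fK _ Dx))// ltW.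
Qed.

Lemma bm_intD f g : bm D f -> bm D g ->
  \int[mu]_(x in D) (f x + g x) =
  \int[mu]_(x in D) f x + \int[mu]_(x in D) g x.
Proof. by move=> bf bg; rewrite RintegralD//; exact: bm_integrable. Qed.

Lemma bm_intB f g : bm D f -> bm D g ->
  \int[mu]_(x in D) (f x - g x) =
  \int[mu]_(x in D) f x - \int[mu]_(x in D) g x.
Proof. by move=> bf bg; rewrite RintegralB//; exact: bm_integrable. Qed.

Lemma bm_intZ c f : bm D f ->
  \int[mu]_(x in D) (c * f x) = c * \int[mu]_(x in D) f x.
Proof. by move=> bf; rewrite RintegralZl//; exact: bm_integrable. Qed.

Lemma bm_intN f : bm D f ->
  \int[mu]_(x in D) (- f x) = - \int[mu]_(x in D) f x.
Proof.
move=> bf; rewrite -mulN1r -bm_intZ//; apply: eq_Rintegral => x _.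
by rewrite mulN1r.
Qed.

Lemma bm_int_le f g : bm D f -> bm D g -> (forall x, D x -> f x <= g x) ->
  \int[mu]_(x in D) f x <= \int[mu]_(x in D) g x.
Proof. by move=> bf bg fg; apply: le_Rintegral => //; exact: bm_integrable. Qed.

Lemma bm_int_norm f : bm D f ->
  `|\int[mu]_(x in D) f x| <= \int[mu]_(x in D) `|f x|.
Proof. by move=> bf; apply: le_normr_Rintegral => //; exact: bm_integrable. Qed.

Lemma bm_int_bound K f : bm D f -> (forall x, D x -> `|f x| <= K) ->
  `|\int[mu]_(x in D) f x| <= K * fine (mu D).
Proof.
move=> bf fK; rewrite (le_trans (bm_int_norm bf))//.
rewrite -Rintegral_cst//; apply: bm_int_le => //; first exact: bm_norm.
exact: bm_cst.
Qed.

Lemma bounded_convergence (f_ : nat -> T -> R) f K :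
  (forall n, measurable_fun D (f_ n)) ->
  (forall n x, D x -> `|f_ n x| <= K) ->
  (forall x, D x -> f_ n x @[n --> \oo] --> f x) ->
  (\int[mu]_(x in D) f_ n x) @[n --> \oo] --> \int[mu]_(x in D) f x.
Proof.
move=> mf fK ff.
have mfl : measurable_fun D f by exact: measurable_fun_cvg ff.
have bfl : bm D f.
  split => //; exists K => x Dx.
  have := ff _ Dx; move/cvg_norm => h.
  apply: (cvgr_to_le h); near=> n; exact: fK.
have h := @dominated_convergence _ _ _ mu D mD (fun n => EFin \o f_ n)
  (EFin \o f) (fun=> K%:E).
apply: fine_cvg.
rewrite fineK; last first.
  by apply: integrable_fin_num => //; exact: bm_integrable.
case: h => //.
- by move=> n; exact/measurable_EFinP.
- exact/measurable_EFinP.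
- apply: aeW => x Dx; apply: cvg_EFin; first by near=> n.
  exact: ff.
- by apply: (@bm_integrable (fun=> K)); exact: bm_cst.
- by apply: aeW => x n Dx; rewrite lee_fin fK.
Unshelve. all: by end_near. Qed.

End bounded_integral.

(* [u] is only almost everywhere equal to a Borel function, so integrals of
   nonmeasurable functions have to be compared. *)
Section nonmeasurable.
Context d (T : measurableType d) (R : realType).
Variables (mu : {measure set T -> \bar R}).
Local Open Scope ereal_scope.
Import HBNNSimple.

(** The integral of any nonnegative function is a supremum over the simple functions below it.
    Cutting such a simple function off on [N] puts it below [g] and does not change its integral. *)
Lemma ge0_ae_le_integral_nm (f g : T -> \bar R) (N : set T) :
  measurable N -> mu N = 0 ->
  (forall x, 0 <= f x) -> (forall x, 0 <= g x) ->
  (forall x, ~ N x -> f x = g x) ->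
  \int[mu]_x f x <= \int[mu]_x g x.
Proof.
move=> mN N0 f0 g0 fg; rewrite !ge0_integralTE//.
apply: ge_ereal_sup => _ [h hf <-].
apply: ereal_sup_ubound; exists (proj_nnsfun h (measurableC mN)).
  move=> x /=; rewrite mindicE; case: (pselect (N x)) => Nx.
    by rewrite memNset ?mulr0//= => /(_ Nx).
  by rewrite mem_set// mulr1 -fg.
rewrite -!integralT_nnsfun; apply: ae_eq_integral => //.
- exact/measurable_EFinP.
- exact/measurable_EFinP.
- exists N; split => // x /=; apply: contra_notP => Nx _.
  by rewrite mindicE mem_set// mulr1.
Qed.

Lemma ae_eq_integral_nm D (f g : T -> \bar R) :
  {ae mu, forall x, D x -> f x = g x} ->
  \int[mu]_(x in D) f x = \int[mu]_(x in D) g x.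
Proof.
move=> [N [mN N0 Nfg]].
have H x : ~ N x -> (f \_ D) x = (g \_ D) x.
  move=> Nx; rewrite !patchE; case: ifPn => // /set_mem Dx.
  by apply: contrapT => fg; apply: Nx; apply: Nfg => /(_ Dx).
rewrite !(integral_mkcond D) integralE [RHS]integralE.
by congr (_ - _); apply/eqP; rewrite eq_le; apply/andP; split;
  apply: (ge0_ae_le_integral_nm mN N0) => // x Nx;
  rewrite ?funeposE ?funenegE H.
Qed.

End nonmeasurable.

Lemma ae_eq_Rintegral_nm d (T : measurableType d) (R : realType)
    (mu : {measure set T -> \bar R}) D (f g : T -> R) :
  {ae mu, forall x, D x -> f x = g x} ->
  \int[mu]_(x in D) f x = \int[mu]_(x in D) g x.
Proof.
move=> fg; congr fine; apply: ae_eq_integral_nm.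
by apply: filterS fg => x h /h ->.
Qed.

Section fubini.
Context d1 (T1 : measurableType d1) d2 (T2 : measurableType d2) (R : realType).
Variables (m1 : {sigma_finite_measure set T1 -> \bar R})
          (m2 : {sigma_finite_measure set T2 -> \bar R}).
Variables (A : set T1) (B : set T2).
Hypotheses (mA : measurable A) (mB : measurable B).
Hypotheses (fA : (m1 A < +oo)%E) (fB : (m2 B < +oo)%E).
Variable F : T1 * T2 -> R.
Hypothesis bF : bm (A `*` B) F.

Let mAB : measurable (A `*` B). Proof. exact: measurableX. Qed.

(** Extension by zero, which reduces Fubini on the box to Fubini on the whole product. *)
Let G := (EFin \o F) \_ (A `*` B).

Let iG : (m1 \x m2)%E.-integrable setT G.
Proof.
rewrite /G; apply: (iffLR (integrable_mkcond (EFin \o F) mAB)).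
apply: (bm_integrable mAB _ bF).
by rewrite /= product_measure1E// lte_mul_pinfty// ge0_fin_numE.
Qed.

Let G1 x : A x -> (\int[m2]_y G (x, y) = \int[m2]_(y in B) (F (x, y))%:E)%E.
Proof.
move=> Ax; rewrite [RHS]integral_mkcond; apply: eq_integral => y _.
rewrite /G !patchE; congr (if _ then _ else _); apply/idP/idP; rewrite !inE/=.
  by case.
by split.
Qed.

Let G1' x : ~ A x -> (\int[m2]_y G (x, y) = 0)%E.
Proof.
move=> Ax; apply: integral0_eq => y _; rewrite /G patchE memNset//.
by case.
Qed.

Let G2 y : B y -> (\int[m1]_x G (x, y) = \int[m1]_(x in A) (F (x, y))%:E)%E.
Proof.
move=> Ax; rewrite [RHS]integral_mkcond; apply: eq_integral => x _.
rewrite /G !patchE; congr (if _ then _ else _); apply/idP/idP; rewrite !inE/=.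
  by case.
by split.
Qed.

Let G2' y : ~ B y -> (\int[m1]_x G (x, y) = 0)%E.
Proof.
move=> Ax; apply: integral0_eq => x _; rewrite /G patchE memNset//.
by case.
Qed.

Let b1 x : A x -> bm B (fun y => F (x, y)).
Proof.
move=> Ax; have [mF [K FK]] := bF; split.
  apply: (measurable_comp (F := A `*` B)) => //.
    by move=> _ [y By <-].
  exact: measurable_funTS.
by exists K => y By; apply: FK.
Qed.

Let b2 y : B y -> bm A (fun x => F (x, y)).
Proof.
move=> By; have [mF [K FK]] := bF; split.
  apply: (measurable_comp (F := A `*` B)) => //.
    by move=> _ [x Ax <-].
  exact: measurable_funTS.
by exists K => x Ax; apply: FK.
Qed.

Lemma bm_fubini1 : bm A (fun x => \int[m2]_(y in B) F (x, y)).
Proof.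
split; last first.
  have [mF [K FK]] := bF; exists (K * fine (m2 B)) => x Ax.
  by apply: bm_int_bound => //; [exact: b1|move=> y By; exact: FK].
have h := measurable_fubini_F iG.
have : measurable_fun A (fine \o fubini_F m2 G).
  by apply: measurableT_comp => //; exact: measurable_funTS.
apply: eq_measurable_fun => x /set_mem Ax.
by rewrite /= /fubini_F G1.
Qed.

Lemma bm_fubini2 : bm B (fun y => \int[m1]_(x in A) F (x, y)).
Proof.
split; last first.
  have [mF [K FK]] := bF; exists (K * fine (m1 A)) => x Ax.
  by apply: bm_int_bound => //; [exact: b2|move=> y By; exact: FK].
have h := measurable_fubini_G iG.
have : measurable_fun B (fine \o fubini_G m1 G).
  by apply: measurableT_comp => //; exact: measurable_funTS.
apply: eq_measurable_fun => x /set_mem Ax.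
by rewrite /= /fubini_G G2.
Qed.

Lemma bm_fubini :
  \int[m1]_(x in A) (\int[m2]_(y in B) F (x, y)) =
  \int[m2]_(y in B) (\int[m1]_(x in A) F (x, y)).
Proof.
have := Fubini iG.
have -> : (\int[m1]_x \int[m2]_y G (x, y) =
    \int[m1]_(x in A) (\int[m2]_(y in B) F (x, y))%:E)%E.
  rewrite [RHS]integral_mkcond; apply: eq_integral => x _; rewrite patchE.
  case: ifPn => [/set_mem Ax|/negP Ax]; last by rewrite G1'// => /mem_set.
  rewrite G1// fineK//; apply: integrable_fin_num => //.
  exact: bm_integrable (b1 Ax).
have -> : (\int[m2]_y \int[m1]_x G (x, y) =
    \int[m2]_(y in B) (\int[m1]_(x in A) F (x, y))%:E)%E.
  rewrite [RHS]integral_mkcond; apply: eq_integral => x _; rewrite patchE.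
  case: ifPn => [/set_mem Ax|/negP Ax]; last by rewrite G2'// => /mem_set.
  rewrite G2// fineK//; apply: integrable_fin_num => //.
  exact: bm_integrable (b2 Ax).
by move=> h; rewrite /Rintegral h.
Qed.

End fubini.

Ltac bm_tac := repeat lazymatch goal with
  | |- bm _ (fun _ => ?c) => exact: bm_cst
  | |- bm _ (fun _ => GRing.add _ (GRing.opp _)) => apply: bmB
  | |- bm _ (fun _ => GRing.add _ _) => apply: bmD
  | |- bm _ (fun _ => GRing.mul _ _) => apply: bmM
  | |- bm _ (fun _ => GRing.opp _) => apply: bmN
  | |- bm _ (fun _ => GRing.exp _ _) => apply: bmX
  | |- bm _ (fun _ => Num.Def.normr _) => apply: bm_norm
  | |- _ => assumption
  end.

(** * Smooth functions and test functions *)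

Section smooth.
Context {R : realType}.
Implicit Types (f g a b : R -> R) (k n : nat).

Lemma is_derive_addf f g (x df dg : R) : is_derive x 1 f df -> is_derive x 1 g dg ->
  is_derive x 1 (fun z => f z + g z) (df + dg).
Proof. by move=> hf hg; exact: (is_deriveD hf hg). Qed.

Lemma is_derive_oppf f (x df : R) : is_derive x 1 f df ->
  is_derive x 1 (fun z => - f z) (- df).
Proof. by move=> hf; exact: (is_deriveN hf). Qed.

Lemma is_derive_mulf f g (x df dg : R) : is_derive x 1 f df -> is_derive x 1 g dg ->
  is_derive x 1 (fun z => f z * g z) (df * g x + f x * dg).
Proof.
move=> hf hg; apply: (@is_derive_eq _ _ _ _ _ _ _ _ (is_deriveM hf hg)).
by rewrite /GRing.scale /= addrC [g x * _]mulrC.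
Qed.

Lemma is_derive_compf f g (x df dg : R) : is_derive (g x) 1 f df -> is_derive x 1 g dg ->
  is_derive x 1 (fun z => f (g z)) (df * dg).
Proof. by move=> hf hg; exact: (is_derive1_comp hf hg). Qed.

Lemma is_derive_continuous f (x df : R) : is_derive x 1 f df -> {for x, continuous f}.
Proof.
move=> h; apply: differentiable_continuous; apply/derivable1_diffP.
by case: h.
Qed.

Lemma is_derive_derive1 f g : (forall x : R, is_derive x 1 f (g x)) -> derive1 f = g.
Proof. by move=> h; apply/funext => x; rewrite derive1E; apply: derive_val. Qed.

(** An explicit derivative is demanded at each level, so that closure under products, compositions
    and inverses is a direct induction on k. *)
Fixpoint Dk k f : Prop :=
  if k is j.+1 then exists2 g, (forall x : R, is_derive x 1 f (g x)) & Dk j g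
  else continuous f.

Definition smooth f := forall k, Dk k f.

Lemma Dk_continuous k f : Dk k f -> continuous f.
Proof.
by case: k => [//|k] [g fg _] x; exact: is_derive_continuous (fg x).
Qed.

Lemma DkS k f : Dk k.+1 f -> Dk k f.
Proof.
elim: k f => [|k ih] f; first by move=> h; exact: Dk_continuous h.
by move=> [g fg gk]; exists g => //; exact: ih.
Qed.

Lemma smooth_continuous f : smooth f -> continuous f.
Proof. by move=> /(_ 0%N). Qed.

Lemma smooth_is_derive f (x : R) : smooth f -> is_derive x 1 f (derive1 f x).
Proof. by move=> /(_ 1%N) [g fg _]; rewrite (is_derive_derive1 fg). Qed.

Lemma smooth_derive1 f : smooth f -> smooth (derive1 f).
Proof. by move=> sf k; have [g fg gk] := sf k.+1; rewrite (is_derive_derive1 fg). Qed.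

Lemma Dk_cst k (c : R) : Dk k (fun=> c).
Proof.
elim: k c => [|k ih] c; first exact: cst_continuous.
by exists (fun=> 0) => // x; exact: is_derive_cst.
Qed.

Lemma Dk_id k : Dk k (fun x : R => x).
Proof.
case: k => [|k]; first by move=> x; exact: cvg_id.
by exists (fun=> 1); [move=> x; exact: is_derive_id|exact: Dk_cst].
Qed.

Lemma Dk_add k f g : Dk k f -> Dk k g -> Dk k (fun x => f x + g x).
Proof.
elim: k f g => [|k ih] f g; first by move=> cf cg x; apply: cvgD; [exact: cf|exact: cg].
move=> [f' hf kf] [g' hg kg]; exists (fun x => f' x + g' x); last exact: ih.
by move=> x; exact: is_derive_addf.
Qed.

Lemma Dk_mul k f g : Dk k f -> Dk k g -> Dk k (fun x => f x * g x).
Proof.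
elim: k f g => [|k ih] f g; first by move=> cf cg x; apply: cvgM; [exact: cf|exact: cg].
move=> hf0 hg0; have [hf1 hg1] := (DkS hf0, DkS hg0).
case: hf0 hg0 => [f' hf kf] [g' hg kg].
exists (fun x => f' x * g x + f x * g' x); last by apply: Dk_add; exact: ih.
by move=> x; exact: is_derive_mulf.
Qed.

Lemma Dk_comp k f g : Dk k f -> Dk k g -> Dk k (fun x => f (g x)).
Proof.
elim: k f g => [|k ih] f g.
  by move=> cf cg x; apply: continuous_comp; [exact: cg|exact: cf].
move=> hf0 hg0; have [hf1 hg1] := (DkS hf0, DkS hg0).
case: hf0 hg0 => [f' hf kf] [g' hg kg].
exists (fun x => f' (g x) * g' x); last by apply: Dk_mul => //; exact: ih.
by move=> x; exact: is_derive_compf.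
Qed.

Lemma Dk_inv k f : (forall x, f x != 0) -> Dk k f -> Dk k (fun x => (f x)^-1).
Proof.
move=> f0; elim: k => [|k ih]; first by move=> cf x; apply: cvgV; [exact: f0|exact: cf].
move=> hf0; have hf1 := ih (DkS hf0).
case: hf0 => [f' hf kf].
exists (fun x => - ((f x)^-1 * (f x)^-1 * f' x)).
  move=> x; apply: (@is_derive_eq _ _ _ _ _ _ _ _ (is_deriveV (f0 x) (hf x))).
  by rewrite /GRing.scale /= mulNr expr2 invfM.
have := Dk_mul (Dk_cst k (-1)) (Dk_mul (Dk_mul hf1 hf1) kf).
by congr Dk; apply/funext => x; rewrite mulN1r.
Qed.

Lemma Dk_expR k : Dk k (@expR R).
Proof.
elim: k => [|k ih]; first exact: continuous_expR.
by exists expR => // x; exact: is_derive_expR.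
Qed.

Lemma smooth_cst (c : R) : smooth (fun=> c).
Proof. by move=> k; exact: Dk_cst. Qed.

Lemma smooth_id : smooth (fun x => x).
Proof. by move=> k; exact: Dk_id. Qed.

Lemma smooth_add f g : smooth f -> smooth g -> smooth (fun x => f x + g x).
Proof. by move=> sf sg k; exact: Dk_add. Qed.

Lemma smooth_mul f g : smooth f -> smooth g -> smooth (fun x => f x * g x).
Proof. by move=> sf sg k; exact: Dk_mul. Qed.

Lemma smooth_opp f : smooth f -> smooth (fun x => - f x).
Proof.
move=> sf k; have := Dk_mul (Dk_cst k (-1)) (sf k).
by congr Dk; apply/funext => x; rewrite mulN1r.
Qed.

Lemma smooth_sub f g : smooth f -> smooth g -> smooth (fun x => f x - g x).
Proof. by move=> sf sg; apply: smooth_add => //; exact: smooth_opp. Qed.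

Lemma smooth_comp f g : smooth f -> smooth g -> smooth (fun x => f (g x)).
Proof. by move=> sf sg k; exact: Dk_comp. Qed.

Lemma smooth_inv f : (forall x, f x != 0) -> smooth f -> smooth (fun x => (f x)^-1).
Proof. by move=> f0 sf k; exact: Dk_inv. Qed.

Lemma smooth_expR : smooth (@expR R).
Proof. by move=> k; exact: Dk_expR. Qed.

(* The factor [x^-1 ^+ n] makes the family stable under differentiation. *)
Definition flat n (x : R) : R := if 0 < x then x^-1 ^+ n * expR (- x^-1) else 0.

Lemma flat_ge0 n x : 0 <= flat n x.
Proof.
by rewrite /flat; case: ifPn => // x0; rewrite mulr_ge0 ?expR_ge0// exprn_ge0// invr_ge0 ltW.
Qed.

(** With y = 1/x, the bound y^(n+1) / (n+1)! <= exp y gives y^n exp (- y) <= (n+1)! / y. It is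
    needed for differentiability at the origin. *)
Lemma flat_le n x : 0 <= x -> flat n x <= (n.+1)`!%:R * x.
Proof.
move=> x0; rewrite /flat; case: ifPn => [{}x0|_]; last by rewrite mulr_ge0.
have y0 : 0 < x^-1 by rewrite invr_gt0.
have h : x^-1 ^+ n.+1 <= (n.+1)`!%:R * expR x^-1.
  have := expR_ge1Dxn n (ltW y0) => h.
  rewrite mulrC -ler_pdivrMr ?ltr0n ?fact_gt0//.
  by apply: le_trans h; rewrite lerDr.
rewrite expRN ler_pdivrMr ?expR_gt0// mulrAC -ler_pdivrMr ?invr_gt0//.
by rewrite -exprSr.
Qed.

Lemma flat_derive n (x : R) : is_derive x 1 (flat n) (flat n.+2 x - n%:R * flat n.+1 x).
Proof.
have [x0|x0|x0] := ltgtP 0 x.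
- have h : is_derive x 1 (fun z => (z^-1) ^+ n * expR (- z^-1))
     (flat n.+2 x - n%:R * flat n.+1 x).
    have hV : is_derive x 1 (fun z : R => z^-1) (- x ^- 2).
      apply: (@is_derive_eq _ _ _ _ _ _ _ _ (is_deriveV (lt0r_neq0 x0) (is_derive_id x 1))).
      by rewrite /GRing.scale /= mulr1.
    have := is_deriveX n hV; rewrite exprfctE => hX.
    have hE := @is_derive_compf expR (fun z => - z^-1) _ _ _ (is_derive_expR (- x^-1)) (is_derive_oppf hV).
    apply: (@is_derive_eq _ _ _ _ _ _ _ _ (is_derive_mulf hX hE)).
    rewrite /flat x0 /GRing.scale /= opprK -exprVn !exprS.
    case: n {hX} => [|n]; first by rewrite /=; ring.
    by rewrite /= exprS; ring.
  apply: near_eq_is_derive h; near=> z.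
  by rewrite /flat ifT//; near: z; exact: lt_nbhsr.
- have -> : flat n.+2 x - n%:R * flat n.+1 x = 0.
    by rewrite /flat !ifN -?leNgt ?ltW// mulr0 subr0.
  apply: near_eq_is_derive (is_derive_cst 0 x 1).
  near=> z; rewrite /flat ifN// -leNgt ltW//; near: z.
  exact: lt_nbhsl.
- subst x.
  have -> : flat n.+2 0 - n%:R * flat n.+1 0 = 0 :> R by rewrite /flat ltxx mulr0 subr0.
  have h : h^-1 *: ((flat n \o shift 0) (h *: 1) - flat n 0) @[h --> 0^'] --> (0 : R).
    apply/cvgrPdist_le => /= e e0.
    have K0 : 0 < (n.+2)`!%:R :> R by rewrite ltr0n fact_gt0.
    near=> h.
    rewrite sub0r normrN /= addr0 /GRing.scale /= mulr1.
    have -> : flat n 0 = 0 by rewrite /flat ltxx.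
    rewrite subr0.
    have [h0|h0] := ltP 0 h; last first.
      by rewrite /flat ifN -?leNgt// mulr0 normr0 ltW.
    (* Dividing by h raises the index by one, so the difference quotient at 0 is again covered by
       [flat_le]. *)
    have -> : h^-1 * flat n h = flat n.+1 h by rewrite /flat h0 exprS mulrA.
    rewrite ger0_norm ?flat_ge0//; apply: le_trans (flat_le _ (ltW h0)) _.
    rewrite mulrC -ler_pdivlMr//.
    apply: le_trans (ler_norm _) _; near: h.
    apply: (@dnbhs0_le _ _ (e / (n.+2)`!%:R)); by rewrite divr_gt0.
  by apply: DeriveDef; [apply/cvg_ex; exists 0|exact/cvg_lim].
Unshelve. all: by end_near. Qed.

Lemma smooth_flat n : smooth (flat n).
Proof.
move=> k; elim: k n => [|k ih] n.
  by move=> x; exact: is_derive_continuous (flat_derive n x).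
exists (fun x => flat n.+2 x - n%:R * flat n.+1 x); first exact: flat_derive.
have := Dk_add (ih n.+2) (Dk_mul (Dk_cst k (- n%:R)) (ih n.+1)).
by congr Dk; apply/funext => x; rewrite mulNr.
Qed.

Lemma flat0_gt0 x : 0 < x -> 0 < flat 0 x.
Proof. by move=> x0; rewrite /flat x0 mulr_gt0 ?expR_gt0 ?exprn_gt0// invr_gt0. Qed.

Lemma flat_le0 n x : x <= 0 -> flat n x = 0.
Proof. by move=> x0; rewrite /flat ifN// -leNgt. Qed.

(** A smooth step rising from 0 at -1 to 1 at 1. The denominator is positive because 1 + x and 1 - x
    are never both nonpositive. *)
Definition sstep (x : R) : R := flat 0 (1 + x) / (flat 0 (1 + x) + flat 0 (1 - x)).

Lemma sstep_den_gt0 x : 0 < flat 0 (1 + x) + flat 0 (1 - x).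
Proof.
have [x0|x0] := leP 0 x.
  by rewrite ltr_pwDl ?flat_ge0// flat0_gt0// ltr_pwDl.
by rewrite ltr_wpDl ?flat_ge0// flat0_gt0// ltr_wpDl// oppr_gt0.
Qed.

Lemma smooth_sstep : smooth sstep.
Proof.
have s1 : smooth (fun x => flat 0 (1 + x)).
  by apply: smooth_comp (smooth_flat 0) _; exact: smooth_add (smooth_cst 1) smooth_id.
have s2 : smooth (fun x => flat 0 (1 - x)).
  apply: smooth_comp (smooth_flat 0) _.
  exact: smooth_sub (smooth_cst 1) smooth_id.
apply: smooth_mul => //; apply: smooth_inv; last exact: smooth_add.
by move=> x; rewrite gt_eqF// sstep_den_gt0.
Qed.

Lemma sstep_ge0 x : 0 <= sstep x.
Proof. by rewrite divr_ge0 ?flat_ge0// ltW// sstep_den_gt0. Qed.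

Lemma sstep_le1 x : sstep x <= 1.
Proof. by rewrite ler_pdivrMr ?sstep_den_gt0// mul1r lerDl flat_ge0. Qed.

Lemma sstep0 x : x <= -1 -> sstep x = 0.
Proof. by move=> x1; rewrite /sstep flat_le0 ?mul0r// addrC -lerBrDr sub0r. Qed.

Lemma sstep1 x : 1 <= x -> sstep x = 1.
Proof.
move=> x1; rewrite /sstep [flat 0 (1 - x)]flat_le0 ?subr_le0// addr0 divff//.
by rewrite gt_eqF// flat0_gt0// ltr_pwDl// (le_trans _ x1).
Qed.

Lemma flat0_homo : {homo flat 0 : x y / x <= y}.
Proof.
move=> x y xy; rewrite /flat !expr0 !mul1r; case: ifPn => x0; case: ifPn => y0 //.
- rewrite ler_expR lerN2 lef_pV2//.
- by move: y0; rewrite (lt_le_trans x0 xy).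
Qed.

Lemma sstep_homo : {homo sstep : x y / x <= y}.
Proof.
move=> x y xy; rewrite /sstep ler_pdivrMr ?sstep_den_gt0// mulrAC.
rewrite ler_pdivlMr ?sstep_den_gt0//.
have h1 : flat 0 (1 + x) <= flat 0 (1 + y) by apply: flat0_homo; rewrite lerD2l.
have h2 : flat 0 (1 - y) <= flat 0 (1 - x) by apply: flat0_homo; rewrite lerB.
have := flat_ge0 0 (1 + x); have := flat_ge0 0 (1 + y).
have := flat_ge0 0 (1 - x); have := flat_ge0 0 (1 - y).
nra.
Qed.

End smooth.

Section moving_tests.
Context {R : realType}.
Implicit Types (a b y : R -> R).

Lemma derivable_x (f : R * R -> R) (p : R * R) (d : R) :
  is_derive p.1 1 (fun x => f (x, p.2)) d -> derivable f p (1, 0) /\ d_x f p = d.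
Proof.
case=> h hd; rewrite /d_x /derivable /derive.
have E : (fun h : R => h^-1 *: ((f \o shift p) (h *: (1, 0)) - f p)) =
         (fun h : R => h^-1 *: (((fun x => f (x, p.2)) \o shift p.1) (h *: 1) - f (p.1, p.2))).
  apply/funext => r; congr (_ *: (_ - _)); last by case: p {h hd}.
  by rewrite /=; congr f; apply: injective_projections; rewrite /= ?scaler0 ?add0r.
by rewrite E.
Qed.

Lemma derivable_t (f : R * R -> R) (p : R * R) (d : R) :
  is_derive p.2 1 (fun t => f (p.1, t)) d -> derivable f p (0, 1) /\ d_t f p = d.
Proof.
case=> h hd; rewrite /d_t /derivable /derive.
have E : (fun h : R => h^-1 *: ((f \o shift p) (h *: (0, 1)) - f p)) =
         (fun h : R => h^-1 *: (((fun t => f (p.1, t)) \o shift p.2) (h *: 1) - f (p.1, p.2))).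
  apply/funext => r; congr (_ *: (_ - _)); last by case: p {h hd}.
  by rewrite /=; congr f; apply: injective_projections; rewrite /= ?scaler0 ?add0r.
by rewrite E.
Qed.

Lemma d_xD (f g : R * R -> R) p : derivable f p (1, 0) -> derivable g p (1, 0) ->
  derivable (fun p => f p + g p) p (1, 0) /\
  d_x (fun p => f p + g p) p = d_x f p + d_x g p.
Proof.
move=> hf hg; split; first exact: (@derivableD R _ _ f g p (1, 0) hf hg).
exact: (@deriveD R _ _ f g p (1, 0) hf hg).
Qed.

Lemma d_tD (f g : R * R -> R) p : derivable f p (0, 1) -> derivable g p (0, 1) ->
  derivable (fun p => f p + g p) p (0, 1) /\
  d_t (fun p => f p + g p) p = d_t f p + d_t g p.
Proof.
move=> hf hg; split; first exact: (@derivableD R _ _ f g p (0, 1) hf hg).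
exact: (@deriveD R _ _ f g p (0, 1) hf hg).
Qed.

Lemma continuous_addf (f g : R * R -> R) : continuous f -> continuous g ->
  continuous (fun p => f p + g p).
Proof. by move=> cf cg p; exact: (@cvgD _ _ _ _ _ f g _ _ (cf p) (cg p)). Qed.

Lemma Ck_add k (f g : R * R -> R) : Ck k f -> Ck k g -> Ck k (fun p => f p + g p).
Proof.
elim: k f g => [|k ih] f g /=.
  by move=> [cf _] [cg _]; split => //; exact: continuous_addf.
move=> [cf [df fx ft]] [cg [dg gx gt]]; split; first exact: continuous_addf.
have hx p := d_xD (proj1 (df p)) (proj1 (dg p)).
have ht p := d_tD (proj2 (df p)) (proj2 (dg p)).
split.
- by move=> p; split; [exact: (proj1 (hx p))|exact: (proj1 (ht p))].
- have -> : d_x (fun p => f p + g p) = (fun p => d_x f p + d_x g p).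
    by apply/funext => p; exact: (proj2 (hx p)).
  exact: ih.
- have -> : d_t (fun p => f p + g p) = (fun p => d_t f p + d_t g p).
    by apply/funext => p; exact: (proj2 (ht p)).
  exact: ih.
Qed.

(* Test functions centred on the moving point [y t]. *)
Definition mtest a y b (p : R * R) : R := a (p.1 - y p.2) * b p.2.

Lemma mtest_x a y b p : smooth a ->
  derivable (mtest a y b) p (1, 0) /\ d_x (mtest a y b) p = mtest (derive1 a) y b p.
Proof.
move=> sa; apply: derivable_x; rewrite /mtest /=.
have h : is_derive p.1 1 (fun x => a (x - y p.2)) (derive1 a (p.1 - y p.2)).
  have h1 : is_derive p.1 1 (fun x : R => x - y p.2) 1.
    have := @is_derive_addf _ _ _ p.1 _ _ (is_derive_id _ _) (is_derive_cst (- y p.2) p.1 1).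
    by rewrite addr0.
  have := @is_derive_compf _ a (fun x => x - y p.2) _ _ _ (smooth_is_derive (p.1 - y p.2) sa) h1.
  by rewrite mulr1.
have := is_derive_mulf h (is_derive_cst (b p.2) p.1 1).
by rewrite mulr0 addr0.
Qed.

Lemma mtest_t a y b p : smooth a -> smooth y -> smooth b ->
  derivable (mtest a y b) p (0, 1) /\ d_t (mtest a y b) p =
  mtest (derive1 a) y (fun t => - derive1 y t * b t) p + mtest a y (derive1 b) p.
Proof.
move=> sa sy sb; apply: derivable_t; rewrite /mtest /=.
have h : is_derive p.2 1 (fun t => a (p.1 - y t)) (derive1 a (p.1 - y p.2) * - derive1 y p.2).
  have h1 : is_derive p.2 1 (fun t : R => p.1 - y t) (- derive1 y p.2).
    have := @is_derive_addf _ _ _ p.2 _ _ (is_derive_cst p.1 p.2 1)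
      (is_derive_oppf (smooth_is_derive p.2 sy)).
    by rewrite add0r.
  exact: (@is_derive_compf _ a (fun t => p.1 - y t) _ _ _ (smooth_is_derive (p.1 - y p.2) sa) h1).
have := is_derive_mulf h (smooth_is_derive p.2 sb).
by rewrite -mulrA.
Qed.

Lemma mtest_continuous a y b : continuous a -> continuous y -> continuous b ->
  continuous (mtest a y b).
Proof.
move=> ca cy cb p; rewrite /mtest.
apply: cvgM.
  apply: (@continuous_comp _ _ _ (fun p : R * R => p.1 - y p.2) a); last exact: ca.
  apply: cvgB; first exact: cvg_fst.
  apply: (@continuous_comp _ _ _ (fun p : R * R => p.2) y); [exact: cvg_snd|exact: cy].
apply: (@continuous_comp _ _ _ (fun p : R * R => p.2) b); [exact: cvg_snd|exact: cb].
Qed.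

(** The family is stable under both derivatives: [d_x] replaces [a] by its derivative, and [d_t]
    gives a sum of two members. *)
Lemma Ck_mtest k a y b : smooth a -> smooth y -> smooth b -> Ck k (mtest a y b).
Proof.
elim: k a b => [|k ih] a b sa sy sb.
  by split => //; apply: mtest_continuous; exact: smooth_continuous.
split; first by apply: mtest_continuous; exact: smooth_continuous.
split.
- by move=> p; split; [have [] := mtest_x y b p sa|have [] := mtest_t p sa sy sb].
- have -> : d_x (mtest a y b) = mtest (derive1 a) y b.
    by apply/funext => p; have [_] := mtest_x y b p sa.
  by apply: ih => //; exact: smooth_derive1.
- have -> : d_t (mtest a y b) = fun p =>
      mtest (derive1 a) y (fun t => - derive1 y t * b t) p + mtest a y (derive1 b) p.
    by apply/funext => p; have [_] := mtest_t p sa sy sb.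
  apply: Ck_add; apply: ih => //; try exact: smooth_derive1.
  by apply: smooth_mul => //; apply: smooth_opp; exact: smooth_derive1.
Qed.

Lemma smooth_bounded_itv a (l r : R) : smooth a ->
  exists2 K, 0 <= K & forall x, l <= x <= r -> `|a x| <= K.
Proof.
move=> sa; have [lr|lr] := leP l r; last first.
  by exists 0 => // x /andP[lx xr]; move: lr; rewrite ltNge (le_trans lx xr).
have cna : {within `[l, r], continuous (fun x => `|a x|)}.
  apply: continuous_subspaceT => x; apply: (@continuous_comp _ _ _ a); last exact: norm_continuous.
  exact: smooth_continuous.
have [c cin cm] := EVT_max lr cna.
by exists `|a c| => // x xin; apply: cm; rewrite in_itv.
Qed.

(** Compact support encoded by a radius, which is easy to track under shifts and derivatives. *)
Definition suppin a (A : R) := forall x, A < `|x| -> a x = 0.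

Lemma smooth_suppin_derive1 a A : smooth a -> suppin a A -> suppin (derive1 a) A.
Proof.
move=> sa aA x Ax.
rewrite derive1E (@near_eq_derive _ _ _ a (cst 0)) ?derive_cst//.
near=> z; apply: aA; near: z.
apply: (@cvgr_gt _ _ _ _ (fun z : R => `|z|) `|x|) => //.
exact: norm_continuous.
Unshelve. all: by end_near. Qed.

Lemma smooth_suppin_bounded a A : smooth a -> suppin a A ->
  exists2 K, 0 <= K & forall x, `|a x| <= K.
Proof.
move=> sa aA; have [K K0 hK] := smooth_bounded_itv (- A) A sa.
exists K => // x; have [xA|xA] := ltP A `|x|; first by rewrite aA// normr0.
by apply: hK; rewrite -ler_norml.
Qed.

Lemma Cc_smooth_mtest a y b (A s t : R) : smooth a -> smooth y -> smooth b ->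
  suppin a A -> 0 < s -> (forall r, ~~ (s <= r <= t) -> b r = 0) ->
  Cc_smooth (mtest a y b).
Proof.
move=> sa sy sb aA s0 bst.
have [Y Y0 hY] := smooth_bounded_itv s t sy.
pose K : set (R * R) := `[- (A + Y), A + Y] `*` `[s, t].
have cK : compact K by apply: compact_setX; exact: segment_compact.
have clK : closed K by apply: compact_closed => //; exact: norm_hausdorff.
have sub : tsupport (mtest a y b) `<=` K.
  rewrite /tsupport closureE; apply: bigcap_inf; split => // -[x r] /= nz.
  rewrite /mtest /= in nz.
  have br : s <= r <= t.
    by apply: contraT => /bst b0; move: nz; rewrite b0 mulr0 eqxx.
  split; rewrite /= in_itv//=.
  rewrite -ler_norml; have [h|h] := leP `|x| (A + Y) => //.
  move: nz; rewrite aA ?mul0r ?eqxx//.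
  have := hY _ br; have := lerB_normD x (- y r); rewrite normrN; lra.
split.
- by move=> k; exact: Ck_mtest.
- by apply: (subclosed_compact _ cK) => //; exact: closed_closure.
- by move=> p /sub [_]; rewrite /= in_itv/= => /andP[+ _]; exact: lt_le_trans.
Qed.

End moving_tests.

(** * Integration in time and distributional derivatives *)

Section time_integrals.
Context {R : realType}.
Notation leb := (@lebesgue_measure R).
Implicit Types (f g k P : R -> R) (s t r : R).

Lemma leb_itv_fin s t : (leb `[s, t] < +oo)%E.
Proof. by rewrite /= lebesgue_measure_itv /=; case: ifP => _; rewrite ?ltry. Qed.

Lemma leb_itvoo_fin s t : (leb `]s, t[ < +oo)%E.
Proof. by rewrite /= lebesgue_measure_itv /=; case: ifP => _; rewrite ?ltry. Qed.

Definition cintD s t := @bm_intD _ _ _ leb `[s, t] (measurable_itv _) (leb_itv_fin s t).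
Definition cintB s t := @bm_intB _ _ _ leb `[s, t] (measurable_itv _) (leb_itv_fin s t).
Definition cintZ s t := @bm_intZ _ _ _ leb `[s, t] (measurable_itv _) (leb_itv_fin s t).
Definition cintN s t := @bm_intN _ _ _ leb `[s, t] (measurable_itv _) (leb_itv_fin s t).
Definition cint_le s t := @bm_int_le _ _ _ leb `[s, t] (measurable_itv _) (leb_itv_fin s t).
Definition cint_norm s t := @bm_int_norm _ _ _ leb `[s, t] (measurable_itv _) (leb_itv_fin s t).
Definition cint_bound s t := @bm_int_bound _ _ _ leb `[s, t] (measurable_itv _) (leb_itv_fin s t).
Definition cint_cvg s t := @bounded_convergence _ _ _ leb `[s, t] (measurable_itv _) (leb_itv_fin s t).
Definition ointD s t := @bm_intD _ _ _ leb `]s, t[ (measurable_itv _) (leb_itvoo_fin s t).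
Definition ointB s t := @bm_intB _ _ _ leb `]s, t[ (measurable_itv _) (leb_itvoo_fin s t).
Definition ointZ s t := @bm_intZ _ _ _ leb `]s, t[ (measurable_itv _) (leb_itvoo_fin s t).
Definition ointN s t := @bm_intN _ _ _ leb `]s, t[ (measurable_itv _) (leb_itvoo_fin s t).
Definition oint_le s t := @bm_int_le _ _ _ leb `]s, t[ (measurable_itv _) (leb_itvoo_fin s t).
Definition oint_norm s t := @bm_int_norm _ _ _ leb `]s, t[ (measurable_itv _) (leb_itvoo_fin s t).
Definition oint_bound s t := @bm_int_bound _ _ _ leb `]s, t[ (measurable_itv _) (leb_itvoo_fin s t).
Definition oint_cvg s t := @bounded_convergence _ _ _ leb `]s, t[ (measurable_itv _) (leb_itvoo_fin s t).

Lemma fine_leb_itv s t : s <= t -> fine (leb `[s, t]) = t - s.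
Proof.
move=> st; rewrite /= lebesgue_measure_itv /= lte_fin; case: ltP => // ts.
by have -> : s = t; [apply/eqP; rewrite eq_le st|rewrite subrr].
Qed.

Lemma fine_leb_itvoo s t : s <= t -> fine (leb `]s, t[) = t - s.
Proof.
move=> st; rewrite /= lebesgue_measure_itv /= lte_fin; case: ltP => // ts.
by have -> : s = t; [apply/eqP; rewrite eq_le st|rewrite subrr].
Qed.

Lemma bm_itv_split f s r t : s <= r -> r <= t -> bm `[s, t] f ->
  \int[leb]_(x in `[s, t]) f x =
  \int[leb]_(x in `[s, r]) f x + \int[leb]_(x in `[r, t]) f x.
Proof.
move=> sr rt bf.
have i1 : leb.-integrable `[s, t] (EFin \o f).
  by apply: bm_integrable => //; exact: leb_itv_fin.
have i2 : leb.-integrable `[r, t] (EFin \o f).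
  apply: integrableS i1 => //.
  by apply: subset_itvr; rewrite bnd_simp.
rewrite -(Rintegral_itv_obnd_cbnd (r := r)); last first.
  apply: integrableS i2 => //.
  by apply: subset_itvr; rewrite bnd_simp.
rewrite -(Rintegral_itvB i1)//.
by rewrite addrC subrK.
Qed.

Lemma bm_sub_itv f s t s' t' : s <= s' -> t' <= t -> bm `[s, t] f -> bm `[s', t'] f.
Proof.
move=> ss tt; apply: bm_sub => // x /=; rewrite !in_itv/= => /andP[h1 h2].
by rewrite (le_trans ss)//= (le_trans h2).
Qed.

Lemma int_derive1 f s t : s <= t -> smooth f ->
  \int[leb]_(x in `[s, t]) derive1 f x = f t - f s.
Proof.
rewrite le_eqVlt => /predU1P[<-|st] sf.
  by rewrite set_itv1 Rintegral_set1 subrr.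
have cf := smooth_continuous sf.
rewrite /Rintegral (@continuous_FTC2 _ _ f)//.
- by apply: continuous_subspaceT; apply: smooth_continuous; exact: smooth_derive1.
- split.
  + by move=> x _; case: (smooth_is_derive x sf).
  + exact/cvg_at_right_filter/cf.
  + exact/cvg_at_left_filter/cf.
Qed.

Lemma bm_smooth f s t : smooth f -> bm `[s, t] f.
Proof.
move=> sf; split.
  by apply: measurable_funTS; apply: continuous_measurable_fun; exact: smooth_continuous.
have [K _ hK] := smooth_bounded_itv s t sf.
by exists K => x; rewrite /= in_itv/=; exact: hK.
Qed.

Lemma measurable_pos_continuous f : (forall t, 0 < t -> {for t, continuous f}) ->
  measurable_fun (`]0%R, +oo[%classic : set R) f.
Proof.
move=> cf; apply: open_continuous_measurable_fun; first exact: interval_open.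
by move=> x; rewrite inE/= in_itv/= andbT => /cf.
Qed.

Lemma Rint_support f s t : 0 < s -> (forall r, ~~ (s <= r <= t) -> f r = 0) ->
  \int[leb]_(r in `]0%R, +oo[) f r = \int[leb]_(r in `[s, t]) f r.
Proof.
move=> s0 fst; rewrite Rintegral_mkcond [RHS]Rintegral_mkcond.
congr Rintegral; apply/funext => r; rewrite !patchE.
have [h|h] := boolP (s <= r <= t).
  rewrite !mem_set//= in_itv/= ?andbT//; case/andP: h => sr _.
  exact: lt_le_trans s0 sr.
by rewrite fst//; do 2 case: ifP.
Qed.

(** An approximate Dirac mass at s: nonnegative, supported in [s - d, s + d], of integral 1, and
    equal to the derivative of a rescaled step. *)
Definition sbump s d r : R := derive1 sstep ((r - s) / d) / d.

Lemma is_derive_sstep_shift s d r : is_derive r 1 (fun z => sstep ((z - s) / d)) (sbump s d r).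
Proof.
have h : is_derive r 1 (fun z : R => (z - s) / d) (1 / d).
  have h0 := is_derive_addf (is_derive_id r 1) (is_derive_cst (- s) r 1).
  have := is_derive_mulf h0 (is_derive_cst d^-1 r 1).
  by rewrite mulr0 !addr0.
have := @is_derive_compf _ sstep (fun z => (z - s) / d) _ _ _ (smooth_is_derive _ smooth_sstep) h.
by rewrite mulrA mulr1.
Qed.

Lemma smooth_sstep_shift s d : smooth (fun z => sstep ((z - s) / d)).
Proof.
apply: smooth_comp smooth_sstep _; apply: smooth_mul; last exact: smooth_cst.
by apply: smooth_sub; [exact: smooth_id|exact: smooth_cst].
Qed.

Lemma derive1_sstep_shift s d : derive1 (fun z => sstep ((z - s) / d)) = sbump s d.
Proof. by apply: is_derive_derive1 => r; exact: is_derive_sstep_shift. Qed.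

Lemma derive1_sstep_ge0 (x : R) : 0 <= derive1 sstep x.
Proof.
have h (y : R) : is_derive y 1 sstep (derive1 sstep y) by exact: smooth_is_derive smooth_sstep.
rewrite derive1E; case: (h x) => hx _.
have hx1 : h^-1 *: ((sstep \o shift x) (h *: 1) - sstep x) @[h --> 0^'] --> 'D_1 sstep x := hx.
apply: (cvgr_to_ge hx1).
near=> z; rewrite /GRing.scale /= mulr1.
have [z0|z0] := leP 0 z.
  by rewrite mulr_ge0 ?invr_ge0// subr_ge0 sstep_homo// lerDr.
by rewrite mulr_le0 ?invr_le0 ?(ltW z0)// subr_le0 sstep_homo// gerDr ltW.
Unshelve. all: by end_near. Qed.

Lemma derive1_sstep0 (x : R) : 1 < `|x| -> derive1 sstep x = 0.
Proof.
move=> x1; rewrite derive1E.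
have [x0|x0] := leP 0 x.
  have {}x1 : 1 < x by rewrite ger0_norm in x1.
  rewrite (@near_eq_derive _ _ _ sstep (cst 1)) ?derive_cst//.
  by near=> z; rewrite sstep1// ltW//; near: z; exact: lt_nbhsr.
have {}x1 : x < -1 by rewrite ltrNr; rewrite ltr0_norm in x1.
rewrite (@near_eq_derive _ _ _ sstep (cst 0)) ?derive_cst//.
by near=> z; rewrite sstep0// ltW//; near: z; exact: lt_nbhsl.
Unshelve. all: by end_near. Qed.

Lemma sbump_ge0 s d r : 0 < d -> 0 <= sbump s d r.
Proof. by move=> d0; rewrite mulr_ge0 ?derive1_sstep_ge0// invr_ge0 ltW. Qed.

Lemma sbump0 s d r : 0 < d -> d < `|r - s| -> sbump s d r = 0.
Proof.
move=> d0 h; rewrite /sbump derive1_sstep0 ?mul0r// normrM normfV (gtr0_norm d0).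
by rewrite ltr_pdivlMr// mul1r.
Qed.

Lemma smooth_sbump s d : smooth (sbump s d).
Proof. by rewrite -derive1_sstep_shift; apply: smooth_derive1; exact: smooth_sstep_shift. Qed.

Lemma int_sbump s d l u : 0 < d -> l <= s - d -> s + d <= u ->
  \int[leb]_(r in `[l, u]) sbump s d r = 1.
Proof.
move=> d0 ls su; rewrite -derive1_sstep_shift int_derive1//; last first.
- exact: smooth_sstep_shift.
- by lra.
rewrite sstep1 ?sstep0 ?subr0//.
- by rewrite ler_pdivrMr// mulN1r; lra.
- by rewrite ler_pdivlMr// mul1r; lra.
Qed.

Lemma sbump_cvg P (s l u : R) (d : nat -> R) :
  bm `[l, u] P -> l < s < u -> {for s, continuous P} ->
  (forall n, 0 < d n) -> d n @[n --> \oo] --> 0 ->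
  \int[leb]_(r in `[l, u]) (sbump s (d n) r * P r) @[n --> \oo] --> P s.
Proof.
move=> bP /andP[ls su] cP d0 d_0; apply/cvgrPdist_le => /= e e0.
have /cvgrPdist_le/(_ _ e0) := cP.
move=> /nbhs_ballP[r0 /= r00 hr0].
near=> n.
have dn : d n < Num.min r0 (Num.min (s - l) (u - s)).
  rewrite (le_lt_trans (ler_norm _))//.
  near: n; move/cvgr0_norm_lt: d_0; apply.
  by rewrite !lt_min r00 !subr_gt0 ls su.
move: dn; rewrite !lt_min => /and3P[dr dsl dus].
have bs : bm `[l, u] (sbump s (d n)) by apply: bm_smooth; exact: smooth_sbump.
have I1 : \int[leb]_(r in `[l, u]) sbump s (d n) r = 1.
  by rewrite int_sbump// ltW//; lra.
have -> : P s = \int[leb]_(r in `[l, u]) (sbump s (d n) r * P s).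
  under eq_Rintegral do rewrite mulrC.
  by rewrite bm_intZ ?I1 ?mulr1//; exact: leb_itv_fin.
have fin := leb_itv_fin l u.
rewrite -bm_intB//; [|by apply: bmM => //; exact: bm_cst|exact: bmM].
rewrite (le_trans (bm_int_norm _ _ _))//.
  by apply: bmB; apply: bmM => //; exact: bm_cst.
have -> : e = \int[leb]_(r in `[l, u]) (e * sbump s (d n) r).
  by rewrite bm_intZ ?I1 ?mulr1.
apply: bm_int_le => //.
- by apply: bm_norm; apply: bmB; apply: bmM => //; exact: bm_cst.
- exact: bmZ.
move=> x _; rewrite -mulrBr normrM ger0_norm ?sbump_ge0// mulrC.
have [xs|xs] := ltP (d n) `|x - s|; first by rewrite sbump0// !mulr0.
apply: ler_pM => //; rewrite ?sbump_ge0//.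
by apply: hr0; rewrite /ball/= distrC (le_lt_trans xs).
Unshelve. all: by end_near. Qed.

(** The hypothesis says that P' = k in the sense of distributions. It is tested with the difference
    of two steps at s and t: their derivatives are bumps that evaluate the continuous P at s and t,
    while the difference itself tends to the indicator of [s, t]. *)
Lemma distribution_integrated P k (s t : R) :
  0 < s -> s < t ->
  (forall r, 0 < r -> {for r, continuous P}) ->
  (forall l u : R, 0 < l -> bm `[l, u] P) -> (forall l u : R, 0 < l -> bm `[l, u] k) ->
  (forall b (l u : R), smooth b -> 0 < l -> (forall r, ~~ (l <= r <= u) -> b r = 0) ->
    \int[leb]_(r in `[l, u]) (derive1 b r * P r + b r * k r) = 0) ->
  P t - P s = \int[leb]_(r in `[s, t]) k r.
Proof.
move=> s0 st cP bP bk H.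
have [d [d0 ds d_0]] : exists d : nat -> R, [/\ forall n, 0 < d n,
    forall n, d n <= s / 2 & d n @[n --> \oo] --> 0].
  exists (fun n => s / 2 * n.+1%:R^-1); split=> [n|n|].
  - by rewrite mulr_gt0 ?divr_gt0// invr_gt0.
  - by rewrite ler_piMr ?divr_ge0 ?(ltW s0)// invf_le1// ler1n.
  - by rewrite -[X in _ --> X](mulr0 (s / 2)); apply: cvgMr; exact: cvg_harmonic.
(* Widths at most s / 2 keep both bumps inside [l, u], and l stays positive. *)
have [l lE] : exists l, l = s / 4 by exists (s / 4).
have [u uE] : exists u, u = t + s by exists (t + s).
have l0 : 0 < l by rewrite lE; lra.
have fin := leb_itv_fin l u.
have [b bE] : exists b, b = fun n r => sstep ((r - s) / d n) - sstep ((r - t) / d n).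
  by exists (fun n r => sstep ((r - s) / d n) - sstep ((r - t) / d n)).
have sb n : smooth (b n) by rewrite bE; apply: smooth_sub; exact: smooth_sstep_shift.
have b' n : derive1 (b n) = fun r => sbump s (d n) r - sbump t (d n) r.
  rewrite bE; apply: is_derive_derive1 => r; apply: is_derive_addf; first exact: is_derive_sstep_shift.
  by apply: is_derive_oppf; exact: is_derive_sstep_shift.
have b0 n r : ~~ (l <= r <= u) -> b n r = 0.
  rewrite bE negb_and -!ltNge => /orP[rl|ur].
    rewrite !sstep0 ?subrr// ler_pdivrMr// mulN1r; have := ds n; rewrite lE in rl; lra.
  rewrite !sstep1 ?subrr// ler_pdivlMr// mul1r; have := ds n; rewrite uE in ur; lra.
have bb n : bm `[l, u] (b n) by exact: bm_smooth.
have bs1 r n : bm `[l, u] (sbump r (d n)) by apply: bm_smooth; exact: smooth_sbump.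
have lin (x y z : R) : x - y + z = 0 -> z = y - x by lra.
have E n : \int[leb]_(r in `[l, u]) (b n r * k r) =
    \int[leb]_(r in `[l, u]) (sbump t (d n) r * P r) -
    \int[leb]_(r in `[l, u]) (sbump s (d n) r * P r).
  have := H _ l u (sb n) l0 (b0 n).
  have bPl := bP l u l0; have bkl := bk l u l0.
  have bs := bs1 s n; have bt := bs1 t n; have bbn := bb n.
  have h1 : bm `[l, u] (fun r => (sbump s (d n) r - sbump t (d n) r) * P r) by bm_tac.
  have h2 : bm `[l, u] (fun r => b n r * k r) by bm_tac.
  have h3 : bm `[l, u] (fun r => sbump s (d n) r * P r) by bm_tac.
  have h4 : bm `[l, u] (fun r => sbump t (d n) r * P r) by bm_tac.
  have mI := measurable_itv `[l, u].
  rewrite b' (cintD h1 h2).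
  under eq_Rintegral do rewrite mulrBl.
  rewrite (cintB h3 h4).
  exact: lin.
have C1 : \int[leb]_(r in `[l, u]) (b n r * k r) @[n --> \oo] --> P t - P s.
  under eq_fun do rewrite E.
  apply: cvgB; apply: sbump_cvg => //; try exact: bP; rewrite ?lE ?uE; try (by apply: cP; lra); lra.
(* The pointwise limit of [b n]. The value at the two ends is [sstep 0], on a null set. *)
pose lim r : R := if r == s then 2^-1 else if r == t then 2^-1 else
  if (s < r < t) then 1 else 0.
have [kK [Kk hKk]] := bk l u l0.
have sstep_half : @sstep R 0 = 2^-1.
  rewrite /sstep addr0 subr0 -mulr2n -[flat 0 1 *+ 2]mulr_natr invfM mulrA divff ?mul1r//.
  by rewrite gt_eqF// flat0_gt0.
have big (x : R) : 0 < x -> \forall n \near \oo, d n <= x.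
  move=> x0; near=> n; rewrite (le_trans (ler_norm _))//.
  by near: n; move/cvgr0_norm_le: d_0; apply.
have sstep_to1 (x y : R) : y < x -> \forall n \near \oo, sstep ((x - y) / d n) = 1.
  move=> yx; have yx0 : 0 < x - y by rewrite subr_gt0.
  by near=> n; rewrite sstep1// ler_pdivlMr// mul1r; near: n; exact: big.
have sstep_to0 (x y : R) : x < y -> \forall n \near \oo, sstep ((x - y) / d n) = 0.
  move=> yx; have yx0 : 0 < y - x by rewrite subr_gt0.
  near=> n; rewrite sstep0// ler_pdivrMr// mulN1r lerNr opprB; near: n; exact: big.
have C2 : \int[leb]_(r in `[l, u]) (b n r * k r) @[n --> \oo] -->
    \int[leb]_(r in `[l, u]) (lim r * k r).
  apply: (@bounded_convergence _ _ _ _ _ _ fin _ _ (2 * Kk)) => //.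
  - move=> n; apply: measurable_funM => //; first by have [] := bb n.
  - move=> n x xlu; rewrite normrM; apply: ler_pM => //; last exact: hKk.
    rewrite bE (le_trans (ler_normB _ _))//.
    have := sstep_ge0 ((x - s) / d n); have := sstep_le1 ((x - s) / d n).
    have := sstep_ge0 ((x - t) / d n); have := sstep_le1 ((x - t) / d n).
    by move=> h1 h2 h3 h4; rewrite !ger0_norm//; lra.
  - move=> x _; apply: cvgMl; apply: cvg_near_cst.
    rewrite /lim bE; have [->|/eqP xs] := eqVneq x s.
      near=> n; rewrite subrr mul0r sstep_half; suff -> : sstep ((s - t) / d n) = 0 by rewrite subr0.
      by near: n; exact: sstep_to0.
    have [->|/eqP xt] := eqVneq x t.
      near=> n; rewrite subrr mul0r sstep_half; suff -> : sstep ((t - s) / d n) = 1 by lra.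
      by near: n; exact: sstep_to1.
    have [xs'|xs'] := ltP s x; have [xt'|xt'] /= := ltP x t.
    + near=> n; suff [-> ->] : sstep ((x - s) / d n) = 1 /\ sstep ((x - t) / d n) = 0 by rewrite subr0.
      by split; near: n; [exact: sstep_to1|exact: sstep_to0].
    + have {}xt' : t < x by rewrite lt_neqAle xt' andbT; apply/eqP => h; apply: xt.
      near=> n; suff [-> ->] : sstep ((x - s) / d n) = 1 /\ sstep ((x - t) / d n) = 1 by rewrite subrr.
      by split; near: n; exact: sstep_to1.
    + have {}xs' : x < s by rewrite lt_neqAle xs' andbT; apply/eqP => h; apply: xs.
      near=> n; suff [-> ->] : sstep ((x - s) / d n) = 0 /\ sstep ((x - t) / d n) = 0 by rewrite subrr.
      by split; near: n; exact: sstep_to0.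
    + lra.
rewrite (cvg_unique _ C1 C2)//.
rewrite [RHS]Rintegral_mkcond [LHS]Rintegral_mkcond.
apply: ae_eq_Rintegral_nm.
exists [set s; t]; split.
- by apply: measurableU; exact: measurable_set1.
- by rewrite null_set_setU//; try exact: lebesgue_measure_set1; exact: measurable_set1.
move=> x /=; apply: contra_notP => /not_orP[xs xt] _.
rewrite !patchE /lim; move/eqP: (xs) => /negbTE ->; move/eqP: (xt) => /negbTE ->.
have [/= xst|xst] := boolP (s < x < t).
  rewrite !mem_set ?mul1r//= in_itv/= ?lE ?uE; lra.
rewrite mul0r [X in _ = if X then _ else _](_ : _ = false); first by case: ifP.
apply/negbTE; rewrite notin_setE /= in_itv/= => /andP[h1 h2].
move/negP: xst; apply; rewrite !lt_neqAle h1 h2 !andbT; apply/andP; split; apply/eqP => h;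
  [exact: xs|exact: xt].
Unshelve. all: by end_near. Qed.

End time_integrals.

(** * Quantile functions *)

Section quantile.
Context {R : realType}.
Notation leb := (@lebesgue_measure R).

Section one_measure.
Variable nu : finmeas R.
Implicit Types (x y w : R).

Definition cdfl x : R := fine (nu `]-oo, x[%classic).

Let nufin (A : set R) : measurable A -> nu A \is a fin_num.
Proof. by move=> mA; exact: fin_num_measure. Qed.

Lemma fine_nu_le (A B : set R) : measurable A -> measurable B -> A `<=` B ->
  fine (nu A) <= fine (nu B).
Proof. by move=> mA mB AB; rewrite fine_le ?nufin// le_measure ?inE. Qed.

Lemma cdfl_homo : {homo cdfl : x y / x <= y}.
Proof.
by move=> x y xy; apply: fine_nu_le => //; apply: subset_itvl; rewrite bnd_simp.
Qed.

Lemma cdfl_ge0 x : 0 <= cdfl x.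
Proof. by rewrite fine_ge0. Qed.

Lemma cdfl_le_mass x : cdfl x <= total_mass nu.
Proof. exact: fine_nu_le. Qed.

Lemma mass_ge0 : 0 <= total_mass nu.
Proof. by rewrite fine_ge0. Qed.

Lemma cdfl_left_lim x : cdfl (x - n.+1%:R^-1) @[n --> \oo] --> cdfl x.
Proof.
rewrite /cdfl.
have -> : `]-oo, x[%classic = \bigcup_n (`]-oo, (x - n.+1%:R^-1)[%classic : set R).
  apply/seteqP; split => y /=; rewrite ?in_itv/=.
    move=> yx; have [k hk] := ltr_add_invr yx.
    by exists k => //=; rewrite in_itv/= ltrBrDr.
  move=> [k _]; rewrite /= in_itv/= => h; apply: lt_trans h _.
  by rewrite ltrBlDr ltrDl invr_gt0.
apply: fine_cvg; rewrite fineK ?nufin//; last by apply: bigcupT_measurable => k; exact: measurable_itv.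
apply: nondecreasing_cvg_mu => //; first by apply: bigcupT_measurable.
move=> a b ab; apply/subsetPset; apply: subset_itvl; rewrite bnd_simp.
by rewrite lerD2l lerN2 lef_pV2 ?posrE ?ltr0n// ler_nat.
Qed.

Lemma cdfl_right_lim x :
  cdfl (x + n.+1%:R^-1) @[n --> \oo] --> fine (nu `]-oo, x]%classic).
Proof.
rewrite /cdfl.
have -> : `]-oo, x]%classic = \bigcap_n (`]-oo, (x + n.+1%:R^-1)[%classic : set R).
  apply/seteqP; split => y /=; rewrite ?in_itv/=.
    by move=> yx k _ /=; rewrite in_itv/= (le_lt_trans yx)// ltrDl invr_gt0.
  move=> h; rewrite leNgt; apply/negP => xy.
  have [k hk] := ltr_add_invr xy.
  have := h k Logic.I; rewrite /= in_itv/= => /(lt_trans hk).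
  by rewrite ltxx.
apply: fine_cvg; rewrite fineK ?nufin//; last by apply: bigcapT_measurable => k; exact: measurable_itv.
apply: nonincreasing_cvg_mu => //.
- by rewrite -ge0_fin_numE// nufin.
- by apply: bigcapT_measurable.
move=> a b ab; apply/subsetPset; apply: subset_itvl; rewrite bnd_simp.
by rewrite lerD2l lef_pV2 ?posrE ?ltr0n// ler_nat.
Qed.

Lemma cdfl_pinfty : cdfl n%:R @[n --> \oo] --> total_mass nu.
Proof.
rewrite /cdfl /total_mass.
have -> : setT = \bigcup_n (`]-oo, n%:R[%classic : set R).
  apply/seteqP; split => y //= _.
  by exists (Num.truncn y).+1 => //=; rewrite in_itv/= truncnS_gt.
apply: fine_cvg; rewrite fineK ?nufin//; last by apply: bigcupT_measurable => k; exact: measurable_itv.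
apply: nondecreasing_cvg_mu => //; first by apply: bigcupT_measurable.
by move=> a b ab; apply/subsetPset; apply: subset_itvl; rewrite bnd_simp ler_nat.
Qed.

Lemma cdfl_ninfty : cdfl (- n%:R) @[n --> \oo] --> 0.
Proof.
rewrite /cdfl.
have -> : 0 = fine (nu (\bigcap_n (`]-oo, (- n%:R)[%classic : set R))).
  rewrite (_ : \bigcap_n _ = set0) ?measure0//.
  apply/seteqP; split => y //= h.
  have := h (Num.truncn (- y)).+1 Logic.I; rewrite /= in_itv/= ltrNr => h1.
  by have := lt_trans (truncnS_gt (- y)) h1; rewrite ltxx.
apply: fine_cvg; rewrite fineK ?nufin//; last by apply: bigcapT_measurable => k; exact: measurable_itv.
apply: nonincreasing_cvg_mu => //.
- by rewrite -ge0_fin_numE// nufin.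
- by apply: bigcapT_measurable.
by move=> a b ab; apply/subsetPset; apply: subset_itvl; rewrite bnd_simp lerN2 ler_nat.
Qed.

Definition qset w : set R := [set x | w <= cdfl x].

(* The left-continuous inverse of [cdfl], with the junk value 0 outside
   ]0, total mass[. *)
Definition qf w : R := if 0 < w < total_mass nu then inf (qset w) else 0.

Lemma qset_has_inf w : 0 < w < total_mass nu -> has_inf (qset w).
Proof.
move=> /andP[w0 wM]; split.
  have /cvgrPdist_lt/(_ (total_mass nu - w)) := cdfl_pinfty.
  rewrite subr_gt0 => /(_ wM)[n _ /(_ n (leqnn n))/= h].
  exists n%:R; rewrite /qset/=.
  have := ler_norm (total_mass nu - cdfl n%:R); lra.
have /cvgrPdist_lt/(_ w w0)[n _ /(_ n (leqnn n))/= h] := cdfl_ninfty.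
exists (- n%:R) => x /=; rewrite /qset /= => wx; rewrite leNgt; apply/negP => xn.
have := cdfl_homo (ltW xn); rewrite sub0r normrN in h.
have := ler_norm (cdfl (- n%:R)); lra.
Qed.

Lemma qf_lt w x : 0 < w < total_mass nu -> qf w < x -> w <= cdfl x.
Proof.
move=> wM; rewrite /qf wM => h.
have [y wy yx] := inf_lt (proj1 (qset_has_inf wM)) h.
by rewrite (le_trans wy)// cdfl_homo// ltW.
Qed.

(** By left continuity of [cdfl]. Together with [qf_lt] it decides whether X(w) < x for every label
    except w = [cdfl nu x], and a single label is negligible. *)
Lemma lt_qf w x : 0 < w < total_mass nu -> w < cdfl x -> qf w < x.
Proof.
move=> wM wx.
have /cvgrPdist_lt/(_ (cdfl x - w)) := @cdfl_left_lim x.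
rewrite subr_gt0 => /(_ wx)[n _ /(_ n (leqnn n))/= h].
rewrite /qf wM (@le_lt_trans _ _ (x - n.+1%:R^-1))//; last first.
  by rewrite ltrBlDr ltrDl invr_gt0.
apply: ge_inf; first by have [] := qset_has_inf wM.
rewrite /qset /=; have := ler_norm (cdfl x - cdfl (x - n.+1%:R^-1)); lra.
Qed.

Lemma qf_homo w w' : 0 < w < total_mass nu -> 0 < w' < total_mass nu ->
  w <= w' -> qf w <= qf w'.
Proof.
move=> wM wM' ww; rewrite /qf wM wM'; apply: lb_le_inf.
  by have [] := qset_has_inf wM'.
move=> x; rewrite /qset /= => wx; apply: ge_inf; first by have [] := qset_has_inf wM.
by rewrite /qset /=; exact: le_trans wx.
Qed.

(** Turns a condition on the quantile into countably many conditions on [cdfl]; joint measurability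
    in label and time follows from it. *)
Lemma qf_geP w x : 0 < w < total_mass nu ->
  (x <= qf w) <-> (forall n, cdfl (x - n.+1%:R^-1) < w).
Proof.
move=> wM; split.
  move=> xw n; rewrite ltNge; apply/negP => h.
  have : qf w <= x - n.+1%:R^-1.
    by rewrite /qf wM; apply: ge_inf; [have [] := qset_has_inf wM|].
  move=> /(le_trans xw); rewrite lerBrDr gerDl leNgt => /negP; apply.
  by rewrite invr_gt0.
move=> h; rewrite leNgt; apply/negP => hx.
have [k hk] := ltr_add_invr hx.
have : w <= cdfl (x - k.+1%:R^-1) by apply: qf_lt => //; rewrite ltrBrDr.
by rewrite leNgt h.
Qed.

End one_measure.

Lemma measurable_qf2 (rho : R -> finmeas R) (M : R) (A : set R) :
  measurable A -> (forall t, A t -> total_mass (rho t) = M) ->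
  (forall x, measurable_fun A (fun t => cdfl (rho t) x)) ->
  measurable_fun (`]0, M[ `*` A) (fun p : R * R => qf (rho p.2) p.1).
Proof.
move=> mA hM mc mD; apply: (measurability _ (RGenCInfty.measurableE R)) => //.
move=> _ [_ [x ->] <-].
rewrite [X in measurable X](_ : _ = \bigcap_n ((`]0, M[ `*` A) `&`
    [set p : R * R | cdfl (rho p.2) (x - n.+1%:R^-1) < p.1])).
  apply: bigcapT_measurable => n.
  have mf : measurable_fun (`]0, M[ `*` A)
      (fun p : R * R => cdfl (rho p.2) (x - n.+1%:R^-1)).
    apply: (measurable_comp (F := A) (f := fun t => cdfl (rho t) (x - n.+1%:R^-1))) => //.
      by move=> _ [[w t] [_ At] <-].
    by apply: measurable_funTS; exact: measurable_snd.
  have mg : measurable_fun (`]0, M[ `*` A) (fun p : R * R => p.1).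
    by apply: measurable_funTS; exact: measurable_fst.
  have h := measurable_fun_ltr mf mg.
  have : measurable ((`]0, M[ `*` A) `&`
      (fun p : R * R => cdfl (rho p.2) (x - n.+1%:R^-1) < p.1) @^-1` [set true]) by exact: h.
  by congr measurable; apply/seteqP; split.
apply/seteqP; split => [[w t] [[]] /=|[w t] h] /=.
  rewrite !in_itv/= andbT => wM At h n _; split => /=; first by split; rewrite //= in_itv.
  by move: n; apply/qf_geP => //; rewrite hM.
have [[/= + At] _] := h 0%N Logic.I; rewrite in_itv/= => wM.
split => //; rewrite in_itv/= andbT; apply/qf_geP; first by rewrite hM.
by move=> n; have [] := h n Logic.I.
Qed.

Section push.
Variable nu : finmeas R.
Let M := total_mass nu.

Lemma measurable_qf : measurable_fun (`]0, M[%classic : set R) (qf nu).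
Proof.
have h : measurable_fun (`]0, M[ `*` [set: R]) (fun p : R * R => qf nu p.1).
  exact: (@measurable_qf2 (fun=> nu) M setT).
apply: (measurable_comp (F := `]0, M[ `*` [set: R]) (g := fun w : R => (w, 0 : R)) _ _ h).
- exact: measurableX.
- by move=> _ [w wM <-].
- by apply: measurable_funTS; exact: measurable_pair2.
Qed.

Lemma leb_qf_lt x : leb (`]0, M[ `&` [set w | qf nu w < x]) = (cdfl nu x)%:E.
Proof.
have c0 := cdfl_ge0 nu x; have cM : cdfl nu x <= M := cdfl_le_mass nu x.
have mS : measurable (`]0, M[ `&` [set w | qf nu w < x]).
  have := measurable_qf; move=> /(_ (measurable_itv _) _ (measurable_itv `]-oo, x[)).
  by congr measurable; apply/seteqP; split => w /=; rewrite !in_itv.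
apply/eqP; rewrite eq_le; apply/andP; split.
  have -> : (cdfl nu x)%:E = leb (`]0, cdfl nu x] : set R).
    rewrite lebesgue_measure_itv /= lte_fin; case: ltP => h; first by rewrite sube0.
    by congr EFin; apply/eqP; rewrite eq_le h c0.
  apply: le_measure; rewrite ?inE//.
  move=> w [/=]; rewrite !in_itv/= => /andP[w0 wM] h; rewrite w0/=.
  by apply: qf_lt => //; rewrite w0.
have -> : (cdfl nu x)%:E = leb (`]0, cdfl nu x[ : set R).
  rewrite lebesgue_measure_itv /= lte_fin; case: ltP => h; first by rewrite sube0.
  by congr EFin; apply/eqP; rewrite eq_le h c0.
apply: le_measure; rewrite ?inE//.
move=> w /=; rewrite !in_itv/= => /andP[w0 wx]; rewrite w0 (lt_le_trans wx)//; split => //.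
by apply: lt_qf => //; rewrite w0 (lt_le_trans wx).
Qed.

Let mD : measurable (`]0, M[%classic : set R) := measurable_itv _.

(** A version of the quantile that is measurable on the whole line, so that the image measure can be
    formed. *)
Let X w := if w \in (`]0, M[%classic : set R) then qf nu w else 0.

Let mX : measurable_fun setT X.
Proof.
have -> : X = (qf nu) \_ (`]0, M[%classic : set R) by apply/funext => w; rewrite /X patchE.
by apply/(measurable_restrictT _ mD); exact: measurable_qf.
Qed.

Let mX' : measurable_fun (setT : set (measurableTypeR R))
  (X : measurableTypeR R -> measurableTypeR R) := mX.

(** Both sides are measures that agree on the half-lines ]-oo, x[ by [leb_qf_lt]. Half-lines are
    stable under intersection and generate the Borel sets, so finite measures that agree on them are
    equal. *)
Lemma push_measure (B : set R) : measurable B ->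
  nu B = leb (`]0, M[ `&` [set w | B (qf nu w)]).
Proof.
move=> mB.
pose m1 : {measure set (measurableTypeR R) -> \bar R} := mrestr leb mD.
pose m2 : {measure set (measurableTypeR R) -> \bar R} :=
  measure_function_pushforward__canonical__measure_function_Measure m1 mX'.
have E C : measurable C -> m2 C = leb (`]0, M[ `&` [set w | C (qf nu w)]).
  move=> mC; rewrite /m2 /= /pushforward /m1 /= /mrestr setIC; congr (leb _).
  by apply/seteqP; split => w [/= h]; rewrite /X; [rewrite mem_set//|move=> h2; rewrite mem_set].
have -> : leb (`]0, M[ `&` [set w | B (qf nu w)]) = m2 B by rewrite E.
have h1 : measurable = <<s @RGenInftyO.G R >> :> set (set (measurableTypeR R)).
  exact: RGenInftyO.measurableE.
have h2 : setI_closed (@RGenInftyO.G R).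
  move=> _ _ [x ->] [y ->]; exists (Num.min x y).
  by apply/seteqP; split => z /=; rewrite !in_itv/= lt_min; [move=> [-> ->]|move=> /andP[]].
have h3 i : @RGenInftyO.G R `]-oo, i%:R[%classic by exists i%:R.
have h4 : \bigcup_k (`]-oo, k%:R[%classic : set (measurableTypeR R)) = setT.
  apply/seteqP; split => y //= _.
  by exists (Num.truncn y).+1 => //=; rewrite in_itv/= truncnS_gt.
apply: (measure_unique _ _ h1 h2 h3 h4 nu m2 _ _ B mB).
- move=> _ [x ->]; rewrite E//; rewrite [RHS](_ : _ = (cdfl nu x)%:E).
    by rewrite /cdfl fineK// fin_num_measure.
  by rewrite -leb_qf_lt; congr (leb _); apply/seteqP; split => w /=; rewrite !in_itv.
- by move=> k; rewrite -ge0_fin_numE// fin_num_measure.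
Qed.

Lemma push_integral (f : R -> R) : bm setT f ->
  \int[nu]_x f x = \int[leb]_(w in `]0, M[) f (qf nu w).
Proof.
move=> bf.
pose m1 : {measure set (measurableTypeR R) -> \bar R} := mrestr leb mD.
pose m2 : {measure set (measurableTypeR R) -> \bar R} :=
  measure_function_pushforward__canonical__measure_function_Measure m1 mX'.
have mf : measurable_fun setT f by have [] := bf.
have bfX : bm setT (fun w => f (X w)) by exact: bm_comp bf.
have fin1 : (m1 setT < +oo)%E by rewrite /m1 /= /mrestr setTI; exact: leb_itvoo_fin.
have i1 : m1.-integrable setT (EFin \o (fun w => f (X w))) by exact: bm_integrable.
congr fine.
transitivity (\int[m2]_x (f x)%:E)%E.
  apply: eq_measure_integral => B mB _.
  transitivity (leb (`]0, M[ `&` [set w | B (qf nu w)])); first exact: push_measure.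
  rewrite /m2 /= /pushforward /m1 /= /mrestr setIC; congr (leb _).
  apply/seteqP; split => w [/= h1 h2]; split => //; move: h1; rewrite /X mem_set//.
rewrite /m2 (integral_pushforward mX')//; last first.
  exact/measurable_EFinP.
transitivity (\int[m1]_(x in `]0%R, M[) (f (X x))%:E)%E.
  have mC : @measurable _ (measurableTypeR R) (~` `]0, M[%classic) by exact: measurableC.
  have N0 : m1 (~` `]0, M[%classic) = 0 by rewrite /m1 /= /mrestr setICl measure0.
  etransitivity; first exact: (@negligible_integral _ (measurableTypeR R) R m1 setT _ _ mC _ i1 N0).
  by rewrite setTD setCK.
transitivity (\int[leb]_(x in `]0%R, M[) (f (X x))%:E)%E.
  apply: eq_measure_integral => B mB BD; rewrite /m1 /= /mrestr; congr (leb _).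
  by apply/setIidPl.
by apply: eq_integral => w wM; rewrite /X wM.
Qed.

End push.
End quantile.

Notation bR b := (GRing.natmul 1 (nat_of_bool b)).

Lemma bm_bool d (T : measurableType d) (R : realType) (D : set T) (b : T -> bool) :
  measurable_fun D b -> bm D (fun x => bR (b x) : R).
Proof.
move=> mb; split.
  have m1 : measurable_fun (setT : set bool) (fun b : bool => bR b : R) by [].
  exact: (measurableT_comp m1 mb).
by exists 1 => x _; case: (b x) => /=; rewrite ?normr1 ?normr0.
Qed.

Lemma int_bool d (T : measurableType d) (R : realType) (mu : {measure set T -> \bar R})
    (D : set T) (b : T -> bool) :
  measurable D -> measurable_fun D b ->
  \int[mu]_(x in D) bR (b x) = fine (mu (D `&` [set x | b x])).
Proof.
move=> mD mb.
have mS : measurable (D `&` [set x | b x]) by exact: (mb mD [set true]).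
have -> : D `&` [set x | b x] = (D `&` [set x | b x]) `&` D by rewrite setIAC setIid.
rewrite -(integral_indic mu mD mS).
congr fine; apply: eq_integral => x /set_mem Dx; rewrite indicE; congr (_%:E).
case bx : (b x); first by rewrite mem_set.
by rewrite memNset//= => -[_ ]; rewrite bx.
Qed.

Section static_identities.
Context {R : realType}.
Notation leb := (@lebesgue_measure R).

Lemma leb_fubini (A B : set R) (F : R * R -> R) : measurable A -> measurable B ->
  (leb A < +oo)%E -> (leb B < +oo)%E -> bm (A `*` B) F ->
  \int[leb]_(x in A) (\int[leb]_(y in B) F (x, y)) =
  \int[leb]_(y in B) (\int[leb]_(x in A) F (x, y)).
Proof. by move=> mA mB fA fB bF; exact: (@bm_fubini _ (measurableTypeR R) _ (measurableTypeR R) R leb leb A B mA mB fA fB F bF). Qed.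

Lemma leb_fubini1 (A B : set R) (F : R * R -> R) : measurable A -> measurable B ->
  (leb A < +oo)%E -> (leb B < +oo)%E -> bm (A `*` B) F ->
  bm A (fun x => \int[leb]_(y in B) F (x, y)).
Proof. by move=> mA mB fA fB bF; exact: (@bm_fubini1 _ (measurableTypeR R) _ (measurableTypeR R) R leb leb A B mA mB fA fB F bF). Qed.

Lemma leb_fubini2 (A B : set R) (F : R * R -> R) : measurable A -> measurable B ->
  (leb A < +oo)%E -> (leb B < +oo)%E -> bm (A `*` B) F ->
  bm B (fun y => \int[leb]_(x in A) F (x, y)).
Proof. by move=> mA mB fA fB bF; exact: (@bm_fubini2 _ (measurableTypeR R) _ (measurableTypeR R) R leb leb A B mA mB fA fB F bF). Qed.

Definition cdflc (nu : finmeas R) x : R := fine (nu `]-oo, x]%classic).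

Variable nu : finmeas R.
Let M := total_mass nu.
Let D : set R := `]0, M[%classic.
Let X := qf nu.
Let mX : measurable_fun D X := @measurable_qf R nu.
Let mD : measurable D := measurable_itv _.
Let fD : (leb D < +oo)%E := leb_itvoo_fin _ _.

Lemma cdfl_int x : cdfl nu x = \int[leb]_(w in D) bR (X w < x).
Proof.
rewrite int_bool//; last by apply: measurable_fun_ltr => //; exact: measurable_cst.
apply/esym; exact: (congr1 fine (@leb_qf_lt R nu x)).
Qed.

Lemma cdflc_int x : cdflc nu x = \int[leb]_(w in D) bR (X w <= x).
Proof.
rewrite int_bool//; last by apply: measurable_fun_ler => //; exact: measurable_cst.
congr fine; etransitivity; first exact: push_measure.
by congr (leb _); apply/seteqP; split => w /=; rewrite !in_itv.
Qed.

Let mfst (E F : set R) : measurable_fun (E `*` F) (fun p : R * R => p.1).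
Proof. by apply: measurable_funTS; exact: measurable_fst. Qed.

Let msnd (E F : set R) : measurable_fun (E `*` F) (fun p : R * R => p.2).
Proof. by apply: measurable_funTS; exact: measurable_snd. Qed.

Lemma measurable_comp1 (E F : set R) (f : R -> R) : measurable E -> measurable F ->
  measurable_fun E f -> measurable_fun (E `*` F) (fun p : R * R => f p.1).
Proof.
move=> mE mF mf; apply: (measurable_comp (F := E) (f := f)) => //.
by move=> _ [[a b] [Ea _] <-].
Qed.

Lemma measurable_comp2 (E F : set R) (f : R -> R) : measurable E -> measurable F ->
  measurable_fun F f -> measurable_fun (E `*` F) (fun p : R * R => f p.2).
Proof.
move=> mE mF mf; apply: (measurable_comp (F := F) (f := f)) => //.
by move=> _ [[a b] [_ Fb] <-].
Qed.

Lemma bm_comp1 (E F : set R) (f : R -> R) : measurable E -> measurable F ->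
  bm E f -> bm (E `*` F) (fun p : R * R => f p.1).
Proof.
move=> mE mF [mf [K fK]]; split; first exact: measurable_comp1.
by exists K => -[a b] [Ea _]; exact: fK.
Qed.

Lemma bm_comp2 (E F : set R) (f : R -> R) : measurable E -> measurable F ->
  bm F f -> bm (E `*` F) (fun p : R * R => f p.2).
Proof.
move=> mE mF [mf [K fK]]; split; first exact: measurable_comp2.
by exists K => -[a b] [_ Fb]; exact: fK.
Qed.

Lemma int_suppin (f : R -> R) (A : R) : suppin f A ->
  \int[leb]_x f x = \int[leb]_(x in `[- A, A]) f x.
Proof.
move=> fA; rewrite [RHS]Rintegral_mkcond; congr Rintegral; apply/funext => x.
rewrite patchE; case: ifPn => // /negP h; apply: fA; rewrite ltNge ler_norml.
by apply/negP => h2; apply: h; rewrite inE /= in_itv.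
Qed.

Lemma int_derive1_above (a : R -> R) (A z : R) : smooth a -> 0 < A -> suppin a A ->
  a A = 0 -> a (- A) = 0 ->
  \int[leb]_(x in `[- A, A]) (derive1 a x * bR (z < x)) = - a z.
Proof.
move=> sa Apos aA aA1 aA2.
have sa' := smooth_derive1 sa.
have cc (l u : R) : l <= u -> (forall x, l < x <= u -> z < x) ->
    \int[leb]_(x in `[l, u]) (derive1 a x * bR (z < x)) = a u - a l.
  move=> lu h; rewrite -int_derive1//; apply: ae_eq_Rintegral_nm.
  exists [set l]; split; [exact: measurable_set1|exact: lebesgue_measure_set1|].
  move=> x /=; apply: contra_notP => xl; rewrite in_itv/= => /andP[lx xu].
  by rewrite h ?mulr1// xu andbT lt_neqAle lx andbT; apply/eqP => h2; apply: xl.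
have c0 (l u : R) : (forall x, l <= x <= u -> x <= z) ->
    \int[leb]_(x in `[l, u]) (derive1 a x * bR (z < x)) = 0.
  move=> h; rewrite -[RHS](mul0r (fine (leb `[l, u]))) -Rintegral_cst//.
  apply: eq_Rintegral => x /set_mem; rewrite /= in_itv/= => /h hx.
  by rewrite ltNge hx mulr0.
have bb (l u : R) : bm `[l, u] (fun x => derive1 a x * bR (z < x)).
  apply: bmM; first exact: bm_smooth.
  by apply: bm_bool; apply: measurable_fun_ltr => //; exact: measurable_cst.
have [h1|h1] := ltP (z) (- A).
  rewrite cc ?aA1 ?aA2; [|by lra|by move=> x /andP[hx _]; exact: lt_trans hx].
  by rewrite aA ?subr0 ?oppr0// ltr0_norm; lra.
have [h2|h2] := ltP A (z).
  rewrite c0; last by move=> x /andP[_ hx]; apply: le_trans hx _; exact: ltW.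
  by rewrite aA ?oppr0// gtr0_norm// (lt_trans Apos).
rewrite (bm_itv_split h1 h2 (bb _ _)) c0 ?add0r; last by move=> x /andP[].
by rewrite cc ?aA1 ?sub0r//; move=> x /andP[].
Qed.

(** Enlarging the radius makes the boundary values vanish outright, without an appeal to
    continuity. *)
Lemma suppin_margin (a : R -> R) (A0 : R) : suppin a A0 ->
  exists A, [/\ 0 < A, suppin a A, a A = 0 & a (- A) = 0].
Proof.
move=> aA0; have [A [Apos AA0]] : exists A, 0 < A /\ A0 < A.
  by exists (`|A0| + 1); have := ler_norm A0; have := normr_ge0 A0; split; lra.
exists A; split => //.
- by move=> x h; apply: aA0; exact: lt_trans h.
- by apply: aA0; rewrite gtr0_norm.
- by apply: aA0; rewrite normrN gtr0_norm.
Qed.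

(** Integration by parts under the label integral: after Fubini each label contributes the integral
    of [derive1 a] over x > X w, that is - a (X w). *)
Lemma int_derive1_lab (a : R -> R) (A : R) (th : R -> R) : smooth a -> 0 < A -> suppin a A ->
  a A = 0 -> a (- A) = 0 -> bm D th ->
  \int[leb]_(x in `[- A, A]) (derive1 a x * \int[leb]_(w in D) (bR (X w < x) * th w)) =
  - \int[leb]_(w in D) (a (X w) * th w).
Proof.
move=> sa Apos aA aA1 aA2 bth.
have [K K0 aK] := smooth_suppin_bounded sa aA.
have ba : bm setT a.
  by split; [exact: continuous_measurable_fun (smooth_continuous sa)|exists K].
have sa' := smooth_derive1 sa.
have mI := measurable_itv `[-A, A].
have bF : bm (`[- A, A] `*` D) (fun p : R * R => derive1 a p.1 * (bR (X p.2 < p.1) * th p.2)).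
  apply: bmM; first by apply: bm_comp1 => //; exact: bm_smooth.
  apply: bmM; last exact: bm_comp2.
  by apply: bm_bool; apply: measurable_fun_ltr; [exact: measurable_comp2|exact: mfst].
have blt (x : R) : bm D (fun w => bR (X w < x) : R).
  by apply: bm_bool; apply: measurable_fun_ltr => //; exact: measurable_cst.
have E1 : \int[leb]_(x in `[- A, A]) (derive1 a x * \int[leb]_(w in D) (bR (X w < x) * th w)) =
    \int[leb]_(x in `[- A, A]) (\int[leb]_(w in D) (derive1 a x * (bR (X w < x) * th w))).
  by apply: eq_Rintegral => x _; rewrite (ointZ _ (bmM (blt x) bth)).
rewrite {}E1 (leb_fubini mI mD (leb_itv_fin _ _) fD bF).
have baX : bm D (fun w => a (X w)) by exact: bm_comp ba.
rewrite -(ointN (bmM baX bth)).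
apply: eq_Rintegral => w /set_mem Dw /=.
have b1 : bm `[- A, A] (fun x => derive1 a x * bR (X w < x)).
  apply: bmM; first exact: bm_smooth.
  by apply: bm_bool; apply: measurable_fun_ltr => //; exact: measurable_cst.
transitivity (\int[leb]_(x in `[- A, A]) (th w * (derive1 a x * bR (X w < x)))).
  by apply: eq_Rintegral => x _; ring.
by rewrite (cintZ _ b1) (int_derive1_above _ sa Apos aA aA1 aA2); ring.
Qed.

Lemma int_derive1_cdfl (a : R -> R) (A0 : R) : smooth a -> suppin a A0 ->
  \int[leb]_x (derive1 a x * cdfl nu x) = - \int[nu]_x a x.
Proof.
move=> sa aA0; have [A [Apos aA aA1 aA2]] := suppin_margin aA0.
have [K K0 aK] := smooth_suppin_bounded sa aA.
have ba : bm setT a.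
  by split; [exact: continuous_measurable_fun (smooth_continuous sa)|exists K].
have aA' := smooth_suppin_derive1 sa aA.
rewrite (@int_suppin _ A); last by move=> x h; rewrite aA'// mul0r.
have -> : \int[nu]_x a x = \int[leb]_(w in D) (a (X w) * 1).
  by rewrite push_integral//; apply: eq_Rintegral => w _; rewrite mulr1.
rewrite -(int_derive1_lab sa Apos aA aA1 aA2 (bm_cst D 1)); apply: eq_Rintegral => x _.
by rewrite cdfl_int; congr (_ * _); apply: eq_Rintegral => w _; rewrite mulr1.
Qed.

(** On an atom all labels share one position, and the mean of the two one-sided limits of m is the
    mean of w over these labels; so the force becomes w - M / 2. Atoms need no separate treatment:
    both sides are double integrals over pairs of labels, and after exchanging the variables in one
    term the integrands agree pointwise. *)
Lemma int_m_tilde (f : R -> R) : bm setT f ->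
  \int[nu]_x (2^-1 * (cdfl nu x + cdflc nu x - M) * f x) =
  \int[leb]_(w in D) (f (X w) * (w - M / 2)).
Proof.
move=> bf.
have bfX : bm D (fun w => f (X w)) by exact: bm_comp bf.
have b1 : bm setT (cdfl nu).
  split; first by apply: nondecreasing_measurable => //; exact: cdfl_homo.
  by exists M => x _; rewrite ger0_norm ?cdfl_ge0// cdfl_le_mass.
have b2 : bm setT (cdflc nu).
  split.
    apply: nondecreasing_measurable => // x y xy; apply: fine_nu_le => //.
    by apply: subset_itvl; rewrite bnd_simp.
  by exists M => x _; rewrite ger0_norm ?fine_ge0//; exact: fine_nu_le.
have c1 : bm D (fun w => cdfl nu (X w)) by exact: bm_comp b1.
have c2 : bm D (fun w => cdflc nu (X w)) by exact: (bm_comp mX b2).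
rewrite push_integral; last by bm_tac.
have bid : bm D (fun w => w).
  split; first exact: measurable_id.
  exists M => w; rewrite /D/= in_itv/= => /andP[w0 wM].
  by rewrite ger0_norm ltW.
have L : \int[leb]_(w in D) (f (X w) * cdfl nu (X w) + f (X w) * cdflc nu (X w)) =
    2 * \int[leb]_(w in D) (f (X w) * w).
  rewrite (ointD); [|by bm_tac|by bm_tac].
  pose F1 (p : R * R) := f (X p.1) * bR (X p.2 < X p.1).
  pose F2 (p : R * R) := f (X p.1) * bR (X p.2 <= X p.1).
  pose F3 (p : R * R) := f (X p.2) * bR (X p.1 <= X p.2).
  pose G1 (p : R * R) := f (X p.1) * bR (p.2 < p.1).
  pose G3 (p : R * R) := f (X p.2) * bR (p.1 <= p.2).
  have mX1 : measurable_fun (D `*` D) (fun p : R * R => X p.1) by exact: measurable_comp1.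
  have mX2 : measurable_fun (D `*` D) (fun p : R * R => X p.2) by exact: measurable_comp2.
  have bf1 : bm (D `*` D) (fun p : R * R => f (X p.1)) by exact: (bm_comp1 (f := fun w => f (X w))).
  have bf2 : bm (D `*` D) (fun p : R * R => f (X p.2)) by exact: (bm_comp2 (f := fun w => f (X w))).
  have bF1 : bm (D `*` D) F1 by apply: bmM => //; apply: bm_bool; exact: measurable_fun_ltr.
  have bF2 : bm (D `*` D) F2 by apply: bmM => //; apply: bm_bool; exact: measurable_fun_ler.
  have bF3 : bm (D `*` D) F3 by apply: bmM => //; apply: bm_bool; exact: measurable_fun_ler.
  have bG1 : bm (D `*` D) G1 by apply: bmM => //; apply: bm_bool; exact: measurable_fun_ltr.
  have bG3 : bm (D `*` D) G3 by apply: bmM => //; apply: bm_bool; exact: measurable_fun_ler.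
  have mlt (x : R) : bm D (fun w => bR (X w < x) : R).
    by apply: bm_bool; apply: measurable_fun_ltr => //; exact: measurable_cst.
  have mle (x : R) : bm D (fun w => bR (X w <= x) : R).
    by apply: bm_bool; apply: measurable_fun_ler => //; exact: measurable_cst.
  have wlt (x : R) : bm D (fun w => bR (w < x) : R).
    by apply: bm_bool; apply: measurable_fun_ltr => //; exact: measurable_cst.
  have wle (x : R) : bm D (fun w => bR (w <= x) : R).
    by apply: bm_bool; apply: measurable_fun_ler => //; exact: measurable_cst.
  have mgt (x : R) : bm D (fun w => bR (x <= X w) : R).
    by apply: bm_bool; apply: measurable_fun_ler => //; exact: measurable_cst.
  have wgt (x : R) : bm D (fun w => bR (x <= w) : R).
    by apply: bm_bool; apply: measurable_fun_ler => //; exact: measurable_cst.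
  have E1 : \int[leb]_(w in D) (f (X w) * cdfl nu (X w)) =
      \int[leb]_(w in D) (\int[leb]_(w' in D) F1 (w, w')).
    by apply: eq_Rintegral => w _; rewrite cdfl_int /F1 /= (ointZ _ (mlt _)).
  have E2 : \int[leb]_(w in D) (f (X w) * cdflc nu (X w)) =
      \int[leb]_(w in D) (\int[leb]_(w' in D) F3 (w, w')).
    rewrite (leb_fubini mD mD fD fD bF3).
    by apply: eq_Rintegral => w _; rewrite cdflc_int /F3 /= (ointZ _ (mle _)).
  have b12 F := @leb_fubini1 D D F mD mD fD fD.
  have d0 x : D x -> 0 < x < M by rewrite /D/= in_itv.
  have int_lt w : D w -> \int[leb]_(w' in D) bR (w' < w) = w.
    move=> /d0/andP[w0 wM]; rewrite int_bool//; last first.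
      by apply: measurable_fun_ltr => //; exact: measurable_cst.
    rewrite (_ : _ `&` _ = `]0, w[%classic).
      etransitivity; first exact: (congr1 fine (lebesgue_measure_itv _)).
      by rewrite /= lte_fin w0 /= subr0.
    apply/seteqP; split => z /=; rewrite /D /= !in_itv/=.
      by move=> [/andP[-> _] ->].
    by move=> /andP[z0 zw]; rewrite z0 zw (lt_trans zw).
  have int_le w : D w -> \int[leb]_(w' in D) bR (w' <= w) = w.
    move=> /d0/andP[w0 wM]; rewrite int_bool//; last first.
      by apply: measurable_fun_ler => //; exact: measurable_cst.
    rewrite (_ : _ `&` _ = `]0, w]%classic).
      etransitivity; first exact: (congr1 fine (lebesgue_measure_itv _)).
      by rewrite /= lte_fin w0 /= subr0.
    apply/seteqP; split => z /=; rewrite /D /= !in_itv/=.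
      by move=> [/andP[-> _] ->].
    by move=> /andP[z0 zw]; rewrite z0 zw (le_lt_trans zw).
  have E3 : \int[leb]_(w in D) (f (X w) * w) =
      \int[leb]_(w in D) (\int[leb]_(w' in D) G1 (w, w')).
    by apply: eq_Rintegral => w /set_mem Dw; rewrite /G1 /= (ointZ _ (wlt _)) int_lt.
  have E4 : \int[leb]_(w in D) (f (X w) * w) =
      \int[leb]_(w in D) (\int[leb]_(w' in D) G3 (w, w')).
    rewrite (leb_fubini mD mD fD fD bG3).
    by apply: eq_Rintegral => w /set_mem Dw; rewrite /G3 /= (ointZ _ (wle _)) int_le.
  rewrite mulr_natl mulr2n {1}E3 E4 E1 E2.
  rewrite -(ointD (b12 _ bF1) (b12 _ bF3)).
  rewrite -(ointD (b12 _ bG1) (b12 _ bG3)).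
  apply: eq_Rintegral => w /set_mem Dw.
  have s1 : bm D (fun w' => F1 (w, w')) := bmZ (f (X w)) (mlt (X w)).
  have s3 : bm D (fun w' => F3 (w, w')) by exact: (bmM bfX (mgt (X w))).
  have s2 : bm D (fun w' => G1 (w, w')) := bmZ (f (X w)) (wlt w).
  have s4 : bm D (fun w' => G3 (w, w')) by exact: (bmM bfX (wgt w)).
  rewrite -(ointD s1 s3) -(ointD s2 s4).
  apply: eq_Rintegral => w' /set_mem Dw'.
  rewrite /F1 /F3 /G1 /G3 /=.
  (* Only X w' = X w with w' < w needs care: the two terms then trade places, with [f] evaluated at
     the same point. *)
  have [ww|ww] := ltP w' w.
    have := qf_homo (d0 _ Dw') (d0 _ Dw) (ltW ww); rewrite -/X.
    rewrite le_eqVlt => /predU1P[->|h]; first by rewrite ltxx lexx /= !mulr0 !mulr1 addrC.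
    by rewrite h leNgt h.
  have := qf_homo (d0 _ Dw) (d0 _ Dw') ww; rewrite -/X => h.
  by rewrite h ltNge h.
transitivity (\int[leb]_(w in D) (2^-1 * (f (X w) * cdfl nu (X w) + f (X w) * cdflc nu (X w)) - M / 2 * f (X w))).
  by apply: eq_Rintegral => w _; ring.
rewrite (ointB); [|by bm_tac|by bm_tac].
rewrite (ointZ); last by bm_tac.
rewrite (ointZ); last by bm_tac.
rewrite L mulrA mulVf ?mul1r ?pnatr_eq0//.
rewrite -(ointZ); last by bm_tac.
rewrite -(ointB); [|by bm_tac|by bm_tac].
by apply: eq_Rintegral => w _; ring.
Qed.

End static_identities.

Section lipschitz.
Context {R : realType}.
Notation leb := (@lebesgue_measure R).

Lemma smooth_lipschitz (a : R -> R) (K : R) : smooth a -> (forall x, `|derive1 a x| <= K) ->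
  forall x y, `|a y - a x| <= K * `|y - x|.
Proof.
move=> sa aK.
have H x y : x <= y -> `|a y - a x| <= K * `|y - x|.
  move=> xy; rewrite -int_derive1//.
  have bb : bm `[x, y] (derive1 a) by apply: bm_smooth; exact: smooth_derive1.
  have := cint_bound bb (fun z _ => aK z).
  by rewrite fine_leb_itv// (ger0_norm (x := y - x)) ?subr_ge0.
move=> x y; have [xy|/ltW xy] := leP x y; first exact: H.
by rewrite distrC (distrC y); exact: H.
Qed.

Lemma smooth_shift (a : R -> R) (y : R) : smooth a -> smooth (fun x => a (x - y)).
Proof.
move=> sa; apply: smooth_comp sa _; apply: smooth_sub; [exact: smooth_id|exact: smooth_cst].
Qed.

Lemma derive1_shift (a : R -> R) (y : R) : smooth a ->
  derive1 (fun x => a (x - y)) = fun x => derive1 a (x - y).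
Proof.
move=> sa; apply: is_derive_derive1 => x.
have h : is_derive x 1 (fun z : R => z - y) 1.
  by have := is_derive_addf (is_derive_id x 1) (is_derive_cst (- y) x 1); rewrite addr0.
by have := @is_derive_compf _ a (fun z => z - y) _ _ _ (smooth_is_derive (x - y) sa) h; rewrite mulr1.
Qed.

Lemma suppin_shift (a : R -> R) (A y : R) : suppin a A -> suppin (fun x => a (x - y)) (A + `|y|).
Proof.
move=> aA x h; apply: aA; have := ler_normD (x - y) y; rewrite subrK; lra.
Qed.

Lemma Cc_suppin (a : R -> R) (A : R) : continuous a -> suppin a A -> Cc a.
Proof.
move=> ca aA; split => //; apply: (@subclosed_compact _ _ `[- A, A]%classic).
- exact: closed_closure.
- exact: segment_compact.
rewrite [X in _ `<=` X](iffLR (closure_id _)); last exact: interval_closed.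
apply: closure_subset => x /= ax; rewrite in_itv/= -ler_norml leNgt; apply/negP => /aA; exact/eqP.
Qed.

End lipschitz.

Lemma ae_imp d (T : measurableType d) (R : realType) (mu : set T -> \bar R) (P Q : T -> Prop) :
  (forall x, P x -> Q x) -> {ae mu, forall x, P x} -> {ae mu, forall x, Q x}.
Proof.
move=> PQ [N [mN N0 h]]; exists N; split => // x nQ; apply: h => /=.
by move=> /PQ.
Qed.

Lemma ae_and d (T : measurableType d) (R : realType) (mu : {measure set T -> \bar R})
    (P Q : T -> Prop) :
  {ae mu, forall x, P x} -> {ae mu, forall x, Q x} -> {ae mu, forall x, P x /\ Q x}.
Proof.
move=> [N [mN N0 h]] [N' [mN' N0' h']]; exists (N `|` N'); split.
- exact: measurableU.
- by rewrite null_set_setU.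
- move=> x /= /not_andP[nP|nQ]; [left; exact: h|right; exact: h'].
Qed.

Section slices.
Context {R : realType}.
Implicit Types (nu : finmeas R) (phi w : R -> R) (C : R).

(** What is known of u at one fixed time: equality almost everywhere with a Borel function that is
    bounded everywhere. *)
Definition slice nu w C := exists U : R -> R,
  [/\ measurable_fun setT U, forall x, `|U x| <= C & {ae nu, forall x, w x = U x}].

Lemma slice_cst nu (c : R) : slice nu (fun=> c) `|c|.
Proof. by exists (fun=> c); split => //; exists set0; split=> [||x h] //=; exact: h. Qed.

Lemma slice_sqr nu w C : slice nu w C -> slice nu (fun x => w x ^+ 2) (C ^+ 2).
Proof.
move=> [U [mU UC wU]]; exists (fun x => U x ^+ 2); split.
- exact: measurable_funX.
- by move=> x; rewrite normrX ler_sqr ?nnegrE// (le_trans _ (UC x)).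
- by apply: ae_imp wU => x ->.
Qed.

Definition clip C (x : R) := Num.max (- C) (Num.min C x).

Lemma clip_id C x : `|x| <= C -> clip C x = x.
Proof.
by rewrite ler_norml => /andP[h1 h2]; rewrite /clip (min_idPr h2) (max_idPr h1).
Qed.

Lemma clip_norm C x : 0 <= C -> `|clip C x| <= C.
Proof.
move=> C0; rewrite /clip ler_norml le_max lexx /= ge_max; apply/andP; split; first by lra.
by rewrite ge_min lexx.
Qed.

Lemma measurable_clip d (T : measurableType d) (D : set T) C (f : T -> R) :
  measurable_fun D f -> measurable_fun D (fun x => clip C (f x)).
Proof.
move=> mf; apply: measurable_maxr; first exact: measurable_cst.
by apply: measurable_minr => //; exact: measurable_cst.
Qed.

Lemma slice_wrt nu w C : 0 <= C -> measurable_wrt nu w -> (forall x, `|w x| <= C) -> slice nu w C.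
Proof.
move=> C0 [g [mg wg]] wC; exists (fun x => clip C (g x)); split.
- exact: measurable_clip.
- by move=> x; exact: clip_norm.
- by apply: ae_imp wg => x wx; rewrite -wx clip_id.
Qed.

Lemma pairing_slice nu w phi (U : R -> R) : {ae nu, forall x, w x = U x} ->
  pairing nu w phi = \int[nu]_x (phi x * U x).
Proof.
by move=> wU; apply: ae_eq_Rintegral_nm; apply: ae_imp wU => x -> _.
Qed.

Let mTT : measurable (setT : set (measurableTypeR R)). Proof. exact: measurableT. Qed.
Let nufin nu : (nu setT < +oo)%E. Proof. by rewrite ltey_eq fin_num_measure. Qed.

Definition nintD nu := @bm_intD _ _ _ nu setT mTT (nufin nu).
Definition nintB nu := @bm_intB _ _ _ nu setT mTT (nufin nu).
Definition nintZ nu := @bm_intZ _ _ _ nu setT mTT (nufin nu).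
Definition nint_le nu := @bm_int_le _ _ _ nu setT mTT (nufin nu).
Definition nint_bound nu := @bm_int_bound _ _ _ nu setT mTT (nufin nu).
Definition nint_cvg nu := @bounded_convergence _ _ _ nu setT mTT (nufin nu).

Lemma pairingB nu w C phi psi : slice nu w C -> bm setT phi -> bm setT psi ->
  pairing nu w (fun x => phi x - psi x) = pairing nu w phi - pairing nu w psi.
Proof.
move=> [U [mU UC wU]] bphi bpsi; rewrite !(pairing_slice _ wU).
have bU : bm setT U by split => //; exists C.
rewrite -(nintB nu (bmM bphi bU) (bmM bpsi bU)).
by apply: eq_Rintegral => x _; rewrite mulrBl.
Qed.

Lemma pairing_bound nu w C phi K : slice nu w C -> bm setT phi -> (forall x, `|phi x| <= K) ->
  `|pairing nu w phi| <= K * C * total_mass nu.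
Proof.
move=> [U [mU UC wU]] bphi phiK; rewrite (pairing_slice _ wU).
have bU : bm setT U by split => //; exists C.
apply: (nint_bound nu (bmM bphi bU)) => x _.
by rewrite normrM ler_pM.
Qed.

Lemma bm_smooth_bounded (a : R -> R) K : smooth a -> (forall x, `|a x| <= K) -> bm setT a.
Proof.
move=> sa aK; split; first exact: continuous_measurable_fun (smooth_continuous sa).
by exists K => x _; exact: aK.
Qed.

(** Weak continuity applies to the test function frozen at y t. Moving it to y s costs at most K C M
    |y t - y s|, because [a] is Lipschitz and the masses are bounded by M. *)
Lemma pairing_shift_continuous (rho : R -> finmeas R) (w : R -> R -> R) C M (a y : R -> R) (A t : R) :
  (forall t, 0 < t -> slice (rho t) (w ^~ t) C) ->
  (forall t, 0 < t -> total_mass (rho t) <= M) ->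
  weakly_continuous rho w ->
  smooth a -> suppin a A -> continuous y -> 0 < t ->
  {for t, continuous (fun s => pairing (rho s) (w ^~ s) (fun x => a (x - y s)))}.
Proof.
move=> sl mM wc sa aA cy t0.
have [K K0 aK] := smooth_suppin_bounded (smooth_derive1 sa) (smooth_suppin_derive1 sa aA).
have [K' _ aK'] := smooth_suppin_bounded sa aA.
have C0 : 0 <= C.
  by have [U [_ UC _]] := sl t t0; exact: le_trans (UC 0).
have lip := smooth_lipschitz sa aK.
have ba (z : R) : bm setT (fun x : R => a (x - z)).
  by apply: (@bm_smooth_bounded _ K') => [|x]; [exact: smooth_shift|exact: aK'].
have M0 : 0 <= M by rewrite (le_trans _ (mM _ t0))// mass_ge0.
apply/cvgrPdist_le => /= e e0.
have h1 : \forall s \near t, `|pairing (rho t) (w ^~ t) (fun x => a (x - y t)) -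
    pairing (rho s) (w ^~ s) (fun x => a (x - y t))| <= e / 2.
  have ca : Cc (fun x => a (x - y t)).
    apply: (@Cc_suppin _ _ (A + `|y t|)); last exact: suppin_shift.
    by apply: smooth_continuous; exact: smooth_shift.
  by move/cvgrPdist_le: (wc _ ca t t0); apply; rewrite divr_gt0.
have d0 : 0 < e / 2 / (K * C * M + 1).
  by rewrite !divr_gt0// ltr_wpDl// !mulr_ge0.
have h2 : \forall s \near t, `|y t - y s| <= e / 2 / (K * C * M + 1).
  by move/cvgrPdist_le: (cy t); apply.
near=> s.
have s0 : 0 < s by near: s; exact: lt_nbhsr.
have -> : pairing (rho t) (w ^~ t) (fun x : R => a (x - y t)) -
  pairing (rho s) (w ^~ s) (fun x : R => a (x - y s)) =
  (pairing (rho t) (w ^~ t) (fun x : R => a (x - y t)) - pairing (rho s) (w ^~ s) (fun x => a (x - y t))) +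
  pairing (rho s) (w ^~ s) (fun x => a (x - y t) - a (x - y s)).
  by rewrite (pairingB (sl s s0)) ?addrA ?subrK.
rewrite [e]splitr (le_trans (ler_normD _ _))// lerD//; first by near: s.
have h : forall x, `|a (x - y t) - a (x - y s)| <= K * `|y t - y s|.
  move=> x; rewrite (le_trans (lip _ _))// ler_wpM2l//.
  by rewrite distrC (_ : _ - _ - _ = y t - y s)//; ring.
rewrite (le_trans (pairing_bound (sl s s0) _ h))//; first exact: bmB.
have h3 : `|y t - y s| <= e / 2 / (K * C * M + 1) by near: s.
rewrite (@le_trans _ _ (K * C * M * (e / 2 / (K * C * M + 1))))//.
  rewrite (_ : K * `|y t - y s| * C * _ = K * C * total_mass (rho s) * `|y t - y s|); last by ring.
  by rewrite ler_pM ?mulr_ge0 ?mass_ge0// ler_wpM2l ?mulr_ge0// mM.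
rewrite mulrCA ger_pMr ?divr_gt0// ler_pdivrMr ?mul1r ?lerDl//.
by rewrite ltr_wpDl// !mulr_ge0.
Unshelve. all: by end_near. Qed.

End slices.

Lemma Rint_zero d (T : measurableType d) (R : realType) (mu : {measure set T -> \bar R})
    (D : set T) (f : T -> R) : (forall x, D x -> f x = 0) -> \int[mu]_(x in D) f x = 0.
Proof. by move=> f0; rewrite /Rintegral integral0_eq// => x /f0 ->. Qed.

(** * Conservation of mass *)

Section time_regularity.
Context {R : realType}.
Notation leb := (@lebesgue_measure R).

Lemma bm_pos_continuous (f : R -> R) (l u : R) : 0 < l ->
  (forall t, 0 < t -> {for t, continuous f}) -> bm `[l, u] f.
Proof.
move=> l0 cf; split.
  apply: measurable_funS (measurable_pos_continuous cf) => //.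
  by move=> x /=; rewrite !in_itv/= andbT => /andP[lx _]; exact: lt_le_trans lx.
have [lu|ul] := leP l u; last first.
  by exists 0 => x; rewrite /= in_itv/= => /andP[lx xu]; move: ul; rewrite ltNge (le_trans lx xu).
have c1 : {within `[l, u], continuous (fun x => `|f x|)}.
  apply: continuous_in_subspaceT => x /set_mem; rewrite /= in_itv/= => /andP[lx _].
  apply: (@continuous_comp _ _ _ f); last exact: norm_continuous.
  by apply: cf; exact: lt_le_trans lx.
have [c _ hc] := EVT_max lu c1.
by exists `|f c| => x; exact: hc.
Qed.

Lemma smooth_zero_derive1 (b : R -> R) (l u : R) : smooth b ->
  (forall r, ~~ (l <= r <= u) -> b r = 0) -> forall r, ~~ (l <= r <= u) -> derive1 b r = 0.
Proof.
move=> sb b0 r rlu; rewrite derive1E (@near_eq_derive _ _ _ b (cst 0)) ?derive_cst//.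
move: rlu; rewrite negb_and -!ltNge => /orP[h|h]; near=> z; apply: b0;
  rewrite negb_and -!ltNge; apply/orP.
- by left; near: z; exact: lt_nbhsl.
- by right; near: z; exact: lt_nbhsr.
Unshelve. all: by end_near. Qed.

End time_regularity.

Section mass_equation.
Context {R : realType}.
Notation leb := (@lebesgue_measure R).
Variables (tau : R) (rho0 : finmeas R) (u0 : R -> R) (rho : R -> finmeas R) (u : R -> R -> R).
Hypothesis ws : weak_solution tau rho0 u0 rho u.
Variable C : R.
Hypothesis C0 : 0 <= C.
Hypothesis uC : forall x t, 0 < t -> `|u x t| <= C.
Notation M := (total_mass rho0).

Lemma u_slice t : 0 < t -> slice (rho t) (u ^~ t) C.
Proof. by move=> t0; apply: slice_wrt => //; [exact: (ws_slice ws t0)|move=> x; exact: uC]. Qed.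

Lemma one_slice t : 0 < t -> slice (rho t) (fun=> 1) 1.
Proof. by move=> _; rewrite -{2}[1]normr1; exact: slice_cst. Qed.

Lemma mass_le t : 0 < t -> total_mass (rho t) <= M.
Proof.
move=> t0; have h := @cdfl_pinfty _ (rho t).
apply: (cvgr_to_le h); near=> n.
by have /andP[] := ws_range ws n%:R t0.
Unshelve. all: by end_near. Qed.

Definition mpair (a : R -> R) (z r : R) := pairing (rho r) (fun=> 1) (fun x => a (x - z)).
Definition upair (a : R -> R) (z r : R) := pairing (rho r) (u ^~ r) (fun x => a (x - z)).

Lemma mpair_continuous (a y : R -> R) (A t : R) : smooth a -> suppin a A -> smooth y -> 0 < t ->
  {for t, continuous (fun s => mpair a (y s) s)}.
Proof.
move=> sa aA sy t0; apply: (pairing_shift_continuous (w := fun _ _ => 1) (M := M)) => //.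
- exact: one_slice.
- exact: mass_le.
- exact: (ws_cont_rho ws).
- exact: aA.
- exact: smooth_continuous.
Qed.

Lemma upair_continuous (a y : R -> R) (A t : R) : smooth a -> suppin a A -> smooth y -> 0 < t ->
  {for t, continuous (fun s => upair a (y s) s)}.
Proof.
move=> sa aA sy t0; apply: (pairing_shift_continuous (M := M)) => //.
- exact: u_slice.
- exact: mass_le.
- exact: (ws_cont_rhou ws).
- exact: aA.
- exact: smooth_continuous.
Qed.

(** The continuity equation is given in terms of m. It is therefore tested with the x-derivative of
    a(x - y t) b(t), and an integration by parts in x turns m into rho. *)
Lemma mass_equation (a y : R -> R) (A s t : R) : smooth a -> suppin a A -> smooth y ->
  0 < s -> s < t ->
  mpair a (y t) t - mpair a (y s) s =
  \int[leb]_(r in `[s, t]) (upair (derive1 a) (y r) r - derive1 y r * mpair (derive1 a) (y r) r).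
Proof.
move=> sa aA sy s0 st.
have sa' := smooth_derive1 sa.
have aA' := smooth_suppin_derive1 sa aA.
have sy' := smooth_derive1 sy.
have cP r : 0 < r -> {for r, continuous (fun s => mpair a (y s) s)} by exact: (mpair_continuous sa aA).
have cP' r : 0 < r -> {for r, continuous (fun s => mpair (derive1 a) (y s) s)}.
  exact: (mpair_continuous sa' aA').
have cQ' r : 0 < r -> {for r, continuous (fun s => upair (derive1 a) (y s) s)}.
  exact: (upair_continuous sa' aA').
have bP (l v : R) : 0 < l -> bm `[l, v] (fun s => mpair a (y s) s).
  by move=> l0; exact: bm_pos_continuous.
have bP' (l v : R) : 0 < l -> bm `[l, v] (fun s => mpair (derive1 a) (y s) s).
  by move=> l0; exact: bm_pos_continuous.
have bQ' (l v : R) : 0 < l -> bm `[l, v] (fun s => upair (derive1 a) (y s) s).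
  by move=> l0; exact: bm_pos_continuous.
have by' (l v : R) : bm `[l, v] (derive1 y) by exact: bm_smooth.
apply: (@distribution_integrated _ (fun s => mpair a (y s) s)) => //.
  by move=> l v l0; apply: bmB; [exact: bQ'|apply: bmM => //; exact: bP'].
move=> b l v sb l0 b0.
have sb' := smooth_derive1 sb.
have b0' := smooth_zero_derive1 sb b0.
have := ws_mass ws (Cc_smooth_mtest sa' sy sb aA' l0 b0).
have E1 r : \int[leb]_x (d_t (mtest (derive1 a) y b) (x, r) * m_of rho x r) =
    derive1 y r * b r * mpair (derive1 a) (y r) r - derive1 b r * mpair a (y r) r.
  (* A primitive in x of the time derivative of the test function, with compact support in x. *)
  pose g x := (- (derive1 y r * b r)) * derive1 a (x - y r) + derive1 b r * a (x - y r).
  have sg : smooth g.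
    apply: smooth_add; apply: smooth_mul; try exact: smooth_cst; exact: smooth_shift.
  have gA : suppin g (A + `|y r|).
    move=> x h; rewrite /g (suppin_shift aA h) (suppin_shift aA' h).
    by rewrite !mulr0 addr0.
  have dg : derive1 g = fun x => d_t (mtest (derive1 a) y b) (x, r).
    apply/funext => x; rewrite (proj2 (mtest_t (x, r) sa' sy sb)) /mtest /=.
    suff h : derive1 g = fun x => (- (derive1 y r * b r)) * derive1 (derive1 a) (x - y r)
        + derive1 b r * derive1 a (x - y r) by rewrite h; ring.
    apply: is_derive_derive1 => z.
    have h1 := smooth_is_derive z (smooth_shift (y r) sa').
    have h2 := smooth_is_derive z (smooth_shift (y r) sa).
    rewrite derive1_shift// in h1; rewrite derive1_shift// in h2.
    have := is_derive_addf (is_derive_mulf (is_derive_cst (- (derive1 y r * b r)) z 1) h1)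
      (is_derive_mulf (is_derive_cst (derive1 b r) z 1) h2).
    by rewrite !mul0r !add0r.
  rewrite -[LHS]/(\int[leb]_x ((fun x => d_t (mtest (derive1 a) y b) (x, r)) x * cdfl (rho r) x)).
  rewrite -dg (int_derive1_cdfl (rho r) sg gA).
  have [K _ aK] := smooth_suppin_bounded sa aA.
  have [K' _ aK'] := smooth_suppin_bounded sa' aA'.
  have b1 : bm setT (fun x : R => a (x - y r)).
    by apply: (@bm_smooth_bounded _ _ K) => [|x]; [exact: smooth_shift|exact: aK].
  have b2 : bm setT (fun x : R => derive1 a (x - y r)).
    by apply: (@bm_smooth_bounded _ _ K') => [|x]; [exact: smooth_shift|exact: aK'].
  rewrite /g (nintD (rho r) (bmZ _ b2) (bmZ _ b1)) (nintZ (rho r) _ b2) (nintZ (rho r) _ b1).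
  rewrite /mpair /pairing.
  under [in X in _ = X]eq_Rintegral do rewrite mulr1.
  under [in X in _ - X]eq_Rintegral do rewrite mulr1.
  by ring.
have E2 r : \int[rho r]_x (mtest (derive1 a) y b (x, r) * u x r) = b r * upair (derive1 a) (y r) r.
  case: (ltP 0 r) => r0; last first.
    have br : b r = 0 by apply: b0; rewrite negb_and -!ltNge (le_lt_trans r0).
    rewrite br mul0r; apply: Rint_zero => x _.
    by rewrite /mtest /= br mulr0 mul0r.
  have [U [mU UC wU]] := u_slice r0.
  have bU : bm setT U by split => //; exists C.
  have [K' _ aK'] := smooth_suppin_bounded sa' aA'.
  have b2 : bm setT (fun x : R => derive1 a (x - y r)).
    by apply: (@bm_smooth_bounded _ _ K') => [|x]; [exact: smooth_shift|exact: aK'].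
  rewrite /upair (pairing_slice _ wU) -(nintZ (rho r) _ (bmM b2 bU)).
  by apply: ae_eq_Rintegral_nm; apply: ae_imp wU => x -> _; rewrite /mtest /=; ring.
under eq_Rintegral do rewrite E1.
under [X in _ - X = _ -> _]eq_Rintegral do rewrite E2.
rewrite (@Rint_support _ _ l v)//; last by move=> r h; rewrite b0// b0'// !mulr0 !mul0r subrr.
rewrite (@Rint_support _ _ l v)//; last by move=> r h; rewrite b0// mul0r.
have bbl : bm `[l, v] b by exact: bm_smooth.
have bbl' : bm `[l, v] (derive1 b) by exact: bm_smooth.
have B1 := bP l v l0; have B2 := bP' l v l0; have B3 := bQ' l v l0; have B4 := by' l v.
have B5 : bm `[l, v] (fun r => derive1 y r * b r * mpair (derive1 a) (y r) r - derive1 b r * mpair a (y r) r).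
  by apply: bmB; apply: bmM => //; apply: bmM.
rewrite -(cintB B5 (bmM bbl B3)) => h.
apply/eqP; rewrite -oppr_eq0; apply/eqP; rewrite -{}h.
rewrite -cintN; last by apply: bmD; apply: bmM => //; apply: bmB => //; exact: bmM.
by apply: eq_Rintegral => r _; ring.
Qed.

End mass_equation.

Section cutoffs.
Context {R : realType}.
Implicit Types (x z : R) (n : nat).

Definition cut z : R := sstep (2 + z) * sstep (2 - z).

Lemma smooth_cut : smooth cut.
Proof.
have h : smooth (fun z : R => sstep (2 + z)).
  by apply: smooth_comp smooth_sstep _; apply: smooth_add; [exact: smooth_cst|exact: smooth_id].
apply: smooth_mul => //.
by apply: smooth_comp smooth_sstep _; apply: smooth_sub; [exact: smooth_cst|exact: smooth_id].
Qed.

Lemma cut_suppin : suppin cut 3.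
Proof.
move=> z; rewrite /cut ltr_normr => /orP[z3|z3].
  by rewrite (@sstep0 _ (2 - z)) ?mulr0//; lra.
by rewrite (@sstep0 _ (2 + z)) ?mul0r//; lra.
Qed.

Lemma cut_norm z : `|cut z| <= 1.
Proof.
rewrite /cut normrM !ger0_norm ?sstep_ge0//.
by rewrite mulr_ile1 ?sstep_ge0 ?sstep_le1.
Qed.

Lemma cut1 z : `|z| <= 1 -> cut z = 1.
Proof. by rewrite ler_norml /cut => /andP[h1 h2]; rewrite !sstep1 ?mul1r//; lra. Qed.

(** Cutoffs equal to 1 on a ball of radius n + 1, with derivatives of size 1 / (n + 1). *)
Definition chi n x : R := cut (x / n.+1%:R).

Lemma smooth_chi n : smooth (chi n).
Proof.
apply: smooth_comp smooth_cut _; apply: smooth_mul; [exact: smooth_id|exact: smooth_cst].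
Qed.

Lemma derive1_chi n x : derive1 (chi n) x = derive1 cut (x / n.+1%:R) / n.+1%:R.
Proof.
suff -> : derive1 (chi n) = fun x => derive1 cut (x / n.+1%:R) / n.+1%:R by [].
apply: is_derive_derive1 => z.
have h : is_derive z 1 (fun z : R => z / n.+1%:R) n.+1%:R^-1.
  have := is_derive_mulf (is_derive_id z 1) (is_derive_cst (n.+1%:R^-1 : R) z 1).
  by rewrite mulr0 mul1r addr0.
exact: (@is_derive_compf _ cut (fun z => z / n.+1%:R) _ _ _ (smooth_is_derive _ smooth_cut) h).
Qed.

Lemma chi_suppin n : suppin (chi n) (3 * n.+1%:R).
Proof.
by move=> x h; apply: cut_suppin; rewrite normrM normfV (ger0_norm (x := n.+1%:R))// ltr_pdivlMr.
Qed.

Lemma chi_norm n x : `|chi n x| <= 1.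
Proof. exact: cut_norm. Qed.

Lemma chi_cvg x : chi n x @[n --> \oo] --> (1 : R).
Proof.
apply: cvg_near_cst; near=> n; apply: cut1.
rewrite normrM normfV (ger0_norm (x := n.+1%:R))// ler_pdivrMr// mul1r.
rewrite (@le_trans _ _ n%:R)// ?ler_nat//; near: n; exact: nbhs_infty_ger.
Unshelve. all: by end_near. Qed.

Lemma derive1_cut_bound : exists2 K : R, 0 <= K & forall z, `|derive1 cut z| <= K.
Proof.
exact: smooth_suppin_bounded (smooth_derive1 smooth_cut) (smooth_suppin_derive1 smooth_cut cut_suppin).
Qed.

Lemma derive1_chi_bound : exists2 K : R, 0 <= K &
  forall n x, `|derive1 (chi n) x| <= K / n.+1%:R.
Proof.
have [K K0 hK] := derive1_cut_bound; exists K => // n x.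
by rewrite derive1_chi normrM normfV (ger0_norm (x := n.+1%:R))// ler_wpM2r// invr_ge0.
Qed.

Lemma cvg_div_succ (K : R) : K / n.+1%:R @[n --> \oo] --> (0 : R).
Proof. by rewrite -[X in _ --> X](mulr0 K); apply: cvgMr; exact: cvg_harmonic. Qed.

Lemma derive1_chi_cvg x : derive1 (chi n) x @[n --> \oo] --> (0 : R).
Proof.
have [K K0 hK] := derive1_chi_bound.
apply: (@squeeze_cvgr _ _ _ _ (fun n => - (K / n.+1%:R)) (fun n => K / n.+1%:R)).
- by near=> n; rewrite -ler_norml.
- by rewrite -oppr0; apply: cvgN; exact: cvg_div_succ.
- exact: cvg_div_succ.
Unshelve. all: by end_near. Qed.

End cutoffs.

Section mass_conservation.
Context {R : realType}.
Notation leb := (@lebesgue_measure R).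
Variables (tau : R) (rho0 : finmeas R) (u0 : R -> R) (rho : R -> finmeas R) (u : R -> R -> R).
Hypothesis ws : weak_solution tau rho0 u0 rho u.
Variable C : R.
Hypothesis C0 : 0 <= C.
Hypothesis uC : forall x t, 0 < t -> `|u x t| <= C.
Notation M := (total_mass rho0).

Lemma bm_chi n : bm setT (@chi R n).
Proof. by apply: (bm_smooth_bounded (smooth_chi n)) => x; exact: chi_norm. Qed.

Lemma nint_chi_cvg (nu : finmeas R) : \int[nu]_x chi n x @[n --> \oo] --> total_mass nu.
Proof.
have -> : total_mass nu = \int[nu]_x 1 by rewrite Rintegral_cst// mul1r.
apply: (@nint_cvg R nu (fun n x => chi n x) (fun=> 1) 1) => [n|n x _|x _].
- by have [] := bm_chi n.
- exact: chi_norm.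
- exact: chi_cvg.
Qed.

Lemma mpairE (a : R -> R) z r : mpair rho a z r = \int[rho r]_x a (x - z).
Proof. by apply: eq_Rintegral => x _; rewrite mulr1. Qed.

(** Tested with [chi n], the mass changes by at most the integral of |u| |chi n'|, which is O(1 / n)
    since u is bounded. *)
Lemma mass_lt s t : 0 < s -> s < t -> total_mass (rho t) = total_mass (rho s).
Proof.
move=> s0 st.
have [K K0 hK] := @derive1_chi_bound R.
have E n : `|mpair rho (chi n) 0 t - mpair rho (chi n) 0 s| <= (K * C * M * (t - s)) / n.+1%:R.
  have scst : smooth (fun=> 0 : R) := smooth_cst 0.
  rewrite (mass_equation ws C0 uC (smooth_chi n) (@chi_suppin R n) scst s0 st).
  have cQ r : 0 < r -> {for r, continuous (fun s => upair rho u (derive1 (chi n)) 0 s)}.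
    apply: (upair_continuous ws C0 uC (y := fun=> 0) (A := 3 * n.+1%:R)) => //.
      exact: smooth_derive1 (smooth_chi n).
    exact: smooth_suppin_derive1 (smooth_chi n) (@chi_suppin R n).
  have -> : \int[leb]_(r in `[s, t]) (upair rho u (derive1 (chi n)) 0 r - derive1 (fun=> 0 : R) r *
      mpair rho (derive1 (chi n)) 0 r) = \int[leb]_(r in `[s, t]) upair rho u (derive1 (chi n)) 0 r.
    by apply: eq_Rintegral => r _; rewrite derive1_cst mul0r subr0.
  have bQ : bm `[s, t] (fun r => upair rho u (derive1 (chi n)) 0 r) by exact: bm_pos_continuous.
  have := @cint_bound _ _ _ (K / n.+1%:R * C * M) _ bQ.
  rewrite (fine_leb_itv (ltW st)) => h.
  rewrite (_ : K * C * M * (t - s) / n.+1%:R = K / n.+1%:R * C * M * (t - s)); last by ring.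
  apply: h => r; rewrite /= in_itv/= => /andP[sr _].
  have r0 : 0 < r by exact: lt_le_trans sr.
  have b1 : bm setT (fun x : R => derive1 (chi n) (x - 0)).
    apply: (@bm_smooth_bounded _ _ (K / n.+1%:R)) => [|x]; last exact: hK.
    by apply: smooth_shift; apply: smooth_derive1; exact: smooth_chi.
  apply: le_trans (pairing_bound (u_slice ws C0 uC r0) b1 (fun x => hK n (x - 0))) _.
  by rewrite ler_wpM2l ?mulr_ge0 ?invr_ge0// (mass_le ws r0).
have L1 : mpair rho (chi n) 0 t - mpair rho (chi n) 0 s @[n --> \oo] -->
    total_mass (rho t) - total_mass (rho s).
  have e n r : mpair rho (chi n) 0 r = \int[rho r]_x chi n x.
    by rewrite mpairE; apply: eq_Rintegral => x _; rewrite subr0.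
  under eq_fun do rewrite !e.
  by apply: cvgB; exact: nint_chi_cvg.
have L2 : mpair rho (chi n) 0 t - mpair rho (chi n) 0 s @[n --> \oo] --> 0.
  apply: (@squeeze_cvgr _ _ _ _ (fun n => - (K * C * M * (t - s) / n.+1%:R))
     (fun n => K * C * M * (t - s) / n.+1%:R)).
  - by near=> n; rewrite -ler_norml.
  - by rewrite -oppr0; apply: cvgN; exact: cvg_div_succ.
  - exact: cvg_div_succ.
by apply/eqP; rewrite -subr_eq0; apply/eqP; exact: cvg_unique L1 L2.
Unshelve. all: by end_near. Qed.

Lemma mass_const s t : 0 < s -> 0 < t -> total_mass (rho t) = total_mass (rho s).
Proof.
move=> s0 t0; have [st|ts|->//] := ltgtP s t; first exact: mass_lt.
by apply/esym; exact: mass_lt.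
Qed.

(** No mass appears, by [mass_le]. None is lost at t = 0+: what a cutoff sees of rho0 is a limit of
    what it sees at positive times, hence at most the constant total mass. *)
Lemma mass_eq t : 0 < t -> total_mass (rho t) = M.
Proof.
move=> t0; apply/eqP; rewrite eq_le (mass_le ws t0)/=.
apply: (cvgr_to_le (@nint_chi_cvg rho0)); near=> n.
have cchi : Cc (@chi R n).
  exact: Cc_suppin (smooth_continuous (smooth_chi n)) (@chi_suppin R n).
have h := ws_init_rho ws cchi.
have -> : \int[rho0]_x chi n x = pairing rho0 (fun=> 1) (chi n).
  by apply: eq_Rintegral => x _; rewrite mulr1.
apply: (cvgr_to_le h); near=> s.
have s0 : 0 < s by near: s; exact: nbhs_right_gt.
rewrite (mass_const s0 t0).
rewrite (_ : total_mass (rho s) = \int[rho s]_x 1); last by rewrite Rintegral_cst// mul1r.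
rewrite (_ : pairing _ _ _ = \int[rho s]_x chi n x); last by apply: eq_Rintegral => x _; rewrite mulr1.
apply: (nint_le (rho s) (bm_chi n)) => [|x _]; first exact: bm_cst.
exact: le_trans (ler_norm _) (chi_norm n x).
Unshelve. all: by end_near. Qed.

(** A pointwise limit of functions continuous in t: pairings with compactly supported smooth
    functions that converge to the indicator of z < x. *)
Lemma measurable_cdfl_time x :
  measurable_fun (`]0%R, +oo[%classic : set R) (fun t => cdfl (rho t) x).
Proof.
pose f n z : R := sstep (n.+1%:R * (x - z) - 1) * chi n z.
have sf n : smooth (f n).
  apply: smooth_mul; last exact: smooth_chi.
  apply: smooth_comp smooth_sstep _; apply: smooth_sub; last exact: smooth_cst.
  apply: smooth_mul; first exact: smooth_cst.
  by apply: smooth_sub; [exact: smooth_cst|exact: smooth_id].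
have fA n : suppin (f n) (3 * n.+1%:R) by move=> z h; rewrite /f (chi_suppin h) mulr0.
have f1 n z : `|f n z| <= 1.
  rewrite /f normrM mulr_ile1 ?chi_norm// ger0_norm ?sstep_ge0//; exact: sstep_le1.
have mf n : measurable_fun setT (f n).
  exact: continuous_measurable_fun (smooth_continuous (sf n)).
apply: (@measurable_fun_cvg _ _ _ _ (fun n t => mpair rho (f n) 0 t)) => [n|t].
  apply: measurable_pos_continuous => t t0.
  by apply: (mpair_continuous ws (y := fun=> 0) (A := 3 * n.+1%:R)) => //; exact: smooth_cst.
rewrite /= in_itv/= andbT => t0.
have e n : mpair rho (f n) 0 t = \int[rho t]_z f n z.
  by rewrite mpairE; apply: eq_Rintegral => z _; rewrite subr0.
have mx : measurable_fun setT (fun z : R => z < x).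
  by apply: measurable_fun_ltr; [exact: measurable_id|exact: measurable_cst].
have -> : cdfl (rho t) x = \int[rho t]_z bR (z < x).
  rewrite (@int_bool _ (measurableTypeR R) _ (rho t) setT (fun z : R => z < x)) //.
  by congr fine; congr (rho t _); apply/seteqP; split => z /=; rewrite in_itv//= => -[].
under eq_fun do rewrite e.
apply: (@nint_cvg R (rho t) (fun n z => f n z) (fun z => bR (z < x)) 1) => // z _.
rewrite -[X in _ --> X]mulr1; apply: cvgM; last exact: chi_cvg.
apply: cvg_near_cst; near=> n; have [zx|xz] := ltP z x.
  rewrite sstep1// lerBrDr -(ler_pdivrMr)// ?subr_gt0//.
  rewrite (@le_trans _ _ n%:R)// ?ler_nat//; near: n; exact: nbhs_infty_ger.
by rewrite sstep0// gerDr -oppr_ge0 -mulrN mulr_ge0// opprB subr_ge0.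
Unshelve. all: by end_near. Qed.

End mass_conservation.

Lemma measurable_fun_pair_on d d1 d2 (T : measurableType d) (T1 : measurableType d1)
    (T2 : measurableType d2) (D : set T) (f : T -> T1) (g : T -> T2) :
  measurable_fun D f -> measurable_fun D g -> measurable_fun D (fun x => (f x, g x)).
Proof.
move=> mf mg mD.
suff h : measurable_fun D (fun x => (f x, g x)) by exact: h.
apply: (measurability _ (@measurable_prod_measurableType _ _ T1 T2)) => //.
move=> _ [_ [A mA [B mB <-]] <-].
have -> : D `&` (fun x => (f x, g x)) @^-1` (A `*` B) = (D `&` f @^-1` A) `&` (D `&` g @^-1` B).
  by apply/seteqP; split => x /= => [[Dx [? ?]]|[[? ?] [? ?]]].
by apply: measurableI; [exact: mf|exact: mg].
Qed.

Section joint.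
Context {R : realType}.
Notation leb := (@lebesgue_measure R).

Lemma bm_slice1 (A B : set R) (F : R * R -> R) y : measurable A -> measurable B ->
  bm (A `*` B) F -> B y -> bm A (fun x => F (x, y)).
Proof.
move=> mA mB [mF [K FK]] By; split.
  apply: (measurable_comp (F := A `*` B) (g := fun x : R => (x, y))).
  - exact: measurableX.
  - by move=> _ [x Ax <-].
  - exact: mF.
  - by apply: measurable_funTS; exact: pair2_measurable.
by exists K => x Ax; apply: FK.
Qed.

Lemma bm_slice2 (A B : set R) (F : R * R -> R) x : measurable A -> measurable B ->
  bm (A `*` B) F -> A x -> bm B (fun y => F (x, y)).
Proof.
move=> mA mB [mF [K FK]] Ax; split.
  apply: (measurable_comp (F := A `*` B) (g := fun y : R => (x, y))).
  - exact: measurableX.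
  - by move=> _ [y By <-].
  - exact: mF.
  - by apply: measurable_funTS; exact: pair1_measurable.
by exists K => y By; apply: FK.
Qed.

Lemma double_cvg (A B : set R) (F_ : nat -> R * R -> R) (F : R * R -> R) (K : R) :
  measurable A -> measurable B -> (leb A < +oo)%E -> (leb B < +oo)%E ->
  (forall n, bm (A `*` B) (F_ n)) -> (forall n p, (A `*` B) p -> `|F_ n p| <= K) ->
  (forall p, (A `*` B) p -> F_ n p @[n --> \oo] --> F p) ->
  \int[leb]_(y in B) (\int[leb]_(x in A) F_ n (x, y)) @[n --> \oo] -->
  \int[leb]_(y in B) (\int[leb]_(x in A) F (x, y)).
Proof.
move=> mA mB fA fB bF FK cF.
apply: (@bounded_convergence _ (measurableTypeR R) R leb B mB fB _ _ (K * fine (leb A))).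
- by move=> n; have [] := leb_fubini2 mA mB fA fB (bF n).
- move=> n y By; apply: (@bm_int_bound _ (measurableTypeR R) R leb A mA fA _ _ (bm_slice1 mA mB (bF n) By)) => x Ax.
  exact: FK.
- move=> y By; apply: (@bounded_convergence _ (measurableTypeR R) R leb A mA fA _ _ K).
  + by move=> n; have [] := bm_slice1 mA mB (bF n) By.
  + by move=> n x Ax; exact: FK.
  + by move=> x Ax; exact: cF.
Qed.

End joint.

(** Test functions without compact support, such as [step n] and [logistic]; [bsm_cutoff] reduces
    them to compactly supported ones. *)
Definition bsm (R : realType) (a : R -> R) := [/\ smooth a,
  exists K, forall x, `|a x| <= K & exists K, forall x, `|derive1 a x| <= K].

Section left_right_limits.
Context {R : realType}.
Variable nu : finmeas R.

Lemma cdfl_at_left x : cdfl nu y @[y --> x^'-] --> cdfl nu x.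
Proof.
apply/cvgrPdist_lt => e e0.
have /cvgrPdist_lt/(_ _ e0) := @cdfl_left_lim R nu x.
move=> [n _ /(_ n (leqnn n)) /= h].
near=> y.
have h1 : cdfl nu (x - n.+1%:R^-1) <= cdfl nu y.
  by apply: cdfl_homo; near: y; apply: nbhs_left_ge; rewrite ltrBlDr ltrDl invr_gt0.
have h2 : cdfl nu y <= cdfl nu x by apply: cdfl_homo; near: y; exact: nbhs_left_le.
rewrite ger0_norm ?subr_ge0//; have := ler_norm (cdfl nu x - cdfl nu (x - n.+1%:R^-1)); lra.
Unshelve. all: by end_near. Qed.

Lemma cdfl_at_right x : cdfl nu y @[y --> x^'+] --> cdflc nu x.
Proof.
apply/cvgrPdist_lt => e e0.
have /cvgrPdist_lt/(_ _ e0) := @cdfl_right_lim R nu x.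
move=> [n _ /(_ n (leqnn n)) /= h].
near=> y.
have h1 : cdfl nu y <= cdfl nu (x + n.+1%:R^-1).
  by apply: cdfl_homo; near: y; apply: nbhs_right_le; rewrite ltrDl invr_gt0.
have h2 : cdflc nu x <= cdfl nu y.
  apply: fine_nu_le => //; apply: subset_itvl; rewrite bnd_simp.
  near: y; exact: nbhs_right_gt.
rewrite distrC ger0_norm ?subr_ge0//.
have := ler_norm (cdfl nu (x + n.+1%:R^-1) - cdflc nu x).
by rewrite distrC in h; rewrite /cdflc in h2 *; lra.
Unshelve. all: by end_near. Qed.

End left_right_limits.

(** * The equations in mass labels *)

Section label_form.
Context {R : realType}.
Notation leb := (@lebesgue_measure R).
Variables (rho : R -> finmeas R) (G : R * R -> R) (M C : R).

Notation D := (`]0%R, M[%classic : set R).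
Definition lab r w : R := qf (rho r) w.
Definition vel r w : R := G (lab r w, r).

Hypothesis mass : forall t, 0 < t -> total_mass (rho t) = M.
Hypothesis mlab : measurable_fun (D `*` (`]0%R, +oo[%classic : set R))
  (fun p : R * R => lab p.2 p.1).
Hypothesis mG : measurable_fun setT G.
Hypothesis GC : forall p, `|G p| <= C.

Let mD : measurable D := measurable_itv _.
Let fD : (leb D < +oo)%E := leb_itvoo_fin _ _.

Lemma lab_int (f : R -> R) t : 0 < t -> bm setT f ->
  \int[rho t]_x f x = \int[leb]_(w in D) f (lab t w).
Proof. by move=> t0 bf; rewrite push_integral// mass. Qed.

Section box.
Variables l v : R.
Hypothesis l0 : 0 < l.
Notation B := (D `*` (`[l, v]%classic : set R)).

Lemma measurable_lab_box : measurable_fun B (fun p : R * R => lab p.2 p.1).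
Proof.
apply: measurable_funS mlab; first exact: measurableX.
move=> [w r] /= []; rewrite !in_itv/= => hw /andP[lr rv]; split => //.
by rewrite andbT (lt_le_trans l0).
Qed.

Lemma measurable_snd_box : measurable_fun B (fun p : R * R => p.2).
Proof. by apply: measurable_funTS; exact: measurable_snd. Qed.

Lemma bm_vel_box : bm B (fun p : R * R => vel p.2 p.1).
Proof.
split; last by exists C => p _; exact: GC.
apply: (measurable_comp (F := setT) (g := fun p : R * R => (lab p.2 p.1, p.2))) => //.
by apply: measurable_fun_pair_on; [exact: measurable_lab_box|exact: measurable_snd_box].
Qed.

Lemma bm_time_box (c : R -> R) : bm `[l, v] c -> bm B (fun p : R * R => c p.2).
Proof. by move=> bc; apply: bm_comp2. Qed.

Lemma bm_lab_box (a y : R -> R) : bm setT a -> measurable_fun `[l, v] y ->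
  bm B (fun p : R * R => a (lab p.2 p.1 - y p.2)).
Proof.
move=> [ma [K aK]] my; split; last by exists K => p _; exact: aK.
apply: (measurable_comp (F := setT) (f := a)) => //.
by apply: measurable_funB; [exact: measurable_lab_box|exact: measurable_comp2].
Qed.

End box.

Lemma measurable_lab t : 0 < t -> measurable_fun D (lab t).
Proof.
move=> t0; have h : measurable_fun (D `*` (`[t, t]%classic : set R)) (fun p : R * R => lab p.2 p.1).
  exact: measurable_lab_box.
apply: (measurable_comp (F := D `*` `[t, t]) (g := fun w : R => (w, t)) _ _ h).
- exact: measurableX.
- by move=> _ [w wD <-]; split => //=; rewrite in_itv/= lexx.
- by apply: measurable_funTS; exact: pair2_measurable.
Qed.

Lemma bm_lab t (a : R -> R) : 0 < t -> bm setT a -> bm D (fun w => a (lab t w)).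
Proof. by move=> t0 ba; apply: bm_comp ba; exact: measurable_lab. Qed.

Lemma bm_slice_G t : bm setT (fun x => G (x, t)).
Proof.
split; last by exists C => x _; exact: GC.
by apply: (measurableT_comp mG); exact: pair2_measurable.
Qed.

Lemma bm_vel t : 0 < t -> bm D (vel t).
Proof. by move=> t0; exact: (bm_lab t0 (bm_slice_G t)). Qed.

End label_form.

Section representative.
Context {R : realType}.
Notation leb := (@lebesgue_measure R).
Variables (tau : R) (rho0 : finmeas R) (u0 : R -> R) (rho : R -> finmeas R) (u : R -> R -> R).
Hypothesis ws : weak_solution tau rho0 u0 rho u.
Variable C : R.
Hypothesis C0 : 0 <= C.
Hypothesis uC : forall x t, 0 < t -> `|u x t| <= C.
Notation M := (total_mass rho0).
Notation D := (`]0%R, M[%classic : set R).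

Lemma measurable_lab_ws : measurable_fun (D `*` (`]0%R, +oo[%classic : set R))
  (fun p : R * R => lab rho p.2 p.1).
Proof.
apply: measurable_qf2; first exact: measurable_itv.
- by move=> t; rewrite /= in_itv/= andbT; exact: (mass_eq ws C0 uC).
- by move=> x; exact: (measurable_cdfl_time ws).
Qed.

(** In labels the mass of the section of N at time t is the Lebesgue measure of the section of one
    Borel set [E], so it is measurable in t. Being nonnegative with integral 0, it vanishes for
    almost every t. *)
Lemma m_x_null_sections (N : set (R * R)) : measurable N -> m_x rho N = 0%E ->
  {ae leb, forall t, 0 < t -> rho t (ysection N t) = 0%E}.
Proof.
move=> mN N0.
pose P : set R := `]0%R, +oo[%classic.
have mP : measurable P := measurable_itv _.
pose E : set (R * R) := (D `*` P) `&` [set p | N (lab rho p.2 p.1, p.2)].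
have mE : measurable E.
  have mDP : measurable (D `*` P) by apply: measurableX => //; exact: measurable_itv.
  have h : measurable_fun (D `*` P) (fun p : R * R => (lab rho p.2 p.1, p.2)).
    apply: measurable_fun_pair_on; first exact: measurable_lab_ws.
    by apply: measurable_funTS; exact: measurable_snd.
  exact: (h mDP N mN).
have mf : measurable_fun P (fun t => leb (ysection E t)).
  by apply: measurable_funTS; exact: (@measurable_fun_ysection _ _ (measurableTypeR R) (measurableTypeR R) R leb E mE).
have sE t : P t -> rho t (ysection N t) = leb (ysection E t).
  move=> Pt; have t0 : 0 < t by move: Pt; rewrite /P/= in_itv/= andbT.
  have mNt : measurable (ysection N t) by exact: measurable_ysection.
  rewrite (push_measure _ mNt) (mass_eq ws C0 uC t0); congr (leb _).
  apply/seteqP; split => w /=; rewrite /ysection /=.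
    by move=> [Dw /set_mem h]; apply/mem_set; split.
  by move=> /set_mem[[Dw _] h]; split => //; apply/mem_set.
have I0 : (\int[leb]_(t in P) `|leb (ysection E t)|)%E = 0.
  rewrite -[RHS]N0; apply: eq_integral => t /set_mem Pt.
  by rewrite gee0_abs// sE.
have [N' [mN' N'0 hN']] := (ae_eq_integral_abs leb mP mf).1 I0.
exists N'; split => // t /= nt; apply: hN' => /= h; apply: nt => t0.
have Pt : P t by rewrite /P/= in_itv/= andbT.
by rewrite (sE t Pt); exact: h.
Qed.

(** u equals a Borel function off an m_x-null set, whose sections are null at almost every time.
    Truncation at C makes the bound hold everywhere without changing values of u. *)
Lemma velocity_representative : exists G : R * R -> R,
  [/\ measurable_fun setT G, forall p, `|G p| <= C &
    {ae leb, forall t, 0 < t -> {ae rho t, forall x, u x t = G (x, t)}}].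
Proof.
have [g [mg [N [mN N0 hN]]]] := ws_measurable ws.
exists (fun p => clip C (g p)); split; first exact: measurable_clip.
  by move=> p; exact: clip_norm.
apply: ae_imp (m_x_null_sections mN N0) => t h t0.
exists (ysection N t); split; [exact: measurable_ysection|exact: h|].
move=> x /= nx; rewrite /ysection /=; apply/mem_set; apply: hN => /= ug; apply: nx.
by rewrite -ug clip_id// uC.
Qed.

End representative.

Lemma ae_eq_time (R : realType) (good : R -> Prop) (D : set R) (f g : R -> R) :
  {ae (@lebesgue_measure R), forall t, 0 < t -> good t} ->
  (forall t, D t -> 0 < t) -> (forall t, good t -> D t -> f t = g t) ->
  \int[lebesgue_measure]_(t in D) f t = \int[lebesgue_measure]_(t in D) g t.
Proof.
move=> ag D0 fg; apply: ae_eq_Rintegral_nm; apply: ae_imp ag => t h Dt.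
exact: fg (h (D0 _ Dt)) Dt.
Qed.

Section transport.
Context {R : realType}.
Notation leb := (@lebesgue_measure R).
Variables (tau : R) (rho0 : finmeas R) (u0 : R -> R) (rho : R -> finmeas R) (u : R -> R -> R).
Hypothesis ws : weak_solution tau rho0 u0 rho u.
Variable C : R.
Hypothesis C0 : 0 <= C.
Hypothesis uC : forall x t, 0 < t -> `|u x t| <= C.
Notation M := (total_mass rho0).
Notation D := (`]0%R, M[%classic : set R).
Variable G : R * R -> R.
Hypothesis mG : measurable_fun setT G.
Hypothesis GC : forall p, `|G p| <= C.

Definition repr_at t := 0 < t /\ {ae rho t, forall x, u x t = G (x, t)}.

Hypothesis aG : {ae leb, forall t, 0 < t -> repr_at t}.

Notation X := (lab rho).
Notation V := (vel rho G).

Let mass := mass_eq ws C0 uC.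
Let mlab := measurable_lab_ws ws C0 uC.
Let mD : measurable D := measurable_itv _.
Let fD : (leb D < +oo)%E := leb_itvoo_fin _ _.

Lemma upair_lab (a : R -> R) z r : repr_at r -> bm setT a ->
  upair rho u a z r = \int[leb]_(w in D) (a (X r w - z) * V r w).
Proof.
move=> [r0 ur] [ma [K aK]]; rewrite /upair (pairing_slice _ ur).
apply: (lab_int mass (f := fun x => a (x - z) * G (x, r)) r0).
apply: bmM; last exact: bm_slice_G mG GC r.
split; last by exists K => x _; exact: aK.
by apply: (measurableT_comp ma); exact: measurable_funB.
Qed.

Lemma bm_shift (a : R -> R) (z : R) : bm setT a -> bm setT (fun x : R => a (x - z)).
Proof.
move=> [ma [K aK]]; split; last by exists K => x _; exact: aK.
by apply: (measurableT_comp ma); exact: measurable_funB.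
Qed.

Lemma mpair_lab (a : R -> R) z r : 0 < r -> bm setT a ->
  mpair rho a z r = \int[leb]_(w in D) a (X r w - z).
Proof.
move=> r0 ba; rewrite mpairE.
exact: (lab_int mass (f := fun x => a (x - z)) r0 (bm_shift z ba)).
Qed.

Lemma bm_suppin (a : R -> R) A : smooth a -> suppin a A -> bm setT a.
Proof.
move=> sa aA; have [K _ aK] := smooth_suppin_bounded sa aA; exact: bm_smooth_bounded sa aK.
Qed.

Lemma bm_D_lab (a : R -> R) z r : 0 < r -> bm setT a -> bm D (fun w => a (X r w - z)).
Proof. by move=> r0 ba; exact: (bm_lab mlab r0 (bm_shift z ba)). Qed.

Lemma bm_D_vel r : 0 < r -> bm D (V r).
Proof. exact: bm_vel mlab mG GC r. Qed.

Lemma mass_label_c (a y : R -> R) (A s t : R) : smooth a -> suppin a A -> smooth y ->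
  0 < s -> s < t ->
  \int[leb]_(w in D) a (X t w - y t) - \int[leb]_(w in D) a (X s w - y s) =
  \int[leb]_(r in `[s, t]) (\int[leb]_(w in D) (derive1 a (X r w - y r) * (V r w - derive1 y r))).
Proof.
move=> sa aA sy s0 st.
have ba := bm_suppin sa aA.
have ba' := bm_suppin (smooth_derive1 sa) (smooth_suppin_derive1 sa aA).
rewrite -!mpair_lab ?(lt_trans s0 st)// (mass_equation ws C0 uC sa aA sy s0 st).
apply: (ae_eq_time aG) => r; first by rewrite /= in_itv/= => /andP[sr _]; exact: lt_le_trans sr.
move=> gr _; have r0 := proj1 gr.
rewrite (upair_lab _ gr ba') (mpair_lab _ r0 ba').
have b1 := bm_D_lab (y r) r0 ba'; have b2 := bm_D_vel r0.
rewrite -(ointZ _ b1) -(ointB (bmM b1 b2) (bmZ _ b1)).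
by apply: eq_Rintegral => w _; ring.
Qed.

Lemma bm_id_D : bm D (fun w => w).
Proof.
split; first exact: measurable_id.
exists M => w; rewrite /= in_itv/= => /andP[w0 wM].
by rewrite ger0_norm ltW.
Qed.

(** The limits in [m_tilde] are [cdfl] and [cdflc], so [int_m_tilde] gives the force w - M / 2 of
    the label w. *)
Lemma m_tilde_lab (f : R -> R) r : repr_at r -> bm setT f ->
  \int[rho r]_x ((m_tilde rho0 rho x r + u x r / tau) * f x) =
  \int[leb]_(w in D) (f (X r w) * (w - M / 2 + V r w / tau)).
Proof.
move=> [r0 ur] bf.
have E : \int[rho r]_x ((m_tilde rho0 rho x r + u x r / tau) * f x) =
    \int[rho r]_x (2^-1 * (cdfl (rho r) x + cdflc (rho r) x - M) * f x + G (x, r) / tau * f x).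
  apply: ae_eq_Rintegral_nm; apply: ae_imp ur => x -> _; rewrite mulrDl; congr (_ * _ + _).
  rewrite /m_tilde.
  have -> : lim (m_of rho y r @[y --> x^'-]) = cdfl (rho r) x.
    apply/cvg_lim => //; exact: cdfl_at_left.
  have -> // : lim (m_of rho y r @[y --> x^'+]) = cdflc (rho r) x.
  apply/cvg_lim => //; exact: cdfl_at_right.
have bc1 : bm setT (cdfl (rho r)).
  split; first by apply: nondecreasing_measurable => //; exact: cdfl_homo.
  by exists M => x _; rewrite ger0_norm ?cdfl_ge0// -(mass r0) cdfl_le_mass.
have bc2 : bm setT (cdflc (rho r)).
  split.
    apply: nondecreasing_measurable => // x y xy; apply: fine_nu_le => //.
    by apply: subset_itvl; rewrite bnd_simp.
  by exists M => x _; rewrite -(mass r0) ger0_norm ?fine_ge0//; exact: fine_nu_le.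
have bG := bm_slice_G mG GC r.
have B1 : bm setT (fun x => 2^-1 * (cdfl (rho r) x + cdflc (rho r) x - M) * f x).
  apply: bmM => //; apply: bmZ; apply: bmB; last exact: bm_cst.
  exact: bmD.
have B2 : bm setT (fun x => G (x, r) / tau * f x).
  by apply: bmM => //; apply: bmM => //; exact: bm_cst.
rewrite E (nintD (rho r) B1 B2) (lab_int mass r0 B2).
have := int_m_tilde (rho r) bf; rewrite (mass r0) => ->.
have bfX : bm D (fun w => f (X r w)) := bm_lab mlab r0 bf.
have bw : bm D (fun w => w - M / 2) by apply: bmB; [exact: bm_id_D|exact: bm_cst].
have b3 : bm D (fun w => V r w / tau * f (X r w)).
  by apply: bmM => //; apply: bmM; [exact: bm_D_vel|exact: bm_cst].
rewrite -(ointD (bmM bfX bw) b3).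
by apply: eq_Rintegral => w _; rewrite /vel; ring.
Qed.

(** The time factor c is absorbed into the test function; later it is the integrating factor of the
    damping. The end times must be represented by [G], because the momentum is evaluated there in
    labels. *)
Lemma momentum_label_c (a y c : R -> R) (A s t : R) : smooth a -> suppin a A -> smooth y ->
  smooth c -> repr_at s -> repr_at t -> s < t ->
  c t * \int[leb]_(w in D) (a (X t w - y t) * V t w)
  - c s * \int[leb]_(w in D) (a (X s w - y s) * V s w) =
  \int[leb]_(r in `[s, t]) (\int[leb]_(w in D)
    (derive1 c r * (a (X r w - y r) * V r w)
     + c r * (derive1 a (X r w - y r) * (V r w - derive1 y r) * V r w
              - a (X r w - y r) * (w - M / 2 + V r w / tau)))).
Proof.
move=> sa aA sy sc gs gt st; have s0 := proj1 gs.
have ba := bm_suppin sa aA.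
have sa' := smooth_derive1 sa.
have sc' := smooth_derive1 sc.
have sy' := smooth_derive1 sy.
have aA' := smooth_suppin_derive1 sa aA.
have ba' := bm_suppin sa' aA'.
rewrite -(upair_lab _ gs ba) -(upair_lab _ gt ba).
have cU r : 0 < r -> {for r, continuous (fun s => upair rho u a (y s) s)}.
  exact: (upair_continuous ws C0 uC sa aA).
have cP r : 0 < r -> {for r, continuous (fun r => c r * upair rho u a (y r) r)}.
  by move=> r0; apply: cvgM; [exact: smooth_continuous|exact: cU].
have bL (l v : R) : 0 < l -> bm (D `*` `[l, v]) (fun p : R * R => a (X p.2 p.1 - y p.2)).
  move=> l0; apply: (bm_lab_box mlab l0 ba); apply: measurable_funTS.
  exact: continuous_measurable_fun (smooth_continuous sy).
have bL' (l v : R) : 0 < l -> bm (D `*` `[l, v]) (fun p : R * R => derive1 a (X p.2 p.1 - y p.2)).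
  move=> l0; apply: (bm_lab_box mlab l0 ba'); apply: measurable_funTS.
  exact: continuous_measurable_fun (smooth_continuous sy).
have bVb (l v : R) : 0 < l -> bm (D `*` `[l, v]) (fun p : R * R => V p.2 p.1).
  by move=> l0; exact: (bm_vel_box mlab mG GC v l0).
have bwb (l v : R) : bm (D `*` `[l, v]) (fun p : R * R => p.1 - M / 2).
  apply: bmB; last exact: bm_cst.
  by apply: (bm_comp1 (f := id)) => //; exact: bm_id_D.
have bt (l v : R) (f : R -> R) : smooth f -> bm (D `*` `[l, v]) (fun p : R * R => f p.2).
  by move=> sf; apply: bm_time_box; exact: bm_smooth.
have bK1 (l v : R) : 0 < l -> bm (D `*` `[l, v]) (fun p : R * R =>
    derive1 a (X p.2 p.1 - y p.2) * (V p.2 p.1 - derive1 y p.2) * V p.2 p.1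
    - a (X p.2 p.1 - y p.2) * (p.1 - M / 2 + V p.2 p.1 / tau)).
  move=> l0; have h1 := bL l v l0; have h2 := bL' l v l0; have h3 := bVb l v l0.
  have h4 := bwb l v; have h5 := bt l v _ sy'.
  apply: bmB; apply: bmM => //; first by apply: bmM => //; exact: bmB.
  by apply: bmD => //; apply: bmM => //; exact: bm_cst.
have bK0 (l v : R) : 0 < l -> bm (D `*` `[l, v]) (fun p : R * R => a (X p.2 p.1 - y p.2) * V p.2 p.1).
  by move=> l0; apply: bmM; [exact: bL|exact: bVb].
have bK (l v : R) : 0 < l -> bm (D `*` `[l, v]) (fun p : R * R =>
    derive1 c p.2 * (a (X p.2 p.1 - y p.2) * V p.2 p.1) +
    c p.2 * (derive1 a (X p.2 p.1 - y p.2) * (V p.2 p.1 - derive1 y p.2) * V p.2 p.1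
    - a (X p.2 p.1 - y p.2) * (p.1 - M / 2 + V p.2 p.1 / tau))).
  move=> l0; have h1 := bt l v _ sc; have h2 := bt l v _ sc'.
  by apply: bmD; apply: bmM => //; [exact: bK0|exact: bK1].
apply: (@distribution_integrated _ (fun r => c r * upair rho u a (y r) r)) => //.
- by move=> l v l0; exact: bm_pos_continuous.
- move=> l v l0; exact: (leb_fubini2 mD (measurable_itv _) fD (leb_itv_fin _ _) (bK l v l0)).
move=> b l v sb l0 b0.
have sb' := smooth_derive1 sb.
have b0' := smooth_zero_derive1 sb b0.
have sbc := smooth_mul sb sc.
have dbc r : derive1 (fun r => b r * c r) r = derive1 b r * c r + b r * derive1 c r.
  suff -> : derive1 (fun r => b r * c r) = fun r => derive1 b r * c r + b r * derive1 c r by [].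
  apply: is_derive_derive1 => z.
  by have := is_derive_mulf (smooth_is_derive z sb) (smooth_is_derive z sc); rewrite addrC [X in is_derive _ _ _ X](_ : _ = derive1 b z * c z + b z * derive1 c z)//; ring.
have bc0 r : ~~ (l <= r <= v) -> b r * c r = 0 by move=> /b0 ->; rewrite mul0r.
have := ws_momentum ws (Cc_smooth_mtest sa sy sbc aA l0 bc0).
have Ex x r : d_x (mtest a y (fun r => b r * c r)) (x, r) = derive1 a (x - y r) * (b r * c r).
  by rewrite (proj2 (mtest_x _ _ _ sa)).
have Et x r : d_t (mtest a y (fun r => b r * c r)) (x, r) =
   derive1 a (x - y r) * (- derive1 y r * (b r * c r)) + a (x - y r) * (derive1 b r * c r + b r * derive1 c r).
  by rewrite (proj2 (mtest_t _ sa sy sbc)) /mtest /= dbc.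
rewrite (@Rint_support _ _ l v)//; last first.
  move=> r h; apply: Rint_zero => x _; rewrite Ex Et bc0// b0// b0'//.
  by rewrite !(mulr0, mul0r, addr0).
rewrite (@Rint_support _ _ l v)//; last first.
  by move=> r h; apply: Rint_zero => x _; rewrite /mtest/= bc0// !mulr0.
have pos r : `[l, v]%classic r -> 0 < r by rewrite /= in_itv/= => /andP[lr _]; exact: lt_le_trans lr.
rewrite (ae_eq_time (g := fun r => \int[leb]_(w in D)
  ((b r * c r) * (derive1 a (X r w - y r) * (V r w - derive1 y r) * V r w) +
   (derive1 b r * c r + b r * derive1 c r) * (a (X r w - y r) * V r w))) aG pos); last first.
  move=> r gr _; have r0 := proj1 gr.
  have -> : \int[rho r]_x (d_t (mtest a y (fun r => b r * c r)) (x, r) * u x r +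
    d_x (mtest a y (fun r => b r * c r)) (x, r) * u x r ^+ 2) =
    \int[rho r]_x ((b r * c r) * (derive1 a (x - y r) * (G (x, r) - derive1 y r) * G (x, r)) +
    (derive1 b r * c r + b r * derive1 c r) * (a (x - y r) * G (x, r))).
    apply: ae_eq_Rintegral_nm; apply: ae_imp (proj2 gr) => x -> _.
    by rewrite Ex Et; ring.
  have h1 := bm_shift (y r) ba; have h2 := bm_shift (y r) ba'.
  have h3 := bm_slice_G mG GC r.
  apply: (lab_int mass r0); apply: bmD; apply: bmZ; last exact: bmM.
  by apply: bmM => //; apply: bmM => //; apply: bmB => //; exact: bm_cst.
rewrite [X in _ = X -> _](ae_eq_time (g := fun r => \int[leb]_(w in D)
  ((b r * c r) * (a (X r w - y r) * (w - M / 2 + V r w / tau)))) aG pos); last first.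
  move=> r gr _; have r0 := proj1 gr.
  have bf : bm setT (fun x : R => mtest a y (fun r => b r * c r) (x, r)).
    exact: (bmM (bm_shift (y r) ba) (bm_cst setT (b r * c r))).
  rewrite (m_tilde_lab gr bf).
  by apply: eq_Rintegral => w _; rewrite /mtest /=; ring.
have hb := bt l v _ sb; have hb' := bt l v _ sb'; have hc := bt l v _ sc; have hc' := bt l v _ sc'.
have h1 := bL l v l0; have h2 := bL' l v l0; have h3 := bVb l v l0.
have h4 := bwb l v; have h5 := bt l v _ sy'.
have mI := measurable_itv `[l, v].
have F1 : bm (D `*` `[l, v]) (fun p : R * R =>
   (b p.2 * c p.2) * (derive1 a (X p.2 p.1 - y p.2) * (V p.2 p.1 - derive1 y p.2) * V p.2 p.1) +
   (derive1 b p.2 * c p.2 + b p.2 * derive1 c p.2) * (a (X p.2 p.1 - y p.2) * V p.2 p.1)).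
  apply: bmD; apply: bmM; [exact: bmM| |by apply: bmD; exact: bmM|exact: bmM].
  by apply: bmM => //; apply: bmM => //; exact: bmB.
have F2 : bm (D `*` `[l, v]) (fun p : R * R =>
   (b p.2 * c p.2) * (a (X p.2 p.1 - y p.2) * (p.1 - M / 2 + V p.2 p.1 / tau))).
  apply: bmM; first exact: bmM.
  by apply: bmM => //; apply: bmD => //; apply: bmM => //; exact: bm_cst.
have I1 := leb_fubini2 mD mI fD (leb_itv_fin _ _) F1.
have I2 := leb_fubini2 mD mI fD (leb_itv_fin _ _) F2.
move=> /eqP; rewrite -subr_eq0 => /eqP; rewrite -(cintB I1 I2) => h; etransitivity; last exact: h.
apply: (ae_eq_time aG pos) => r gr rlv; have r0 := proj1 gr.
rewrite (upair_lab _ gr ba).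
have S0 := bm_slice1 mD mI (bK0 l v l0) rlv.
have S1 := bm_slice1 mD mI F1 rlv; have S2 := bm_slice1 mD mI F2 rlv.
have S3 := bm_slice1 mD mI (bK l v l0) rlv.
rewrite /= in S0 S1 S2 S3 *.
rewrite mulrA -(ointZ _ S0) -(ointZ _ S3) -(ointB S1 S2) -(ointD (bmZ _ S0) (bmZ _ S3)).
by apply: eq_Rintegral => w _ /=; ring.
Qed.

End transport.

Section bounded_smooth.
Context {R : realType}.
Implicit Types a b : R -> R.

Lemma bsm_bm a : bsm a -> bm setT a.
Proof. by move=> [sa [K aK] _]; exact: bm_smooth_bounded sa aK. Qed.

Lemma bsm_bm_derive1 a : bsm a -> bm setT (derive1 a).
Proof. by move=> [sa _ [K aK]]; exact: bm_smooth_bounded (smooth_derive1 sa) aK. Qed.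

Lemma derive1_mul a b : smooth a -> smooth b ->
  derive1 (fun x => a x * b x) = fun x => a x * derive1 b x + derive1 a x * b x.
Proof.
move=> sa sb; apply: is_derive_derive1 => z.
have := is_derive_mulf (smooth_is_derive z sa) (smooth_is_derive z sb).
by rewrite (addrC (derive1 a z * b z)).
Qed.

Lemma bsm_cutoff a : bsm a -> exists (a_ : nat -> R -> R) (K : R),
  [/\ forall n, smooth (a_ n), forall n, exists A, suppin (a_ n) A,
      forall n x, `|a_ n x| <= K /\ `|derive1 (a_ n) x| <= K &
      forall x, a_ n x @[n --> \oo] --> a x /\ derive1 (a_ n) x @[n --> \oo] --> derive1 a x].
Proof.
move=> [sa [K aK] [K' aK']].
have [L L0 hL] := @derive1_chi_bound R.
have K0 : 0 <= K := le_trans (normr_ge0 _) (aK 0).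
have K'0 : 0 <= K' := le_trans (normr_ge0 _) (aK' 0).
have d n x : derive1 (fun x => a x * chi n x) x = a x * derive1 (chi n) x + derive1 a x * chi n x.
  by rewrite (derive1_mul sa (smooth_chi n)).
exists (fun n x => a x * chi n x), (K + K * L + K'); split=> [n|n|n x|x].
- exact: smooth_mul sa (smooth_chi n).
- by exists (3 * n.+1%:R) => x h; rewrite (chi_suppin h) mulr0.
- have L1 : `|derive1 (chi n) x| <= L.
    rewrite (le_trans (hL n x))// ler_pdivrMr// ler_peMr// ler1n//.
  split.
    rewrite normrM (@le_trans _ _ (K * 1))// ?ler_pM ?chi_norm// mulr1 -addrA lerDl.
    by rewrite addr_ge0 ?mulr_ge0.
  rewrite d (le_trans (ler_normD _ _))// (normrM (a x)) (normrM (derive1 a x)).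
  have h1 : `|a x| * `|derive1 (chi n) x| <= K * L by rewrite ler_pM.
  have h2 : `|derive1 a x| * `|chi n x| <= K' * 1 by rewrite ler_pM ?chi_norm.
  by rewrite (le_trans (lerD h1 h2))// mulr1 -addrA lerDr.
- split.
    by rewrite -[X in _ --> X]mulr1; apply: cvgM; [exact: cvg_cst|exact: chi_cvg].
  under eq_fun do rewrite d.
  have h : a x * derive1 (chi n) x + derive1 a x * chi n x @[n --> \oo] -->
      a x * 0 + derive1 a x * 1.
    apply: cvgD; apply: cvgM; try exact: cvg_cst; [exact: derive1_chi_cvg|exact: chi_cvg].
  by rewrite mulr0 add0r mulr1 in h.
Qed.

End bounded_smooth.

(* What the weak formulation says in labels.  [G] is a Borel representative of
   the velocity, valid at the times in [good]. *)
Record flow (R : realType) (tau M C : R) (rho : R -> finmeas R) (G : R * R -> R)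
    (good : R -> Prop) : Prop := Flow {
  fl_mass : forall t, 0 < t -> total_mass (rho t) = M;
  fl_lab : measurable_fun ((`]0%R, M[%classic : set R) `*` (`]0%R, +oo[%classic : set R))
    (fun p : R * R => lab rho p.2 p.1);
  fl_G : measurable_fun setT G;
  fl_GC : forall p, `|G p| <= C;
  fl_pos : forall t, good t -> 0 < t;
  fl_good : {ae lebesgue_measure, forall t, 0 < t -> good t};
  fl_transport : forall (a y : R -> R) (s t : R), bsm a -> smooth y -> 0 < s -> s < t ->
    \int[lebesgue_measure]_(w in `]0, M[) a (lab rho t w - y t)
    - \int[lebesgue_measure]_(w in `]0, M[) a (lab rho s w - y s) =
    \int[lebesgue_measure]_(r in `[s, t]) (\int[lebesgue_measure]_(w in `]0, M[)
      (derive1 a (lab rho r w - y r) * (vel rho G r w - derive1 y r)));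
  fl_momentum : forall (a y c : R -> R) (s t : R), bsm a -> smooth y -> smooth c ->
    good s -> good t -> s < t ->
    c t * \int[lebesgue_measure]_(w in `]0, M[) (a (lab rho t w - y t) * vel rho G t w)
    - c s * \int[lebesgue_measure]_(w in `]0, M[) (a (lab rho s w - y s) * vel rho G s w) =
    \int[lebesgue_measure]_(r in `[s, t]) (\int[lebesgue_measure]_(w in `]0, M[)
      (derive1 c r * (a (lab rho r w - y r) * vel rho G r w)
       + c r * (derive1 a (lab rho r w - y r) * (vel rho G r w - derive1 y r) * vel rho G r w
         - a (lab rho r w - y r) * (w - M / 2 + vel rho G r w / tau))))
}.

Section flow_of_solution.
Context {R : realType}.
Notation leb := (@lebesgue_measure R).
Variables (tau : R) (rho0 : finmeas R) (u0 : R -> R) (rho : R -> finmeas R) (u : R -> R -> R).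
Hypothesis ws : weak_solution tau rho0 u0 rho u.
Variable C : R.
Hypothesis C0 : 0 <= C.
Hypothesis uC : forall x t, 0 < t -> `|u x t| <= C.
Notation M := (total_mass rho0).
Notation D := (`]0%R, M[%classic : set R).
Variable G : R * R -> R.
Hypothesis mG : measurable_fun setT G.
Hypothesis GC : forall p, `|G p| <= C.
Variable good : R -> Prop.
Hypothesis good_repr : forall t, good t -> repr_at rho u G t.
Hypothesis ag : {ae leb, forall t, 0 < t -> good t}.
Notation X := (lab rho).
Notation V := (vel rho G).

Let aG : {ae leb, forall t, 0 < t -> repr_at rho u G t}.
Proof. by apply: ae_imp ag => t h /h /good_repr. Qed.

Let mlab := measurable_lab_ws ws C0 uC.
Let mD : measurable D := measurable_itv _.
Let fD : (leb D < +oo)%E := leb_itvoo_fin _ _.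

Let int_cvg (f_ : nat -> R -> R) (f : R -> R) (K z r : R) : 0 < r ->
  (forall n, smooth (f_ n)) -> (forall n x, `|f_ n x| <= K) ->
  (forall x, f_ n x @[n --> \oo] --> f x) ->
  \int[leb]_(w in D) f_ n (X r w - z) @[n --> \oo] --> \int[leb]_(w in D) f (X r w - z).
Proof.
move=> r0 sf fK cf; apply: (@oint_cvg _ _ _ (fun n w => f_ n (X r w - z)) _ K) => //.
by move=> n; have bf := bm_smooth_bounded (sf n) (fK n);
  have [] := bm_D_lab ws C0 uC z r0 bf.
Qed.

Lemma transport_bsm (a y : R -> R) (s t : R) : bsm a -> smooth y -> 0 < s -> s < t ->
    \int[leb]_(w in D) a (X t w - y t) - \int[leb]_(w in D) a (X s w - y s) =
    \int[leb]_(r in `[s, t]) (\int[leb]_(w in D) (derive1 a (X r w - y r) * (V r w - derive1 y r))).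
Proof.
move=> ba sy s0 st; have [a_ [K [sa sA aK ca]]] := bsm_cutoff ba.
have sy' := smooth_derive1 sy.
have L1 : \int[leb]_(w in D) a_ n (X t w - y t) - \int[leb]_(w in D) a_ n (X s w - y s) @[n --> \oo]
    --> \int[leb]_(w in D) a (X t w - y t) - \int[leb]_(w in D) a (X s w - y s).
  apply: cvgB; apply: (@int_cvg a_ a K); rewrite ?(lt_trans s0 st)//.
  - by move=> n x; have [] := aK n x.
  - by move=> x; have [] := ca x.
  - by move=> n x; have [] := aK n x.
  - by move=> x; have [] := ca x.
have [Y _ hY] := smooth_bounded_itv s t sy'.
have L2 : \int[leb]_(r in `[s, t]) (\int[leb]_(w in D)
     (derive1 (a_ n) (X r w - y r) * (V r w - derive1 y r))) @[n --> \oo] -->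
    \int[leb]_(r in `[s, t]) (\int[leb]_(w in D) (derive1 a (X r w - y r) * (V r w - derive1 y r))).
  apply: (@double_cvg _ D `[s, t]%classic
    (fun n p => derive1 (a_ n) (X p.2 p.1 - y p.2) * (V p.2 p.1 - derive1 y p.2))
    (fun p => derive1 a (X p.2 p.1 - y p.2) * (V p.2 p.1 - derive1 y p.2)) (K * (C + Y))) => //.
  - exact: leb_itv_fin.
  - move=> n; apply: bmM; last first.
      by apply: bmB; [exact: (bm_vel_box mlab mG GC t s0)|apply: bm_time_box; exact: bm_smooth].
    apply: (bm_lab_box mlab s0).
      by apply: (@bm_smooth_bounded _ _ K (smooth_derive1 (sa n))) => x; have [] := aK n x.
    by apply: measurable_funTS; exact: continuous_measurable_fun (smooth_continuous sy).
  - move=> n [w r] /= [_]; rewrite in_itv/= => hr; rewrite normrM ler_pM//.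
      by have [] := aK n (X r w - y r).
    by rewrite (le_trans (ler_normB _ _))// lerD ?hY//; exact: GC.
  - move=> [w r] _ /=; apply: cvgMl; by have [] := ca (X r w - y r).
apply: (cvg_unique _ L1) => //.
suff <- : (fun n => \int[leb]_(r in `[s, t]) (\int[leb]_(w in D)
     (derive1 (a_ n) (X r w - y r) * (V r w - derive1 y r)))) =
  (fun n => \int[leb]_(w in D) a_ n (X t w - y t) - \int[leb]_(w in D) a_ n (X s w - y s)) by [].
apply/funext => n; have [A An] := sA n.
by rewrite (mass_label_c ws C0 uC mG GC aG (sa n) An sy s0 st).
Qed.

Lemma momentum_bsm (a y c : R -> R) (s t : R) : bsm a -> smooth y -> smooth c ->
    good s -> good t -> s < t ->
    c t * \int[leb]_(w in D) (a (X t w - y t) * V t w)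
    - c s * \int[leb]_(w in D) (a (X s w - y s) * V s w) =
    \int[leb]_(r in `[s, t]) (\int[leb]_(w in D)
      (derive1 c r * (a (X r w - y r) * V r w)
       + c r * (derive1 a (X r w - y r) * (V r w - derive1 y r) * V r w
         - a (X r w - y r) * (w - M / 2 + V r w / tau)))).
Proof.
move=> ba sy sc /good_repr gs /good_repr gt st; have [a_ [K [sa sA aK ca]]] := bsm_cutoff ba.
have sy' := smooth_derive1 sy; have sc' := smooth_derive1 sc.
have s0 := proj1 gs; have t0 := proj1 gt.
have L0 r : 0 < r -> \int[leb]_(w in D) (a_ n (X r w - y r) * V r w) @[n --> \oo] -->
     \int[leb]_(w in D) (a (X r w - y r) * V r w).
  move=> r0; apply: (@oint_cvg _ _ _ (fun n w => a_ n (X r w - y r) * V r w) _ (K * C)) => //.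
  - move=> n; have bf : bm setT (a_ n).
      by apply: (@bm_smooth_bounded _ _ K (sa n)) => x; have [] := aK n x.
    by have [] := bmM (bm_D_lab ws C0 uC (y r) r0 bf) (bm_vel mlab mG GC r0).
  - by move=> n w _; rewrite normrM ler_pM//; [have [] := aK n (X r w - y r)|exact: GC].
  - by move=> w _; apply: cvgMl; have [] := ca (X r w - y r).
have L1 : c t * \int[leb]_(w in D) (a_ n (X t w - y t) * V t w) -
    c s * \int[leb]_(w in D) (a_ n (X s w - y s) * V s w) @[n --> \oo]
    --> c t * \int[leb]_(w in D) (a (X t w - y t) * V t w)
    - c s * \int[leb]_(w in D) (a (X s w - y s) * V s w).
  by apply: cvgB; apply: cvgMr; exact: L0.
have [Y _ hY] := smooth_bounded_itv s t sy'.
have [B B0 hB] := smooth_bounded_itv s t sc.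
have [B' B'0 hB'] := smooth_bounded_itv s t sc'.
have M0 : 0 <= M := mass_ge0 rho0.
have L2 : \int[leb]_(r in `[s, t]) (\int[leb]_(w in D)
   (derive1 c r * (a_ n (X r w - y r) * V r w)
       + c r * (derive1 (a_ n) (X r w - y r) * (V r w - derive1 y r) * V r w
         - a_ n (X r w - y r) * (w - M / 2 + V r w / tau)))) @[n --> \oo] -->
    \int[leb]_(r in `[s, t]) (\int[leb]_(w in D)
   (derive1 c r * (a (X r w - y r) * V r w)
       + c r * (derive1 a (X r w - y r) * (V r w - derive1 y r) * V r w
         - a (X r w - y r) * (w - M / 2 + V r w / tau)))).
  apply: (@double_cvg _ D `[s, t]%classic
    (fun n p => derive1 c p.2 * (a_ n (X p.2 p.1 - y p.2) * V p.2 p.1)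
       + c p.2 * (derive1 (a_ n) (X p.2 p.1 - y p.2) * (V p.2 p.1 - derive1 y p.2) * V p.2 p.1
         - a_ n (X p.2 p.1 - y p.2) * (p.1 - M / 2 + V p.2 p.1 / tau)))
    (fun p => derive1 c p.2 * (a (X p.2 p.1 - y p.2) * V p.2 p.1)
       + c p.2 * (derive1 a (X p.2 p.1 - y p.2) * (V p.2 p.1 - derive1 y p.2) * V p.2 p.1
         - a (X p.2 p.1 - y p.2) * (p.1 - M / 2 + V p.2 p.1 / tau)))
    (B' * (K * C) + B * (K * (C + Y) * C + K * (M + M + C / `|tau|)))) => //.
  - exact: leb_itv_fin.
  - move=> n.
    have my : measurable_fun `[s, t] y.
      by apply: measurable_funTS; exact: continuous_measurable_fun (smooth_continuous sy).
    have h1 : bm (D `*` `[s, t]) (fun p : R * R => a_ n (X p.2 p.1 - y p.2)).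
      have b1 : bm setT (a_ n).
        by apply: (@bm_smooth_bounded _ _ K (sa n)) => x; have [] := aK n x.
      exact: (bm_lab_box mlab s0 b1 my).
    have h2 : bm (D `*` `[s, t]) (fun p : R * R => derive1 (a_ n) (X p.2 p.1 - y p.2)).
      have b1 : bm setT (derive1 (a_ n)).
        by apply: (@bm_smooth_bounded _ _ K (smooth_derive1 (sa n))) => x; have [] := aK n x.
      exact: (bm_lab_box mlab s0 b1 my).
    have h3 : bm (D `*` `[s, t]) (fun p : R * R => V p.2 p.1) by exact: (bm_vel_box mlab mG GC t s0).
    have h4 : bm (D `*` `[s, t]) (fun p : R * R => p.1 - M / 2).
      apply: bmB; last exact: bm_cst.
      by apply: (bm_comp1 (f := id)) => //; exact: bm_id_D.
    have bt (f : R -> R) : smooth f -> bm (D `*` `[s, t]) (fun p : R * R => f p.2).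
      by move=> sf; apply: bm_time_box; exact: bm_smooth.
    have h5 := bt _ sy'; have h6 := bt _ sc; have h7 := bt _ sc'.
    apply: bmD; apply: bmM => //; first exact: bmM.
    apply: bmB; apply: bmM => //; first by apply: bmM => //; exact: bmB.
    by apply: bmD => //; apply: bmM => //; exact: bm_cst.
  - move=> n [w r] /= [hw]; move: hw; rewrite in_itv/= => /andP[w0 wM].
    rewrite in_itv/= => hr.
    have [k1 k2] := aK n (X r w - y r).
    have k3 : `|V r w| <= C by exact: GC.
    have k4 := hY _ hr; have k5 := hB _ hr; have k6 := hB' _ hr.
    have k7 : `|V r w - derive1 y r| <= C + Y by rewrite (le_trans (ler_normB _ _))// lerD.
    have k8 : `|w - M / 2 + V r w / tau| <= M + M + C / `|tau|.
      rewrite (le_trans (ler_normD _ _))// lerD//; last by rewrite normrM normfV ler_wpM2r// invr_ge0.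
      by rewrite ler_norml; apply/andP; split; lra.
    rewrite (le_trans (ler_normD _ _))// lerD// normrM ler_pM//; first by rewrite normrM ler_pM.
    rewrite (le_trans (ler_normB _ _))// lerD// normrM ler_pM//.
    by rewrite normrM ler_pM.
  - move=> [w r] _ /=; have [c1 c2] := ca (X r w - y r).
    apply: cvgD; apply: cvgMr; first exact: cvgMl.
    by apply: cvgB; apply: cvgMl => //; exact: cvgMl.
apply: (cvg_unique _ L1) => //.
suff <- : (fun n => \int[leb]_(r in `[s, t]) (\int[leb]_(w in D)
   (derive1 c r * (a_ n (X r w - y r) * V r w)
       + c r * (derive1 (a_ n) (X r w - y r) * (V r w - derive1 y r) * V r w
         - a_ n (X r w - y r) * (w - M / 2 + V r w / tau))))) =
  (fun n => c t * \int[leb]_(w in D) (a_ n (X t w - y t) * V t w) -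
    c s * \int[leb]_(w in D) (a_ n (X s w - y s) * V s w)) by [].
apply/funext => n; have [A An] := sA n.
by rewrite (momentum_label_c ws C0 uC mG GC aG (sa n) An sy sc gs gt st).
Qed.

Lemma flow_of_weak_solution : flow tau M C rho G good.
Proof.
split => //.
- by move=> t t0; exact: (mass_eq ws C0 uC).
- by move=> t /good_repr[].
- exact: transport_bsm.
- exact: momentum_bsm.
Qed.

End flow_of_solution.

(** * Calculus for functions that are integrals of bounded functions *)

Section subdivision.
Context {R : realType}.

(** Over n + 1 equal subintervals the errors add up to K (t - s)^2 / (n + 1). This replaces
    differentiation for functions that need not be differentiable. *)
Lemma quadratic_le (h : R -> R) (s t K : R) : s <= t ->
  (forall x y, s <= x -> x <= y -> y <= t -> h y - h x <= K * (y - x) ^+ 2) -> h t <= h s.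
Proof.
move=> st H.
have E (n : nat) : h t - h s <= K * (t - s) ^+ 2 / n.+1%:R.
  pose d : R := (t - s) / n.+1%:R.
  have d0 : 0 <= d by rewrite divr_ge0// subr_ge0.
  have nd : n.+1%:R * d = t - s by rewrite /d mulrC divfK.
  have I k : (k <= n.+1)%N -> h (s + k%:R * d) - h s <= k%:R * (K * d ^+ 2).
    elim: k => [|k ih] kn; first by rewrite !mul0r addr0 subrr.
    have h1 := ih (ltnW kn).
    have h2 : h (s + k.+1%:R * d) - h (s + k%:R * d) <= K * d ^+ 2.
      have -> : d = (s + k.+1%:R * d) - (s + k%:R * d) by rewrite -natr1; ring.
      rewrite {1 2}(_ : (s + k.+1%:R * d) - (s + k%:R * d) = d); last by rewrite -natr1; ring.
      apply: H.
      - by rewrite lerDl mulr_ge0.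
      - by rewrite lerD2l ler_wpM2r// ler_nat.
      - by rewrite -lerBrDl -nd ler_wpM2r// ler_nat.
    have -> : k.+1%:R * (K * d ^+ 2) = k%:R * (K * d ^+ 2) + K * d ^+ 2.
      by rewrite -[k.+1%:R]natr1 mulrDl mul1r.
    by have := lerD h1 h2; rewrite addrC addrA subrK.
  have := I n.+1 (leqnn _); rewrite nd (addrC s) subrK => /le_trans; apply.
  have -> : n.+1%:R * (K * d ^+ 2) = K * (n.+1%:R * d) * d by ring.
  by rewrite nd expr2 /d !mulrA.
rewrite -subr_le0; apply: (cvgr_to_ge (@cvg_div_succ R (K * (t - s) ^+ 2))).
by near=> n; exact: E.
Unshelve. all: by end_near. Qed.

Lemma quadratic_eq (h : R -> R) (s t K : R) : s <= t ->
  (forall x y, s <= x -> x <= y -> y <= t -> `|h y - h x| <= K * (y - x) ^+ 2) -> h t = h s.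
Proof.
move=> st H; apply/eqP; rewrite eq_le (quadratic_le st (K := K)); last first.
  by move=> x y sx xy yt; exact: le_trans (ler_norm _) (H _ _ sx xy yt).
rewrite -lerN2 (@quadratic_le (fun x => - h x) s t K)// => x y sx xy yt.
by rewrite -opprB opprK addrC (le_trans _ (H _ _ sx xy yt))// -normrN opprB addrC ler_norm.
Qed.

End subdivision.

Section steps.
Context {R : realType}.
Implicit Types z : R.

(* Smooth nonincreasing functions with values in [0, 1] converging to the
   indicator of z < 0; they vanish for z >= 0. *)
Definition step n z : R := sstep (n.+1%:R * (- z) - 1).

Lemma smooth_step n : smooth (step n).
Proof.
apply: smooth_comp smooth_sstep _; apply: smooth_sub; last exact: smooth_cst.
by apply: smooth_mul; [exact: smooth_cst|apply: smooth_opp; exact: smooth_id].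
Qed.

Lemma step_ge0 n z : 0 <= step n z. Proof. exact: sstep_ge0. Qed.
Lemma step_le1 n z : step n z <= 1. Proof. exact: sstep_le1. Qed.

Lemma step_norm n z : `|step n z| <= 1.
Proof. by rewrite ger0_norm ?step_ge0 ?step_le1. Qed.

Lemma step0 n z : 0 <= z -> step n z = 0.
Proof. by move=> z0; rewrite /step sstep0// gerDr mulrN oppr_le0 mulr_ge0. Qed.

Lemma step_cvg z : step n z @[n --> \oo] --> (bR (z < 0) : R).
Proof.
have [z0|z0] := ltP z 0; last by under eq_fun do rewrite step0//; exact: cvg_cst.
apply: cvg_near_cst; near=> n; rewrite /step sstep1// lerBrDr -ler_pdivrMr ?oppr_gt0//.
by rewrite (@le_trans _ _ n%:R)// ?ler_nat//; near: n; exact: nbhs_infty_ger.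
Unshelve. all: by end_near. Qed.

Lemma derive1_step n z : derive1 (step n) z = - n.+1%:R * derive1 sstep (n.+1%:R * (- z) - 1).
Proof.
suff -> : derive1 (step n) = fun z => - n.+1%:R * derive1 sstep (n.+1%:R * (- z) - 1) by [].
apply: is_derive_derive1 => x.
have h : is_derive x 1 (fun z : R => n.+1%:R * (- z) - 1) (- n.+1%:R).
  have := is_derive_addf (is_derive_mulf (is_derive_cst (n.+1%:R : R) x 1)
     (is_derive_oppf (is_derive_id x 1))) (is_derive_cst (- 1 : R) x 1).
  by rewrite mul0r add0r addr0 mulrN1.
have := @is_derive_compf _ sstep (fun z => n.+1%:R * (- z) - 1) _ _ _ (smooth_is_derive _ smooth_sstep) h.
by rewrite mulrC.
Qed.

Lemma derive1_step_le0 n z : derive1 (step n) z <= 0.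
Proof. by rewrite derive1_step mulNr oppr_le0 mulr_ge0// derive1_sstep_ge0. Qed.

Lemma derive1_sstep_bound : exists2 K : R, 0 <= K & forall z, `|derive1 sstep z| <= K.
Proof.
have [K K0 hK] := smooth_bounded_itv (-1) 1 (smooth_derive1 (@smooth_sstep R)).
exists K => // z; have [z1|z1] := ltP 1 `|z|; first by rewrite derive1_sstep0// normr0.
by apply: hK; rewrite -ler_norml.
Qed.

Lemma bsm_step n : bsm (step n).
Proof.
split; [exact: smooth_step|by exists 1 => x; exact: step_norm|].
have [K K0 hK] := derive1_sstep_bound; exists (n.+1%:R * K) => x.
by rewrite derive1_step normrM normrN (ger0_norm (x := n.+1%:R))// ler_wpM2l.
Qed.

End steps.

(** * Convergence as time tends to 0 *)

Section initial_data.
Context {R : realType}.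

(* Limits at 0+ along the times in [P]. *)
Definition tends0 (P : R -> Prop) (f : R -> R) (l : R) := forall e, 0 < e ->
  exists2 d, 0 < d & forall t, P t -> t < d -> `|f t - l| <= e.

Lemma tends0_imp (P Q : R -> Prop) f l : (forall t, Q t -> P t) -> tends0 P f l -> tends0 Q f l.
Proof. by move=> QP h e /h[d d0 hd]; exists d => // t /QP; exact: hd. Qed.

Lemma tends0_eq (P : R -> Prop) f g l : (forall t, P t -> f t = g t) -> tends0 P f l -> tends0 P g l.
Proof. by move=> fg h e /h[d d0 hd]; exists d => // t Pt; rewrite -fg//; exact: hd. Qed.

Lemma tends0_cvg (f : R -> R) (l : R) : f t @[t --> 0^'+] --> l -> tends0 (fun t => 0 < t) f l.
Proof.
move=> h e e0; have /cvgrPdist_le/(_ _ e0) := h.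
move=> /nbhs_ballP[d /= d0 hd]; exists d => // t t0 td.
rewrite distrC; apply: hd => //; by rewrite /ball/= sub0r normrN gtr0_norm.
Qed.

Variables (rho0 : finmeas R) (rho : R -> finmeas R).
Notation M := (total_mass rho0).
Hypothesis mass : forall t, 0 < t -> total_mass (rho t) = M.
Hypothesis init1 : weakly_initial rho (fun _ _ => 1) rho0 (fun=> 1).

Let tail (nu : finmeas R) (w phi : R -> R) (C K : R) n : slice nu w C -> continuous phi ->
  (forall x, `|phi x| <= K) ->
  `|pairing nu w phi - pairing nu w (fun x => phi x * chi n x)| <=
  K * C * (total_mass nu - \int[nu]_x chi n x).
Proof.
move=> sl cphi phiK.
have bphi : bm setT phi by split; [exact: continuous_measurable_fun|exists K => x _].
have bc := @bm_chi R n.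
rewrite -(pairingB sl bphi (bmM bphi bc)).
have [U [mU UC wU]] := sl.
have bU : bm setT U by split => //; exists C.
rewrite (pairing_slice _ wU).
have b1 : bm setT (fun x => (phi x - phi x * chi n x) * U x).
  by apply: bmM => //; apply: bmB => //; exact: bmM.
have b2 : bm setT (fun x : R => 1 - chi n x) by apply: bmB => //; exact: bm_cst.
have -> : total_mass nu - \int[nu]_x chi n x = \int[nu]_x (1 - chi n x).
  by rewrite (nintB nu (bm_cst setT 1) bc) Rintegral_cst// mul1r.
rewrite -(nintZ nu _ b2).
have fin : (nu setT < +oo)%E by rewrite ltey_eq fin_num_measure.
apply: le_trans (@bm_int_norm _ (measurableTypeR R) R nu setT measurableT fin _ b1) _.
apply: (nint_le nu (bm_norm b1) (bmZ _ b2)) => x _.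
rewrite -{1}[phi x]mulr1 -mulrBr mulrAC normrM normrM ler_pM ?mulr_ge0 ?ler_pM//.
by rewrite ger0_norm// subr_ge0 (le_trans (ler_norm _))// chi_norm.
Qed.

(** No mass escapes to infinity: rho_t has the mass of rho0, so the mass outside the cutoff [chi n]
    tends to the one at time 0, which is small for large n. Hence all bounded continuous test
    functions are admissible. *)
Lemma narrow (w : R -> R -> R) (w0 phi : R -> R) (C K : R) :
  weakly_initial rho w rho0 w0 ->
  (forall t, 0 < t -> slice (rho t) (w ^~ t) C) -> slice rho0 w0 C ->
  continuous phi -> (forall x, `|phi x| <= K) ->
  tends0 (fun t => 0 < t) (fun t => pairing (rho t) (w ^~ t) phi) (pairing rho0 w0 phi).
Proof.
move=> iw sl sl0 cphi phiK e e0.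
have C0 : 0 <= C by have [U [_ UC _]] := sl0; exact: le_trans (UC 0).
have K0 : 0 <= K := le_trans (normr_ge0 _) (phiK 0).
have KC : 0 <= K * C by exact: mulr_ge0.
have e1 : 0 < e / 8 / (K * C + 1) by rewrite !divr_gt0// ltr_wpDl.
have [n hn] : exists n, `|M - \int[rho0]_x chi n x| <= e / 8 / (K * C + 1).
  have /cvgrPdist_le/(_ _ e1)[n _ hn] := @nint_chi_cvg R rho0.
  by exists n; apply: hn => /=.
have Cchi : Cc (@chi R n) := Cc_suppin (smooth_continuous (smooth_chi n)) (@chi_suppin R n).
have Cphi : Cc (fun x => phi x * chi n x).
  apply: (@Cc_suppin _ _ (3 * n.+1%:R)).
    by move=> x; apply: cvgM; [exact: cphi|exact: smooth_continuous (smooth_chi n) x].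
  by move=> x h; rewrite (chi_suppin h) mulr0.
have [d1 d10 h1] := tends0_cvg (init1 Cchi) e1.
have e4 : 0 < e / 4 by rewrite divr_gt0.
have [d2 d20 h2] := tends0_cvg (iw _ Cphi) e4.
exists (Num.min d1 d2); first by rewrite lt_min d10.
move=> t t0; rewrite lt_min => /andP[td1 td2].
have {}h1 := h1 t t0 td1; have {}h2 := h2 t t0 td2.
have ec (nu : finmeas R) : pairing nu (fun=> 1) (chi n) = \int[nu]_x chi n x.
  by apply: eq_Rintegral => x _; rewrite mulr1.
rewrite !ec in h1.
have T1 := tail n (sl t t0) cphi phiK; have T0 := tail n sl0 cphi phiK.
rewrite (mass t0) in T1.
have small x : x <= e / 8 / (K * C + 1) -> K * C * x <= e / 8.
  move=> hx; apply: le_trans (ler_wpM2l KC hx) _.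
  rewrite mulrCA ger_pMr ?divr_gt0// ler_pdivrMr ?mul1r ?lerDl//.
  by rewrite ltr_wpDl.
have {}T0 := le_trans T0 (small _ (le_trans (ler_norm _) hn)).
have {}T1 : `|pairing (rho t) (w ^~ t) phi - pairing (rho t) (w ^~ t) (fun x => phi x * chi n x)|
    <= e / 8 + e / 8.
  apply: le_trans T1 _.
  have -> : M - \int[rho t]_x chi n x = (M - \int[rho0]_x chi n x) +
     (\int[rho0]_x chi n x - \int[rho t]_x chi n x) by ring.
  rewrite mulrDr lerD// small//; first exact: le_trans (ler_norm _) hn.
  by rewrite (le_trans (ler_norm _))// distrC.
move: T0 T1 h2; rewrite !ler_norml => /andP[A1 A2] /andP[B1 B2] /andP[D1 D2].
apply/andP; split.
  rewrite -(@lerD2r _ (pairing rho0 w0 phi)) subrK; lra.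
rewrite lerBlDr; lra.
Qed.

End initial_data.

#[global] Opaque sstep step chi cut.

Lemma Rint_ge0 d (T : measurableType d) (R : realType) (mu : {measure set T -> \bar R})
    (D : set T) (f : T -> R) : (forall x, D x -> 0 <= f x) -> 0 <= \int[mu]_(x in D) f x.
Proof. by move=> f0; apply: fine_ge0; apply: integral_ge0 => x /f0; rewrite lee_fin. Qed.

Lemma Rint_le0 d (T : measurableType d) (R : realType) (mu : {measure set T -> \bar R})
    (D : set T) (f : T -> R) : (forall x, D x -> f x <= 0) -> \int[mu]_(x in D) f x <= 0.
Proof.
move=> f0; rewrite /Rintegral integralE [X in (X - _)%E]integral0_eq ?sub0e; last first.
  by move=> x Dx; rewrite funeposE; apply/max_idPr; rewrite lee_fin f0.
by rewrite fineN oppr_le0; apply: fine_ge0; apply: integral_ge0 => x _; rewrite funenegE le_max lexx orbT.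
Qed.

Section products.
Context {R : realType}.
Notation leb := (@lebesgue_measure R).

(** Composing f with the projection onto [s, t] gives a continuous function on the whole line. *)
Lemma lipschitz_bm (f : R -> R) (s t K : R) :
  (forall x y, s <= x -> x <= y -> y <= t -> `|f y - f x| <= K * (y - x)) -> bm `[s, t] f.
Proof.
move=> H; have [st|ts] := leP s t; last first.
  by rewrite set_itv_ge ?bnd_simp -?ltNge//; split; [exact: measurable_fun_set0|exists 0].
have K0 x y : s <= x -> x <= y -> y <= t -> `|f y - f x| <= `|K| * (y - x).
  move=> sx xy yt; apply: le_trans (H _ _ sx xy yt) _.
  by rewrite ler_wpM2r ?subr_ge0 ?ler_norm.
pose cl (x : R) := Num.max s (Num.min t x).
have cl1 x : s <= cl x <= t by rewrite /cl le_max lexx/= ge_max st ge_min lexx.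
have clid x : s <= x <= t -> cl x = x by move=> /andP[sx xt]; rewrite /cl (min_idPr xt) (max_idPr sx).
have clm x y : x <= y -> cl x <= cl y <= cl x + (y - x).
  move=> xy; rewrite /cl; case: (leP t x) => tx; case: (leP t y) => ty;
    try (by have := le_trans tx xy; lra);
    case: (leP s t) => h1 //; try lra; case: (leP s x) => h2; try lra; case: (leP s y) => h3; lra.
have L x y : `|f (cl y) - f (cl x)| <= `|K| * `|y - x|.
  wlog xy : x y / x <= y.
    move=> h; have [xy|/ltW xy] := leP x y; first exact: h.
    by rewrite distrC (distrC y); exact: h.
  have /andP[h1 h2] := clm x y xy; have /andP[h3 h4] := cl1 x; have /andP[h5 h6] := cl1 y.
  rewrite (le_trans (K0 _ _ h3 h1 h6))// ler_wpM2l// ger0_norm ?subr_ge0//.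
  by rewrite lerBlDl.
have cf : continuous (f \o cl).
  move=> x; apply/cvgrPdist_le => /= e e0; near=> y.
  rewrite (le_trans (L _ _))//.
  have h : `|x - y| <= e / (`|K| + 1).
    near: y; have e1 : 0 < e / (`|K| + 1) by rewrite divr_gt0// ltr_wpDl.
    by apply/nbhs_ballP; exists (e / (`|K| + 1)) => // y; rewrite /ball/= => /ltW.
  apply: le_trans (ler_wpM2l (normr_ge0 _) h) _.
  rewrite mulrCA ger_pMr// ler_pdivrMr ?mul1r ?lerDl//; exact: ltr_wpDl.
apply: (@bm_eq _ _ _ _ (f \o cl)).
  by move=> x /set_mem; rewrite /= in_itv/= => h; rewrite clid.
split; first by apply: measurable_funTS; exact: continuous_measurable_fun.
exists (`|f s| + `|K| * (t - s)) => x _ /=.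
have /andP[h1 h2] := cl1 x.
rewrite -[f (cl x)](subrK (f s)) (le_trans (ler_normD _ _))// addrC lerD2l.
by rewrite (le_trans (K0 _ _ (lexx s) h1 h2))// ler_wpM2l// lerD2r.
Unshelve. all: by end_near. Qed.

Section integrated.
Variables (f k : R -> R) (s t : R).
Hypothesis st : s <= t.
Hypothesis bk : bm `[s, t] k.
Hypothesis fk : forall x y, s <= x -> x <= y -> y <= t -> f y - f x = \int[leb]_(r in `[x, y]) k r.

Lemma integrated_lipschitz : exists2 K, 0 <= K & (forall r, s <= r <= t -> `|k r| <= K) /\
  forall x y, s <= x -> x <= y -> y <= t -> `|f y - f x| <= K * (y - x).
Proof.
have [mk [K kK]] := bk.
have K0 : 0 <= K by apply: le_trans (kK s _) => //=; rewrite in_itv/= lexx.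
exists K => //; split=> [r hr|x y sx xy yt]; first by apply: kK; rewrite /= in_itv.
rewrite fk// -(fine_leb_itv xy).
apply: (cint_bound (bm_sub_itv sx yt bk)) => r; rewrite /= in_itv/= => /andP[xr ry].
by apply: kK; rewrite /= in_itv/= (le_trans sx)// (le_trans ry).
Qed.

Lemma integrated_bm : bm `[s, t] f.
Proof. by have [K _ [_ h]] := integrated_lipschitz; exact: lipschitz_bm h. Qed.

(** Here f is only an integral of a bounded function. On [x, y] the defect of the product formula is
    O((y - x)^2), one factor from each Lipschitz bound, so [quadratic_eq] applies. *)
Lemma int_product (c : R -> R) : smooth c ->
  c t * f t - c s * f s = \int[leb]_(r in `[s, t]) (derive1 c r * f r + c r * k r).
Proof.
move=> sc; have sc' := smooth_derive1 sc.
have [K K0 [kK fK]] := integrated_lipschitz.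
have bf := integrated_bm.
have [L L0 hL] := smooth_bounded_itv s t sc'.
have bc (x y : R) : bm `[x, y] c by exact: bm_smooth.
have bc' (x y : R) : bm `[x, y] (derive1 c) by exact: bm_smooth.
have bg : bm `[s, t] (fun r => derive1 c r * f r + c r * k r) by apply: bmD; exact: bmM.
have cL (x y : R) : s <= x -> x <= y -> y <= t -> `|c x - c y| <= L * (y - x).
  move=> sx xy yt; rewrite distrC -int_derive1// -(fine_leb_itv xy).
  apply: (cint_bound (bc' x y)) => r; rewrite /= in_itv/= => /andP[xr ry].
  by apply: hL; rewrite (le_trans sx)// (le_trans ry).
pose h r := c r * f r - \int[leb]_(z in `[s, r]) (derive1 c z * f z + c z * k z).
have hE : h t = h s.
  apply: (@quadratic_eq _ h s t (2 * (L * K))) => // x y sx xy yt.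
  have bs := bm_sub_itv sx yt bk.
  have bfs := bm_sub_itv sx yt bf.
  have bgs : bm `[x, y] (fun r => derive1 c r * f r + c r * k r) by exact: bm_sub_itv bg.
  have b1 : bm `[x, y] (fun r => derive1 c r * (f y - f r)).
    by apply: bmM => //; apply: bmB => //; exact: bm_cst.
  have b2 : bm `[x, y] (fun r => (c x - c r) * k r).
    by apply: bmM => //; apply: bmB => //; exact: bm_cst.
  have b3 : bm `[x, y] (fun r => f y * derive1 c r) by exact: bmZ.
  have b4 : bm `[x, y] (fun r => c x * k r) by exact: bmZ.
  have -> : h y - h x = \int[leb]_(r in `[x, y]) (derive1 c r * (f y - f r) + (c x - c r) * k r).
    have sp : \int[leb]_(z in `[s, y]) (derive1 c z * f z + c z * k z) =
        \int[leb]_(z in `[s, x]) (derive1 c z * f z + c z * k z) +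
        \int[leb]_(z in `[x, y]) (derive1 c z * f z + c z * k z).
      by rewrite (@bm_itv_split _ _ s x y)//; exact: bm_sub_itv bg.
    have e0 : c y * f y - c x * f x = (c y - c x) * f y + c x * (f y - f x) by ring.
    have e1 : c y * f y - c x * f x = \int[leb]_(r in `[x, y]) (f y * derive1 c r + c x * k r).
      rewrite e0 (cintD b3 b4) (cintZ _ (bc' x y)) (cintZ _ bs) fk// int_derive1//.
      by rewrite (mulrC (f y)).
    rewrite /h sp (_ : forall a b c d : R, a - (b + c) - (d - b) = (a - d) - c); last by move=> *; ring.
    rewrite e1 -(cintB (bmD b3 b4) bgs).
    by apply: eq_Rintegral => r _; ring.
  have -> : 2 * (L * K) * (y - x) ^+ 2 = (2 * (L * K) * (y - x)) * fine (leb `[x, y]).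
    by rewrite (fine_leb_itv xy); ring.
  apply: (cint_bound (bmD b1 b2)) => r; rewrite /= in_itv/= => /andP[xr ry].
  have sr := le_trans sx xr; have rt := le_trans ry yt.
  rewrite (le_trans (ler_normD _ _))// !normrM.
  have -> : 2 * (L * K) * (y - x) = L * (K * (y - x)) + L * (y - x) * K by ring.
  apply: lerD.
    apply: ler_pM => //; first by apply: hL; rewrite sr.
    by apply: le_trans (fK _ _ sr ry yt) _; rewrite ler_wpM2l// lerD2l lerN2.
  apply: ler_pM => //; last by apply: kK; rewrite sr.
  by apply: le_trans (cL _ _ sx xr rt) _; rewrite ler_wpM2l// lerD2r.
have -> : c s * f s = h s.
  by rewrite /h set_itv1 Rintegral_set1 subr0.
by rewrite -hE /h opprB addrC subrK.
Qed.

End integrated.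
End products.

(** The initial conditions in labels. Those involving the velocity are taken along good times, at
    which [vel] represents u. [g0] is a Borel version of u0. *)
Record flow_init (R : realType) (M C : R) (rho : R -> finmeas R) (G : R * R -> R)
    (good : R -> Prop) (rho0 : finmeas R) (g0 : R -> R) : Prop := FlowInit {
  fi_mass : total_mass rho0 = M;
  fi_g : measurable_fun setT g0;
  fi_gC : forall x, `|g0 x| <= C;
  fi_1 : forall (phi : R -> R) K, continuous phi -> (forall x, `|phi x| <= K) ->
    tends0 (fun t => 0 < t) (fun t => \int[lebesgue_measure]_(w in `]0, M[) phi (lab rho t w))
      (\int[lebesgue_measure]_(w in `]0, M[) phi (qf rho0 w));
  fi_u : forall (phi : R -> R) K, continuous phi -> (forall x, `|phi x| <= K) ->
    tends0 good (fun t => \int[lebesgue_measure]_(w in `]0, M[) (phi (lab rho t w) * vel rho G t w))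
      (\int[lebesgue_measure]_(w in `]0, M[) (phi (qf rho0 w) * g0 (qf rho0 w)));
  fi_u2 : forall (phi : R -> R) K, continuous phi -> (forall x, `|phi x| <= K) ->
    tends0 good (fun t => \int[lebesgue_measure]_(w in `]0, M[) (phi (lab rho t w) * vel rho G t w ^+ 2))
      (\int[lebesgue_measure]_(w in `]0, M[) (phi (qf rho0 w) * g0 (qf rho0 w) ^+ 2))
}.

Lemma cvg_le_to (R : realType) (f g : nat -> R) (a b : R) : f n @[n --> \oo] --> a ->
  g n @[n --> \oo] --> b -> (forall n, f n <= g n) -> a <= b.
Proof.
move=> fa gb fg; rewrite -subr_ge0; apply: (cvgr_to_ge (cvgB gb fa)); near=> n.
by rewrite subr_ge0; exact: fg.
Unshelve. all: by end_near. Qed.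

(** * Finite speed of propagation *)

Section speed.
Context {R : realType}.
Notation leb := (@lebesgue_measure R).

Lemma step_homo n : {homo @step R n : x y / x <= y >-> y <= x}.
Proof. by move=> x y xy; apply: sstep_homo; rewrite lerD2r ler_wpM2l// lerN2. Qed.

Lemma qf_le_shift (nu nu' : finmeas R) (c w : R) : total_mass nu' = total_mass nu ->
  (forall x, cdfl nu x <= cdfl nu' (x + c)) -> 0 < w < total_mass nu -> qf nu' w <= qf nu w + c.
Proof.
move=> mm h hw; rewrite leNgt; apply/negP => h1.
have h2 : qf nu w < qf nu' w - c by rewrite ltrBrDr.
pose x := (qf nu w + (qf nu' w - c)) / 2.
have x1 : qf nu w < x by rewrite /x midf_lt.
have x2 : x < qf nu' w - c by rewrite /x midf_lt.
have wx := le_trans (qf_lt hw x1) (h x).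
have : x + c < qf nu' w by rewrite -ltrBrDr.
rewrite ltNge => /negP; apply; rewrite {1}/qf mm hw; apply: ge_inf.
  by rewrite -mm in hw; have [] := qset_has_inf hw.
exact: wx.
Qed.

Variables (tau M C : R) (rho : R -> finmeas R) (G : R * R -> R) (good : R -> Prop).
Hypothesis F : flow tau M C rho G good.
Notation D := (`]0%R, M[%classic : set R).
Notation X := (lab rho).
Notation V := (vel rho G).

Let mD : measurable D := measurable_itv _.
Let fD : (leb D < +oo)%E := leb_itvoo_fin _ _.

Lemma cdfl_lab t y : 0 < t -> cdfl (rho t) y = \int[leb]_(w in D) bR (X t w < y).
Proof. by move=> t0; rewrite cdfl_int (fl_mass F t0). Qed.

Lemma fl_bm_lab t (a : R -> R) z : 0 < t -> bm setT a -> bm D (fun w => a (X t w - z)).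
Proof. by move=> t0 ba; exact: (bm_lab (fl_lab F) t0 (bm_shift z ba)). Qed.

Lemma fl_bm_vel t : 0 < t -> bm D (V t).
Proof. by move=> t0; exact: (bm_vel (fl_lab F) (fl_G F) (fl_GC F) t0). Qed.

Lemma fl_C0 : 0 <= C.
Proof. exact: le_trans (normr_ge0 _) (fl_GC F (0, 0)). Qed.

Lemma step_int_cvg t y : 0 < t ->
  \int[leb]_(w in D) step n (X t w - y) @[n --> \oo] --> cdfl (rho t) y.
Proof.
move=> t0; rewrite cdfl_lab//.
apply: (@oint_cvg _ _ _ (fun n w => step n (X t w - y)) (fun w => bR (X t w < y)) 1) => //.
- by move=> n; have [] := fl_bm_lab y t0 (bsm_bm (bsm_step n)).
- by move=> n w _; exact: step_norm.
- by move=> w _; rewrite -subr_lt0; exact: step_cvg.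
Qed.

(** The front y + C (r - s) moves at least as fast as any particle. In the transport identity
    [derive1 a] and V - C are both nonpositive, so their product is nonnegative. *)
Lemma decreasing_up (a : R -> R) (y s t : R) : bsm a -> (forall z, derive1 a z <= 0) ->
  0 < s -> s < t ->
  \int[leb]_(w in D) a (X s w - y) <= \int[leb]_(w in D) a (X t w - (y + C * (t - s))).
Proof.
move=> ba a0 s0 st.
have [yf yE] : exists yf : R -> R, yf = fun r : R => y + C * (r - s) by eexists.
have sy : smooth yf.
  rewrite yE; apply: smooth_add; [exact: smooth_cst|apply: smooth_mul; [exact: smooth_cst|]].
  by apply: smooth_sub; [exact: smooth_id|exact: smooth_cst].
have dy : derive1 yf = fun=> C.
  rewrite yE; apply: is_derive_derive1 => r.
  have := is_derive_addf (is_derive_cst y r 1) (is_derive_mulf (is_derive_cst C r 1)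
    (is_derive_addf (is_derive_id r 1) (is_derive_cst (- s) r 1))).
  by rewrite mul0r !add0r addr0 mulr1.
have yt : yf t = y + C * (t - s) by rewrite yE.
have ys : yf s = y by rewrite yE subrr mulr0 addr0.
have := fl_transport F ba sy s0 st; rewrite dy yt ys => h.
rewrite -subr_ge0 h; apply: Rint_ge0 => r _; apply: Rint_ge0 => w _.
rewrite mulr_le0// subr_le0.
exact: le_trans (ler_norm _) (fl_GC F _).
Qed.

Lemma decreasing_down (a : R -> R) (y s t : R) : bsm a -> (forall z, derive1 a z <= 0) ->
  0 < s -> s < t ->
  \int[leb]_(w in D) a (X t w - y) <= \int[leb]_(w in D) a (X s w - (y + C * (t - s))).
Proof.
move=> ba a0 s0 st.
have [yf yE] : exists yf : R -> R, yf = fun r : R => y + C * (t - r) by eexists.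
have sy : smooth yf.
  rewrite yE; apply: smooth_add; [exact: smooth_cst|apply: smooth_mul; [exact: smooth_cst|]].
  by apply: smooth_sub; [exact: smooth_cst|exact: smooth_id].
have dy : derive1 yf = fun=> - C.
  rewrite yE; apply: is_derive_derive1 => r.
  have := is_derive_addf (is_derive_cst y r 1) (is_derive_mulf (is_derive_cst C r 1)
    (is_derive_addf (is_derive_cst t r 1) (is_derive_oppf (is_derive_id r 1)))).
  by rewrite mul0r !add0r mulrN1.
have yt : yf t = y by rewrite yE subrr mulr0 addr0.
have ys : yf s = y + C * (t - s) by rewrite yE.
have := fl_transport F ba sy s0 st; rewrite dy yt ys => h.
rewrite -subr_le0 h; apply: Rint_le0 => r _; apply: Rint_le0 => w _.
rewrite mulr_le0_ge0// opprK -lerBlDr sub0r.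
by have := fl_GC F (X r w, r); rewrite ler_norml => /andP[].
Qed.

Variables (rho0 : finmeas R) (g0 : R -> R).
Hypothesis I : flow_init M C rho G good rho0 g0.
Notation X0 := (qf rho0).

Lemma measurable_lab0 : measurable_fun D X0.
Proof. by rewrite -(fi_mass I); exact: (@measurable_qf R rho0). Qed.

Lemma fi_bm_lab (a : R -> R) : bm setT a -> bm D (fun w => a (X0 w)).
Proof. by move=> ba; exact: (bm_comp measurable_lab0 ba). Qed.

Lemma fi_bm_lab_shift (a : R -> R) z : bm setT a -> bm D (fun w => a (X0 w - z)).
Proof. by move=> ba; exact: (fi_bm_lab (bm_shift z ba)). Qed.

Lemma step_int_cvg0 y :
  \int[leb]_(w in D) step n (X0 w - y) @[n --> \oo] --> cdfl rho0 y.
Proof.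
rewrite cdfl_int (fi_mass I).
apply: (@oint_cvg _ _ _ (fun n w => step n (X0 w - y)) (fun w => bR (X0 w < y)) 1) => //.
- by move=> n; have [] := fi_bm_lab_shift y (bsm_bm (bsm_step n)).
- by move=> n w _; exact: step_norm.
- by move=> w _; rewrite -subr_lt0; exact: step_cvg.
Qed.

Lemma tends0_le (f : R -> R) (l b : R) : tends0 (fun t => 0 < t) f l ->
  (exists2 d, 0 < d & forall t, 0 < t -> t < d -> f t <= b) -> l <= b.
Proof.
move=> fl [d d0 hd]; rewrite leNgt; apply/negP => bl.
have e0 : 0 < (l - b) / 2 by rewrite divr_gt0// subr_gt0.
have [d' d'0 h] := fl _ e0.
have m0 : 0 < Num.min d d' / 2 by rewrite divr_gt0// lt_min d0.
have := h _ m0; have := hd _ m0.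
have m1 : Num.min d d' / 2 < d by rewrite (@lt_le_trans _ _ (Num.min d d'))// ?ge_min ?lexx//; lra.
have m2 : Num.min d d' / 2 < d' by rewrite (@lt_le_trans _ _ (Num.min d d'))// ?ge_min ?lexx ?orbT//; lra.
move=> /(_ m1) h1 /(_ m2); rewrite ler_norml => /andP[h2 _]; lra.
Qed.

(** Fronts moving at speed C to the right and to the left bracket the distribution function at time
    t by shifts of the initial one. A shift of distribution functions is a shift of quantiles. *)
Lemma lab_speed0 t w : 0 < t -> D w -> `|X t w - X0 w| <= C * t.
Proof.
move=> t0; rewrite /= in_itv/= => wD.
have mm : total_mass (rho t) = total_mass rho0 by rewrite (fl_mass F)// (fi_mass I).
have C0 := fl_C0.
have init n y := fi_1 I (smooth_continuous (smooth_shift y (@smooth_step R n)))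
  (fun x => step_norm n (x - y)).
have c1 y : cdfl rho0 y <= cdfl (rho t) (y + C * t).
  have Hc := (@cvg_le_to _ (fun n => \int[leb]_(w in D) step n (X0 w - y)) (fun n => \int[leb]_(w in D) step n (X t w - (y + C * t))) _ _ (step_int_cvg0 (y := y)) (step_int_cvg t0)).
  apply: Hc => n; apply: (tends0_le (init n y)); exists t; [exact: t0|move=> s s0 st].
  apply: le_trans (decreasing_up y (bsm_step n) (derive1_step_le0 n) s0 st) _; apply: oint_le => [||w' _].
  - exact: (fl_bm_lab _ t0 (bsm_bm (bsm_step n))).
  - exact: (fl_bm_lab _ t0 (bsm_bm (bsm_step n))).
  - by apply: step_homo; rewrite lerD2l lerN2 lerD2l ler_wpM2l// gerBl ltW.
have c2 y : cdfl (rho t) y <= cdfl rho0 (y + C * t).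
  have Hc := (@cvg_le_to _ (fun n => \int[leb]_(w in D) step n (X t w - y)) (fun n => \int[leb]_(w in D) step n (X0 w - (y + C * t))) _ _ (step_int_cvg t0) (@step_int_cvg0 _)).
  apply: Hc => n; rewrite -lerN2; apply: (@tends0_le (fun s => - \int[leb]_(w in D) step n (X s w - (y + C * t)))).
    move=> e e0; have [d d0 hd] := init n (y + C * t) e e0; exists d; [exact: d0|move=> s s0 sd].
    have -> (a b : R) : - a - - b = - (a - b) by ring.
    by rewrite normrN; exact: hd.
  exists t; [exact: t0|move=> s s0 st; rewrite lerN2].
  apply: le_trans (decreasing_down y (bsm_step n) (derive1_step_le0 n) s0 st) _; apply: oint_le => [||w' _].
  - exact: (fl_bm_lab _ s0 (bsm_bm (bsm_step n))).
  - exact: (fl_bm_lab _ s0 (bsm_bm (bsm_step n))).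
  - by apply: step_homo; rewrite lerD2l lerN2 lerD2l ler_wpM2l// gerBl ltW.
have h1 : X t w <= X0 w + C * t by apply: qf_le_shift => //; rewrite (fi_mass I).
have h2 : X0 w <= X t w + C * t by apply: qf_le_shift => //; rewrite (fl_mass F).
by rewrite ler_norml; apply/andP; split; lra.
Qed.

End speed.

Section tends0_algebra.
Context {R : realType}.
Variable P : R -> Prop.
Implicit Types (f g : R -> R) (l m : R).

Lemma tends0_cst l : tends0 P (fun=> l) l.
Proof. by move=> e e0; exists 1 => // t _ _; rewrite subrr normr0 ltW. Qed.

Lemma tends0D f g l m : tends0 P f l -> tends0 P g m -> tends0 P (fun t => f t + g t) (l + m).
Proof.
move=> fl gm e e0; have e2 : 0 < e / 2 by rewrite divr_gt0.
have [d d0 hd] := fl _ e2; have [d' d'0 hd'] := gm _ e2.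
exists (Num.min d d'); first by rewrite lt_min d0.
move=> t Pt; rewrite lt_min => /andP[td td'].
rewrite (_ : _ - _ = (f t - l) + (g t - m)); last by ring.
rewrite [e]splitr (le_trans (ler_normD _ _))// lerD//; [exact: hd|exact: hd'].
Qed.

Lemma tends0M f g l m : tends0 P f l -> tends0 P g m -> tends0 P (fun t => f t * g t) (l * m).
Proof.
move=> fl gm e e0.
have [k kE] : exists k, k = 1 + `|l| + `|m| by eexists.
have k0 : 0 < k by rewrite kE -addrA ltr_pwDl// addr_ge0.
have e2 : 0 < Num.min 1 (e / k) by rewrite lt_min ltr01 divr_gt0.
have [d d0 hd] := fl _ e2; have [d' d'0 hd'] := gm _ e2.
exists (Num.min d d'); first by rewrite lt_min d0.
move=> t Pt; rewrite lt_min => /andP[td td'].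
have := hd t Pt td; have := hd' t Pt td'; rewrite !le_min => /andP[a1 a2] /andP[b1 b2].
rewrite (_ : _ - _ = (f t - l) * (g t - m) + l * (g t - m) + (f t - l) * m); last by ring.
have -> : e = e / k + `|l| * (e / k) + (e / k) * `|m|.
  have kn : k != 0 by rewrite gt_eqF.
  by rewrite -[LHS](divfK kn) {2}kE; ring.
rewrite (le_trans (ler_normD _ _))// lerD//; last by rewrite normrM ler_wpM2r.
rewrite (le_trans (ler_normD _ _))// lerD//; last by rewrite normrM ler_wpM2l.
by rewrite normrM (le_trans (ler_wpM2r _ b1))// mul1r.
Qed.

Lemma tends0N f l : tends0 P f l -> tends0 P (fun t => - f t) (- l).
Proof.
move=> fl e /fl[d d0 hd]; exists d => // t Pt td.
by rewrite -opprD normrN; exact: hd.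
Qed.

Lemma tends0B f g l m : tends0 P f l -> tends0 P g m -> tends0 P (fun t => f t - g t) (l - m).
Proof. by move=> fl gm; apply: tends0D => //; exact: tends0N. Qed.

Lemma tends0_squeeze f g l : tends0 P g 0 -> (exists2 d, 0 < d & forall t, P t -> t < d -> `|f t - l| <= g t) ->
  tends0 P f l.
Proof.
move=> g0 [d d0 hd] e e0; have [d' d'0 hd'] := g0 e e0.
exists (Num.min d d'); first by rewrite lt_min d0.
move=> t Pt; rewrite lt_min => /andP[td td'].
apply: le_trans (hd t Pt td) _; apply: le_trans (hd' t Pt td').
by rewrite subr0 ler_norm.
Qed.

Hypothesis P0 : forall t, P t -> 0 < t.

Lemma tends0_smooth f : smooth f -> tends0 P f (f 0).
Proof.
move=> sf; have [K K0 hK] := smooth_bounded_itv 0 1 (smooth_derive1 sf).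
move=> e e0; exists (Num.min 1 (e / (K + 1))); first by rewrite lt_min ltr01 divr_gt0// ltr_wpDl.
move=> t /P0 t0; rewrite lt_min => /andP[t1 te].
rewrite -(int_derive1 (ltW t0) sf).
have b : bm `[0, t] (derive1 f) by apply: bm_smooth; exact: smooth_derive1.
have := @cint_bound _ _ _ K _ b; rewrite (fine_leb_itv (ltW t0)) subr0 => h.
apply: le_trans (h _) _.
  by move=> x; rewrite /= in_itv/= => /andP[x0 xt]; apply: hK; rewrite x0 (le_trans xt)// ltW.
rewrite (@le_trans _ _ (K * (e / (K + 1))))//; first by rewrite ler_wpM2l// ltW.
by rewrite mulrCA ger_pMr// ler_pdivrMr ?mul1r ?lerDl//; exact: ltr_wpDl.
Qed.

Lemma ae_near0 m : {ae (@lebesgue_measure R), forall t, 0 < t -> P t} -> 0 < m ->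
  exists2 t, P t & t < m.
Proof.
move=> [N [mN N0 hN]] m0; apply: contrapT => nt.
have : (lebesgue_measure (`]0%R, m[%classic : set R) <= 0)%E.
  rewrite -N0; apply: le_measure; rewrite ?inE//.
  move=> t /=; rewrite in_itv/= => /andP[t0 td]; apply: hN => /= ht; apply: nt.
  by exists t => //; exact: ht.
rewrite leNgt => /negP; apply.
by rewrite [X in (_ < X)%E](lebesgue_measure_itv (`]0%R, m[)) /= lte_fin m0 sube0 lte_fin.
Qed.

Lemma tends0_le_along f l b : tends0 P f l -> {ae (@lebesgue_measure R), forall t, 0 < t -> P t} ->
  (exists2 d, 0 < d & forall t, P t -> t < d -> b <= f t) -> b <= l.
Proof.
move=> fl ag [d d0 hd]; rewrite leNgt; apply/negP => lb.
have e0 : 0 < (b - l) / 2 by rewrite divr_gt0// subr_gt0.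
have [d' d'0 h] := fl _ e0.
have m0 : 0 < Num.min d d' by rewrite lt_min d0.
have [t Pt] := ae_near0 ag m0; rewrite lt_min => /andP[td td'].
have := hd t Pt td; have := h t Pt td'; rewrite ler_norml => /andP[_ h2] h1 {ag}; lra.
Qed.

End tends0_algebra.

Lemma bm_label (R : realType) (M : R) : bm (`]0, M[%classic : set R) (fun w => w).
Proof.
split; first exact: measurable_id.
exists M => w; rewrite /= in_itv/= => /andP[w0 wM].
by rewrite ger0_norm ltW.
Qed.

(** * Monotone quantities along paths *)

Section triangle.
Variables (R : realType) (M w0 : R).
Hypothesis hw0 : 0 <= w0 <= M.
Notation leb := (@lebesgue_measure R).

Let bsub : bm (`]0, M[%classic : set R) (fun w => w0 - w).
Proof. by apply: bmB; [exact: bm_cst|exact: bm_label]. Qed.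

Lemma bm_below : bm (`]0, M[%classic : set R) (fun w => bR (w < w0) : R).
Proof.
by apply: bm_bool; apply: measurable_fun_ltr; [exact: measurable_id|exact: measurable_cst].
Qed.

Lemma tri_int : \int[leb]_(w in `]0, M[) (bR (w < w0) * (w0 - w)) = w0 ^+ 2 / 2.
Proof.
have /andP[w00 w0M] := hw0.
pose p w : R := bR (w < w0) * (w0 - w).
pose g (w : R) := w0 * w - w * w / 2.
have sg : smooth g.
  apply: smooth_sub; apply: smooth_mul; [exact: smooth_cst|exact: smooth_id| |exact: smooth_cst].
  by apply: smooth_mul; exact: smooth_id.
have dg : derive1 g = fun w => w0 - w.
  apply: is_derive_derive1 => z.
  have := is_derive_addf (is_derive_mulf (is_derive_cst w0 z 1) (is_derive_id z 1))
     (is_derive_oppf (is_derive_mulf (is_derive_mulf (is_derive_id z 1) (is_derive_id z 1))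
       (is_derive_cst (2^-1 : R) z 1))).
  by rewrite (_ : 0 * z + _ - _ = w0 - z)//= /cst; field.
transitivity (\int[lebesgue_measure]_(w in `[0, w0]) derive1 g w); last first.
  by rewrite int_derive1// /g !mulr0 mul0r !subr0 -expr2; lra.
rewrite dg [LHS]Rintegral_mkcond [RHS]Rintegral_mkcond.
have pt (w : R) : w <> 0 -> (p \_ `]0, M[) w = ((fun w => w0 - w) \_ `[0, w0]) w.
  move=> wn; rewrite !patchE.
  have [h1|h1] := boolP (0 < w < M).
    rewrite mem_set/=; last by rewrite in_itv.
    have [h2|h2] := boolP (0 <= w <= w0).
      rewrite mem_set/=; last by rewrite in_itv.
      rewrite /p; case: ltP => h3; first by rewrite mul1r.
      by have -> : w = w0; [lra|rewrite subrr mulr0].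
    rewrite memNset/=; last by rewrite in_itv/=; exact/negP.
    by rewrite /p; case: ltP => h3; [lra|rewrite mul0r].
  rewrite memNset/=; last by rewrite in_itv/=; exact/negP.
  have [h2|h2] := boolP (0 <= w <= w0).
    rewrite mem_set/=; last by rewrite in_itv.
    have -> : w = w0; last by rewrite subrr.
    have w0' : 0 < w by rewrite lt_neqAle eq_sym; case/andP: h2 => -> _; rewrite andbT; apply/eqP.
    by move: h1; rewrite w0' /= -leNgt => h1; lra.
  by rewrite memNset//= in_itv/=; exact/negP.
apply: ae_eq_Rintegral_nm.
exists [set 0]; split; [exact: measurable_set1|exact: lebesgue_measure_set1|].
by move=> w /=; apply: contra_notP => wn _; exact: pt.
Qed.

(** Bathtub principle: among weights with values in [0, 1], the indicator of w < w0 maximises the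
    integral of f (w0 - w). *)
Lemma tri_bound (f : R -> R) : bm (`]0, M[%classic : set R) f -> (forall w, 0 <= f w <= 1) ->
  \int[leb]_(w in `]0, M[) (f w * (w0 - w)) <= w0 ^+ 2 / 2.
Proof.
move=> bf f01; rewrite -tri_int; apply: (oint_le (bmM bf bsub) (bmM bm_below bsub)) => w _.
have /andP[h1 h2] := f01 w.
have [h|h] := ltP w w0; first by rewrite ler_wpM2r// subr_ge0 ltW.
by rewrite mul0r mulr_ge0_le0// subr_le0.
Qed.

Lemma below_int : \int[leb]_(w in `]0, M[) bR (w < w0) = w0.
Proof.
have /andP[w00 w0M] := hw0.
rewrite int_bool//; last by apply: measurable_fun_ltr; [exact: measurable_id|exact: measurable_cst].
rewrite (_ : _ `&` _ = `]0, w0[%classic); first by rewrite fine_leb_itvoo// subr0.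
apply/seteqP; split => z /=; rewrite !in_itv/=.
  by move=> [/andP[-> _] ->].
by move=> /andP[z0 zw]; rewrite z0 zw (lt_le_trans zw).
Qed.

Lemma below_int_linear : \int[leb]_(w in `]0, M[) (bR (w < w0) * (M / 2 - w)) = w0 * (M - w0) / 2.
Proof.
have b := bm_below.
transitivity (\int[leb]_(w in `]0, M[) (bR (w < w0) * (w0 - w) + (M / 2 - w0) * bR (w < w0))).
  by apply: eq_Rintegral => w _; ring.
rewrite (ointD (bmM b bsub) (bmZ _ b)) (ointZ _ b) tri_int below_int.
by field.
Qed.

End triangle.

Section path.
Context {R : realType}.
Notation leb := (@lebesgue_measure R).
Variables (tau M C : R) (rho : R -> finmeas R) (G : R * R -> R) (good : R -> Prop).
Hypothesis F : flow tau M C rho G good.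
Hypothesis tau0 : 0 < tau.
Notation D := (`]0%R, M[%classic : set R).
Notation X := (lab rho).
Notation V := (vel rho G).

Let mD : measurable D := measurable_itv _.
Let fD : (leb D < +oo)%E := leb_itvoo_fin _ _.

Lemma fl_lab_box (l v : R) (a y : R -> R) : 0 < l -> bm setT a -> smooth y ->
  bm (D `*` `[l, v]) (fun p : R * R => a (X p.2 p.1 - y p.2)).
Proof.
move=> l0 ba sy; apply: (bm_lab_box (fl_lab F) l0 ba).
by apply: measurable_funTS; exact: continuous_measurable_fun (smooth_continuous sy).
Qed.

Lemma fl_vel_box (l v : R) : 0 < l -> bm (D `*` `[l, v]) (fun p : R * R => V p.2 p.1).
Proof. exact: (bm_vel_box (fl_lab F) (fl_G F) (fl_GC F) v). Qed.

Lemma fl_time_box (l v : R) (f : R -> R) : smooth f -> bm (D `*` `[l, v]) (fun p : R * R => f p.2).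
Proof. by move=> sf; apply: bm_time_box; exact: bm_smooth. Qed.

Lemma fl_label_box (l v : R) : bm (D `*` `[l, v]) (fun p : R * R => p.1).
Proof. by apply: (bm_comp1 (f := id)) => //; exact: bm_label. Qed.

Lemma fl_box_int (l v : R) (H : R * R -> R) : bm (D `*` `[l, v]) H ->
  bm `[l, v] (fun r => \int[leb]_(w in D) H (w, r)).
Proof. by move=> bH; exact: (leb_fubini2 mD (measurable_itv _) fD (leb_itv_fin _ _) bH). Qed.

Lemma fl_slice (l v : R) (H : R * R -> R) r : l <= r <= v -> bm (D `*` `[l, v]) H ->
  bm D (fun w => H (w, r)).
Proof.
move=> hr bH; apply: (bm_slice1 mD (measurable_itv `[l, v]) bH).
by rewrite /= in_itv.
Qed.

(** After completing the square in V - y', the derivative is [ef] times the integral of a' (V -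
    y')^2 plus that of a (w0 - w), minus w0^2 / 2. The first is nonpositive since [a] decreases; the
    rest is nonpositive by [tri_bound]. *)
Lemma path_decreasing (a ef vf yf : R -> R) (w0 s t : R) :
  bsm a -> (forall z, derive1 a z <= 0) -> (forall z, 0 <= a z <= 1) ->
  smooth ef -> (forall r, derive1 ef r = ef r / tau) -> (forall r, 0 <= ef r) ->
  smooth vf -> (forall r, derive1 vf r = - (w0 - M / 2) * ef r) ->
  smooth yf -> (forall r, vf r = ef r * derive1 yf r) ->
  0 <= w0 <= M -> good s -> good t -> s < t ->
  ef t * \int[leb]_(w in D) (a (X t w - yf t) * V t w) - vf t * \int[leb]_(w in D) a (X t w - yf t)
    + vf t * w0 - tau * ef t * (w0 * (M - w0) / 2) <=
  ef s * \int[leb]_(w in D) (a (X s w - yf s) * V s w) - vf s * \int[leb]_(w in D) a (X s w - yf s)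
    + vf s * w0 - tau * ef s * (w0 * (M - w0) / 2).
Proof.
move=> ba a' a01 se de e0 sv dv sy vy hw0 gs gt st.
have s0 := fl_pos F gs; have st' := ltW st.
have sy' := smooth_derive1 sy; have sv' := smooth_derive1 sv; have se' := smooth_derive1 se.
have b1 := fl_lab_box t s0 (bsm_bm ba) sy.
have b2 := fl_lab_box t s0 (bsm_bm_derive1 ba) sy.
have b3 := fl_vel_box t s0.
have b4 := fl_time_box s t sy'.
have b5 := fl_time_box s t se.
have b6 := fl_time_box s t se'.
have b7 := fl_label_box s t.
have bA : bm (D `*` `[s, t]) (fun p : R * R =>
   derive1 ef p.2 * (a (X p.2 p.1 - yf p.2) * V p.2 p.1)
   + ef p.2 * (derive1 a (X p.2 p.1 - yf p.2) * (V p.2 p.1 - derive1 yf p.2) * V p.2 p.1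
         - a (X p.2 p.1 - yf p.2) * (p.1 - M / 2 + V p.2 p.1 / tau))).
  apply: bmD; apply: bmM => //; first exact: bmM.
  apply: bmB; apply: bmM => //; first by apply: bmM => //; exact: bmB.
  by apply: bmD; [apply: bmB => //; exact: bm_cst|apply: bmM => //; exact: bm_cst].
have bk : bm (D `*` `[s, t]) (fun p : R * R =>
   derive1 a (X p.2 p.1 - yf p.2) * (V p.2 p.1 - derive1 yf p.2)).
  by apply: bmM => //; exact: bmB.
have A1 := fl_momentum F ba sy se gs gt st.
have tr x y : s <= x -> x <= y -> y <= t ->
   \int[leb]_(w in D) a (X y w - yf y) - \int[leb]_(w in D) a (X x w - yf x) =
   \int[leb]_(r in `[x, y]) (\int[leb]_(w in D) (derive1 a (X r w - yf r) * (V r w - derive1 yf r))).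
  move=> sx; rewrite le_eqVlt => /predU1P[<- _|xy yt].
    by rewrite subrr set_itv1 Rintegral_set1.
  exact: (fl_transport F ba sy (lt_le_trans s0 sx) xy).
have Ik := fl_box_int bk; have IA := fl_box_int bA.
have A2 := int_product st' Ik tr sv.
have A3 : (vf t - vf s) * w0 = \int[leb]_(r in `[s, t]) (w0 * derive1 vf r).
  by rewrite (cintZ _ (bm_smooth s t sv')) int_derive1// mulrC.
have A4 : tau * (ef t - ef s) * (w0 * (M - w0) / 2) =
    \int[leb]_(r in `[s, t]) ((w0 * (M - w0) / 2 * tau) * derive1 ef r).
  by rewrite (cintZ _ (bm_smooth s t se')) int_derive1//; ring.
have IP : bm `[s, t] (fun r => \int[leb]_(w in D) a (X r w - yf r)).
  exact: (integrated_bm st' Ik tr).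
have bv := bm_smooth s t sv; have bv' := bm_smooth s t sv'; have be' := bm_smooth s t se'.
have IB := bmD (bmM bv' IP) (bmM bv Ik).
have IC := bmZ w0 bv'; have ID := bmZ (w0 * (M - w0) / 2 * tau) be'.
rewrite -subr_le0.
rewrite (_ : forall a1 a2 a3 a4 c1 c2 c3 c4 : R, (a1 - a2 + a3 - a4) - (c1 - c2 + c3 - c4) =
   (a1 - c1) - (a2 - c2) + ((a3 - c3) - (a4 - c4))); last by move=> *; ring.
rewrite {}A1 {}A2 -mulrBl {}A3 -mulrBl -mulrBr {}A4.
rewrite -(cintB IA IB) -(cintB IC ID) -(cintD (bmB IA IB) (bmB IC ID)).
apply: Rint_le0 => r; rewrite /= in_itv/= => hr.
have r0 : 0 < r by case/andP: hr => sr _; exact: lt_le_trans sr.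
have S1 := fl_slice hr b1; have S2 := fl_slice hr b2; have S3 := fl_slice hr b3.
have SA := fl_slice hr bA; have Sk := fl_slice hr bk; rewrite /= in S1 S2 S3 SA Sk.
have Sw : bm D (fun w => w0 - w) by apply: bmB; [exact: bm_cst|exact: bm_label].
have Sq : bm D (fun w => derive1 a (X r w - yf r) * (V r w - derive1 yf r) ^+ 2).
  by apply: bmM => //; apply: bmX; apply: bmB => //; exact: bm_cst.
have Sv := bmM S1 Sw.
have E : \int[leb]_(w in D) (derive1 ef r * (a (X r w - yf r) * V r w)
   + ef r * (derive1 a (X r w - yf r) * (V r w - derive1 yf r) * V r w
         - a (X r w - yf r) * (w - M / 2 + V r w / tau)))
   - (derive1 vf r * \int[leb]_(w in D) a (X r w - yf r) +
      vf r * \int[leb]_(w in D) (derive1 a (X r w - yf r) * (V r w - derive1 yf r))) =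
   ef r * (\int[leb]_(w in D) (derive1 a (X r w - yf r) * (V r w - derive1 yf r) ^+ 2) +
     \int[leb]_(w in D) (a (X r w - yf r) * (w0 - w))).
  rewrite -(ointD Sq Sv) -(ointZ _ (bmD Sq Sv)) -(ointZ _ S1) -(ointZ _ Sk).
  rewrite -(ointD (bmZ _ S1) (bmZ _ Sk)) -(ointB SA (bmD (bmZ _ S1) (bmZ _ Sk))).
  by apply: eq_Rintegral => w _; rewrite de dv vy; ring.
rewrite {}E dv de.
(* The terms in w0 alone add up to the constant of [tri_bound]; this is what fixes the last term of
   the monotone quantity. *)
rewrite (_ : _ - _ * (_ / tau) = - (ef r * (w0 ^+ 2 / 2))); last by field; rewrite gt_eqF.
rewrite -mulrBr mulr_ge0_le0// subr_le0 -[leRHS]add0r lerD//.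
  by apply: Rint_le0 => w _; rewrite mulr_le0_ge0// sqr_ge0.
exact: tri_bound.
Qed.

End path.

Section path_bound.
Context {R : realType}.
Notation leb := (@lebesgue_measure R).
Variables (tau M C : R) (rho : R -> finmeas R) (G : R * R -> R) (good : R -> Prop).
Hypothesis F : flow tau M C rho G good.
Hypothesis tau0 : 0 < tau.
Variables (rho0 : finmeas R) (g0 : R -> R).
Hypothesis I : flow_init M C rho G good rho0 g0.
Notation D := (`]0%R, M[%classic : set R).
Notation X := (lab rho).
Notation V := (vel rho G).
Notation X0 := (qf rho0).
Notation V0 := (fun w => g0 (qf rho0 w)).

Let mD : measurable D := measurable_itv _.
Let fD : (leb D < +oo)%E := leb_itvoo_fin _ _.

Lemma fl_M0 : 0 <= M. Proof. by rewrite -(fi_mass I) mass_ge0. Qed.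

Lemma bm_vel0 : bm D V0.
Proof.
by apply: (fi_bm_lab I (a := g0)); split; [exact: (fi_g I)|exists C => x _; exact: (fi_gC I)].
Qed.

Lemma measurable_lab_t t : 0 < t -> measurable_fun D (X t).
Proof. exact: (measurable_lab (fl_lab F)). Qed.

Lemma bm_lab_lt t y : 0 < t -> bm D (fun w => bR (X t w < y) : R).
Proof.
move=> t0; apply: bm_bool; apply: measurable_fun_ltr; last exact: measurable_cst.
exact: measurable_lab_t.
Qed.

Let step_weight (Y W : R -> R) (y : R) : measurable_fun D Y -> bm D W ->
  \int[leb]_(w in D) (step n (Y w - y) * W w) @[n --> \oo] --> \int[leb]_(w in D) (bR (Y w < y) * W w).
Proof.
move=> mY [mW [K WK]].
apply: (@oint_cvg _ _ _ (fun n w => step n (Y w - y) * W w) (fun w => bR (Y w < y) * W w) K).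
- move=> n; apply: measurable_funM => //.
  have ms : measurable_fun setT (@step R n) := continuous_measurable_fun (smooth_continuous (@smooth_step R n)).
  apply: (measurable_comp (F := setT) (f := @step R n)) => //.
  by apply: measurable_funB => //; exact: measurable_cst.
- by move=> n w Dw; rewrite normrM -[K]mul1r ler_pM ?step_norm ?WK.
- by move=> w _; apply: cvgM; [rewrite -subr_lt0; exact: step_cvg|exact: cvg_cst].
Qed.

Lemma step_vel_cvg t y : 0 < t ->
  \int[leb]_(w in D) (step n (X t w - y) * V t w) @[n --> \oo] -->
  \int[leb]_(w in D) (bR (X t w < y) * V t w).
Proof. by move=> t0; apply: step_weight; [exact: measurable_lab_t|exact: (fl_bm_vel F)]. Qed.

Lemma step_vel0_cvg y :
  \int[leb]_(w in D) (step n (X0 w - y) * V0 w) @[n --> \oo] -->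
  \int[leb]_(w in D) (bR (X0 w < y) * V0 w).
Proof. by apply: step_weight; [exact: (measurable_lab0 I)|exact: bm_vel0]. Qed.

(** Replacing y t by y 0 costs O(|y t - y 0|) since [a] is Lipschitz, so only a fixed test function
    is needed at time 0. *)
Lemma tends0_moving (W : R -> R -> R) (W0 L : R) (a y : R -> R) : bsm a -> smooth y -> 0 <= L ->
  (forall t, 0 < t -> bm D (W t)) -> (forall t w, `|W t w| <= L) ->
  tends0 good (fun t => \int[leb]_(w in D) (a (X t w - y 0) * W t w)) W0 ->
  tends0 good (fun t => \int[leb]_(w in D) (a (X t w - y t) * W t w)) W0.
Proof.
move=> ba sy L0 bW WL h.
have [sa _ [K aK]] := ba.
have K0 : 0 <= K := le_trans (normr_ge0 _) (aK 0).
have M0 := fl_M0.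
have hy : tends0 good (fun t => `|y t - y 0|) 0.
  move=> e e0; have [d d0 hd] := tends0_smooth (fl_pos F) sy e0.
  by exists d => // t Pt td; rewrite subr0 normr_id; exact: hd.
have h2 : tends0 good (fun t => \int[leb]_(w in D) (a (X t w - y t) * W t w)
   - \int[leb]_(w in D) (a (X t w - y 0) * W t w)) 0.
  have hs := tends0M (tends0_cst good (K * L * M)) hy; rewrite mulr0 in hs.
  apply: (tends0_squeeze hs).
  exists 1 => // t gt _; have t0 := fl_pos F gt.
  have b1 := bmM (fl_bm_lab F (y t) t0 (bsm_bm ba)) (bW t t0).
  have b2 := bmM (fl_bm_lab F (y 0) t0 (bsm_bm ba)) (bW t t0).
  rewrite subr0 -(ointB b1 b2).
  have -> : K * L * M * `|y t - y 0| = (K * `|y t - y 0| * L) * fine (leb D).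
    by rewrite (fine_leb_itvoo M0) subr0; ring.
  apply: (oint_bound (bmB b1 b2)) => w _; rewrite -mulrBl normrM ler_pM//.
  apply: le_trans (smooth_lipschitz sa aK _ _) _.
  by rewrite distrC (_ : _ - _ - _ = y t - y 0)//; ring.
have := tends0D h h2; rewrite addr0; apply: tends0_eq => t _; ring.
Qed.

Lemma tends0_lab (a y : R -> R) : bsm a -> smooth y ->
  tends0 good (fun t => \int[leb]_(w in D) a (X t w - y t)) (\int[leb]_(w in D) a (X0 w - y 0)).
Proof.
move=> ba sy; have [sa [K aK] _] := ba.
have h := tends0_imp (fl_pos F) (fi_1 I (smooth_continuous (smooth_shift (y 0) sa)) (fun x => aK (x - y 0))).
have e t z : \int[leb]_(w in D) (a (X t w - z) * 1) = \int[leb]_(w in D) a (X t w - z).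
  by apply: eq_Rintegral => w _; rewrite mulr1.
apply: (@tends0_eq _ _ (fun t => \int[leb]_(w in D) (a (X t w - y t) * 1))) => [t _|]; first exact: e.
apply: (@tends0_moving (fun _ _ => 1) _ 1) => //.
- by move=> t _; exact: bm_cst.
- by move=> t w; rewrite normr1.
by apply: tends0_eq h => t _; rewrite e.
Qed.

Lemma tends0_lab_vel (a y : R -> R) : bsm a -> smooth y ->
  tends0 good (fun t => \int[leb]_(w in D) (a (X t w - y t) * V t w))
    (\int[leb]_(w in D) (a (X0 w - y 0) * V0 w)).
Proof.
move=> ba sy; have [sa [K aK] _] := ba.
apply: (@tends0_moving V _ C) => //.
- exact: (fl_C0 F).
- by move=> t t0; exact: (fl_bm_vel F).
- by move=> t w; exact: (fl_GC F).
exact: (fi_u I (smooth_continuous (smooth_shift (y 0) sa)) (fun x => aK (x - y 0))).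
Qed.

Section sharp.
Variables (ef vf yf : R -> R) (w0 : R).
Hypotheses (se : smooth ef) (de : forall r, derive1 ef r = ef r / tau) (e0 : forall r, 0 <= ef r)
  (sv : smooth vf) (dv : forall r, derive1 vf r = - (w0 - M / 2) * ef r)
  (sy : smooth yf) (vy : forall r, vf r = ef r * derive1 yf r) (hw0 : 0 <= w0 <= M).

(** The monotone quantity with the sharp indicator. When w0 is the mass to the left of yf t, the two
    terms with [vf] cancel and only the momentum to the left remains, up to an explicit constant. *)
Definition excess t :=
  ef t * \int[leb]_(w in D) (bR (X t w < yf t) * V t w) - vf t * cdfl (rho t) (yf t)
    + vf t * w0 - tau * ef t * (w0 * (M - w0) / 2).

Definition excess0 :=
  ef 0 * \int[leb]_(w in D) (bR (X0 w < yf 0) * V0 w) - vf 0 * cdfl rho0 (yf 0)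
    + vf 0 * w0 - tau * ef 0 * (w0 * (M - w0) / 2).

Let exs n t :=
  ef t * \int[leb]_(w in D) (step n (X t w - yf t) * V t w)
  - vf t * \int[leb]_(w in D) step n (X t w - yf t)
    + vf t * w0 - tau * ef t * (w0 * (M - w0) / 2).

Let exs0 n :=
  ef 0 * \int[leb]_(w in D) (step n (X0 w - yf 0) * V0 w)
  - vf 0 * \int[leb]_(w in D) step n (X0 w - yf 0)
    + vf 0 * w0 - tau * ef 0 * (w0 * (M - w0) / 2).

Let exs_cvg t : 0 < t -> exs n t @[n --> \oo] --> excess t.
Proof.
move=> t0; rewrite /exs /excess.
apply: cvgB; last exact: cvg_cst.
apply: cvgD; last exact: cvg_cst.
by apply: cvgB; apply: cvgMr; [exact: step_vel_cvg|exact: (step_int_cvg F)].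
Qed.

Let exs0_cvg : exs0 n @[n --> \oo] --> excess0.
Proof.
rewrite /exs0 /excess0.
apply: cvgB; last exact: cvg_cst.
apply: cvgD; last exact: cvg_cst.
by apply: cvgB; apply: cvgMr; [exact: step_vel0_cvg|exact: (step_int_cvg0 I)].
Qed.

Let exs_le n s t : good s -> good t -> s < t -> exs n t <= exs n s.
Proof.
apply: (path_decreasing F tau0 (@bsm_step R n) (@derive1_step_le0 R n)) => // z.
by rewrite step_ge0 step_le1.
Qed.

Lemma excess_le s t : good s -> good t -> s < t -> excess t <= excess s.
Proof.
move=> gs gt st.
apply: (cvg_le_to (exs_cvg (fl_pos F gt)) (exs_cvg (fl_pos F gs))) => n.
exact: exs_le.
Qed.

(** The sharp indicator is not a continuous test function: the limit at time 0 is taken with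
    [step n] fixed, and n tends to infinity afterwards. *)
Lemma excess_le0 t : good t -> excess t <= excess0.
Proof.
move=> gt; apply: (cvg_le_to (exs_cvg (fl_pos F gt)) exs0_cvg) => n.
have P0 := fl_pos F.
have h : tends0 good (exs n) (exs0 n).
  have h1 := tends0M (tends0_smooth P0 se) (tends0_lab_vel (@bsm_step R n) sy).
  have h2 := tends0M (tends0_smooth P0 sv) (tends0_lab (@bsm_step R n) sy).
  have h3 := tends0M (tends0_smooth P0 sv) (tends0_cst good w0).
  have h4 := tends0M (tends0M (tends0_cst good tau) (tends0_smooth P0 se))
    (tends0_cst good (w0 * (M - w0) / 2)).
  exact: (tends0B (tends0D (tends0B h1 h2) h3) h4).
apply: (tends0_le_along h (fl_good F)).
by exists t; [exact: P0|move=> s gs st; exact: exs_le].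
Qed.

End sharp.

End path_bound.

Section path_functions.
Context {R : realType}.
Variables (tau : R).
Hypothesis tau0 : 0 < tau.

Definition gro (r : R) : R := expR (r / tau).

Lemma smooth_gro : smooth gro.
Proof.
apply: (smooth_comp (f := @expR R)); first exact: smooth_expR.
by apply: smooth_mul; [exact: smooth_id|exact: smooth_cst].
Qed.

Lemma derive1_gro r : derive1 gro r = gro r / tau.
Proof.
suff -> : derive1 gro = fun r => gro r / tau by [].
apply: is_derive_derive1 => z.
have h : is_derive z 1 (fun z : R => z / tau) tau^-1.
  have := is_derive_mulf (is_derive_id z 1) (is_derive_cst (tau^-1 : R) z 1).
  by rewrite mulr0 mul1r addr0.
exact: (@is_derive_compf _ (@expR R) (fun z => z / tau) _ _ _ (is_derive_expR _) h).
Qed.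

Lemma gro_gt0 r : 0 < gro r. Proof. exact: expR_gt0. Qed.
Lemma gro0 : gro 0 = 1. Proof. by rewrite /gro mul0r expR0. Qed.
Lemma groN r : gro (- r) = (gro r)^-1. Proof. by rewrite /gro mulNr expRN. Qed.
Lemma gro_gt1 r : 0 < r -> 1 < gro r.
Proof. by move=> r0; rewrite /gro expR_gt1 divr_gt0. Qed.

(** The explicit solution of v' = - g [gro], y' = v / [gro] with g = w0 - M / 2. *)
Lemma path_exists (M w0 v0 y0 : R) : exists vf yf : R -> R,
  [/\ smooth vf /\ smooth yf, forall r, derive1 vf r = - (w0 - M / 2) * gro r,
      forall r, vf r = gro r * derive1 yf r,
      vf 0 = v0 & yf 0 = y0 /\
      forall r, yf r = y0 + tau * (v0 + tau * (w0 - M / 2)) * (1 - (gro r)^-1) - tau * (w0 - M / 2) * r].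
Proof.
have tn : tau != 0 by rewrite gt_eqF.
have [g gE] : exists g, g = w0 - M / 2 by eexists.
rewrite -gE.
have sm : smooth (fun r : R => gro (- r)).
  by apply: (smooth_comp smooth_gro); apply: smooth_opp; exact: smooth_id.
have dm (r : R) : is_derive r 1 (fun r : R => gro (- r)) (- (gro (- r) / tau)).
  have h := is_derive_oppf (is_derive_id r (1 : R)).
  have := @is_derive_compf _ gro (fun z => - z) _ _ _ (smooth_is_derive _ smooth_gro) h.
  by rewrite derive1_gro mulrN1.
have sv : smooth (fun r => v0 + (- (tau * g)) * (gro r - 1)).
  apply: smooth_add; first exact: smooth_cst.
  apply: smooth_mul; first exact: smooth_cst.
  by apply: smooth_sub; [exact: smooth_gro|exact: smooth_cst].
have sy : smooth (fun r => y0 + tau * (v0 + tau * g) * (1 - gro (- r)) - tau * g * r).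
  apply: smooth_sub.
    apply: smooth_add; first exact: smooth_cst.
    apply: smooth_mul; first exact: smooth_cst.
    by apply: smooth_sub; [exact: smooth_cst|].
  by apply: smooth_mul; [exact: smooth_cst|exact: smooth_id].
(* Writing [gro (- r)] for the inverse of [gro r] makes smoothness immediate. *)
exists (fun r => v0 + (- (tau * g)) * (gro r - 1)),
  (fun r => y0 + tau * (v0 + tau * g) * (1 - gro (- r)) - tau * g * r); split => //.
- move=> r; suff -> : derive1 (fun r => v0 + (- (tau * g)) * (gro r - 1)) = fun r => - g * gro r by [].
  apply: is_derive_derive1 => z.
  have := is_derive_addf (is_derive_cst v0 z 1) (is_derive_mulf (is_derive_cst (- (tau * g)) z 1)
    (is_derive_addf (smooth_is_derive z smooth_gro) (is_derive_cst (- 1 : R) z 1))).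
  rewrite derive1_gro (_ : 0 + _ = - g * gro z)//= /cst; field => //.
- move=> r; suff -> : derive1 (fun r => y0 + tau * (v0 + tau * g) * (1 - gro (- r)) - tau * g * r) =
     fun r => (v0 + tau * g) * gro (- r) - tau * g.
    have gn : gro r != 0 by rewrite gt_eqF// gro_gt0.
    by rewrite groN; field.
  apply: is_derive_derive1 => z.
  have := is_derive_addf (is_derive_addf (is_derive_cst y0 z 1)
    (is_derive_mulf (is_derive_cst (tau * (v0 + tau * g)) z 1)
      (is_derive_addf (is_derive_cst (1 : R) z 1) (is_derive_oppf (dm z)))))
    (is_derive_oppf (is_derive_mulf (is_derive_cst (tau * g) z 1) (is_derive_id z 1))).
  by rewrite (_ : 0 + _ - _ = (v0 + tau * g) * gro (- z) - tau * g)//= /cst; field.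
- by rewrite gro0 subrr mulr0 addr0.
- by split=> [|r]; [rewrite oppr0 gro0 subrr !mulr0 addr0 subr0|rewrite groN].
Qed.

End path_functions.

Section label_order.
Context {R : realType}.
Notation leb := (@lebesgue_measure R).
Variables (nu : finmeas R) (M : R).
Hypothesis mass : total_mass nu = M.
Notation D := (`]0%R, M[%classic : set R).
Notation Y := (qf nu).

Lemma lab_homo w w' : D w -> D w' -> w <= w' -> Y w <= Y w'.
Proof. by rewrite /= !in_itv/= -mass; exact: qf_homo. Qed.

(** Only the label w = [cdfl nu x] can make the two indicators differ. Integrals of label functions
    over X < x thus depend on x through m alone. *)
Lemma below_lab (f : R -> R) x : \int[leb]_(w in D) (bR (Y w < x) * f w) =
  \int[leb]_(w in D) (bR (w < cdfl nu x) * f w).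
Proof.
apply: ae_eq_Rintegral_nm; exists [set cdfl nu x]; split.
- exact: measurable_set1.
- exact: lebesgue_measure_set1.
move=> w /=; apply: contra_notP => wn; rewrite in_itv/= -mass => hw.
congr (GRing.natmul 1 (nat_of_bool _) * _); apply/idP/idP => h.
  by rewrite lt_neqAle (qf_lt hw h) andbT; apply/eqP.
exact: lt_qf.
Qed.

Lemma below_lab1 x : \int[leb]_(w in D) bR (Y w < x) = cdfl nu x.
Proof. by rewrite cdfl_int mass. Qed.

Lemma cdfl_range x : 0 <= cdfl nu x <= M.
Proof. by rewrite cdfl_ge0 -mass cdfl_le_mass. Qed.

End label_order.

Lemma le_of_sub (R : realType) (a b e : R) : - e <= a - b -> a <= 0 -> b <= e.
Proof. by move=> *; lra. Qed.

Section initial_minimum.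
Context {R : realType}.
Notation leb := (@lebesgue_measure R).
Variables (M C : R) (rho0 : finmeas R) (g0 : R -> R).
Hypothesis mass : total_mass rho0 = M.
Hypothesis mg : measurable_fun setT g0.
Hypothesis gC : forall x, `|g0 x| <= C.
Notation D := (`]0%R, M[%classic : set R).
Notation X0 := (qf rho0).

Let mD : measurable D := measurable_itv _.
Let fD : (leb D < +oo)%E := leb_itvoo_fin _ _.
Let mX0 : measurable_fun D X0.
Proof. by rewrite -mass; exact: (@measurable_qf R rho0). Qed.
Let bV0 : bm D (fun w => g0 (X0 w)).
Proof. by apply: bm_comp mX0 _; split => //; exists C => x _. Qed.
Let blt y : bm D (fun w => bR (X0 w < y) : R).
Proof. by apply: bm_bool; apply: measurable_fun_ltr => //; exact: measurable_cst. Qed.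

Definition mom0 w0 : R := \int[leb]_(w in D) (bR (w < w0) * g0 (X0 w)).

Let gap v w0 y : 0 <= w0 <= M ->
  \int[leb]_(w in D) (bR (X0 w < y) * g0 (X0 w)) - v * cdfl rho0 y + v * w0 - mom0 w0 =
  \int[leb]_(w in D) ((bR (X0 w < y) - bR (w < w0)) * (g0 (X0 w) - v)).
Proof.
move=> hw0; have b1 := blt y; have b2 := bm_below M w0.
have -> : v * w0 = v * \int[leb]_(w in D) bR (w < w0) by rewrite below_int.
rewrite -(below_lab1 mass) /mom0.
rewrite -(ointZ _ b1) -(ointZ _ b2) -(ointB (bmM b1 bV0) (bmZ v b1)).
rewrite -(ointD (bmB (bmM b1 bV0) (bmZ v b1)) (bmZ v b2)).
rewrite -(ointB (bmD (bmB (bmM b1 bV0) (bmZ v b1)) (bmZ v b2)) (bmM b2 bV0)).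
by apply: eq_Rintegral => w _; ring.
Qed.

(** Here al - be y is the initial velocity of the path from y to a prescribed endpoint. By [gap],
    the excess over [mom0] is the integral of (1_{X0 < y} - 1_{w < w0}) (V0 - (al - be y)). For y at
    the quantile z of w0 the indicators differ only on the atom at z, where V0 = g0 z is constant.
    According to the sign of g0 z - (al - be z), the atom is left out (y = z) or included (y
    slightly above z). The second choice is only approximate, hence the margin e. *)
Lemma initial_minimum (al be w0 e : R) : 0 < be -> 0 <= w0 <= M -> 0 < e ->
  exists y, \int[leb]_(w in D) (bR (X0 w < y) * g0 (X0 w)) - (al - be * y) * cdfl rho0 y
    + (al - be * y) * w0 <= mom0 w0 + e.
Proof.
move=> be0 hw0 e0; have ben : be != 0 by rewrite gt_eqF.
suff [y hy] : exists y, \int[leb]_(w in D) ((bR (X0 w < y) - bR (w < w0)) *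
    (g0 (X0 w) - (al - be * y))) <= e.
  by exists y; rewrite -lerBlDl (gap _ _ hw0).
have g0C x : - C <= g0 x <= C by rewrite -ler_norml.
have Dw w : D w -> 0 < w < M by rewrite /= in_itv.
case/andP: hw0 => w00 w0M.
(* If w0 is 0 or M there is no quantile. Then y is chosen so that al - be y is C or - C, which gives
   V0 - (al - be y) a constant sign. *)
have [w0e|w0n] := eqVneq w0 0.
  exists ((al - C) / be); apply: le_trans (ltW e0); apply: Rint_le0 => w /Dw/andP[wpos _].
  rewrite w0e (lt_gtF wpos) subr0 [be * _]mulrC divfK//.
  by rewrite mulr_ge0_le0//; have := g0C (X0 w); lra.
have [wMe|wMn] := eqVneq w0 M.
  exists ((al + C) / be); apply: le_trans (ltW e0); apply: Rint_le0 => w /Dw/andP[_ wM].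
  rewrite wMe wM [be * _]mulrC divfK//.
  have := g0C (X0 w); case: (X0 w < _) => h; first by rewrite subrr mul0r.
  by rewrite sub0r mulN1r oppr_le0; lra.
have w0D : D w0 by rewrite /= in_itv/= !lt_neqAle eq_sym w0n w00 wMn w0M.
have [z zE] : exists z, z = X0 w0 by eexists.
have below w : D w -> X0 w < z -> w < w0.
  move=> wD; rewrite zE ltNge => h; rewrite ltNge; apply: contra h => h.
  exact: (lab_homo mass).
have above w : D w -> w < w0 -> X0 w <= z by move=> wD h; rewrite zE; exact: (lab_homo mass wD w0D (ltW h)).
have [gz|gz] := leP (al - be * z) (g0 z).
  exists z; apply: le_trans (ltW e0); apply: Rint_le0 => w wD.
  have [h|h] := ltP (X0 w) z; first by rewrite below// subrr mul0r.
  have [h2|h2] := ltP w w0; last by rewrite subrr mul0r.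
  have -> : X0 w = z by apply/eqP; rewrite eq_le h above.
  by rewrite sub0r mulN1r oppr_le0 subr_ge0.
(* Approaching z from the right turns X0 < yn n into X0 <= z in the limit, so the whole atom is
   included. *)
pose yn (n : nat) := z + 1 / n.+1%:R.
have ynz : yn n @[n --> \oo] --> z.
  by rewrite -[X in _ --> X]addr0; apply: cvgD; [exact: cvg_cst|exact: cvg_div_succ].
have L : \int[leb]_(w in D) ((bR (X0 w < yn n) - bR (w < w0)) * (g0 (X0 w) - (al - be * yn n)))
   @[n --> \oo] --> \int[leb]_(w in D) ((bR (X0 w <= z) - bR (w < w0)) * (g0 (X0 w) - (al - be * z))).
  apply: (@oint_cvg _ _ _
    (fun n w => (bR (X0 w < yn n) - bR (w < w0)) * (g0 (X0 w) - (al - be * yn n))) _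
    (1 * (C + (`|al| + be * (`|z| + 1))))).
  - move=> n; have [] // : bm D (fun w => (bR (X0 w < yn n) - bR (w < w0)) * (g0 (X0 w) - (al - be * yn n))).
    by apply: bmM; apply: bmB => //; [exact: bm_below|exact: bm_cst].
  - move=> n w _; rewrite normrM ler_pM//.
      by case: (X0 w < _); case: (w < w0) => /=; rewrite ?subrr ?subr0 ?sub0r ?normr0 ?normrN ?normr1.
    rewrite (le_trans (ler_normB _ _))// lerD// (le_trans (ler_normB _ _))// lerD//.
    rewrite normrM gtr0_norm// ler_wpM2l ?(ltW be0)// (le_trans (ler_normD _ _))// lerD//.
    by rewrite ger0_norm ?divr_ge0// ler_pdivrMr// mul1r ler1n.
  - move=> w _; apply: cvgM; last first.
      apply: cvgB; first exact: cvg_cst.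
      by apply: cvgB; [exact: cvg_cst|exact: cvgMr].
    apply: cvgB; last exact: cvg_cst.
    have [h|h] := leP (X0 w) z.
      by apply: cvg_near_cst; near=> n; rewrite (le_lt_trans h)// ltrDl divr_gt0.
    apply: cvg_near_cst; near=> n.
    have -> // : (X0 w < yn n) = false.
    by apply/negbTE; rewrite -leNgt; near: n; exact: (@cvgr_le _ _ _ _ yn z ynz (X0 w) h).
have [n hn] : exists n, \int[leb]_(w in D) ((bR (X0 w < yn n) - bR (w < w0)) *
    (g0 (X0 w) - (al - be * yn n))) <= e.
  have Lle : \int[leb]_(w in D) ((bR (X0 w <= z) - bR (w < w0)) * (g0 (X0 w) - (al - be * z))) <= 0.
    apply: Rint_le0 => w wD.
    have [h2|h2] := ltP w w0; first by rewrite above// subrr mul0r.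
    have [h|h] := leP (X0 w) z; last by rewrite subrr mul0r.
    have -> : X0 w = z.
      by apply/eqP; rewrite eq_le h zE; exact: (lab_homo mass w0D wD h2).
    by rewrite subr0 mul1r subr_le0 ltW.
  have /cvgrPdist_le/(_ _ e0)[n _ hn] := L.
  exists n; have := hn n (leqnn n); rewrite /= ler_norml => /andP[h1 _].
  exact: le_of_sub h1 Lle.
by exists (yn n).
Unshelve. all: by end_near. Qed.

End initial_minimum.

Section deficit.
Context {R : realType}.
Notation leb := (@lebesgue_measure R).
Variables (tau M C : R).
Hypothesis tau0 : 0 < tau.
Variables (rho0 : finmeas R) (g0 : R -> R).
Notation D := (`]0%R, M[%classic : set R).
Notation X0 := (qf rho0).
Notation V0 := (fun w => g0 (qf rho0 w)).
Notation ef := (gro tau).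

Definition path_to (w0 : R) (vf yf : R -> R) := [/\ smooth vf /\ smooth yf,
  forall r, derive1 vf r = - (w0 - M / 2) * ef r & forall r, vf r = ef r * derive1 yf r].

(** With k = tau (1 - 1 / [ef t]) and g = w0 - M / 2, the path from y with initial velocity v0 ends
    at y + k (v0 + tau g) - tau g t. Solving for the endpoint x makes v0 affine in y with slope - 1
    / k, the form that [initial_minimum] accepts. *)
Lemma good_path (t x w0 e : R) : total_mass rho0 = M -> measurable_fun setT g0 ->
  (forall x, `|g0 x| <= C) -> 0 < t -> 0 <= w0 <= M -> 0 < e ->
  exists vf yf, [/\ path_to w0 vf yf, yf t = x &
    excess0 tau M rho0 g0 ef vf yf w0 <= mom0 M rho0 g0 w0 + e - tau * (w0 * (M - w0) / 2)].
Proof.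
move=> mass mg gC t0 hw0 e0.
have e1 : 1 < ef t by exact: gro_gt1.
have [k [k0 kE]] : exists k, 0 < k /\ k = tau * (1 - (ef t)^-1).
  exists (tau * (1 - (ef t)^-1)); split => //.
  by rewrite mulr_gt0// subr_gt0 invf_lt1// (lt_trans _ e1).
have kn : k != 0 by rewrite gt_eqF.
have [g gE] : exists g, g = w0 - M / 2 by eexists.
have [y hy] := @initial_minimum R M C rho0 g0 mass mg gC ((x + tau * g * t) / k - tau * g) k^-1 w0 e
  ltac:(by rewrite invr_gt0) hw0 e0.
have [vf [yf [[sv sy] dv vy v0 [y0 yE]]]] :=
  path_exists tau0 M w0 ((x + tau * g * t) / k - tau * g - k^-1 * y) y.
exists vf, yf; split => //.
  rewrite yE -gE (_ : tau * _ * (1 - (ef t)^-1) = k * ((x + tau * g * t) / k - tau * g - k^-1 * y + tau * g)).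
    by field.
  by rewrite kE; ring.
by rewrite /excess0 gro0 mul1r mulr1 v0 y0 lerD2r.
Qed.

Section one_flow.
Variables (rho : R -> finmeas R) (G : R * R -> R) (good : R -> Prop).
Hypothesis F : flow tau M C rho G good.
Hypothesis I : flow_init M C rho G good rho0 g0.
Notation X := (lab rho).
Notation V := (vel rho G).

Let mD : measurable D := measurable_itv _.
Let fD : (leb D < +oo)%E := leb_itvoo_fin _ _.

Lemma excess_end vf yf w0 t : 0 < t -> w0 = cdfl (rho t) (yf t) ->
  excess tau M rho G ef vf yf w0 t =
  ef t * \int[leb]_(w in D) (bR (X t w < yf t) * V t w) - tau * ef t * (w0 * (M - w0) / 2).
Proof. by move=> t0 ->; rewrite /excess; ring. Qed.

Lemma momentum_deficit t x : good t ->
  ef t * \int[leb]_(w in D) (bR (X t w < x) * V t w) <=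
  mom0 M rho0 g0 (cdfl (rho t) x) + tau * (ef t - 1) * (cdfl (rho t) x * (M - cdfl (rho t) x) / 2).
Proof.
move=> gt; have t0 := fl_pos F gt.
have [w0 w0E] : exists w0, w0 = cdfl (rho t) x by eexists.
have hw0 : 0 <= w0 <= M by rewrite w0E; exact: (cdfl_range (fl_mass F t0)).
rewrite -w0E; apply/ler_addgt0Pr => e e0.
have [vf [yf [[[sv sy] dv vy] yt h]]] := good_path x (fi_mass I) (fi_g I) (fi_gC I) t0 hw0 e0.
have := excess_le0 F tau0 I (smooth_gro tau) (derive1_gro tau) (fun r => ltW (gro_gt0 tau r))
  sv dv sy vy hw0 gt.
rewrite excess_end ?yt// => h1.
have := le_trans h1 h; rewrite lerBlDr => h2; apply: le_trans h2 _.
by apply/eqP/eqP; rewrite le_eqVlt; apply/orP; left; apply/eqP; ring.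
Qed.

Definition deficit t w := g0 (X0 w) + tau * (ef t - 1) * (M / 2 - w) - ef t * V t w.

Let bmid : bm D (fun w => M / 2 - w).
Proof. by apply: bmB; [exact: bm_cst|exact: bm_label]. Qed.

Lemma bm_deficit t : 0 < t -> bm D (deficit t).
Proof.
move=> t0; apply: bmB; last exact: bmZ (fl_bm_vel F t0).
by apply: bmD; [exact: (bm_vel0 I)|exact: bmZ].
Qed.

Lemma deficit_split t (f : R -> R) : 0 < t -> bm D f ->
  \int[leb]_(w in D) (f w * deficit t w) =
  \int[leb]_(w in D) (f w * V0 w) + tau * (ef t - 1) * \int[leb]_(w in D) (f w * (M / 2 - w))
  - ef t * \int[leb]_(w in D) (f w * V t w).
Proof.
move=> t0 bf; have b0 := bmM bf (bm_vel0 I); have b1 := bmM bf bmid.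
have b2 := bmM bf (fl_bm_vel F t0).
rewrite -(ointZ _ b1) -(ointZ _ b2) -(ointD b0 (bmZ _ b1)) -(ointB (bmD b0 (bmZ _ b1)) (bmZ _ b2)).
by apply: eq_Rintegral => w _; rewrite /deficit; ring.
Qed.

Lemma deficit_ge0 t x : good t -> 0 <= \int[leb]_(w in D) (bR (X t w < x) * deficit t w).
Proof.
move=> gt; have t0 := fl_pos F gt.
rewrite (deficit_split t0 (bm_lab_lt F x t0)) subr_ge0.
rewrite !(below_lab (fl_mass F t0)) below_int_linear ?(cdfl_range (fl_mass F t0))//.
by rewrite -(below_lab (fl_mass F t0)); exact: momentum_deficit.
Qed.

Lemma midpoint_int : \int[leb]_(w in D) (M / 2 - w) = 0.
Proof.
have h := @below_int_linear R M M; rewrite lexx (fl_M0 I) in h.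
have {}h := h isT; rewrite subrr mulr0 mul0r in h; etransitivity; last exact: h.
apply: eq_Rintegral => w /set_mem; rewrite /= in_itv/= => /andP[_ ->].
by rewrite mul1r.
Qed.

(** Tested with the constant 1, the damping is absorbed by [ef], and the total force vanishes
    because M / 2 - w has integral 0. *)
Lemma total_momentum t : good t -> ef t * \int[leb]_(w in D) V t w = \int[leb]_(w in D) V0 w.
Proof.
move=> gt; have t0 := fl_pos F gt.
have b1 : bsm (fun _ : R => 1 : R).
  split; [exact: smooth_cst|by exists 1 => _; rewrite normr1|].
  by exists 0 => x; rewrite derive1_cst normr0.
have e1 (W : R -> R) : \int[leb]_(w in D) (1 * W w) = \int[leb]_(w in D) W w.
  by apply: eq_Rintegral => w _; rewrite mul1r.
have E s : good s -> s < t -> ef t * \int[leb]_(w in D) V t w = ef s * \int[leb]_(w in D) V s w.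
  move=> gs st; have := fl_momentum F b1 (smooth_cst 0) (smooth_gro tau) gs gt st.
  rewrite !e1 => /eqP; rewrite subr_eq => /eqP ->.
  rewrite [X in X + _](_ : _ = 0) ?add0r//.
  apply: Rint_zero => r _.
  transitivity (\int[leb]_(w in D) (ef r * (M / 2 - w))).
    apply: eq_Rintegral => w _; rewrite derive1_cst derive1_gro; field.
    by rewrite gt_eqF.
  by rewrite (ointZ _ bmid) midpoint_int mulr0.
have h : tends0 good (fun s => ef s * \int[leb]_(w in D) V s w) (\int[leb]_(w in D) V0 w).
  have h1 := tends0_lab_vel F I b1 (smooth_cst 0).
  have := tends0M (tends0_smooth (fl_pos F) (smooth_gro tau)) h1.
  rewrite gro0 mul1r e1; apply: tends0_eq => s _; by rewrite e1.
apply/eqP; rewrite eq_le; apply/andP; split.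
  apply: (tends0_le_along h (fl_good F)); exists t => // s gs st; by rewrite (E s).
rewrite -lerN2; apply: (tends0_le_along (tends0N h) (fl_good F)).
by exists t => // s gs st; rewrite (E s).
Qed.

Lemma deficit_total t : good t -> \int[leb]_(w in D) deficit t w = 0.
Proof.
move=> gt; have t0 := fl_pos F gt.
have e1 (W : R -> R) : \int[leb]_(w in D) (1 * W w) = \int[leb]_(w in D) W w.
  by apply: eq_Rintegral => w _; rewrite mul1r.
rewrite -e1 (deficit_split t0 (bm_cst D 1)) !e1 midpoint_int total_momentum//.
by rewrite mulr0 addr0 subrr.
Qed.

End one_flow.
End deficit.

Lemma bsm_cst (R : realType) (c : R) : bsm (fun=> c).
Proof.
split; [exact: smooth_cst|by exists `|c| |].
by exists 0 => x; rewrite derive1_cst normr0.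
Qed.

Lemma bsm_add (R : realType) (a b : R -> R) : bsm a -> bsm b -> bsm (fun x => a x + b x).
Proof.
move=> [sa [K aK] [K' aK']] [sb [L bL] [L' bL']]; split.
- exact: smooth_add.
- by exists (K + L) => x; rewrite (le_trans (ler_normD _ _))// lerD.
- have d : derive1 (fun x => a x + b x) = fun x => derive1 a x + derive1 b x.
    by apply: is_derive_derive1 => x; apply: is_derive_addf; exact: smooth_is_derive.
  by exists (K' + L') => x; rewrite d (le_trans (ler_normD _ _))// lerD.
Qed.

Lemma bsm_mul (R : realType) (a b : R -> R) : bsm a -> bsm b -> bsm (fun x => a x * b x).
Proof.
move=> [sa [K aK] [K' aK']] [sb [L bL] [L' bL']]; split.
- exact: smooth_mul.
- by exists (K * L) => x; rewrite normrM ler_pM.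
- exists (K * L' + K' * L) => x; rewrite derive1_mul// (le_trans (ler_normD _ _))//.
  by rewrite lerD// normrM ler_pM.
Qed.

(** The sum counts the positive integers up to h, so it is the integer part of h. *)
Lemma floor_sum (R : realType) (N : nat) (h : R) : 0 <= h -> h <= N%:R ->
  `|h - \sum_(i < N) bR (i.+1%:R <= h)| <= 1.
Proof.
move=> h0.
have C1 n : n%:R <= h -> \sum_(i < n) bR (i.+1%:R <= h) = n%:R :> R.
  elim: n => [|n ih] nh; first by rewrite big_ord0.
  rewrite big_ord_recr /= nh ih ?natr1//.
  by apply: le_trans nh; rewrite ler_nat.
have C2 n : \sum_(i < n) bR (i.+1%:R <= h) <= h.
  elim: n => [|n ih]; first by rewrite big_ord0.
  rewrite big_ord_recr /=; case: (leP n.+1%:R h) => nh /=; last by rewrite addr0.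
  rewrite C1 ?natr1//; by apply: le_trans nh; rewrite ler_nat.
have C3 n : h <= n%:R -> h <= \sum_(i < n) bR (i.+1%:R <= h) + 1.
  elim: n => [|n ih] hn; first by rewrite big_ord0 add0r (le_trans hn).
  rewrite big_ord_recr /=; case: (leP n.+1%:R h) => nh /=.
    rewrite C1; last by apply: le_trans nh; rewrite ler_nat.
    by rewrite natr1 (le_trans hn)// lerDl.
  rewrite addr0; have [h2|h2] := leP h n%:R; first exact: ih.
  by rewrite C1 ?natr1// ltW.
move=> hN; rewrite ger0_norm ?subr_ge0//.
by rewrite lerBlDl addrC; rewrite addrC; exact: C3.
Qed.

(** * Transport with weights depending on the label *)

Section density.
Context {R : realType}.
Notation leb := (@lebesgue_measure R).
Variables (M : R) (Y : R -> R).
Hypothesis M0 : 0 <= M.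
Notation D := (`]0%R, M[%classic : set R).
Hypothesis mY : measurable_fun D Y.

(** Approximation in L^1 of the image of Lebesgue measure under [Y]. *)
Definition apx (g : R -> R) := forall e, 0 < e ->
  exists2 b, bsm b & \int[leb]_(w in D) `|g (Y w) - b (Y w)| <= e.

Let bY (g : R -> R) : bm setT g -> bm D (fun w => g (Y w)).
Proof. by move=> bg; exact: (bm_comp mY bg). Qed.

Let bYn (g h : R -> R) : bm setT g -> bm setT h -> bm D (fun w => `|g (Y w) - h (Y w)|).
Proof. by move=> bg bh; apply: bm_norm; apply: bmB; exact: bY. Qed.

Let tri (g h k : R -> R) : bm setT g -> bm setT h -> bm setT k ->
  \int[leb]_(w in D) `|g (Y w) - k (Y w)| <=
  \int[leb]_(w in D) `|g (Y w) - h (Y w)| + \int[leb]_(w in D) `|h (Y w) - k (Y w)|.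
Proof.
move=> bg bh bk; rewrite -(ointD (bYn bg bh) (bYn bh bk)).
apply: (oint_le (bYn bg bk) (bmD (bYn bg bh) (bYn bh bk))) => w _.
exact: ler_distD.
Qed.

Let apx_bsm b : bsm b -> apx b.
Proof.
move=> bb e e0; exists b => //; apply: le_trans (ltW e0).
by apply: Rint_le0 => w _; rewrite subrr normr0.
Qed.

Let apx_limit g : bm setT g -> (forall e, 0 < e ->
  exists h, [/\ bm setT h, apx h & \int[leb]_(w in D) `|g (Y w) - h (Y w)| <= e]) -> apx g.
Proof.
move=> bg H e e0; have e2 : 0 < e / 2 by rewrite divr_gt0.
have [h [bh ah gh]] := H _ e2; have [b bb hb] := ah _ e2.
exists b => //; apply: le_trans (tri bg bh (bsm_bm bb)) _.
by rewrite [e]splitr lerD.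
Qed.

Let apxD g h : bm setT g -> bm setT h -> apx g -> apx h -> apx (fun x => g x + h x).
Proof.
move=> bg bh ag ah e e0; have e2 : 0 < e / 2 by rewrite divr_gt0.
have [a ba ga] := ag _ e2; have [b bb hb] := ah _ e2.
exists (fun x => a x + b x); first exact: bsm_add.
have b1 := bYn bg (bsm_bm ba); have b2 := bYn bh (bsm_bm bb).
apply: le_trans (oint_le _ (bmD b1 b2) _) _.
- exact: bYn (bmD bg bh) (bmD (bsm_bm ba) (bsm_bm bb)).
- by move=> w _; rewrite opprD addrACA ler_normD.
- by rewrite (ointD b1 b2) [e]splitr lerD.
Qed.

Let apxZ c g : bm setT g -> apx g -> apx (fun x => c * g x).
Proof.
move=> bg ag e e0.
have k0 : 0 < `|c| + 1 by rewrite ltr_wpDl.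
have [b bb gb] := ag _ (divr_gt0 e0 k0).
exists (fun x => c * b x); first exact: bsm_mul (bsm_cst c) bb.
have b1 := bYn bg (bsm_bm bb).
apply: le_trans (oint_le _ (bmZ `|c| b1) _) _.
- exact: bYn (bmZ c bg) (bmZ c (bsm_bm bb)).
- by move=> w _; rewrite -mulrBr normrM.
- rewrite (ointZ _ b1) (le_trans (ler_wpM2l (normr_ge0 c) gb))//.
  by rewrite mulrCA ger_pMr// ler_pdivrMr// mul1r lerDl.
Qed.

Let apx_pointwise (g_ : nat -> R -> R) g K : bm setT g -> (forall n, bm setT (g_ n)) ->
  (forall n, apx (g_ n)) -> (forall n x, `|g x - g_ n x| <= K) ->
  (forall x, g_ n x @[n --> \oo] --> g x) -> apx g.
Proof.
move=> bg bg_ ag_ gK cg; apply: apx_limit => // e e0.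
have L : \int[leb]_(w in D) `|g (Y w) - g_ n (Y w)| @[n --> \oo] --> \int[leb]_(w in D) (0 : R).
  apply: (@oint_cvg _ _ _ (fun n w => `|g (Y w) - g_ n (Y w)|) (fun=> 0) K).
  - by move=> n; have [] := bYn bg (bg_ n).
  - by move=> n w _; rewrite normr_id; exact: gK.
  - move=> w _.
    have h : `|g (Y w) - g_ n (Y w)| @[n --> \oo] --> `|g (Y w) - g (Y w)|.
      by apply: cvg_norm; apply: cvgB; [exact: cvg_cst|exact: cg].
    by rewrite subrr normr0 in h.
rewrite [X in _ --> X]Rint_zero// in L.
have /cvgrPdist_le/(_ _ e0)[n _ hn] := L.
exists (g_ n); split => //; apply: le_trans (hn n (leqnn n)).
by rewrite /= sub0r normrN ler_norm.
Qed.

Let bm_indic (E : set R) : measurable E -> bm setT (\1_E : R -> R).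
Proof.
move=> mE; split; first exact: measurable_indic.
by exists 1 => x _; rewrite indicE; case: (x \in E); rewrite ?normr1 ?normr0.
Qed.

Let apx_half c : apx (\1_(`]-oo, c[%classic) : R -> R).
Proof.
have E x : \1_(`]-oo, c[%classic) x = (bR (x < c) : R).
  rewrite indicE; congr (GRing.natmul 1 (nat_of_bool _)).
  by apply/idP/idP; rewrite ?inE /= in_itv.
apply: (@apx_pointwise (fun n x => step n (x - c)) _ 2) => [|n|n|n x|x].
- exact: bm_indic.
- exact: (bm_shift c (bsm_bm (bsm_step n))).
- apply: apx_bsm; have [sa [K aK] [K' aK']] := @bsm_step R n; split.
  + exact: smooth_shift.
  + by exists K => x; exact: aK.
  + by exists K' => x; rewrite derive1_shift.
- rewrite E (le_trans (ler_normB _ _))// (_ : 2 = 1 + 1 :> R)// lerD ?step_norm//.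
  by case: (x < c); rewrite ?normr1 ?normr0.
- by rewrite E -subr_lt0; exact: step_cvg.
Qed.

(** The half-lines are stable under intersection and generate the Borel sets. The sets with
    approximable indicator contain them and are stable under complements and countable disjoint
    unions. *)
Let apx_set (E : set R) : measurable E -> apx (\1_E : R -> R).
Proof.
have eqf (f g : R -> R) : f =1 g -> apx f -> apx g by move=> /funext ->.
pose P (E : set R) := measurable E /\ apx (\1_E : R -> R).
suff H : forall S, <<s [set A | exists x, A = `]-oo, x[%classic] >> S -> P S.
  move=> mE; apply: (proj2 (H E _)).
  have mE' : (@RGenInftyO.G R).-sigma.-measurable E by rewrite -RGenInftyO.measurableE.
  exact: mE'.
apply: dynkin_induction.
- exact: RGenInftyO.measurableE.
- move=> _ _ [x ->] [y ->]; exists (Num.min x y); apply/seteqP; split => z /=; rewrite !in_itv/= lt_min.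
    by move=> [-> ->].
  by move=> /andP[].
- split; first exact: measurableT.
  apply: (eqf (fun=> 1)); last exact: apx_bsm (bsm_cst 1).
  by move=> x; rewrite indicE in_setT.
- by move=> _ [x ->]; split; [exact: measurable_itv|exact: apx_half].
- move=> S mS [_ aS]; split; first exact: measurableC.
  apply: (eqf (fun x => 1 + -1 * \1_S x)).
    move=> x; rewrite !indicE in_setC; case: (x \in S); rewrite /= ?mulr1 ?mulr0 ?addr0 ?subrr//.
  apply: apxD; [exact: bm_cst|exact: bmZ (bm_indic mS)|exact: apx_bsm (bsm_cst 1)|].
  exact: apxZ (bm_indic mS) aS.
- move=> E_ mE tE PE.
  have mU : measurable (\bigcup_k E_ k) by exact: bigcupT_measurable.
  split => //.
  pose U n := \bigcup_(k in [set k | (k < n)%N]) E_ k.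
  have mUn n : measurable (U n) by apply: bigcup_measurable => k _.
  have US n x : \1_(U n.+1) x = \1_(U n) x + \1_(E_ n) x :> R.
    rewrite !indicE; have [h1|h1] := boolP (x \in U n).
      have [k kn Ek] := set_mem h1.
      rewrite (mem_set (A := U n.+1)); last by exists k => //=; exact: ltnW.
      rewrite memNset ?addr0// => Enx.
      have := tE k n Logic.I Logic.I; move=> /(_ (ex_intro _ x (conj Ek Enx))) kn'.
      by move: kn; rewrite /= kn' ltnn.
    rewrite add0r; congr (GRing.natmul 1 (nat_of_bool _)); apply/idP/idP.
      move=> /set_mem[k /=]; rewrite ltnS leq_eqVlt => /predU1P[-> h|kn Ek]; first exact: mem_set.
      by move/negP: h1; case; apply: mem_set; exists k.
    by move=> /set_mem h; apply: mem_set; exists n => /=.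
  have aU n : apx (\1_(U n) : R -> R).
    elim: n => [|n ih].
      apply: (eqf (fun=> 0)); last exact: apx_bsm (bsm_cst 0).
      by move=> x; rewrite indicE memNset// => -[].
    apply: (eqf (fun x => \1_(U n) x + \1_(E_ n) x)); first by move=> x; rewrite US.
    by apply: apxD => //; [exact: bm_indic|exact: bm_indic|exact: (proj2 (PE n))].
  apply: (@apx_pointwise (fun n => \1_(U n)) _ 2) => [|n|n|n x|x].
  - exact: bm_indic.
  - exact: bm_indic.
  - exact: aU.
  - rewrite (le_trans (ler_normB _ _))// (_ : 2 = 1 + 1 :> R)// lerD//;
      by rewrite indicE; case: (x \in _); rewrite ?normr1 ?normr0.
  - apply: cvg_near_cst; rewrite indicE; have [h|h] := boolP (x \in _).
      have [k _ Ek] := set_mem h; exists k.+1 => // n /= kn.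
      by rewrite indicE mem_set//; exists k.
    near=> n; rewrite indicE memNset// => -[k _ Ek]; move/negP: h; apply; apply: mem_set.
    by exists k.
Unshelve. all: by end_near. Qed.

(** A bounded Borel function is uniformly close to a linear combination of indicators of superlevel
    sets, and these are covered by [apx_set]. *)
Lemma smooth_density (g : R -> R) : bm setT g -> apx g.
Proof.
move=> bg; have [mg [K0 gK0]] := bg.
have [K [Kpos gK]] : exists K, 0 < K /\ forall x, `|g x| <= K.
  by exists (`|K0| + 1); split=> [|x]; [exact: ltr_wpDl|rewrite (le_trans (gK0 x Logic.I))// ler_wpDr ?ler_norm].
have eqf (f h : R -> R) : f =1 h -> apx f -> apx h by move=> /funext ->.
apply: apx_limit => // e e0.
have [N [N0 hN]] : exists N : nat, (0 < N)%N /\ 2 * K / N%:R * M <= e.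
  pose q : R := 2 * K * M / e.
  exists (Num.truncn q).+1; split => //.
  have qN : q < (Num.truncn q).+1%:R by exact: truncnS_gt.
  have qe : 2 * K * M = q * e by rewrite divfK// gt_eqF.
  by rewrite mulrAC ler_pdivrMr// qe mulrC ler_wpM2l ?(ltW e0) ?(ltW qN).
have NR : 0 < N%:R :> R by rewrite ltr0n.
(* Maps the range [- K, K] of g to [0, N]. Replacing f by its integer part then changes g by at most
   2 K / N. *)
pose f x : R := (g x + K) * N%:R / (2 * K).
have K2 : 0 < 2 * K by rewrite mulr_gt0.
have f0 x : 0 <= f x.
  by rewrite /f mulr_ge0 ?invr_ge0 ?(ltW K2)// mulr_ge0// addrC -lerBlDl sub0r; have := gK x; rewrite ler_norml => /andP[].
have fN x : f x <= N%:R.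
  rewrite /f ler_pdivrMr// mulrC ler_wpM2l//.
  by have := gK x; rewrite ler_norml => /andP[_ h]; lra.
have mf : measurable_fun setT f.
  apply: measurable_funM; last exact: measurable_cst.
  apply: measurable_funM; last exact: measurable_cst.
  by apply: measurable_funD => //; exact: measurable_cst.
have mS i : measurable [set x | i.+1%:R <= f x].
  have : measurable_fun setT (fun x => i.+1%:R <= f x).
    by apply: measurable_fun_ler => //; exact: measurable_cst.
  by move=> /(_ measurableT [set true] Logic.I); rewrite setTI.
pose h n x : R := \sum_(i < n) \1_[set x | i.+1%:R <= f x] x.
have bh n : bm setT (h n).
  elim: n => [|n ih]; first by rewrite /h; under eq_fun do rewrite big_ord0; exact: bm_cst.
  by rewrite /h; under eq_fun do rewrite big_ord_recr; apply: bmD => //; exact: bm_indic.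
have ah n : apx (h n).
  elim: n => [|n ih].
    apply: (eqf (fun=> 0)); last exact: apx_bsm (bsm_cst 0).
    by move=> x; rewrite /h big_ord0.
  apply: (eqf (fun x => h n x + \1_[set x | n.+1%:R <= f x] x)); first by move=> x; rewrite /h big_ord_recr.
  by apply: apxD => //; [exact: bm_indic|exact: apx_set].
exists (fun x => (2 * K / N%:R) * h N x + - K).
have b1 : bm setT (fun x => 2 * K / N%:R * h N x) by exact: bmZ.
split.
- by apply: bmD => //; exact: bm_cst.
- by apply: apxD => //; [exact: bm_cst|exact: apxZ|exact: apx_bsm (bsm_cst _)].
have b2 : bm setT (fun x => 2 * K / N%:R * h N x + - K) by apply: bmD => //; exact: bm_cst.
have eM : 2 * K / N%:R * M = 2 * K / N%:R * fine (leb D) by rewrite (fine_leb_itvoo M0) subr0.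
rewrite eM in hN; apply: le_trans hN.
apply: le_trans (ler_norm _) _.
apply: (oint_bound (bYn bg b2)) => w _; rewrite normr_id.
set x := Y w.
have -> : g x - (2 * K / N%:R * h N x - K) = 2 * K / N%:R * (f x - h N x).
  by rewrite /f; field; rewrite gt_eqF//= gt_eqF.
rewrite normrM ger0_norm ?divr_ge0// ?(ltW K2)// ger_pMr ?divr_gt0//.
rewrite (_ : h N x = \sum_(i < N) bR (i.+1%:R <= f x)); first exact: floor_sum.
apply: eq_bigr => i _; rewrite indicE; congr (GRing.natmul 1 (nat_of_bool _)).
by apply/idP/idP; rewrite inE.
Qed.

End density.

Section primitives.
Context {R : realType}.
Notation leb := (@lebesgue_measure R).

Lemma smooth_primitive (th : R -> R) (A : R) : smooth th -> suppin th A ->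
  exists P, smooth P /\ derive1 P = th.
Proof.
move=> sth thA.
pose P (x : R) := \int[leb]_(t in [set` `]-oo, x]]) th t.
have [K K0 thK] := smooth_suppin_bounded sth thA.
have bth : bm setT th := bm_smooth_bounded sth thK.
have dP (x : R) : is_derive x 1 P (th x).
  have int u : leb.-integrable [set` Interval -oo%O (BRight u)] (EFin \o th).
    apply: (@integrableS _ _ _ leb setT) => //.
    have mI : measurable (`[- A, A]%classic : set R) := measurable_itv _.
    have := @bm_integrable _ (measurableTypeR R) R leb _ mI (leb_itv_fin (- A) A) _ (bm_sub measurableT (@subsetT _ _) bth).
    move=> h0; have := (@integrable_mkcond _ (measurableTypeR R) R leb `[- A, A] (EFin \o th) mI).1 h0; apply: eq_integrable => // z _.
    rewrite patchE /=; case: ifPn => // /negP h; rewrite thA//.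
    by rewrite ltNge ler_norml; apply/negP => h2; apply: h; rewrite inE /= in_itv.
  have xu : x < x + 1 by rewrite ltrDl.
  have [d e] := @continuous_FTC1 R th -oo%O x (x + 1) xu (int (x + 1)) ltac:(by rewrite ltNyr) (smooth_continuous sth (x := x)).
  by apply: DeriveDef => //; rewrite -e derive1E.
exists P; split; last exact: is_derive_derive1.
case=> [x|k]; first exact: is_derive_continuous (dP x).
by exists th; [exact: dP|exact: sth].
Qed.

Section chain.
Variables (f k : R -> R) (s t : R).
Hypothesis st : s <= t.
Hypothesis bk : bm `[s, t] k.
Hypothesis fk : forall x y, s <= x -> x <= y -> y <= t -> f y - f x = \int[leb]_(r in `[x, y]) k r.

(** Chain rule for f an integral of a bounded function: on [x, y] both the Taylor remainder of P and
    the variation of [derive1 P] along f contribute O((y - x)^2), so [quadratic_eq] applies. *)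
Lemma int_chain (P : R -> R) (L : R) : smooth P -> (forall x, `|derive1 (derive1 P) x| <= L) ->
  P (f t) - P (f s) = \int[leb]_(r in `[s, t]) (derive1 P (f r) * k r).
Proof.
move=> sP P2.
have sP' := smooth_derive1 sP.
have lip := smooth_lipschitz sP' P2.
have L0 : 0 <= L := le_trans (normr_ge0 _) (P2 0).
have [K K0 [kK fK]] := integrated_lipschitz st bk fk.
have bf := integrated_bm st bk fk.
have bPf : bm `[s, t] (fun r => derive1 P (f r)).
  split.
    apply: (measurable_comp (F := setT) (f := derive1 P)) => //; last by have [] := bf.
    exact: continuous_measurable_fun (smooth_continuous sP').
  have [_ [B fB]] := bf.
  have [B' B'0 hB'] := smooth_bounded_itv (- B) B sP'.
  by exists B' => r hr; apply: hB'; rewrite -ler_norml; exact: fB.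
have bg := bmM bPf bk.
have taylor0 a b c : a <= b -> (forall z, a <= z <= b -> `|z - c| <= b - a) ->
    `|P b - P a - derive1 P c * (b - a)| <= L * (b - a) ^+ 2.
  move=> ab hc; rewrite -int_derive1//.
  have b1 : bm `[a, b] (derive1 P) by exact: bm_smooth.
  have b2 : bm `[a, b] (fun=> derive1 P c) by exact: bm_cst.
  have -> : derive1 P c * (b - a) = \int[leb]_(z in `[a, b]) derive1 P c.
    by rewrite Rintegral_cst// (fine_leb_itv ab).
  have -> : L * (b - a) ^+ 2 = (L * (b - a)) * fine (leb `[a, b]).
    by rewrite (fine_leb_itv ab); ring.
  rewrite -(cintB b1 b2).
  apply: (cint_bound (bmB b1 b2)) => z; rewrite /= in_itv/= => hz.
  by apply: le_trans (lip _ _) _; rewrite ler_wpM2l// hc.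
have taylor u v : `|P v - P u - derive1 P u * (v - u)| <= L * (v - u) ^+ 2.
  have [uv|/ltW vu] := leP u v.
    by apply: taylor0 => // z /andP[uz zv]; rewrite ger0_norm ?subr_ge0// lerD2r.
  have -> : P v - P u - derive1 P u * (v - u) = - (P u - P v - derive1 P u * (u - v)) by ring.
  have -> : (v - u) ^+ 2 = (u - v) ^+ 2 by ring.
  rewrite normrN; apply: taylor0 => // z /andP[vz zu].
  by rewrite distrC ger0_norm ?subr_ge0// lerD2l lerN2.
pose h r := P (f r) - \int[leb]_(z in `[s, r]) (derive1 P (f z) * k z).
have hE : h t = h s.
  apply: (@quadratic_eq _ h s t (2 * (L * K * K))) => // x y sx xy yt.
  have bs := bm_sub_itv sx yt bk.
  have bgs : bm `[x, y] (fun z => derive1 P (f z) * k z) by exact: bm_sub_itv bg.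
  have bPs : bm `[x, y] (fun z => derive1 P (f z)) by exact: bm_sub_itv bPf.
  have b1 : bm `[x, y] (fun z => (derive1 P (f x) - derive1 P (f z)) * k z).
    by apply: bmM => //; apply: bmB => //; exact: bm_cst.
  have -> : h y - h x = (P (f y) - P (f x) - derive1 P (f x) * (f y - f x)) +
      \int[leb]_(z in `[x, y]) ((derive1 P (f x) - derive1 P (f z)) * k z).
    have sp : \int[leb]_(z in `[s, y]) (derive1 P (f z) * k z) =
        \int[leb]_(z in `[s, x]) (derive1 P (f z) * k z) +
        \int[leb]_(z in `[x, y]) (derive1 P (f z) * k z).
      by rewrite (@bm_itv_split _ _ s x y)//; exact: bm_sub_itv bg.
    have -> : \int[leb]_(z in `[x, y]) ((derive1 P (f x) - derive1 P (f z)) * k z) =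
        derive1 P (f x) * (f y - f x) - \int[leb]_(z in `[x, y]) (derive1 P (f z) * k z).
      rewrite fk// -(cintZ _ bs) -(cintB (bmZ _ bs) bgs).
      by apply: eq_Rintegral => z _; rewrite mulrBl.
    by rewrite /h sp; ring.
  have xyx := fK x y sx xy yt.
  have yx0 : 0 <= y - x by rewrite subr_ge0.
  rewrite (le_trans (ler_normD _ _))//.
  have -> : 2 * (L * K * K) * (y - x) ^+ 2 = L * (K * (y - x)) ^+ 2 + (L * (K * (y - x)) * K) * (y - x).
    by ring.
  apply: lerD.
    apply: le_trans (taylor _ _) _; rewrite ler_wpM2l// -[(f y - f x) ^+ 2]real_normK ?num_real//.
    by rewrite ler_sqr ?nnegrE ?mulr_ge0.
  rewrite -{2}(fine_leb_itv xy).
  apply: (cint_bound b1) => z; rewrite /= in_itv/= => /andP[xz zy].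
  rewrite normrM ler_pM//; last by apply: kK; rewrite (le_trans sx)// (le_trans zy).
  rewrite distrC (le_trans (lip _ _))// ler_wpM2l// distrC distrC.
  apply: le_trans (fK x z sx xz (le_trans zy yt)) _.
  by rewrite ler_wpM2l// lerD2r.
have -> : P (f s) = h s by rewrite /h set_itv1 Rintegral_set1 subr0.
by rewrite -hE /h opprB addrC subrK.
Qed.

End chain.
End primitives.

Section step_kernel.
Context {R : realType}.
Notation leb := (@lebesgue_measure R).
Implicit Types (n : nat) (c z x : R).

(** A nonnegative mollifier. The x-derivative of [step n (X w - x)] is [ker n (X w - x)]. *)
Definition ker n z : R := - derive1 (step n) z.

Lemma ker_ge0 n z : 0 <= ker n z.
Proof. by rewrite oppr_ge0 derive1_step_le0. Qed.

Lemma bm_ker n : bm setT (ker n).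
Proof. exact: bmN (bsm_bm_derive1 (bsm_step n)). Qed.

Lemma smooth_rev (f : R -> R) c : smooth f -> smooth (fun z => f (c - z)).
Proof.
by move=> sf; apply: (smooth_comp sf); apply: smooth_sub; [exact: smooth_cst|exact: smooth_id].
Qed.

Lemma derive1_rev (f : R -> R) c : smooth f ->
  derive1 (fun z => f (c - z)) = fun z => - derive1 f (c - z).
Proof.
move=> sf; apply: is_derive_derive1 => z.
have h : is_derive z 1 (fun z : R => c - z) (-1).
  by have := is_derive_addf (is_derive_cst c z 1) (is_derive_oppf (is_derive_id z 1)); rewrite add0r.
by have := @is_derive_compf _ f (fun z => c - z) _ _ _ (smooth_is_derive (c - z) sf) h; rewrite mulrN1.
Qed.

Lemma ker_int n c x y : x <= y ->
  \int[leb]_(z in `[x, y]) ker n (c - z) = step n (c - y) - step n (c - x).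
Proof.
move=> xy; have s := smooth_rev c (@smooth_step R n).
by rewrite -(int_derive1 xy s) (derive1_rev c (@smooth_step R n)).
Qed.

Lemma ker_int_le1 n c x y : x <= y -> 0 <= \int[leb]_(z in `[x, y]) ker n (c - z) <= 1.
Proof.
move=> xy; rewrite Rint_ge0 => [|z _]; last exact: ker_ge0.
rewrite ker_int// lerBlDr (le_trans (step_le1 _ _))// lerDl; exact: step_ge0.
Qed.

(** The derivative of [sstep] lives on [-1, 1], so (n + 1)(- z) - 1 must lie there. *)
Lemma ker_supp n z : ker n z != 0 -> `|z| <= 2 / n.+1%:R.
Proof.
rewrite /ker oppr_eq0 derive1_step mulf_eq0 negb_or => /andP[_ h].
have : `|n.+1%:R * (- z) - 1| <= 1.
  by rewrite leNgt; apply: contra h => /derive1_sstep0 ->.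
rewrite ler_norml => /andP[h1 h2].
have n0 : 0 < n.+1%:R :> R by [].
rewrite ler_pdivlMr// -[X in _ * X](ger0_norm (ltW n0)) -normrM ler_norml mulrC.
by move: h1 h2; rewrite mulrN; set q := n.+1%:R * z; move=> h1 h2; apply/andP; split; lra.
Qed.

Lemma bm_diff_box (X f : R -> R) (M A : R) : measurable_fun (`]0%R, M[%classic : set R) X ->
  bm setT f -> bm ((`[- A, A]%classic : set R) `*` (`]0%R, M[%classic : set R))
     (fun p : R * R => f (X p.2 - p.1)).
Proof.
move=> mX [mf [K fK]]; split; last by exists K => p _; exact: fK.
apply: (measurable_comp (F := setT) (f := f)) => //.
apply: measurable_funB; first exact: measurable_comp2.
by apply: measurable_funTS; exact: measurable_fst.
Qed.

Lemma bm_diff (X f : R -> R) (M x : R) : measurable_fun (`]0%R, M[%classic : set R) X ->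
  bm setT f -> bm (`]0%R, M[%classic : set R) (fun w => f (X w - x)).
Proof.
move=> mX bf; apply: (bm_comp mX (g := fun z => f (z - x))); exact: bm_shift.
Qed.

Lemma bm_diff_rev (f : R -> R) (c A : R) : bm setT f ->
  bm (`[- A, A]%classic : set R) (fun x => f (c - x)).
Proof.
move=> [mf [K fK]]; split; last by exists K => p _; exact: fK.
apply: (measurable_comp (F := setT) (f := f)) => //.
by apply: measurable_funB; [exact: measurable_cst|exact: measurable_id].
Qed.

Section static.
Variables (nu : finmeas R) (M : R).
Hypothesis mass : total_mass nu = M.
Notation D := (`]0%R, M[%classic : set R).
Notation X := (qf nu).
Variables (P : R -> R) (T L2 A0 A : R).
Hypotheses (sP : smooth P) (PT : forall x, `|derive1 P x| <= T)
  (P2 : forall x, `|derive1 (derive1 P) x| <= L2).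
Hypotheses (A0A : A0 < A) (Apos : 0 < A).
Notation I := (`[- A, A]%classic : set R).
Notation th := (derive1 P).

Let mD : measurable D := measurable_itv _.
Let fD : (leb D < +oo)%E := leb_itvoo_fin _ _.
Let mI : measurable I := measurable_itv _.
Let fI : (leb I < +oo)%E := leb_itv_fin _ _.
Let M0 : 0 <= M. Proof. by rewrite -mass mass_ge0. Qed.
Let mX : measurable_fun D X. Proof. by rewrite -mass; exact: (@measurable_qf R nu). Qed.
Let AA : - A <= A. Proof. by rewrite (@le_trans _ _ 0) ?oppr_le0// ltW. Qed.
Let sth : smooth th. Proof. exact: smooth_derive1. Qed.
Let bth : bm setT th. Proof. exact: bm_smooth_bounded sth PT. Qed.
Let T0 : 0 <= T. Proof. exact: le_trans (normr_ge0 _) (PT 0). Qed.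

(* A mollification of [cdfl nu x], which makes [P (cdfl nu x)] differentiable in
   [x] and in time. *)
Definition mol n x := \int[leb]_(w in D) step n (X w - x).

Let bstep n x : bm D (fun w => step n (X w - x)).
Proof. exact: bm_diff mX (bsm_bm (bsm_step n)). Qed.

Let bker n x : bm D (fun w => ker n (X w - x)).
Proof. exact: bm_diff mX (bm_ker n). Qed.

Lemma mol_range n x : 0 <= mol n x <= M.
Proof.
rewrite /mol Rint_ge0 => [|w _]; last exact: step_ge0.
have := oint_bound (bstep n x) (fun w _ => step_norm n (X w - x)).
by rewrite (fine_leb_itvoo M0) subr0 mul1r => /(le_trans (ler_norm _)).
Qed.

Let dens n x := \int[leb]_(w in D) ker n (X w - x).

Let bdens n : bm I (dens n).
Proof. exact: (leb_fubini1 mI mD fI fD (@bm_diff_box X (ker n) M A mX (bm_ker n))). Qed.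

Lemma mol_diff n x y : - A <= x -> x <= y -> y <= A ->
  mol n y - mol n x = \int[leb]_(z in `[x, y]) dens n z.
Proof.
move=> Ax xy yA; rewrite /mol -(ointB (bstep n y) (bstep n x)).
have bF : bm ((`[x, y]%classic : set R) `*` D) (fun p : R * R => ker n (X p.2 - p.1)).
  apply: (bm_sub _ _ (@bm_diff_box X (ker n) M A mX (bm_ker n))); first exact: measurableX.
  move=> [z w] /= []; rewrite !in_itv/= => /andP[xz zy] Dw; split => //.
  by rewrite (le_trans Ax)//= (le_trans zy).
rewrite (leb_fubini (measurable_itv `[x, y]) mD (leb_itv_fin _ _) fD bF).
apply: eq_Rintegral => w _; symmetry; exact: (ker_int n (X w) xy).
Qed.

Let bmol n : bm I (mol n).
Proof. exact: (integrated_bm AA (bdens n) (@mol_diff n)). Qed.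

Lemma bth_mol_itv n : bm I (fun x => th (mol n x)).
Proof.
split; last by exists T => x _; exact: PT.
apply: (measurable_comp (F := setT) (f := th)) => //; last by have [] := bmol n.
by have [] := bth.
Qed.

Let bw c (Y : R -> R) : bm D Y -> bm D (fun w => c * Y w).
Proof. exact: bmZ. Qed.

Section with_weight.
Variable b : R -> R.
Hypotheses (sb : smooth b) (bB : suppin b A0).

Let bbI : bm I b. Proof. exact: bm_smooth. Qed.

(** The chain rule for P (mol n x) tested against b: W = 1 gives the x-derivative, and W = V minus
    the time derivative. *)
Definition smear n (W : R -> R) :=
  \int[leb]_(x in I) (b x * th (mol n x) * \int[leb]_(w in D) (ker n (X w - x) * W w)).

Let bker_box n W : bm D W -> bm (I `*` D) (fun p : R * R => ker n (X p.2 - p.1) * W p.2).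
Proof. by move=> bW; apply: bmM; [exact: bm_diff_box mX (bm_ker n)|exact: bm_comp2]. Qed.

Let bin n W : bm D W -> bm I (fun x => \int[leb]_(w in D) (ker n (X w - x) * W w)).
Proof. by move=> bW; exact: (leb_fubini1 mI mD fI fD (bker_box n bW)). Qed.

Let bsm_in n W : bm D W -> bm I (fun x => b x * th (mol n x) * \int[leb]_(w in D) (ker n (X w - x) * W w)).
Proof. by move=> bW; exact: (bmM (bmM bbI (bth_mol_itv n)) (bin n bW)). Qed.

(** By Fubini, since the kernel has integral at most 1 in x. The bound is uniform in n and involves
    only the L^1 norm of W, so limits extend by density. *)
Lemma smear_bound n W B : bm D W -> (forall x, `|b x| <= B) ->
  `|smear n W| <= B * T * \int[leb]_(w in D) `|W w|.
Proof.
move=> bW bbB; have bWn := bm_norm bW.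
have B0 : 0 <= B := le_trans (normr_ge0 _) (bbB 0).
apply: le_trans (cint_norm (bsm_in n bW)) _.
have b1 := bin n bWn.
apply: (@le_trans _ _ (\int[leb]_(x in I) (B * T * \int[leb]_(w in D) (ker n (X w - x) * `|W w|)))).
  apply: (cint_le (bm_norm (bsm_in n bW)) (bmZ (B * T) b1)) => x _.
  rewrite normrM ler_pM//; first by rewrite normrM ler_pM.
  have b2 := bmM (bker n x) bW.
  apply: le_trans (oint_norm b2) _.
  apply: (oint_le (bm_norm b2) (bmM (bker n x) bWn)) => w _.
  by rewrite normrM (ger0_norm (ker_ge0 _ _)).
rewrite (cintZ _ b1) ler_wpM2l ?mulr_ge0//.
rewrite (leb_fubini mI mD fI fD (bker_box n bWn)) /=.
apply: (oint_le (leb_fubini2 mI mD fI fD (bker_box n bWn)) bWn) => w _.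
have b3 : bm I (fun x => ker n (X w - x)) by exact: bm_diff_rev (bm_ker n).
rewrite (_ : \int[leb]_(x in I) _ = `|W w| * \int[leb]_(x in I) ker n (X w - x)).
  by rewrite ler_piMr//; have /andP[] := ker_int_le1 n (X w) AA.
by rewrite -(cintZ _ b3); apply: eq_Rintegral => x _; rewrite mulrC.
Qed.

Lemma smearB n W W' : bm D W -> bm D W' ->
  smear n W - smear n W' = smear n (fun w => W w - W' w).
Proof.
move=> bW bW'; rewrite /smear -(cintB (bsm_in n bW) (bsm_in n bW')).
apply: eq_Rintegral => x _; rewrite -mulrBr; congr (_ * _).
rewrite -(ointB (bmM (bker n x) bW) (bmM (bker n x) bW')).
by apply: eq_Rintegral => w _; rewrite mulrBr.
Qed.

End with_weight.

(** P (m(x)) is P 0 plus the integral of th over the labels with X w < x. Integrating by parts in x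
    moves the derivative to b, and P 0 drops out because b vanishes at both ends. This encodes a
    weight in the label as a function of m. *)
Lemma static_identity b : smooth b -> suppin b A0 ->
  \int[leb]_(w in D) (b (X w) * th w) = - \int[leb]_(x in I) (derive1 b x * P (cdfl nu x)).
Proof.
move=> sb bA0.
have bA : suppin b A by move=> x h; apply: bA0; exact: lt_trans h.
have bA1 : b A = 0 by apply: bA0; rewrite gtr0_norm.
have bA2 : b (- A) = 0 by apply: bA0; rewrite normrN gtr0_norm.
have bthD : bm D th.
  by apply: bm_sub bth => //.
have prim v : 0 <= v <= M -> P v = P 0 + \int[leb]_(w in D) (bR (w < v) * th w).
  move=> /andP[v0 vM].
  rewrite (_ : \int[leb]_(w in D) _ = \int[leb]_(w in `[0, v]) th w).
    by rewrite int_derive1// addrC subrK.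
  rewrite [LHS]Rintegral_mkcond [RHS]Rintegral_mkcond.
  have pt (w : R) : w <> 0 -> w <> v ->
     ((fun w => bR (w < v) * th w) \_ D) w = (th \_ `[0, v]) w.
    move=> w0 wv; rewrite !patchE.
    have [h|h] := boolP (0 < w < v).
      case/andP: h => h1 h2; rewrite !mem_set/= ?in_itv/= ?h1 ?(ltW h1) ?(ltW h2) ?(lt_le_trans h2)//.
      by rewrite mul1r.
    rewrite [in RHS]memNset/=; last first.
      rewrite in_itv/= => /andP[h1 h2]; move/negP: h; apply.
      by rewrite !lt_neqAle h1 h2 !andbT; apply/andP; split; apply/eqP => // h3; exact: w0.
    case: ifPn => // /set_mem; rewrite /= in_itv/= => /andP[h1 _].
    by move: h; rewrite h1 /= => /negbTE ->; rewrite mul0r.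
  apply: ae_eq_Rintegral_nm; exists [set 0; v]; split.
  - by apply: measurableU; exact: measurable_set1.
  - by rewrite null_set_setU//; try exact: lebesgue_measure_set1; exact: measurable_set1.
  - by move=> w /=; apply: contra_notP => /not_orP[w0 wv] _; exact: pt.
have b' : bm I (derive1 b) by apply: bm_smooth; exact: smooth_derive1.
have blab x : bm D (fun w => bR (X w < x) * th w).
  by apply: bmM => //; apply: bm_bool; apply: measurable_fun_ltr => //; exact: measurable_cst.
have blabI : bm I (fun x => derive1 b x * \int[leb]_(w in D) (bR (X w < x) * th w)).
  apply: bmM => //; apply: (leb_fubini1 mI mD fI fD (F := fun p : R * R => bR (X p.2 < p.1) * th p.2)).
  apply: bmM; last exact: bm_comp2.
  apply: bm_bool; apply: measurable_fun_ltr; first exact: measurable_comp2.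
  by apply: measurable_funTS; exact: measurable_fst.
have e : \int[leb]_(x in I) (derive1 b x * P (cdfl nu x)) =
   \int[leb]_(x in I) (P 0 * derive1 b x + derive1 b x * \int[leb]_(w in D) (bR (X w < x) * th w)).
  apply: eq_Rintegral => x _; rewrite prim ?(cdfl_range mass)// (below_lab mass).
  by rewrite mulrDr mulrC.
rewrite e (cintD (bmZ (P 0) b') blabI) (cintZ _ b') int_derive1// bA1 bA2 subrr mulr0 add0r.
have bthn : bm (`]0, total_mass nu[%classic : set R) th by rewrite mass.
have := int_derive1_lab sb Apos bA bA1 bA2 bthn; rewrite mass => ->.
by rewrite opprK.
Qed.

Lemma mol_cvg x : mol n x @[n --> \oo] --> cdfl nu x.
Proof.
rewrite cdfl_int mass.
apply: (@oint_cvg _ _ _ (fun n w => step n (X w - x)) (fun w => bR (X w < x)) 1) => //.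
- by move=> n; have [] := bstep n x.
- by move=> n w _; exact: step_norm.
- by move=> w _; rewrite -subr_lt0; exact: step_cvg.
Qed.

(** For W = 1 the smeared quantity is an exact x-derivative. After an integration by parts, [mol n]
    can be replaced by its pointwise limit [cdfl nu]. *)
Lemma smear_one_cvg b : smooth b -> suppin b A0 ->
  smear b n (fun=> 1) @[n --> \oo] --> \int[leb]_(w in D) (b (X w) * th w).
Proof.
move=> sb bA0.
have [B B0 bB] := smooth_suppin_bounded sb bA0.
have bA : suppin b A by move=> x h; apply: bA0; exact: lt_trans h.
have bA1 : b A = 0 by apply: bA0; rewrite gtr0_norm.
have bA2 : b (- A) = 0 by apply: bA0; rewrite normrN gtr0_norm.
have E n : smear b n (fun=> 1) = - \int[leb]_(x in I) (derive1 b x * P (mol n x)).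
  have ch x y : - A <= x -> x <= y -> y <= A ->
      P (mol n y) - P (mol n x) = \int[leb]_(z in `[x, y]) (th (mol n z) * dens n z).
    move=> Ax xy yA; apply: (@int_chain _ (mol n) (dens n) x y xy _ _ P L2) => //.
      exact: bm_sub_itv (bdens n).
    move=> x' y' h1 h2 h3; apply: mol_diff => //; [exact: le_trans Ax h1|exact: le_trans h3 yA].
  have bk : bm I (fun z => th (mol n z) * dens n z) by exact: (bmM (bth_mol_itv n) (bdens n)).
  have := @int_product _ (fun x => P (mol n x)) (fun z => th (mol n z) * dens n z) (- A) A AA bk ch b sb.
  rewrite bA1 bA2 !mul0r subrr => /esym.
  have bP := integrated_bm AA bk ch.
  have b' : bm I (derive1 b) by apply: bm_smooth; exact: smooth_derive1.
  have bb : bm I b by exact: bm_smooth.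
  rewrite (cintD (bmM b' bP) (bmM bb bk)) => /eqP; rewrite addrC addr_eq0 => /eqP <-.
  apply: eq_Rintegral => x _; rewrite -mulrA; congr (_ * (_ * _)).
  by apply: eq_Rintegral => w _; rewrite mulr1.
rewrite (static_identity sb bA0).
under eq_fun do rewrite E.
apply: cvgN.
have [K _ hK] := smooth_bounded_itv 0 M sP.
have [K' _ hK'] := smooth_suppin_bounded (smooth_derive1 sb) (smooth_suppin_derive1 sb bA0).
apply: (@cint_cvg _ _ _ (fun n x => derive1 b x * P (mol n x)) _ (K' * K)).
- move=> n; have [mmol _] := bmol n.
  apply: measurable_funM.
    by apply: measurable_funTS; exact: continuous_measurable_fun (smooth_continuous (smooth_derive1 sb)).
  apply: (measurable_comp (F := setT) (f := P)) => //.
  exact: continuous_measurable_fun (smooth_continuous sP).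
- by move=> n x _; rewrite normrM ler_pM// hK// mol_range.
- move=> x _; apply: cvgM; first exact: cvg_cst.
  apply: cvg_comp; last exact: (smooth_continuous sP (x := cdfl nu x)).
  exact: mol_cvg.
Qed.

End static.
End step_kernel.

Lemma four_close (R : realType) (a b c d f e : R) : `|a - b| <= e / 4 -> `|b - c| <= e / 4 ->
  `|d - c| <= e / 4 -> `|f - d| <= e / 4 -> `|a - f| <= e.
Proof.
rewrite !ler_norml => /andP[h1 h2] /andP[h3 h4] /andP[h5 h6] /andP[h7 h8].
by apply/andP; split; lra.
Qed.

Section smear_limit.
Context {R : realType}.
Notation leb := (@lebesgue_measure R).
Variables (nu : finmeas R) (M : R).
Hypothesis mass : total_mass nu = M.
Notation D := (`]0%R, M[%classic : set R).
Notation X := (qf nu).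
Variables (P : R -> R) (T L2 A0 A : R).
Hypotheses (sP : smooth P) (PT : forall x, `|derive1 P x| <= T)
  (P2 : forall x, `|derive1 (derive1 P) x| <= L2).
Hypotheses (A0A : A0 < A) (Apos : 0 < A).
Notation I := (`[- A, A]%classic : set R).
Notation th := (derive1 P).
Variable b : R -> R.
Hypotheses (sb : smooth b) (bA0 : suppin b A0).

Let mD : measurable D := measurable_itv _.
Let fD : (leb D < +oo)%E := leb_itvoo_fin _ _.
Let mI : measurable I := measurable_itv _.
Let fI : (leb I < +oo)%E := leb_itv_fin _ _.
Let mX : measurable_fun D X. Proof. by rewrite -mass; exact: (@measurable_qf R nu). Qed.
Let AA : - A <= A. Proof. by rewrite (@le_trans _ _ 0) ?oppr_le0// ltW. Qed.
Let T0 : 0 <= T. Proof. exact: le_trans (normr_ge0 _) (PT 0). Qed.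
Let M0 : 0 <= M. Proof. by rewrite -mass mass_ge0. Qed.
Let bker n x : bm D (fun w => ker n (X w - x)).
Proof. exact: (bm_diff x mX (bm_ker n)). Qed.
Let bth_mol n : bm I (fun x => th (mol nu M n x)) := @bth_mol_itv R nu M mass P T A sP PT Apos n.

Lemma ker_total n : \int[leb]_(x in I) (\int[leb]_(w in D) ker n (X w - x)) <= M.
Proof.
rewrite -(mol_diff mass n (lexx _) AA (lexx _)) lerBlDr.
have /andP[_ h] := mol_range mass n A; have /andP[h' _] := mol_range mass n (- A).
by apply: (le_trans h); rewrite lerDl.
Qed.

Lemma smear_kernel_bound n (F : R * R -> R) B c : bm (I `*` D) F -> (forall x, `|b x| <= B) ->
  (forall x w, `|ker n (X w - x) * F (x, w)| <= c * ker n (X w - x)) -> 0 <= c ->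
  `|\int[leb]_(x in I) (b x * th (mol nu M n x) * \int[leb]_(w in D) (ker n (X w - x) * F (x, w)))|
    <= B * T * (c * M).
Proof.
move=> bF bB FC c0; have B0 : 0 <= B := le_trans (normr_ge0 _) (bB 0).
have bk := @bm_diff_box R X (ker n) M A mX (bm_ker n).
have bkF := leb_fubini1 mI mD fI fD (bmM bk bF).
have bk1 := leb_fubini1 mI mD fI fD bk.
have bb : bm I b by exact: bm_smooth.
have bG := bmM (bmM bb (bth_mol n)) bkF.
apply: le_trans (cint_norm bG) _.
apply: (@le_trans _ _ (\int[leb]_(x in I) (B * T * c * \int[leb]_(w in D) ker n (X w - x)))); last first.
  have -> : \int[leb]_(x in I) (B * T * c * \int[leb]_(w in D) ker n (X w - x)) =
      B * T * c * \int[leb]_(x in I) (\int[leb]_(w in D) ker n (X w - x)) by exact: (cintZ (B * T * c) bk1).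
  rewrite mulrA ler_wpM2l//; last exact: ker_total.
  by apply: mulr_ge0 => //; exact: mulr_ge0.
apply: (cint_le (bm_norm bG) (bmZ (B * T * c) bk1)) => x Ix.
rewrite normrM -(mulrA (B * T)) ler_pM//; first by rewrite normrM ler_pM.
have bx : bm D (fun w => ker n (X w - x) * F (x, w)).
  apply: bmM; first exact: bker.
  have [mF [K FK]] := bF; split; last by exists K => w Dw; apply: FK.
  apply: (measurable_comp (F := I `*` D)) => //; first exact: measurableX.
    by move=> _ [w Dw <-].
  exact: measurable_funTS.
apply: le_trans (oint_norm bx) _; rewrite -(ointZ c (bker n x)).
by apply: (oint_le (bm_norm bx) (bmZ c (bker n x))) => w _; exact: FC.
Qed.

(** The function g, later a velocity, is only Borel. It is first replaced by a smooth [be] close to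
    it in L^1. The kernel forces |X w - x| <= 2 / (n + 1), so be (X w) may be replaced by be x and
    absorbed into b, which leaves the case W = 1. *)
Lemma smear_cvg (g : R -> R) : bm setT g ->
  smear nu M P A b n (fun w => g (X w)) @[n --> \oo] -->
  \int[leb]_(w in D) (b (X w) * th w * g (X w)).
Proof.
move=> bg.
have [B B0 bB] := smooth_suppin_bounded sb bA0.
apply/cvgrPdist_le => e e0.
pose d := e / 4 / (B * T + 1).
have BT : 0 < B * T + 1 by rewrite ltr_wpDl// mulr_ge0.
have d0 : 0 < d by rewrite !divr_gt0.
have BTd : B * T * d <= e / 4.
  by rewrite /d mulrA ler_pdivrMr// mulrC ler_wpM2l ?lerDl// ltW// divr_gt0.
have [be bebsm hbe] := smooth_density M0 mX bg d0.
have [sbe [Kb beK] [K beL]] := bebsm.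
have K0 : 0 <= K := le_trans (normr_ge0 _) (beL 0).
have lipb := smooth_lipschitz sbe beL.
have bgX := bm_comp mX bg; have bbX := bm_comp mX (bsm_bm bebsm).
have sbb : smooth (fun x => b x * be x) by exact: smooth_mul.
have bbA0 : suppin (fun x => b x * be x) A0 by move=> x h; rewrite bA0 ?mul0r.
have e40 : 0 < e / 4 by rewrite divr_gt0.
have hmain := smear_one_cvg mass sP PT P2 A0A Apos sbb bbA0.
have hK := cvg_div_succ (B * T * (K * 2 * M)).
have s1 n : `|smear nu M P A b n (fun w => g (X w)) - smear nu M P A b n (fun w => be (X w))| <= e / 4.
  rewrite (smearB mass sP PT Apos sb n bgX bbX).
  apply: le_trans (smear_bound mass sP PT Apos sb n (bmB bgX bbX) bB) _.
  by apply: le_trans BTd; rewrite ler_wpM2l ?mulr_ge0.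
have bX1 : bm (I `*` D) (fun p : R * R => be (X p.2)) by exact: (@bm_comp2 R I D (fun w => be (X w)) mI mD bbX).
have bX2 : bm (I `*` D) (fun p : R * R => be p.1).
  by apply: bm_comp1 => //; exact: bm_smooth.
have s2 n : `|smear nu M P A b n (fun w => be (X w)) - smear nu M P A (fun x => b x * be x) n (fun=> 1)|
    <= B * T * (K * 2 * M) / n.+1%:R.
  have := @smear_kernel_bound n (fun p => be (X p.2) - be p.1) B (K * (2 / n.+1%:R)) (bmB bX1 bX2) bB.
  rewrite (_ : B * T * (K * (2 / n.+1%:R) * M) = B * T * (K * 2 * M) / n.+1%:R); last by ring.
  rewrite (_ : \int[leb]_(x in I) _ = smear nu M P A b n (fun w => be (X w)) - smear nu M P A (fun x => b x * be x) n (fun=> 1)).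
    apply; last by rewrite mulr_ge0.
    move=> x w; rewrite normrM (ger0_norm (ker_ge0 _ _)) mulrC.
    have [->|nz] := eqVneq (ker n (X w - x)) 0; first by rewrite !mulr0.
    rewrite ler_wpM2r ?ker_ge0//; apply: le_trans (lipb _ _) _.
    by rewrite ler_wpM2l//; exact: ker_supp nz.
  have bk := @bm_diff_box R X (ker n) M A mX (bm_ker n).
  have bth' := bth_mol n; have bb : bm I b by exact: bm_smooth.
  have bbb : bm I (fun x => b x * be x) by exact: bm_smooth.
  have bb1 := leb_fubini1 mI mD fI fD (bmM bk bX1).
  have bb2 := leb_fubini1 mI mD fI fD (bmM bk (bm_cst (I `*` D) 1)).
  have b1 := bmM (bmM bb bth') bb1; have b2 := bmM (bmM bbb bth') bb2.
  rewrite /smear -(cintB b1 b2); apply: eq_Rintegral => x _.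
  rewrite (_ : \int[leb]_(w in D) (ker n (X w - x) * (be (X w) - be x)) =
      \int[leb]_(w in D) (ker n (X w - x) * be (X w)) - be x * \int[leb]_(w in D) (ker n (X w - x) * 1)).
    by ring.
  have bk1 := bmM (bker n x) (bm_cst D 1).
  rewrite -(ointZ (be x) bk1) -(ointB (bmM (bker n x) bbX) (bmZ (be x) bk1)).
  by apply: eq_Rintegral => w _; ring.
have bth : bm D th by apply: bm_sub (bm_smooth_bounded (smooth_derive1 sP) PT).
have bbX0 : bm D (fun w => b (X w)) by exact: (bm_comp mX (bm_smooth_bounded sb bB)).
have s3 : `|\int[leb]_(w in D) (b (X w) * th w * g (X w)) -
    \int[leb]_(w in D) (b (X w) * be (X w) * th w)| <= e / 4.
  have bi1 := bmM (bmM bbX0 bth) bgX; have bi2 := bmM (bmM bbX0 bbX) bth.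
  rewrite -(ointB bi1 bi2).
  apply: le_trans (oint_norm (bmB bi1 bi2)) _.
  apply: le_trans BTd; apply: (@le_trans _ _ (\int[leb]_(w in D) (B * T * `|g (X w) - be (X w)|))).
    apply: (oint_le (bm_norm (bmB bi1 bi2)) (bmZ (B * T) (bm_norm (bmB bgX bbX)))) => w _.
    rewrite (_ : _ - _ = b (X w) * th w * (g (X w) - be (X w))); last by ring.
    by rewrite normrM ler_wpM2r// normrM ler_pM.
  by rewrite (ointZ _ (bm_norm (bmB bgX bbX))) ler_wpM2l ?mulr_ge0.
move/cvgrPdist_le/(_ _ e40) : hmain => hmain.
move/cvgrPdist_le/(_ _ e40) : hK => hK.
near=> n.
have h1 : `|B * T * (K * 2 * M) / n.+1%:R| <= e / 4.
  by rewrite -normrN -sub0r; near: n; exact: hK.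
have h2 : `|\int[leb]_(w in D) (b (X w) * be (X w) * th w) - smear nu M P A (fun x => b x * be x) n (fun=> 1)| <= e / 4.
  by near: n; exact: hmain.
have {}h1 := le_trans (s2 n) (le_trans (ler_norm _) h1).
exact: four_close s3 h2 h1 (s1 n).
Unshelve. all: by end_near. Qed.

End smear_limit.

Lemma eq_cvg_unique (R : realType) (f g : nat -> R) (a b : R) : (forall n, f n = g n) ->
  f n @[n --> \oo] --> a -> g n @[n --> \oo] --> b -> a = b.
Proof. by move=> /funext -> ha; exact: cvg_unique. Qed.

Section weighted_transport.
Context {R : realType}.
Notation leb := (@lebesgue_measure R).
Variables (tau M C : R) (rho : R -> finmeas R) (G : R * R -> R) (good : R -> Prop).
Hypothesis F : flow tau M C rho G good.
Hypothesis M0 : 0 <= M.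
Notation D := (`]0%R, M[%classic : set R).
Notation X := (lab rho).
Notation V := (vel rho G).

Let mD : measurable D := measurable_itv _.
Let fD : (leb D < +oo)%E := leb_itvoo_fin _ _.
Let VC r w : `|V r w| <= C. Proof. exact: (fl_GC F). Qed.

Variables (s t : R).
Hypotheses (s0 : 0 < s) (st : s < t).
Notation J := (`[s, t]%classic : set R).
Let mJ : measurable J := measurable_itv _.
Let fJ : (leb J < +oo)%E := leb_itv_fin _ _.
Let t0 : 0 < t := lt_trans s0 st.
Let Jpos r : J r -> 0 < r.
Proof. by rewrite /= in_itv/= => /andP[sr _]; exact: lt_le_trans sr. Qed.

Lemma label_int_measurable (B : set (R * R)) (H : (R * R) * R -> R) : measurable B ->
  bm (B `*` D) H -> measurable_fun B (fun p => \int[leb]_(w in D) H (p, w)).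
Proof.
move=> mB bH.
(* Only measurability in the parameter is wanted, so Fubini is applied with a Dirac mass as measure
   on the parameters. *)
have fB : ((\d_ ((0%R : measurableTypeR R), (0%R : measurableTypeR R)) : {measure set _ -> \bar R}) B < +oo)%E.
  by rewrite /= diracE ltry.
by have [] := @bm_fubini1 _ _ _ (measurableTypeR R) R (\d_ ((0%R : measurableTypeR R), (0%R : measurableTypeR R))) leb B D mB mD fB fD H bH.
Qed.

Variables (P : R -> R) (T L2 A0 A : R).
Hypotheses (sP : smooth P) (PT : forall x, `|derive1 P x| <= T)
  (P2 : forall x, `|derive1 (derive1 P) x| <= L2).
Hypotheses (A0A : A0 < A) (Apos : 0 < A).
Notation I := (`[- A, A]%classic : set R).
Notation th := (derive1 P).
Let mI : measurable I := measurable_itv _.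
Let fI : (leb I < +oo)%E := leb_itv_fin _ _.
Let AA : - A <= A. Proof. by rewrite (@le_trans _ _ 0) ?oppr_le0// ltW. Qed.
Let T0 : 0 <= T. Proof. exact: le_trans (normr_ge0 _) (PT 0). Qed.
Let IJD := (I `*` J) `*` D.
Let mIJ : measurable (I `*` J). Proof. exact: measurableX. Qed.

Let mfst2 : measurable_fun IJD (fun p : (R * R) * R => p.1.2).
Proof.
apply: measurable_funTS.
apply: (measurable_comp (F := setT) (f := snd) (g := fst)) => //.
Qed.

Let mfst1 : measurable_fun IJD (fun p : (R * R) * R => p.1.1).
Proof.
apply: measurable_funTS.
apply: (measurable_comp (F := setT) (f := fst) (g := fst)) => //.
Qed.

Let msnd : measurable_fun IJD (fun p : (R * R) * R => p.2).
Proof. by apply: measurable_funTS; exact: measurable_snd. Qed.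

Let box_diff (f : R -> R) : bm setT f ->
  bm IJD (fun p : (R * R) * R => f (X p.1.2 p.2 - p.1.1)).
Proof.
move=> [mf [K fK]]; split; last by exists K => p _; exact: fK.
apply: (measurable_comp (F := setT) (f := f)) => //.
apply: measurable_funB; last exact: mfst1.
apply: (@measurable_comp _ _ _ _ _ _ (D `*` (`]0%R, +oo[%classic : set R)) (fun p : R * R => X p.2 p.1)
  IJD (fun p : (R * R) * R => (p.2, p.1.2))).
- exact: measurableX.
- move=> _ [[[x r] w] /= [[_ Jr] Dw] <-]; split => //=.
  by rewrite in_itv/= andbT; exact: Jpos.
- exact: (fl_lab F).
- exact: measurable_fun_pair_on.
Qed.

Let box_vel : bm IJD (fun p : (R * R) * R => V p.1.2 p.2).
Proof.
split; last by exists C => p _; exact: VC.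
have [mV _] := fl_vel_box F t s0.
apply: (measurable_comp (F := D `*` J) (f := fun p : R * R => V p.2 p.1)
  (g := fun p : (R * R) * R => (p.2, p.1.2))).
- exact: measurableX.
- by move=> _ [[[x r] w] /= [[_ Jr] Dw] <-].
- exact: mV.
- exact: measurable_fun_pair_on.
Qed.

Let bvel r : J r -> bm D (V r).
Proof. by move=> Jr; exact: (fl_bm_vel F (Jpos Jr)). Qed.

Let mass r : J r -> total_mass (rho r) = M.
Proof. by move=> Jr; exact: (fl_mass F (Jpos Jr)). Qed.

Let Js : J s. Proof. by rewrite /= in_itv/= lexx ltW. Qed.
Let Jt : J t. Proof. by rewrite /= in_itv/= lexx ltW. Qed.

Let mol_box n : bm (I `*` J) (fun p : R * R => mol (rho p.2) M n p.1).
Proof.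
split; last first.
  exists M => -[x r] [_ Jr] /=; have /andP[h h'] := mol_range (mass Jr) n x.
  by rewrite ger0_norm.
exact: (label_int_measurable mIJ (box_diff (bsm_bm (bsm_step n)))).
Qed.

Let ker_box n : bm (I `*` J) (fun p : R * R => \int[leb]_(w in D) (ker n (X p.2 w - p.1) * V p.2 w)).
Proof.
have bH := bmM (box_diff (bm_ker n)) box_vel.
split; first exact: (label_int_measurable mIJ bH).
have [_ [K HK]] := bH; exists (K * fine (leb D)) => -[x r] [Ix Jr] /=.
have b1 : bm D (fun w => ker n (X r w - x) * V r w).
  apply: bmM (bvel Jr); exact: (fl_bm_lab F x (Jpos Jr) (bm_ker n)).
apply: (oint_bound b1) => w Dw.
exact: (HK ((x, r), w)).
Qed.

Let th_box n : bm (I `*` J) (fun p : R * R => th (mol (rho p.2) M n p.1)).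
Proof.
split; last by exists T => p _; exact: PT.
have [m1 _] := mol_box n.
apply: (measurable_comp (F := setT) (f := th)) => //.
exact: continuous_measurable_fun (smooth_continuous (smooth_derive1 sP)).
Qed.

Lemma mol_time n x : P (mol (rho t) M n x) - P (mol (rho s) M n x) =
  \int[leb]_(r in J) (- (th (mol (rho r) M n x) * \int[leb]_(w in D) (ker n (X r w - x) * V r w))).
Proof.
have bk : bm (D `*` J) (fun p : R * R => derive1 (step n) (X p.2 p.1 - x) * V p.2 p.1).
  apply: bmM; last exact: (fl_vel_box F).
  exact: (fl_lab_box F _ s0 (bsm_bm_derive1 (bsm_step n)) (@smooth_cst R x)).
have bk' := fl_box_int bk.
have fk u v : s <= u -> u <= v -> v <= t -> mol (rho v) M n x - mol (rho u) M n x =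
    \int[leb]_(r in `[u, v]) (\int[leb]_(w in D) (derive1 (step n) (X r w - x) * V r w)).
  move=> su; rewrite le_eqVlt => /orP[/eqP <- _|uv vt].
    by rewrite subrr set_itv1 Rintegral_set1.
  have := fl_transport F (bsm_step n) (@smooth_cst R x) (lt_le_trans s0 su) uv.
  move=> h; etransitivity; first exact: h.
  apply: eq_Rintegral => r _; apply: eq_Rintegral => w _; congr (_ * _).
  by rewrite derive1_cst subr0.
have := int_chain (ltW st) bk' fk sP P2.
move=> h; etransitivity; first exact: h.
apply: eq_Rintegral => r /set_mem Jr; rewrite -mulrN; congr (_ * _).
rewrite -ointN; first by apply: eq_Rintegral => w _; rewrite /ker mulNr opprK.
apply: bmM (bvel Jr); exact: (fl_bm_lab F x (Jpos Jr) (bm_ker n)).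
Qed.

Variable b : R -> R.
Hypotheses (sb : smooth b) (bA0 : suppin b A0).

Let bbI : bm (I `*` J) (fun p : R * R => b p.1).
Proof. by apply: bm_comp1 => //; exact: bm_smooth. Qed.

Let H n (p : R * R) := b p.1 * th (mol (rho p.2) M n p.1) *
  \int[leb]_(w in D) (ker n (X p.2 w - p.1) * V p.2 w).

Let bH n : bm (I `*` J) (H n).
Proof. exact: (bmM (bmM bbI (th_box n)) (ker_box n)). Qed.

Let bPmol r n : J r -> bm I (fun x => P (mol (rho r) M n x)).
Proof.
move=> Jr; have [K _ hK] := smooth_bounded_itv 0 M sP.
have [m1 _] := mol_box n.
split; last by exists K => x _; apply: hK; exact: mol_range (mass Jr) n x.
apply: (measurable_comp (F := setT) (f := P)) => //.
  exact: continuous_measurable_fun (smooth_continuous sP).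
apply: (measurable_comp (F := I `*` J) (f := fun p : R * R => mol (rho p.2) M n p.1)
  (g := fun x => (x, r))) => //.
  by move=> _ [x Ix <-].
exact: measurable_funTS.
Qed.

Lemma mol_space_time n :
  \int[leb]_(x in I) (b x * P (mol (rho t) M n x)) - \int[leb]_(x in I) (b x * P (mol (rho s) M n x))
  = - \int[leb]_(r in J) smear (rho r) M P A b n (V r).
Proof.
have bb : bm I b by exact: bm_smooth.
have h2 := leb_fubini2 mI mJ fI fJ (bH n).
have slice1 x : I x -> bm J (fun r => th (mol (rho r) M n x) * \int[leb]_(w in D) (ker n (X r w - x) * V r w)).
  move=> Ix; have [mK [K hK]] := bmM (th_box n) (ker_box n).
  split; last by exists K => r Jr; exact: (hK (x, r)).
  apply: (measurable_comp (F := I `*` J) (f := fun p : R * R => th (mol (rho p.2) M n p.1) *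
    \int[leb]_(w in D) (ker n (X p.2 w - p.1) * V p.2 w)) (g := fun r => (x, r))) => //.
    by move=> _ [r Jr <-].
  by apply: measurable_funTS; exact: pair1_measurable.
etransitivity.
  symmetry; exact: (cintB (bmM bb (bPmol n Jt)) (bmM bb (bPmol n Js))).
transitivity (\int[leb]_(x in I) (\int[leb]_(r in J) (- H n (x, r)))).
  apply: eq_Rintegral => x /set_mem Ix.
  rewrite -mulrBr mol_time -(cintZ (b x) (bmN (slice1 x Ix))).
  by apply: eq_Rintegral => r _; rewrite mulrN mulrA.
etransitivity; first exact: (@leb_fubini _ I J (fun p => - H n p) mI mJ fI fJ (bmN (bH n))).
etransitivity; last exact: (cintN h2).
apply: eq_Rintegral => r /set_mem Jr.
exact: (cintN (bm_slice1 mI mJ (bH n) Jr)).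
Qed.

Lemma smear_time_cvg :
  \int[leb]_(r in J) smear (rho r) M P A b n (V r) @[n --> \oo] -->
  \int[leb]_(r in J) (\int[leb]_(w in D) (b (X r w) * th w * V r w)).
Proof.
have [B B0 bB] := smooth_suppin_bounded sb bA0.
apply: (@cint_cvg _ _ _ (fun n r => smear (rho r) M P A b n (V r)) _ (B * T * (C * M))).
- by move=> n; have [] := leb_fubini2 mI mJ fI fJ (bH n).
- move=> n r Jr; apply: le_trans (smear_bound (mass Jr) sP PT Apos sb n (bvel Jr) bB) _.
  rewrite ler_wpM2l ?mulr_ge0//.
  have := oint_bound (bm_norm (bvel Jr)) (K := C).
  rewrite (fine_leb_itvoo M0) subr0 => h; apply: le_trans (ler_norm _) (h _) => w _.
  by rewrite normr_id.
- move=> r Jr; apply: (smear_cvg (mass Jr) sP PT P2 A0A Apos sb bA0 (g := fun x => G (x, r))).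
  split; last by exists C => x _; exact: (fl_GC F).
  apply: (measurable_comp (F := setT) (f := G) (g := fun x => (x, r))) => //; exact: (fl_G F).
Qed.

Let mol_P_cvg r : J r -> \int[leb]_(x in I) (b x * P (mol (rho r) M n x)) @[n --> \oo] -->
  \int[leb]_(x in I) (b x * P (cdfl (rho r) x)).
Proof.
move=> Jr; have [K _ hK] := smooth_bounded_itv 0 M sP.
have [B B0 bB] := smooth_suppin_bounded sb bA0.
apply: (@cint_cvg _ _ _ (fun n x => b x * P (mol (rho r) M n x)) _ (B * K)).
- by move=> n; have [] := bmM (bm_smooth (- A) A sb) (bPmol n Jr).
- by move=> n x _; rewrite normrM ler_pM// hK// (mol_range (mass Jr)).
- move=> x _; apply: cvgM; first exact: cvg_cst.
  apply: cvg_comp; last exact: (smooth_continuous sP (x := cdfl (rho r) x)).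
  exact: (mol_cvg (mass Jr)).
Qed.

Lemma cdfl_space_time :
  \int[leb]_(x in I) (b x * P (cdfl (rho t) x)) - \int[leb]_(x in I) (b x * P (cdfl (rho s) x))
  = - \int[leb]_(r in J) (\int[leb]_(w in D) (b (X r w) * th w * V r w)).
Proof.
have h1 := cvgB (mol_P_cvg Jt) (mol_P_cvg Js).
have h2 := cvgN smear_time_cvg.
apply: (eq_cvg_unique _ (h1 _) (h2 _)) => n; exact: mol_space_time.
Qed.

End weighted_transport.

Section weighted_transport_smooth.
Context {R : realType}.
Notation leb := (@lebesgue_measure R).
Variables (tau M C : R) (rho : R -> finmeas R) (G : R * R -> R) (good : R -> Prop).
Hypothesis F : flow tau M C rho G good.
Hypothesis M0 : 0 <= M.
Notation D := (`]0%R, M[%classic : set R).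
Notation X := (lab rho).
Notation V := (vel rho G).

(** With P a primitive of th, [static_identity] expresses both integrals on the left through P (m),
    and [cdfl_space_time] for the test function [derive1 a] gives the change in time. *)
Lemma transport_smooth_weight (s t : R) (a th : R -> R) (A Q : R) : 0 < s -> s < t ->
  smooth a -> suppin a A -> smooth th -> suppin th Q ->
  \int[leb]_(w in D) (a (X t w) * th w) - \int[leb]_(w in D) (a (X s w) * th w) =
  \int[leb]_(r in `[s, t]) (\int[leb]_(w in D) (derive1 a (X r w) * th w * V r w)).
Proof.
move=> s0 st sa aA sth thQ.
have [P [sP eP]] := smooth_primitive sth thQ.
have [T _ hT] := smooth_suppin_bounded sth thQ.
have [L2 _ hL] := smooth_suppin_bounded (smooth_derive1 sth) (smooth_suppin_derive1 sth thQ).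
rewrite -eP in hT hL *.
have AA : A < `|A| + 1 by rewrite (le_lt_trans (ler_norm A))// ltrDl.
have A1 : 0 < `|A| + 1 by rewrite ltr_wpDl.
have := cdfl_space_time F M0 s0 st sP hT hL AA A1 (smooth_derive1 sa) (smooth_suppin_derive1 sa aA).
have e r : 0 < r -> \int[leb]_(w in D) (a (X r w) * derive1 P w) =
    - \int[leb]_(x in `[- (`|A| + 1), `|A| + 1]) (derive1 a x * P (cdfl (rho r) x)).
  by move=> r0; exact: (static_identity (fl_mass F r0) sP hT AA A1 sa aA).
rewrite (e t) ?(e s)//; last exact: lt_trans st.
by move=> h; rewrite -opprD h opprK.
Qed.

End weighted_transport_smooth.

Section transport_weight.
Context {R : realType}.
Notation leb := (@lebesgue_measure R).
Variables (tau M C : R) (rho : R -> finmeas R) (G : R * R -> R) (good : R -> Prop).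
Hypothesis F : flow tau M C rho G good.
Hypothesis M0 : 0 <= M.
Notation D := (`]0%R, M[%classic : set R).
Notation X := (lab rho).
Notation V := (vel rho G).
Implicit Types (a th : R -> R) (r w : R).
Let mD : measurable D := measurable_itv _.
Let fD : (leb D < +oo)%E := leb_itvoo_fin _ _.
Variables (s t : R).
Hypotheses (s0 : 0 < s) (st : s < t).
Notation J := (`[s, t]%classic : set R).
Let mJ : measurable J := measurable_itv _.
Let fJ : (leb J < +oo)%E := leb_itv_fin _ _.
Let t0 : 0 < t := lt_trans s0 st.

Lemma fl_bm_comp r a : 0 < r -> bm setT a -> bm D (fun w => a (X r w)).
Proof.
move=> r0 ba; have := fl_bm_lab F 0 r0 ba; congr (bm _ _).
by apply/funext => w; rewrite subr0.
Qed.

Lemma fl_comp_vel_box a : bm setT a -> bm (D `*` J) (fun p : R * R => a (X p.2 p.1) * V p.2 p.1).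
Proof.
move=> ba; apply: bmM; last exact: (fl_vel_box F).
have := fl_lab_box F t s0 ba (@smooth_cst R 0); congr (bm _ _).
by apply/funext => p; rewrite subr0.
Qed.

(** The defect of X' = V for a single label, tested by a. It is shown orthogonal to successively
    larger classes of weights: first a and th compactly supported, then a in [bsm], then th in
    [bsm], finally th bounded and measurable. *)
Let psi a w := a (X t w) - a (X s w) - \int[leb]_(r in J) (derive1 a (X r w) * V r w).

Let bpsi a : bsm a -> bm D (psi a).
Proof.
move=> ba; have b1 := fl_comp_vel_box (bsm_bm_derive1 ba).
apply: bmB; first by apply: bmB; apply: fl_bm_comp => //; exact: bsm_bm.
exact: (leb_fubini1 mD mJ fD fJ b1).
Qed.

Let psi_int a th : bsm a -> bm D th -> \int[leb]_(w in D) (psi a w * th w) =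
  \int[leb]_(w in D) (a (X t w) * th w) - \int[leb]_(w in D) (a (X s w) * th w)
  - \int[leb]_(r in J) (\int[leb]_(w in D) (derive1 a (X r w) * th w * V r w)).
Proof.
move=> ba bth; have bxa r (r0 : 0 < r) := bmM (fl_bm_comp r0 (bsm_bm ba)) bth.
have bb := fl_comp_vel_box (bsm_bm_derive1 ba).
have bth2 : bm (D `*` J) (fun p : R * R => th p.1) by exact: bm_comp1.
have b3 := bmM bb bth2.
have b4 := leb_fubini1 mD mJ fD fJ b3.
have e : \int[leb]_(r in J) (\int[leb]_(w in D) (derive1 a (X r w) * th w * V r w)) =
    \int[leb]_(w in D) (\int[leb]_(r in J) (derive1 a (X r w) * V r w * th w)).
  etransitivity; last first.
    symmetry; exact: (leb_fubini mD mJ fD fJ b3).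
  by apply: eq_Rintegral => r _; apply: eq_Rintegral => w _; rewrite mulrAC.
rewrite e.
etransitivity; last first.
  apply: (f_equal2 (fun x y => x - y)); last reflexivity.
  exact: (ointB (bxa _ t0) (bxa _ s0)).
etransitivity; last exact: (ointB (bmB (bxa _ t0) (bxa _ s0)) b4).
apply: eq_Rintegral => w /set_mem Dw; rewrite /psi !mulrBl; congr (_ - _).
have b5 : bm J (fun r => derive1 a (X r w) * V r w).
  exact: (bm_slice2 mD mJ bb Dw).
rewrite mulrC -(cintZ (th w) b5).
by apply: eq_Rintegral => r _; rewrite mulrC.
Qed.

Let psi_test a th A Q : smooth a -> suppin a A -> smooth th -> suppin th Q ->
  \int[leb]_(w in D) (psi a w * th w) = 0.
Proof.
move=> sa aA sth thQ.
have [T _ hT] := smooth_suppin_bounded sth thQ.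
have ba : bsm a.
  split => //.
    by have [K _ hK] := smooth_suppin_bounded sa aA; exists K.
  by have [K _ hK] := smooth_suppin_bounded (smooth_derive1 sa) (smooth_suppin_derive1 sa aA); exists K.
rewrite psi_int//; last by apply: bm_sub (bm_smooth_bounded sth hT).
by rewrite (transport_smooth_weight F M0 s0 st sa aA sth thQ) subrr.
Qed.

Let psi_cvg a th Q : bsm a -> smooth th -> suppin th Q -> \int[leb]_(w in D) (psi a w * th w) = 0.
Proof.
move=> ba sth thQ; have [T T0 hT] := smooth_suppin_bounded sth thQ.
have [a_ [K [sa_ supa_ boundK acvg]]] := bsm_cutoff ba.
have ba_ n : bsm (a_ n).
  by split => //; exists K => x; have [] := boundK n x.
have K0 : 0 <= K by apply: le_trans (normr_ge0 _) (proj1 (boundK 0 0)).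
have C0 : 0 <= C by apply: le_trans (normr_ge0 _) (fl_GC F (0, 0)).
have bth : bm D th by apply: bm_sub (bm_smooth_bounded sth hT).
have pw n w : D w -> `|psi (a_ n) w| <= K + K + K * C * (t - s).
  move=> Dw; apply: le_trans (ler_normB _ _) _; apply: lerD.
    by apply: le_trans (ler_normB _ _) _; apply: lerD; have [] := boundK n (X t w); have [] := boundK n (X s w).
  have bb := fl_comp_vel_box (bsm_bm_derive1 (ba_ n)).
  have b5 : bm J (fun r => derive1 (a_ n) (X r w) * V r w) by exact: (bm_slice2 mD mJ bb Dw).
  have := cint_bound b5 (K := K * C); rewrite (fine_leb_itv (ltW st)); apply => r _.
  by rewrite normrM ler_pM//; [have [] := boundK n (X r w)|exact: (fl_GC F)].
apply: (@cvg_unique _ _ (\int[leb]_(w in D) (psi (a_ n) w * th w) @[n --> \oo])) => //; last first.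
  rewrite (_ : (fun n => _) = fun=> 0); first exact: cvg_cst.
  by apply/funext => n; have [A aA] := supa_ n; exact: psi_test (sa_ n) aA sth thQ.
apply: (@oint_cvg _ _ _ (fun n w => psi (a_ n) w * th w) _ ((K + K + K * C * (t - s)) * T)).
- by move=> n; have [] := bmM (bpsi (ba_ n)) bth.
- by move=> n w Dw; rewrite normrM ler_pM//; exact: pw.
- move=> w Dw; apply: cvgM; last exact: cvg_cst.
  apply: cvgB; first by apply: cvgB; have [] := acvg (X t w); have [] := acvg (X s w).
  apply: (@cint_cvg _ _ _ (fun n r => derive1 (a_ n) (X r w) * V r w) _ (K * C)).
  + move=> n; have bb := fl_comp_vel_box (bsm_bm_derive1 (ba_ n)).
    by have [] := bm_slice2 mD mJ bb Dw.
  + move=> n r _; rewrite normrM ler_pM//; [by have [] := boundK n (X r w)|exact: (fl_GC F)].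
  + by move=> r _; apply: cvgM; [have [] := acvg (X r w)|exact: cvg_cst].
Qed.

Let psi_bsm a th : bsm a -> bsm th -> \int[leb]_(w in D) (psi a w * th w) = 0.
Proof.
move=> ba [sth [T hT] _].
have [_ [K hK]] := bpsi ba.
apply: (@cvg_unique _ _ (\int[leb]_(w in D) (psi a w * (th w * chi n w)) @[n --> \oo])) => //; last first.
  rewrite (_ : (fun n => _) = fun=> 0); first exact: cvg_cst.
  apply/funext => n; apply: (psi_cvg ba (smooth_mul sth (@smooth_chi R n))).
  by move=> x /(@chi_suppin R n) ->; rewrite mulr0.
have bth : bm D th by apply: bm_sub (bm_smooth_bounded sth hT).
have T0 : 0 <= T by apply: le_trans (normr_ge0 _) (hT 0).
apply: (@oint_cvg _ _ _ (fun n w => psi a w * (th w * chi n w)) _ (K * (T * 1))).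
- move=> n; have bc : bm D (chi n) by apply: bm_sub (bm_chi n).
  by have [] := bmM (bpsi ba) (bmM bth bc).
- by move=> n w Dw; rewrite normrM ler_pM ?hK// normrM ler_pM// chi_norm.
- move=> w _; apply: cvgM; first exact: cvg_cst.
  rewrite -[X in _ --> X]mulr1; apply: cvgM; [exact: cvg_cst|exact: chi_cvg].
Qed.

(** [psi a] is bounded and orthogonal to every [bsm] weight, and these are dense in L^1, so it is
    orthogonal to th. *)
Lemma transport_weight a th : bsm a -> bm D th ->
  \int[leb]_(w in D) (a (X t w) * th w) - \int[leb]_(w in D) (a (X s w) * th w) =
  \int[leb]_(r in `[s, t]) (\int[leb]_(w in D) (derive1 a (X r w) * th w * V r w)).
Proof.
move=> ba bth; apply/eqP; rewrite -subr_eq0 -psi_int//; apply/eqP.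
have bp := bpsi ba; have [_ [K0 hK0]] := bp.
pose K := `|K0|; have hK w : D w -> `|psi a w| <= K.
  by move=> Dw; apply: le_trans (hK0 w Dw) (ler_norm _).
have bthT : bm setT (th \_ D).
  have [mth [T hT]] := bth; split; first by apply/(measurable_restrictT th mD).
  exists `|T| => x _; rewrite patchE; case: ifPn => [/set_mem Dx|_]; last by rewrite normr0.
  by apply: le_trans (hT x Dx) (ler_norm _).
have mid : measurable_fun D (fun w : R => w) by exact: measurable_id.
apply/eqP; rewrite -normr_le0; apply/ler_addgt0Pr => e e0; rewrite add0r.
have K00 : 0 <= K by exact: normr_ge0.
have K1 : 0 < K + 1 by rewrite ltr_wpDl.
have [b bb hb] := smooth_density M0 mid bthT (divr_gt0 e0 K1).
have bbD : bm D b by apply: bm_sub (bsm_bm bb).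
have e1 : \int[leb]_(w in D) (psi a w * th w) = \int[leb]_(w in D) (psi a w * ((th \_ D) w - b w)).
  have := ointB (bmM bp bth) (bmM bp bbD); rewrite (psi_bsm ba bb) subr0 => <-.
  by apply: eq_Rintegral => w Dw; rewrite patchE Dw -mulrBr.
have bd : bm D (fun w => (th \_ D) w - b w) by apply: bmB => //; apply: bm_sub bthT.
rewrite e1; apply: le_trans (oint_norm (bmM bp bd)) _.
apply: (@le_trans _ _ (\int[leb]_(w in D) (K * `|(th \_ D) w - b w|))).
  apply: (oint_le (bm_norm (bmM bp bd)) (bmZ K (bm_norm bd))) => w Dw.
  by rewrite normrM ler_wpM2r// hK.
rewrite (ointZ K (bm_norm bd)).
apply: (@le_trans _ _ (K * (e / (K + 1)))); first by rewrite ler_wpM2l.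
by rewrite mulrCA ler_piMr ?ltW// ltr_pdivrMr// mul1r ltrDl.
Qed.

End transport_weight.

(** * Vanishing of the deficit *)

Section layer_cake.
Context {R : realType}.
Notation leb := (@lebesgue_measure R).
Variables (M : R) (Y f : R -> R).
Notation D := (`]0%R, M[%classic : set R).
Hypotheses (mY : measurable_fun D Y) (bf : bm D f).
Hypothesis f_lt : forall x, 0 <= \int[leb]_(w in D) (bR (Y w < x) * f w).
Hypothesis f_all : \int[leb]_(w in D) f w = 0.

Let mD : measurable D := measurable_itv _.
Let fD : (leb D < +oo)%E := leb_itvoo_fin _ _.

Let f_le x : 0 <= \int[leb]_(w in D) (bR (Y w <= x) * f w).
Proof.
have [K fK] := bf.2.
have h : \int[leb]_(w in D) (bR (Y w < x + n.+1%:R^-1) * f w) @[n --> \oo] -->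
    \int[leb]_(w in D) (bR (Y w <= x) * f w).
  apply: (@oint_cvg _ _ _ (fun n w => bR (Y w < x + n.+1%:R^-1) * f w) _ K).
  - move=> n; apply: measurable_funM bf.1.
    have : bm D (fun w => bR (Y w < x + n.+1%:R^-1) : R).
      by apply: bm_bool; apply: measurable_fun_ltr => //; exact: measurable_cst.
    by case.
  - move=> n w Dw; rewrite normrM -[leRHS]mul1r ler_pM ?fK//.
    by case: (_ < _); rewrite ?normr1 ?normr0.
  - move=> w _; apply: cvgM; last exact: cvg_cst.
    have [le|lt] := leP (Y w) x.
      rewrite (_ : (fun n => _) = fun=> bR true); first exact: cvg_cst.
      by apply/funext => n; rewrite (le_lt_trans le)// ltrDl invr_gt0.
    have d0 : 0 < Y w - x by rewrite subr_gt0.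
    apply: (@cvg_near_cst _ _ _ _ \oo); near=> n.
    rewrite ltNge (_ : _ <= _ = true)//.
    rewrite -lerBrDl; apply/ltW; near: n; exact: (near_infty_natSinv_lt (PosNum d0)).
by apply: (cvgr_to_ge h); apply: nearW => n; exact: f_lt.
Unshelve. all: by end_near. Qed.

(** A down-set of the line is empty, everything, or an open or closed half-line. The total integral
    0 settles the second case. *)
Let f_down (S : R -> bool) : (forall x y, x <= y -> S y -> S x) ->
  0 <= \int[leb]_(w in D) (bR (S (Y w)) * f w).
Proof.
move=> dS.
have [[x0 Sx0]|none] := pselect (exists x, S x); last first.
  rewrite (_ : \int[leb]_(w in D) _ = 0)//; apply: Rint_zero => w _; rewrite (_ : S (Y w) = false) ?mul0r//.
  by apply/negP => h; apply: none; exists (Y w).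
have [[y0 nSy0]|all_] := pselect (exists x, ~~ S x); last first.
  rewrite (_ : \int[leb]_(w in D) _ = \int[leb]_(w in D) f w) ; first by rewrite f_all.
  apply: eq_Rintegral => w _; rewrite (_ : S (Y w) = true) ?mul1r//.
  by apply/negPn/negP => h; apply: all_; exists (Y w).
pose s := sup [set x | S x].
have hs : has_sup [set x | S x].
  split; first by exists x0.
  exists y0 => x /= Sx; rewrite leNgt; apply/negP => lt.
  by move/negP: nSy0; apply; exact: (dS _ x (ltW lt)).
have below x : x < s -> S x.
  by move=> xs; have [y /= Sy xy] := sup_gt hs.1 xs; exact: (dS _ y (ltW xy)).
have above x : S x -> x <= s by move=> Sx; apply: (ub_le_sup hs.2).
have [Ss|nSs] := boolP (S s).
  rewrite (_ : \int[leb]_(w in D) _ = \int[leb]_(w in D) (bR (Y w <= s) * f w)) ?f_le//.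
  apply: eq_Rintegral => w _; congr (bR _ * _); apply/idP/idP => [/above//|].
  by move=> h; exact: (dS _ s h).
rewrite (_ : \int[leb]_(w in D) _ = \int[leb]_(w in D) (bR (Y w < s) * f w)) ?f_lt//.
apply: eq_Rintegral => w _; congr (bR _ * _); apply/idP/idP => [h|/below//].
by rewrite lt_neqAle above// andbT; apply: contra nSs => /eqP <-.
Qed.

(** g + K is the integral over y of the indicators of its superlevel sets, which are down-sets
    because g is nonincreasing. Adding the constant K is harmless since f has integral 0. *)
Lemma layer_cake (g : R -> R) K : {homo g : x y / x <= y >-> y <= x} ->
  (forall x, `|g x| <= K) -> 0 <= \int[leb]_(w in D) (g (Y w) * f w).
Proof.
move=> dg gK.
have K0 : 0 <= K + K by rewrite addr_ge0//; exact: le_trans (normr_ge0 _) (gK 0).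
have mg : measurable_fun D (fun w => g (Y w)).
  by apply: (measurableT_comp (nonincreasing_measurable _ _) mY).
have bg : bm D (fun w => g (Y w)) by split => //; exists K => w _.
have gr w : 0 <= g (Y w) + K <= K + K.
  by have := gK (Y w); rewrite ler_norml => /andP[h1 h2]; rewrite -lerBlDr sub0r h1 lerD2r.
pose E := (`]0%R, (K + K)[%classic : set R).
have mE : measurable E := measurable_itv _.
have fE : (leb E < +oo)%E := leb_itvoo_fin _ _.
have bH : bm (D `*` E) (fun p : R * R => bR (p.2 < g (Y p.1) + K) * f p.1).
  apply: bmM; last by apply: bm_comp1.
  apply: bm_bool; apply: measurable_fun_ltr.
    by apply: measurable_funTS; exact: measurable_snd.
  have bgK := bmD bg (bm_cst D K).
  by have [] := @bm_comp1 R D E (fun w => g (Y w) + K) mD mE bgK.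
have e : \int[leb]_(w in D) ((g (Y w) + K) * f w) =
    \int[leb]_(y in E) (\int[leb]_(w in D) (bR (y < g (Y w) + K) * f w)).
  etransitivity; last exact: (leb_fubini mD mE fD fE bH).
  apply: eq_Rintegral => w _.
  have b1 := @bm_below R (K + K) (g (Y w) + K).
  rewrite -{1}(below_int (gr w)) mulrC -(ointZ (f w) b1).
  by apply: eq_Rintegral => y _; rewrite mulrC.
have e2 : \int[leb]_(w in D) ((g (Y w) + K) * f w) = \int[leb]_(w in D) (g (Y w) * f w).
  have := ointD (bmM bg bf) (bmZ K bf); rewrite (ointZ K bf) f_all mulr0 addr0 => <-.
  by apply: eq_Rintegral => w _; rewrite mulrDl.
rewrite -e2 e; apply: Rint_ge0 => y _.
apply: (f_down (S := fun x => y < g x + K)) => x x' xx' /lt_le_trans; apply.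
by rewrite lerD2r dg.
Qed.

End layer_cake.

Section logistic.
Context {R : realType}.
Notation leb := (@lebesgue_measure R).

Definition logistic (x : R) : R := (1 + expR (- x))^-1.

Let den_gt0 (x : R) : 0 < 1 + expR (- x).
Proof. by rewrite addr_gt0// expR_gt0. Qed.

Let smooth_den : smooth (fun x : R => 1 + expR (- x)).
Proof.
apply: smooth_add; first exact: smooth_cst.
by apply: (smooth_comp (@smooth_expR R)); apply: smooth_opp; exact: smooth_id.
Qed.

Lemma smooth_logistic : smooth logistic.
Proof. by apply: smooth_inv smooth_den => x; rewrite gt_eqF. Qed.

Lemma logistic_gt0 x : 0 < logistic x.
Proof. by rewrite invr_gt0. Qed.

Lemma logistic_lt1 x : logistic x < 1.
Proof. by rewrite invf_lt1// ltrDl expR_gt0. Qed.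

Lemma logistic_norm x : `|logistic x| <= 1.
Proof. by rewrite ger0_norm ltW// ?logistic_lt1// logistic_gt0. Qed.

(* Differentiating [logistic * (1 + exp (- x)) = 1]. *)
Lemma derive1_logistic : derive1 logistic = fun x => logistic x * (1 - logistic x).
Proof.
apply/funext => x.
have e : (fun x => logistic x * (1 + expR (- x))) = fun=> 1.
  by apply/funext => y; rewrite /logistic mulVf// gt_eqF.
have := derive1_mul smooth_logistic smooth_den; rewrite e => /(congr1 (fun f => f x)); rewrite (@derive1_cst _ _ (1 : R)).
have -> : derive1 (fun x : R => 1 + expR (- x)) x = - expR (- x).
  rewrite derive1E; apply: derive_val.
  have h : is_derive x 1 (fun z : R => - z) (-1) by exact: is_derive_oppf (is_derive_id x 1).
  have h2 := @is_derive_compf _ expR (fun z => - z) _ _ _ (is_derive_expR (- x)) h.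
  have := is_derive_addf (is_derive_cst (1 : R) x 1) h2.
  by rewrite add0r mulrN1.
rewrite /= => h.
have d0 := den_gt0 x.
have lE : logistic x * (1 + expR (- x)) = 1 by rewrite /logistic mulVf// gt_eqF.
have : derive1 logistic x * (1 + expR (- x)) = logistic x * expR (- x).
  by move/esym/eqP: h; rewrite mulrN addrC subr_eq0 => /eqP.
move/(congr1 (fun z => logistic x * z)); rewrite mulrCA lE mulr1 => ->.
by congr (_ * _); move: lE; rewrite mulrDr mulr1 => <-; rewrite addrC addKr.
Qed.

Lemma derive1_logistic_gt0 x : 0 < derive1 logistic x.
Proof. by rewrite derive1_logistic mulr_gt0 ?logistic_gt0// subr_gt0 logistic_lt1. Qed.

Lemma derive1_logistic_le1 x : derive1 logistic x <= 1.
Proof.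
rewrite derive1_logistic -[leRHS]mulr1 ler_pM ?subr_ge0 ?ltW ?logistic_lt1 ?logistic_gt0//.
by rewrite gtrBl logistic_gt0.
Qed.

Lemma derive2_logistic x : derive1 (derive1 logistic) x = derive1 logistic x * (1 - 2 * logistic x).
Proof.
rewrite {1}derive1_logistic (derive1_mul smooth_logistic); last first.
  by apply: smooth_sub smooth_logistic; exact: smooth_cst.
have -> : derive1 (fun x => 1 - logistic x) x = - derive1 logistic x.
  rewrite derive1E; apply: derive_val.
  have := is_derive_addf (is_derive_cst (1 : R) x 1) (is_derive_oppf (smooth_is_derive x smooth_logistic)).
  by rewrite add0r.
by ring.
Qed.

Lemma derive2_logistic_le x : `|derive1 (derive1 logistic) x| <= derive1 logistic x.
Proof.
rewrite derive2_logistic normrM (ger0_norm (ltW (derive1_logistic_gt0 x))).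
rewrite ler_piMr//; first by rewrite ltW// derive1_logistic_gt0.
rewrite ler_norml.
have := logistic_gt0 x; have := logistic_lt1 x; set l := logistic x => h1 h2.
by apply/andP; split; lra.
Qed.

Lemma bsm_logistic : bsm logistic.
Proof.
split; [exact: smooth_logistic|by exists 1; exact: logistic_norm|].
by exists 1 => x; rewrite ger0_norm ?derive1_logistic_le1// ltW// derive1_logistic_gt0.
Qed.

Lemma bsm_derive1_logistic : bsm (derive1 logistic).
Proof.
have [_ _ hb] := bsm_logistic.
split; [exact: smooth_derive1 smooth_logistic|exact: hb|].
by exists 1 => x; apply: le_trans (derive2_logistic_le x) (derive1_logistic_le1 x).
Qed.

Lemma logistic_chord (x y : R) : x <= y ->
  `|derive1 logistic y - derive1 logistic x| <= logistic y - logistic x.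
Proof.
move=> xy; have s1 := smooth_logistic; have s2 := smooth_derive1 s1.
rewrite -(int_derive1 xy s2) -(int_derive1 xy s1).
have b2 := bm_smooth x y (smooth_derive1 s2); have b1 := bm_smooth x y s2.
apply: le_trans (cint_norm b2) _.
by apply: (cint_le (bm_norm b2) b1) => z _; exact: derive2_logistic_le.
Qed.

(** A finite-difference form of the derivative, with a quadratic error that [quadratic_le]
    tolerates; it will multiply increments of a velocity that need not be continuous. *)
Lemma logistic_increment (x y : R) : x <= y ->
  derive1 logistic y * (y - x) <= logistic y - logistic x + (y - x) ^+ 2.
Proof.
move=> xy; have s1 := smooth_logistic; have b1 := bm_smooth x y (smooth_derive1 s1).
have bc := bm_cst (`[x, y]%classic : set R) (derive1 logistic y).
have bs : bm `[x, y] (fun z => derive1 logistic z + (y - x)) by apply: bmD => //; exact: bm_cst.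
have h : \int[leb]_(z in `[x, y]) derive1 logistic y <= \int[leb]_(z in `[x, y]) (derive1 logistic z + (y - x)).
  apply: (cint_le bc bs) => z; rewrite /= in_itv/= => /andP[xz zy].
  have h2 w : `|derive1 (derive1 logistic) w| <= 1.
    by apply: le_trans (derive2_logistic_le w) (derive1_logistic_le1 w).
  have := smooth_lipschitz (smooth_derive1 s1) h2 z y; rewrite mul1r => /(le_trans (ler_norm _)).
  rewrite ger0_norm ?subr_ge0// lerBlDl => /le_trans; apply; rewrite lerD2l lerD2l lerN2//.
have cc c : \int[leb]_(_ in `[x, y]) c = c * (y - x) by rewrite Rintegral_cst// (fine_leb_itv xy).
move: h; rewrite (cintD b1 (bm_cst _ (y - x))) !cc int_derive1// expr2; exact.
Qed.

End logistic.

Section weighted_deficit.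
Context {R : realType}.
Notation leb := (@lebesgue_measure R).
Variables (tau M C : R) (rho : R -> finmeas R) (G : R * R -> R) (good : R -> Prop).
Hypothesis F : flow tau M C rho G good.
Hypothesis tau0 : 0 < tau.
Variables (rho0 : finmeas R) (g0 : R -> R).
Hypothesis I : flow_init M C rho G good rho0 g0.
Notation D := (`]0%R, M[%classic : set R).
Notation X := (lab rho).
Notation V := (vel rho G).
Notation X0 := (qf rho0).
Notation V0 := (fun w => g0 (qf rho0 w)).
Notation ef := (gro tau).
Notation df := (deficit tau M rho0 g0 rho G).
Variable a : R -> R.
Hypotheses (ba : bsm a).
Implicit Types (r w s t : R) (f c om th : R -> R).

Let mD : measurable D := measurable_itv _.
Let fD : (leb D < +oo)%E := leb_itvoo_fin _ _.
Let M0 : 0 <= M := fl_M0 I.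
Let b0 : bm D V0 := bm_vel0 I.

Let bq : bm D (fun w => M / 2 - w).
Proof. by apply: bmB; [exact: bm_cst|exact: bm_label]. Qed.

(** The J of the overview for a general a; [wdef_rate] is its J'. *)
Definition wdef t := - \int[leb]_(w in D) (a (X t w) * df t w).
Definition wdef_rate r := - \int[leb]_(w in D) (derive1 a (X r w) * V r w * df r w).

Let ba' : bm setT (derive1 a). Proof. exact: bsm_bm_derive1. Qed.
Let bX f r : 0 < r -> bm setT f -> bm D (fun w => f (X r w)).
Proof. exact: (fl_bm_comp F). Qed.
Let bV r : 0 < r -> bm D (V r). Proof. exact: (fl_bm_vel F). Qed.

Let f1 th r := \int[leb]_(w in D) (a (X r w) * th w).
Let k1 th r := \int[leb]_(w in D) (derive1 a (X r w) * th w * V r w).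

Let wdefE t : 0 < t -> wdef t = ef t * f1 (V t) t - f1 V0 t - tau * (ef t - 1) * f1 (fun w => M / 2 - w) t.
Proof.
move=> t0; rewrite /wdef (deficit_split F I t0 (bX t0 (bsm_bm ba))) /f1.
by rewrite opprB opprD addrA.
Qed.

Let rateE r : 0 < r -> wdef_rate r = ef r * k1 (V r) r - k1 V0 r - tau * (ef r - 1) * k1 (fun w => M / 2 - w) r.
Proof.
move=> r0; rewrite /wdef_rate (deficit_split F I r0 (bmM (bX r0 ba') (bV r0))) /k1.
rewrite opprB opprD addrA; congr (_ - _ - _).
  by apply: eq_Rintegral => w _; rewrite mulrAC.
by congr (_ * _); apply: eq_Rintegral => w _; rewrite mulrAC.
Qed.

Variables (s t : R).
Hypotheses (gs : good s) (gt : good t) (st : s < t).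
Let s0 : 0 < s := fl_pos F gs.
Let t0 : 0 < t := fl_pos F gt.

Let bk1 th : bm D th -> bm `[s, t] (k1 th).
Proof.
move=> bth; have bb := fl_comp_vel_box F t s0 ba'.
have bth2 : bm (D `*` `[s, t]) (fun p : R * R => th p.1) by exact: bm_comp1.
have := fl_box_int (bmM bb bth2); congr (bm _ _); apply/funext => r.
by apply: eq_Rintegral => w _; rewrite mulrAC.
Qed.

Let f1_diff th x y : bm D th -> s <= x -> x <= y -> y <= t ->
  f1 th y - f1 th x = \int[leb]_(r in `[x, y]) k1 th r.
Proof.
move=> bth sx; rewrite le_eqVlt => /orP[/eqP <- _|xy yt].
  by rewrite subrr set_itv1 Rintegral_set1.
exact: (transport_weight F M0 (lt_le_trans s0 sx) xy ba bth).
Qed.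

Let f1_product th c : bm D th -> smooth c ->
  c t * f1 th t - c s * f1 th s = \int[leb]_(r in `[s, t]) (derive1 c r * f1 th r + c r * k1 th r).
Proof.
move=> bth sc; apply: (int_product (ltW st) (bk1 bth) _ sc).
by move=> x y; exact: f1_diff.
Qed.

Let bf1 th : bm D th -> bm `[s, t] (f1 th).
Proof. by move=> bth; apply: (integrated_bm (ltW st) (bk1 bth)) => x y; exact: f1_diff. Qed.

Let momentum_rate c r := \int[leb]_(w in D)
  (derive1 c r * (a (X r w) * V r w) + c r * (derive1 a (X r w) * V r w * V r w
     - a (X r w) * (w - M / 2 + V r w / tau))).

Let momentum_product c : smooth c ->
  c t * f1 (V t) t - c s * f1 (V s) s = \int[leb]_(r in `[s, t]) momentum_rate c r.
Proof.
move=> sc; have := fl_momentum F ba (@smooth_cst R 0) sc gs gt st.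
have e r : \int[leb]_(w in D) (a (X r w - 0) * V r w) = f1 (V r) r.
  by apply: eq_Rintegral => w _; rewrite subr0.
rewrite !e => ->; apply: eq_Rintegral => r _; apply: eq_Rintegral => w _.
by rewrite subr0 (@derive1_cst _ _ (0 : R)) subr0.
Qed.

Let momentum_rateE c r : 0 < r -> momentum_rate c r =
  derive1 c r * f1 (V r) r + c r * (k1 (V r) r + f1 (fun w => M / 2 - w) r - f1 (V r) r / tau).
Proof.
move=> r0; have bav := bmM (bX r0 (bsm_bm ba)) (bV r0).
have bavv := bmM (bmM (bX r0 ba') (bV r0)) (bV r0).
have baq := bmM (bX r0 (bsm_bm ba)) bq.
rewrite /f1 /k1 /momentum_rate [_ / tau]mulrC.
rewrite -(ointZ (derive1 c r) bav) -(ointD bavv baq) -(ointZ tau^-1 bav).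
rewrite -(ointB (bmD bavv baq) (bmZ tau^-1 bav)).
rewrite -(ointZ (c r) (bmB (bmD bavv baq) (bmZ tau^-1 bav))).
rewrite -(ointD (bmZ (derive1 c r) bav) (bmZ (c r) (bmB (bmD bavv baq) (bmZ tau^-1 bav)))).
by apply: eq_Rintegral => w _; congr (_ + _ * _); ring.
Qed.

Let bmomentum_rate c : smooth c -> bm `[s, t] (momentum_rate c).
Proof.
move=> sc; have bb := fl_comp_vel_box F t s0 ba'.
have bv := fl_vel_box F t s0.
have bcc := fl_time_box M s t sc; have bcc' := fl_time_box M s t (smooth_derive1 sc).
have bl := fl_label_box M s t.
have ba2 : bm (D `*` `[s, t]) (fun p : R * R => a (X p.2 p.1)).
  have := fl_lab_box F t s0 (bsm_bm ba) (@smooth_cst R 0); congr (bm _ _).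
  by apply/funext => p; rewrite subr0.
have bcst (z : R) : bm (D `*` `[s, t]) (fun p : R * R => z) by exact: bm_cst.
apply: (fl_box_int (H := fun p => derive1 c p.2 * (a (X p.2 p.1) * V p.2 p.1) + c p.2 * (derive1 a (X p.2 p.1) * V p.2 p.1 * V p.2 p.1
     - a (X p.2 p.1) * (p.1 - M / 2 + V p.2 p.1 / tau)))).
exact: (bmD (bmM bcc' (bmM ba2 bv)) (bmM bcc (bmB (bmM bb bv) (bmM ba2 (bmD (bmB bl (bcst _)) (bmM bv (bcst _))))))).
Qed.

(** The part of the deficit given by V0 and M / 2 - w has label weights, so [transport_weight]
    applies; the part with [ef] V uses the momentum equation. In the sum the forcing terms [ef] (M /
    2 - w) cancel, so no time derivative of the deficit survives. The multiplier om is 1 when J =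
    o(t) is proved and the Gronwall factor afterwards. *)
Lemma wdef_product om : smooth om -> exists2 k,
  bm `[s, t] k /\ (forall r, s <= r <= t -> k r = derive1 om r * wdef r + om r * wdef_rate r) &
  om t * wdef t - om s * wdef s = \int[leb]_(r in `[s, t]) k r.
Proof.
move=> som.
have se := smooth_gro tau.
pose c1 r := om r * ef r; pose c2 r := om r * (tau * (ef r - 1)).
have sc1 : smooth c1 by exact: smooth_mul.
have se2 : smooth (fun r => tau * (ef r - 1)).
  by apply: smooth_mul; [exact: smooth_cst|apply: smooth_sub se _; exact: smooth_cst].
have sc2 : smooth c2 by exact: smooth_mul.
have dc1 r : derive1 c1 r = om r * (ef r / tau) + derive1 om r * ef r.
  by rewrite /c1 (derive1_mul som se) derive1_gro.
have dc2 r : derive1 c2 r = om r * ef r + derive1 om r * (tau * (ef r - 1)).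
  rewrite /c2 (derive1_mul som se2); congr (_ * _ + _).
  have := derive1_mul (@smooth_cst R tau) (smooth_sub se (@smooth_cst R 1)).
  move=> /(congr1 (fun f => f r)) ->; rewrite (@derive1_cst _ _ tau) mul0r addr0.
  have -> : derive1 (fun x => ef x - 1) r = ef r / tau.
    rewrite derive1E; apply: derive_val.
    have := is_derive_addf (smooth_is_derive r se) (is_derive_oppf (is_derive_cst (1 : R) r 1)).
    by rewrite oppr0 addr0 derive1_gro.
  by rewrite mulrC divfK// gt_eqF.
have e1 := momentum_product sc1; have e2 := f1_product b0 som; have e3 := f1_product bq sc2.
have br f : smooth f -> bm `[s, t] f by exact: bm_smooth.
have b1 := bmomentum_rate sc1.
have bt th f : bm D th -> smooth f -> bm `[s, t] (fun r => derive1 f r * f1 th r + f r * k1 th r).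
  move=> bth sf; exact: (bmD (bmM (br _ (smooth_derive1 sf)) (bf1 bth)) (bmM (br _ sf) (bk1 bth))).
exists (fun r => momentum_rate c1 r - (derive1 om r * f1 V0 r + om r * k1 V0 r)
   - (derive1 c2 r * f1 (fun w => M / 2 - w) r + c2 r * k1 (fun w => M / 2 - w) r)).
  split; first exact: (bmB (bmB b1 (bt _ _ b0 som)) (bt _ _ bq sc2)).
  move=> r /andP[sr _]; have r0 := lt_le_trans s0 sr.
  rewrite momentum_rateE// wdefE// rateE// dc1 dc2 /c1 /c2.
  have := lt0r_neq0 tau0 => tn.
  by field.
rewrite (cintB (bmB b1 (bt _ _ b0 som)) (bt _ _ bq sc2)) (cintB b1 (bt _ _ b0 som)).
rewrite -e1 -e2 -e3 wdefE// wdefE// /c1 /c2.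
by ring.
Qed.

End weighted_deficit.

Lemma tends0_bounded (R : realType) (P : R -> Prop) (f g : R -> R) (K : R) : tends0 P g 0 ->
  (forall t, P t -> `|f t| <= K) -> tends0 P (fun t => g t * f t) 0.
Proof.
move=> g0 fK; have h := tends0M (tends0_cst P `|K|) g0; rewrite mulr0 in h.
have h' : tends0 P (fun t => `|K| * `|g t|) 0.
  move=> e e0; have [d d0 hd] := h e e0; exists d => // t Pt td.
  by have := hd t Pt td; rewrite !subr0 !normrM !normr_id.
apply: (tends0_squeeze h'); exists 1 => // t Pt _.
by rewrite subr0 normrM mulrC ler_wpM2r// (le_trans (fK t Pt))// ler_norm.
Qed.

Lemma three_close (R : realType) (a b c d e : R) : `|a - b| <= e / 4 + e / 4 -> `|b - c| <= e / 4 ->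
  `|c - d| <= e / 4 -> `|a - d| <= e.
Proof.
rewrite !ler_norml => /andP[h1 h2] /andP[h3 h4] /andP[h5 h6].
by apply/andP; split; lra.
Qed.

Section initial_rates.
Context {R : realType}.
Notation leb := (@lebesgue_measure R).
Variables (tau M C : R) (rho : R -> finmeas R) (G : R * R -> R) (good : R -> Prop).
Hypothesis F : flow tau M C rho G good.
Hypothesis tau0 : 0 < tau.
Variables (rho0 : finmeas R) (g0 : R -> R).
Hypothesis I : flow_init M C rho G good rho0 g0.
Notation D := (`]0%R, M[%classic : set R).
Notation X := (lab rho).
Notation V := (vel rho G).
Notation X0 := (qf rho0).
Notation V0 := (fun w => g0 (qf rho0 w)).
Notation ef := (gro tau).
Notation df := (deficit tau M rho0 g0 rho G).
Implicit Types (r w s t : R) (a f c om th : R -> R).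

Let mD : measurable D := measurable_itv _.
Let fD : (leb D < +oo)%E := leb_itvoo_fin _ _.
Let M0 : 0 <= M := fl_M0 I.
Let C0 : 0 <= C := fl_C0 F.
Let b0 : bm D V0 := bm_vel0 I.
Let mX0 : measurable_fun D X0.
Proof. by rewrite -(fi_mass I); exact: (@measurable_qf R rho0). Qed.

Let bX f r : 0 < r -> bm setT f -> bm D (fun w => f (X r w)).
Proof. exact: (fl_bm_comp F). Qed.
Let bX0 f : bm setT f -> bm D (fun w => f (X0 w)).
Proof. exact: bm_comp. Qed.
Let bV r : 0 < r -> bm D (V r). Proof. exact: (fl_bm_vel F). Qed.
Let bq : bm D (fun w => M / 2 - w).
Proof. by apply: bmB; [exact: bm_cst|exact: bm_label]. Qed.
Let oM (f : R -> R) K : bm D f -> (forall w, D w -> `|f w| <= K) -> `|\int[leb]_(w in D) f w| <= K * M.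
Proof. by move=> bf fK; have := oint_bound bf fK; rewrite (fine_leb_itvoo M0) subr0. Qed.

Let tends0_id : tends0 good (fun t => t) 0.
Proof. exact: (tends0_smooth (fl_pos F) (@smooth_id R)). Qed.

Lemma tends0_weight a th : bsm a -> bm D th ->
  tends0 good (fun t => \int[leb]_(w in D) (a (X t w) * th w)) (\int[leb]_(w in D) (a (X0 w) * th w)).
Proof.
move=> ba bth; have [sa _ [K aK]] := ba; have [_ [T hT]] := bth.
have K0 : 0 <= K := le_trans (normr_ge0 _) (aK 0).
have h := tends0M (tends0_cst good (K * C * T * M)) tends0_id; rewrite mulr0 in h.
apply: (tends0_squeeze h); exists 1 => // t gt _; have t0 := fl_pos F gt.
have b1 := bmM (bX t0 (bsm_bm ba)) bth; have b2 := bmM (bX0 (bsm_bm ba)) bth.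
rewrite -(ointB b1 b2) (_ : K * C * T * M * t = K * (C * t) * T * M); last by ring.
apply: (oM (bmB b1 b2)) => w Dw; rewrite -mulrBl normrM ler_pM ?hT//.
apply: le_trans (smooth_lipschitz sa aK _ _) _; rewrite ler_wpM2l//.
exact: (lab_speed0 F I).
Qed.

(** V0 w is a Borel function of X0 w. It is approximated in L^1 by a smooth be (X0 w), which is
    close to be (X t w) by [lab_speed0]; then a be is an admissible test function for the
    convergence of rho u. *)
Lemma tends0_vel_weight a : bsm a ->
  tends0 good (fun t => \int[leb]_(w in D) (a (X t w) * V0 w * V t w))
    (\int[leb]_(w in D) (a (X0 w) * V0 w ^+ 2)).
Proof.
move=> ba e e0; have [sa [K aK] _] := ba.
have K0 : 0 <= K := le_trans (normr_ge0 _) (aK 0).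
have bg : bm setT g0 by split; [exact: (fi_g I)|exists C => x _; exact: (fi_gC I)].
have e4 : 0 < e / 4 by rewrite divr_gt0.
have KC : 0 < K * C + 1 by rewrite ltr_wpDl// mulr_ge0.
pose d := e / 4 / (K * C + 1).
have d0 : 0 < d by rewrite divr_gt0.
have dle : K * C * d <= e / 4.
  by rewrite /d mulrA ler_pdivrMr// mulrC ler_wpM2l ?lerDl// ltW.
have [be bbe hbe] := smooth_density M0 mX0 bg d0.
have [sbe [Kb beK] [L beL]] := bbe.
have L0 : 0 <= L := le_trans (normr_ge0 _) (beL 0).
have bab := bsm_mul ba bbe; have [sab [Kab abK] _] := bab.
have [d1 d10 h1] := fi_u I (smooth_continuous sab) abK e4.
pose N := K * C * (L * C * M).
have N0 : 0 <= N by rewrite !mulr_ge0.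
exists (Num.min d1 (e / 4 / (N + 1))).
  by rewrite lt_min d10 divr_gt0// ltr_wpDl.
move=> t gt; rewrite lt_min => /andP[td1 td2]; have t0 := fl_pos F gt.
have ba0 := bX0 (bsm_bm ba); have bbe0 := bX0 (bsm_bm bbe).
have bat := bX t0 (bsm_bm ba); have bbet := bX t0 (bsm_bm bbe).
have bdiff := bm_norm (bmB b0 bbe0).
have Nt : N * t <= e / 4.
  move: td2; rewrite ltr_pdivlMr ?ltr_wpDl// => /ltW; apply: le_trans.
  by rewrite mulrC ler_wpM2l ?lerDl// ltW.
have s1 : `|\int[leb]_(w in D) (a (X t w) * V0 w * V t w) - \int[leb]_(w in D) (a (X t w) * be (X t w) * V t w)| <= e / 4 + e / 4.
  have bi1 := bmM (bmM bat b0) (bV t0); have bi2 := bmM (bmM bat bbet) (bV t0).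
  rewrite -(ointB bi1 bi2); apply: le_trans (oint_norm (bmB bi1 bi2)) _.
  have bdt := bmD bdiff (bm_cst D (L * (C * t))).
  apply: (@le_trans _ _ (\int[leb]_(w in D) (K * C * (`|g0 (X0 w) - be (X0 w)| + L * (C * t))))).
    apply: (oint_le (bm_norm (bmB bi1 bi2)) (bmZ (K * C) bdt)) => w Dw.
    rewrite (_ : _ - _ = a (X t w) * V t w * (g0 (X0 w) - be (X t w))); last by ring.
    rewrite normrM ler_pM//; first by rewrite normrM ler_pM//; exact: (fl_GC F).
    apply: le_trans (ler_distD (be (X0 w)) _ _) _; rewrite lerD2l distrC.
    apply: le_trans (smooth_lipschitz sbe beL _ _) _; rewrite ler_wpM2l//.
    exact: (lab_speed0 F I).
  rewrite (ointZ (K * C) bdt) (ointD bdiff (bm_cst D (L * (C * t)))) mulrDr; apply: lerD.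
    by apply: le_trans dle; rewrite ler_wpM2l ?mulr_ge0.
  rewrite Rintegral_cst// (fine_leb_itvoo M0) subr0; apply: le_trans Nt.
  by rewrite /N le_eqVlt; apply/orP; left; apply/eqP; ring.
have s2 := h1 t gt td1.
have s3 : `|\int[leb]_(w in D) (a (X0 w) * be (X0 w) * V0 w) - \int[leb]_(w in D) (a (X0 w) * V0 w ^+ 2)| <= e / 4.
  have bi1 := bmM (bmM ba0 bbe0) b0; have bi2 := bmM ba0 (bmX 2 b0).
  rewrite -(ointB bi1 bi2); apply: le_trans (oint_norm (bmB bi1 bi2)) _.
  apply: (@le_trans _ _ (\int[leb]_(w in D) (K * C * `|g0 (X0 w) - be (X0 w)|))).
    apply: (oint_le (bm_norm (bmB bi1 bi2)) (bmZ (K * C) bdiff)) => w Dw.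
    rewrite (_ : _ - _ = a (X0 w) * V0 w * (be (X0 w) - g0 (X0 w))); last by ring.
    by rewrite normrM distrC ler_pM// normrM ler_pM//; exact: (fi_gC I).
  by rewrite (ointZ _ bdiff); apply: le_trans dle; rewrite ler_wpM2l ?mulr_ge0.
exact: three_close s1 s2 s3.
Qed.

Let tends0_ef : tends0 good ef 1.
Proof. by have := tends0_smooth (fl_pos F) (smooth_gro tau); rewrite gro0. Qed.

Let tends0_c : tends0 good (fun t => tau * (ef t - 1)) 0.
Proof.
have := tends0M (tends0_cst good tau) (tends0B tends0_ef (tends0_cst good 1)).
by rewrite subrr mulr0.
Qed.

Lemma tends0_wdef a : bsm a -> tends0 good (wdef tau M rho G rho0 g0 a) 0.
Proof.
move=> ba; have [sa [K aK] _] := ba.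
have h1 := tends0M tends0_ef (fi_u I (smooth_continuous sa) aK).
have h2 := tends0_weight ba b0.
have [_ [Q hQ]] := bq.
have h3 : tends0 good (fun t => tau * (ef t - 1) * \int[leb]_(w in D) (a (X t w) * (M / 2 - w))) 0.
  apply: (tends0_bounded (K := K * Q * M) tends0_c) => t gt.
  apply: (oM (bmM (bX (fl_pos F gt) (bsm_bm ba)) bq)) => w Dw.
  by rewrite normrM ler_pM// hQ.
have := tends0B (tends0B h1 h2) h3; rewrite mul1r subrr subr0.
apply: tends0_eq => t gt; have t0 := fl_pos F gt.
rewrite /wdef (deficit_split F I t0 (bX t0 (bsm_bm ba))).
by rewrite opprB opprD addrA.
Qed.

(** Both [derive1 a] V^2 and [derive1 a] V0 V have the limit [derive1 a] V0^2 in the mean, the first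
    by the convergence of rho u^2. They enter with opposite signs, and the third term carries a
    factor tending to 0. *)
Lemma tends0_wdef_rate a : bsm (derive1 a) -> tends0 good (wdef_rate tau M rho G rho0 g0 a) 0.
Proof.
move=> ba; have [sa [K aK] _] := ba.
have h1 := tends0M tends0_ef (fi_u2 I (smooth_continuous sa) aK).
have h2 := tends0_vel_weight ba.
have [_ [Q hQ]] := bq.
have h3 : tends0 good (fun t => tau * (ef t - 1) * \int[leb]_(w in D) (derive1 a (X t w) * V t w * (M / 2 - w))) 0.
  apply: (tends0_bounded (K := K * C * Q * M) tends0_c) => t gt.
  apply: (oM (bmM (bmM (bX (fl_pos F gt) (bsm_bm ba)) (bV (fl_pos F gt))) bq)) => w Dw.
  rewrite normrM ler_pM//; last exact: hQ.
  by rewrite normrM ler_pM//; exact: (fl_GC F).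
have := tends0B (tends0B h1 h2) h3; rewrite mul1r subrr subr0.
apply: tends0_eq => t gt; have t0 := fl_pos F gt.
rewrite /wdef_rate (deficit_split F I t0 (bmM (bX t0 (bsm_bm ba)) (bV t0))).
rewrite opprB opprD addrA; congr (_ - _ - _); last by apply: eq_Rintegral => w _; rewrite mulrAC.
by congr (_ * _); apply: eq_Rintegral => w _; rewrite expr2 mulrA.
Qed.

End initial_rates.

(* [exp (- C r) / r] near [s, t], with the pole at 0 cut off. *)
Lemma gronwall_weight (R : realType) (C s : R) : 0 < s -> exists om : R -> R,
  [/\ smooth om, forall r, s <= r -> om r = expR (- C * r) / r &
      forall r, s <= r -> derive1 om r = - ((r^-1 + C) * om r)].
Proof.
move=> s0; pose ch (r : R) := sstep ((r - s / 2) / (s / 4)).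
have s4 : 0 < s / 4 by rewrite divr_gt0.
have sch : smooth ch by exact: smooth_sstep_shift.
(* A positive smooth function equal to 1 for r <= s / 4 and to r for r >= 3 s / 4. *)
pose q r := 1 + ch r * (r - 1).
have sr : smooth (fun r : R => r - 1) by apply: smooth_sub; [exact: smooth_id|exact: smooth_cst].
have sq : smooth q by apply: smooth_add; [exact: smooth_cst|exact: smooth_mul].
have q0 r : 0 < q r.
  have [h0 h1] : 0 <= ch r /\ ch r <= 1 by split; [exact: sstep_ge0|exact: sstep_le1].
  have [rs|sr'] := leP r 0.
    rewrite /q /ch sstep0 ?mul0r ?addr0//.
    rewrite ler_pdivrMr// mulN1r; move: rs s0; clear; lra.
  have -> : q r = (1 - ch r) + ch r * r by rewrite /q; ring.
  move: h0; rewrite le_eqVlt => /orP[/eqP <-|h0]; first by rewrite subr0 mul0r addr0.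
  by rewrite ltr_wpDl// ?subr_ge0// mulr_gt0.
have large r : s <= r -> 2 <= (r - s / 2) / (s / 4).
  by move=> sr'; rewrite ler_pdivlMr//; move: sr' s0; clear; lra.
have chE r : s <= r -> ch r = 1.
  by move=> sr'; rewrite /ch sstep1// (le_trans _ (large r sr'))// ler1n.
have qE r : s <= r -> q r = r by move=> sr'; rewrite /q chE// mul1r addrC subrK.
have dch r : s <= r -> derive1 ch r = 0.
  move=> sr'; rewrite derive1_sstep_shift /sbump derive1_sstep0 ?mul0r//.
  by rewrite (lt_le_trans _ (ler_norm _))// (lt_le_trans _ (large r sr'))// ltr1n.
have dq r : s <= r -> derive1 q r = 1.
  move=> sr'; rewrite derive1E; apply: derive_val.
  have h1 := is_derive_addf (is_derive_id r (1 : R)) (is_derive_oppf (is_derive_cst (1 : R) r 1)).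
  have h := is_derive_addf (is_derive_cst (1 : R) r 1) (is_derive_mulf (smooth_is_derive r sch) h1).
  by move: h; rewrite chE// dch// oppr0 addr0 mul0r add0r mulr1 ?mul1r ?addr0 ?add0r.
have sN : smooth (fun r : R => - C * r) by apply: smooth_mul; [exact: smooth_cst|exact: smooth_id].
have se : smooth (fun r : R => expR (- C * r)) by exact: smooth_comp (@smooth_expR R) sN.
have de r : derive1 (fun r : R => expR (- C * r)) r = - C * expR (- C * r).
  rewrite derive1E; apply: derive_val.
  have h1 := is_derive_mulf (is_derive_cst (- C : R) r 1) (is_derive_id r (1 : R)).
  have := @is_derive_compf _ expR (fun r => - C * r) r _ _ (is_derive_expR (- C * r)) h1.
  by rewrite mulr1 ?mul0r ?addr0 ?add0r mulrC.
have qn r : q r != 0 by rewrite gt_eqF.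
have sqi := smooth_inv qn sq.
pose om r := expR (- C * r) / q r.
have som : smooth om by exact: smooth_mul.
exists om; split => // r sr'; first by rewrite /om qE.
have e : (fun r => om r * q r) = fun r => expR (- C * r) by apply/funext => z; rewrite /om divfK.
have := derive1_mul som sq; rewrite e => /(congr1 (fun f => f r)); rewrite /= de dq// qE//.
have r0 : r != 0 by rewrite gt_eqF// (lt_le_trans s0).
rewrite (_ : expR (- C * r) = om r * r); last by rewrite /om qE// divfK.
move=> h; apply: (mulIf r0).
have -> : derive1 om r * r = - C * (om r * r) - om r * 1 by rewrite h; ring.
by field.
Qed.

Lemma int_le0_ae (R : realType) (good : R -> Prop) (f : R -> R) (s t : R) : 0 < s ->
  {ae (@lebesgue_measure R), forall t, 0 < t -> good t} ->
  (forall r, good r -> s <= r <= t -> f r <= 0) -> \int[lebesgue_measure]_(r in `[s, t]) f r <= 0.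
Proof.
move=> s0 ag f0.
rewrite (@ae_eq_time R good `[s, t] f (fun r => Num.min (f r) 0) ag).
- by apply: Rint_le0 => r _; rewrite ge_min lexx orbT.
- by move=> r; rewrite /= in_itv/= => /andP[sr _]; exact: lt_le_trans sr.
- by move=> r gr; rewrite /= in_itv/= => h; rewrite min_l// f0.
Qed.

(** The bound concerns u at every pair of points, whereas [vel] is built from the Borel
    representative; h is the slice of u, equal to [vel] for almost every label. *)
Definition one_sided (R : realType) (M C : R) (rho : R -> finmeas R) (G : R * R -> R)
    (good : R -> Prop) := forall t, good t -> exists h : R -> R,
  [/\ forall x, `|h x| <= C, forall x y, x < y -> h y - h x <= t^-1 * (y - x) &
      {ae (@lebesgue_measure R), forall w, (`]0%R, M[%classic : set R) w ->
        h (lab rho t w) = vel rho G t w}].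

Section vanishing.
Context {R : realType}.
Notation leb := (@lebesgue_measure R).
Variables (tau M C : R) (rho : R -> finmeas R) (G : R * R -> R) (good : R -> Prop).
Hypothesis F : flow tau M C rho G good.
Hypothesis tau0 : 0 < tau.
Variables (rho0 : finmeas R) (g0 : R -> R).
Hypothesis I : flow_init M C rho G good rho0 g0.
Hypothesis O : one_sided M C rho G good.
Notation D := (`]0%R, M[%classic : set R).
Notation X := (lab rho).
Notation V := (vel rho G).
Notation df := (deficit tau M rho0 g0 rho G).
Notation J := (wdef tau M rho G rho0 g0 (@logistic R)).
Notation J' := (wdef_rate tau M rho G rho0 g0 (@logistic R)).
Notation lg := (@logistic R).
Implicit Types (r w s t x y : R) (f : R -> R).

Let mD : measurable D := measurable_itv _.
Let fD : (leb D < +oo)%E := leb_itvoo_fin _ _.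
Let C0 : 0 <= C := fl_C0 F.
Let mX t : 0 < t -> measurable_fun D (X t). Proof. exact: (measurable_lab_t F). Qed.
Let bX f r : 0 < r -> bm setT f -> bm D (fun w => f (X r w)).
Proof. exact: (fl_bm_comp F). Qed.
Let bV r : 0 < r -> bm D (V r). Proof. exact: (fl_bm_vel F). Qed.
Let bdf r : 0 < r -> bm D (df r). Proof. exact: (bm_deficit F I). Qed.
Let blg : bm setT lg := bsm_bm (@bsm_logistic R).
Let blg' : bm setT (derive1 lg) := bsm_bm (@bsm_derive1_logistic R).

Lemma deficit_layer t (g : R -> R) K : good t -> {homo g : x y / x <= y >-> y <= x} ->
  (forall x, `|g x| <= K) -> 0 <= \int[leb]_(w in D) (g (X t w) * df t w).
Proof.
move=> gt; have t0 := fl_pos F gt.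
apply: (layer_cake (mX t0) (bdf t0)); last exact: (deficit_total tau0 F I).
by move=> x; exact: (deficit_ge0 tau0 F I).
Qed.

Lemma logistic_homo : {homo lg : x y / x <= y >-> - y <= - x}.
Proof.
by move=> x y xy; rewrite lerN2 -subr_ge0 (le_trans _ (logistic_chord xy)).
Qed.

Lemma wdef_ge0 t : good t -> 0 <= J t.
Proof.
move=> gt; have t0 := fl_pos F gt.
have := deficit_layer (g := fun x => - lg x) (K := 1) gt.
rewrite /wdef -(ointN (bmM (bX t0 blg) (bdf t0))) => h.
rewrite (_ : \int[leb]_(w in D) _ = \int[leb]_(w in D) (- lg (X t w) * df t w)); last first.
  by apply: eq_Rintegral => w _; rewrite mulNr.
apply: h => [x y /logistic_homo//|x]; by rewrite normrN logistic_norm.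
Qed.

(* By the one-sided bound [a' u - (1/r + C) a] is nonincreasing in [x]. *)
Lemma wdef_rate_le r : good r -> J' r <= (r^-1 + C) * J r.
Proof.
move=> gr; have r0 := fl_pos F gr; have [h [hC hO hV]] := O gr.
pose nu x := derive1 lg x * h x - (r^-1 + C) * lg x.
have ri : 0 <= r^-1 by rewrite invr_ge0 ltW.
have nuK x : `|nu x| <= C + (r^-1 + C).
  apply: le_trans (ler_normB _ _) _; apply: lerD.
    rewrite normrM -[leRHS]mul1r ler_pM//.
    by rewrite ger0_norm ?derive1_logistic_le1// ltW// derive1_logistic_gt0.
  rewrite normrM (ger0_norm (addr_ge0 ri C0)) -[leRHS]mulr1 ler_wpM2l ?addr_ge0//.
  exact: logistic_norm.
have nuh : {homo nu : x y / x <= y >-> y <= x}.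
  (* h need not be differentiable, so monotonicity is checked on increments, up to the quadratic
     error of [logistic_increment]. *)
  move=> x y xy; apply: (quadratic_le (K := r^-1) xy) => x' y' _.
  rewrite le_eqVlt => /orP[/eqP <- _|xy' _].
    by rewrite !subrr expr0n mulr0.
  have h1 := hO x' y' xy'; have h2 := logistic_chord (ltW xy').
  have h3 := logistic_increment (ltW xy').
  have p0 := ltW (derive1_logistic_gt0 y').
  have q1 : derive1 lg y' * (h y' - h x') <= r^-1 * (lg y' - lg x' + (y' - x') ^+ 2).
    apply: le_trans (ler_wpM2l p0 h1) _; rewrite mulrCA; exact: ler_wpM2l.
  have q2 : (derive1 lg y' - derive1 lg x') * h x' <= C * (lg y' - lg x').
    apply: le_trans (ler_norm _) _; rewrite normrM mulrC; exact: ler_pM.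
  have -> : nu y' - nu x' = derive1 lg y' * (h y' - h x') + (derive1 lg y' - derive1 lg x') * h x'
     - (r^-1 + C) * (lg y' - lg x') by rewrite /nu; ring.
  have -> : r^-1 * (y' - x') ^+ 2 = r^-1 * (lg y' - lg x' + (y' - x') ^+ 2) + C * (lg y' - lg x')
     - (r^-1 + C) * (lg y' - lg x') by ring.
  by rewrite lerD2r lerD.
have := deficit_layer gr nuh nuK.
rewrite (@ae_eq_Rintegral_nm _ _ _ leb D _ (fun w => derive1 lg (X r w) * V r w * df r w - (r^-1 + C) * (lg (X r w) * df r w))); last first.
  by apply: ae_imp hV => w e Dw; rewrite /nu (e Dw) mulrBl mulrA.
have b1 := bmM (bmM (bX r0 blg') (bV r0)) (bdf r0); have b2 := bmM (bX r0 blg) (bdf r0).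
rewrite (ointB b1 (bmZ _ b2)) (ointZ _ b2) => hh.
by rewrite /wdef_rate /wdef mulrN lerN2 -subr_ge0.
Qed.

Lemma wdef_gronwall s t : good s -> good t -> s < t ->
  expR (- C * t) / t * J t <= expR (- C * s) / s * J s.
Proof.
move=> gs gt st; have s0 := fl_pos F gs.
have [om [som omE dom]] := gronwall_weight C s0.
rewrite -(omE s (lexx _)) -(omE t (ltW st)) -subr_le0.
have [k [bk kE] ->] := wdef_product F tau0 I (@bsm_logistic R) gs gt st som.
apply: (int_le0_ae s0 (fl_good F)) => r gr srt; rewrite kE//.
have /andP[sr _] := srt; have r0 := lt_le_trans s0 sr.
rewrite dom// (_ : _ + _ = om r * (J' r - (r^-1 + C) * J r)); last by ring.
rewrite mulr_ge0_le0//; first by rewrite omE// divr_ge0 ?expR_ge0// ltW.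
by rewrite subr_le0; exact: wdef_rate_le.
Qed.

(** J tends to 0, so J t is an integral of J' over ]0, t[ in the limit, and J' is eventually below
    e. *)
Let wdef_small e : 0 < e -> exists2 d, 0 < d & forall t, good t -> t < d -> J t <= e * t.
Proof.
move=> e0; have [d d0 hd] := tends0_wdef_rate F I (@bsm_derive1_logistic R) e0.
exists d => // t gt td; have t0 := fl_pos F gt.
rewrite -subr_le0; apply: (tends0_le_along (tends0_wdef F I (@bsm_logistic R)) (fl_good F)).
exists t => // s gs st; have s0 := fl_pos F gs.
have [k [bk kE]] := wdef_product F tau0 I (@bsm_logistic R) gs gt st (@smooth_cst R 1).
rewrite !mul1r => h; rewrite lerBlDr -lerBlDl h.
apply: (@le_trans _ _ (e * (t - s))); last by rewrite ler_wpM2l ?ltW// gtrBl.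
rewrite -(fine_leb_itv (ltW st)) -(@Rintegral_cst _ _ _ leb `[s, t])// -subr_le0.
rewrite -(cintB bk (bm_cst _ e)); apply: (int_le0_ae s0 (fl_good F)) => r gr srt.
rewrite kE// (@derive1_cst _ _ (1 : R)) mul0r add0r mul1r subr_le0.
have /andP[_ rt] := srt; have := hd r gr (le_lt_trans rt td).
by rewrite subr0 => /(le_trans (ler_norm _)).
Qed.

Lemma wdef0 t : good t -> J t = 0.
Proof.
move=> gt; have t0 := fl_pos F gt; apply/eqP; rewrite eq_le wdef_ge0// andbT.
have q0 : 0 < expR (- C * t) / t by rewrite divr_gt0 ?expR_gt0.
rewrite -(pmulr_rle0 _ q0); apply/ler_addgt0Pr => e e0; rewrite add0r.
have [d d0 hd] := wdef_small e0.
have td : 0 < Num.min t d by rewrite lt_min t0.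
have [s gs] := ae_near0 (fl_good F) td; rewrite lt_min => /andP[st sd].
have s0 := fl_pos F gs.
apply: le_trans (wdef_gronwall gs gt st) _.
apply: (@le_trans _ _ (1 / s * (e * s))); last by rewrite mul1r mulrCA mulVf ?mulr1// gt_eqF.
rewrite ler_pM ?hd ?wdef_ge0//; first by rewrite divr_ge0 ?expR_ge0// ltW.
rewrite ler_pM2r ?invr_gt0// -expR0 ler_expR mulNr oppr_le0 mulr_ge0//; exact: ltW.
Qed.

(** On the support of the derivative of the step, contained in |z - x0| <= 2, the derivative a (1 -
    a) of the logistic function is at least m > 0. A small multiple of the step can therefore be
    subtracted from - a without destroying its monotonicity. *)
Let tilt n x0 : exists2 e, 0 < e &
  {homo (fun x => - lg x - e * step n (x - x0)) : x y / x <= y >-> y <= x}.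
Proof.
have [ss [K0 hK0] [K hK]] := bsm_step (R := R) n.
have K1 : 0 < K + 1 by rewrite ltr_wpDl//; exact: le_trans (normr_ge0 _) (hK 0).
pose m := lg (x0 - 2) * (1 - lg (x0 + 2)).
have m0 : 0 < m by rewrite mulr_gt0 ?logistic_gt0// subr_gt0 logistic_lt1.
exists (m / (K + 1)); first exact: divr_gt0.
move=> x y xy; rewrite -subr_le0.
have s1 := @smooth_logistic R; have s2 := smooth_shift x0 ss.
have b1 : bm `[x, y] (derive1 lg) by exact: bm_smooth (smooth_derive1 s1).
have b2 : bm `[x, y] (derive1 (fun z => step n (z - x0))) by exact: bm_smooth (smooth_derive1 s2).
rewrite (_ : _ - _ = - ((lg y - lg x) + m / (K + 1) * (step n (y - x0) - step n (x - x0)))); last by ring.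
rewrite -(int_derive1 xy s1) -(int_derive1 xy s2) -(cintZ _ b2) -(cintD b1 (bmZ _ b2)) oppr_le0.
apply: Rint_ge0 => z _; rewrite derive1_shift//.
have [e|nz] := eqVneq (derive1 (step n) (z - x0)) 0.
  by rewrite e mulr0 addr0 ltW// derive1_logistic_gt0.
have : `|z - x0| <= 2.
  have := @ker_supp R n (z - x0); rewrite /ker oppr_eq0 => /(_ nz) /le_trans; apply.
  by rewrite ler_pdivrMr// ler_peMr// ler1n.
rewrite ler_norml => /andP[z1 z2].
have lm : m <= derive1 lg z.
  have l1 : lg (x0 - 2) <= lg z.
    by rewrite -lerN2; apply: logistic_homo; rewrite addrC -lerBrDr.
  have l2 : lg z <= lg (x0 + 2).
    by rewrite -lerN2; apply: logistic_homo; rewrite -lerBlDl.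
  rewrite derive1_logistic /m ler_pM ?(ltW (logistic_gt0 _)) ?subr_ge0 ?(ltW (logistic_lt1 _))//.
  by rewrite lerD2l lerN2.
rewrite -lerBlDr sub0r -mulrN; apply: le_trans lm.
rewrite mulrAC ler_pdivrMr//; apply: ler_wpM2l; first exact: ltW.
apply: le_trans (ler_norm _) _; rewrite normrN; apply: le_trans (hK _) _.
by rewrite lerDl.
Qed.

(** Since J = 0, testing the deficit with the function of [tilt] leaves - e times its integral
    against [step n]; this is nonnegative by [deficit_layer], which gives the inequality opposite to
    [deficit_ge0]. *)
Lemma deficit_below t x0 : good t -> \int[leb]_(w in D) (bR (X t w < x0) * df t w) = 0.
Proof.
move=> gt; have t0 := fl_pos F gt; apply/eqP; rewrite eq_le (deficit_ge0 tau0 F I)// andbT.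
have [K dK] := (bdf t0).2.
have bst n : bm D (fun w => step n (X t w - x0)) := fl_bm_lab F x0 t0 (bsm_bm (bsm_step n)).
have h : \int[leb]_(w in D) (step n (X t w - x0) * df t w) @[n --> \oo] -->
    \int[leb]_(w in D) (bR (X t w < x0) * df t w).
  apply: (@oint_cvg _ _ _ (fun n w => step n (X t w - x0) * df t w) _ (1 * K)).
  - by move=> n; have [] := bmM (bst n) (bdf t0).
  - by move=> n w Dw; rewrite normrM ler_pM ?step_norm// dK.
  - move=> w _; apply: cvgM; last exact: cvg_cst.
    by rewrite -subr_lt0; exact: step_cvg.
apply: (cvgr_to_le h); apply: nearW => n.
have [e e0 he] := tilt n x0.
have := deficit_layer (K := 1 + e * 1) gt he.
have b1 := bmM (bX t0 blg) (bdf t0); have b2 := bmM (bst n) (bdf t0).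
rewrite (_ : \int[leb]_(w in D) ((- lg (X t w) - _) * _) = \int[leb]_(w in D) (- (lg (X t w) * df t w) - e * (step n (X t w - x0) * df t w))); last first.
  apply: eq_Rintegral => w _; rewrite mulrBl mulNr; congr (_ - _); by rewrite -mulrA.
rewrite (ointB (bmN b1) (bmZ e b2)) (ointZ e b2) (ointN b1).
have := wdef0 gt; rewrite /wdef => ->; rewrite sub0r oppr_ge0 pmulr_rle0//; apply.
move=> x; apply: le_trans (ler_normB _ _) _; rewrite normrN lerD ?logistic_norm//.
by rewrite normrM (ger0_norm (ltW e0)) ler_wpM2l ?step_norm// ltW.
Qed.

Lemma momentum_below t x : good t ->
  gro tau t * \int[leb]_(w in D) (bR (X t w < x) * V t w) =
  mom0 M rho0 g0 (cdfl (rho t) x) + tau * (gro tau t - 1) * (cdfl (rho t) x * (M - cdfl (rho t) x) / 2).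
Proof.
move=> gt; have t0 := fl_pos F gt.
have := deficit_below x gt.
rewrite (deficit_split F I t0 (bm_lab_lt F x t0)) => /eqP; rewrite subr_eq0 => /eqP <-.
rewrite !(below_lab (fl_mass F t0)) below_int_linear ?(cdfl_range (fl_mass F t0))//.
Qed.

End vanishing.

(** * Comparison of two solutions *)

Section negative_part.
Context {R : realType}.
Implicit Types (n : nat) (z : R).

(* Bounded smooth approximations of [min z 0] with uniformly bounded derivatives. *)
Definition nega n z : R := z * step n z * chi n z.

Let smooth_zstep n : smooth (fun z => z * step n z).
Proof. by apply: smooth_mul; [exact: smooth_id|exact: smooth_step]. Qed.

Lemma derive1_nega n z : derive1 (nega n) z =
  z * derive1 (chi n) z * step n z + (step n z + z * derive1 (step n) z) * chi n z.
Proof.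
have h := derive1_mul (smooth_zstep n) (@smooth_chi R n).
rewrite -[LHS]/(derive1 (fun z => (fun z => z * step n z) z * chi n z) z) h.
have -> : derive1 (fun z => z * step n z) z = step n z + z * derive1 (step n) z.
  rewrite (derive1_mul (@smooth_id R) (@smooth_step R n)).
  have -> : derive1 (fun x : R => x) z = 1 by rewrite derive1E; apply: derive_val; exact: is_derive_id.
  by rewrite mul1r addrC.
by congr (_ + _); rewrite mulrAC.
Qed.

Let chi_part : exists2 K, 0 <= K & forall n z, `|z * derive1 (chi n) z| <= K.
Proof.
have [K K0 hK] := @derive1_chi_bound R; exists (3 * K) => [|n z]; first by rewrite mulr_ge0.
have [z3|z3] := ltP (3 * n.+1%:R) `|z|.
  rewrite (smooth_suppin_derive1 (@smooth_chi R n) (@chi_suppin R n) z3) mulr0 normr0.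
  by rewrite mulr_ge0.
rewrite normrM (le_trans (ler_pM _ _ z3 (hK n z)))//.
rewrite (_ : 3 * n.+1%:R * (K / n.+1%:R) = 3 * K)//.
have : n.+1%:R != 0 :> R by rewrite pnatr_eq0.
by move=> ?; field.
Qed.

(** The derivative of [step n] has size n + 1 on |z| <= 2 / (n + 1). So its product with z is
    bounded uniformly in n, and a further factor |z| makes it O(1 / n). *)
Let step_part : exists2 K, 0 <= K & forall n z, `|z| * `|z * derive1 (step n) z| <= K / n.+1%:R
  /\ `|z * derive1 (step n) z| <= K.
Proof.
have [K K0 hK] := @derive1_sstep_bound R.
have n0 n : n.+1%:R != 0 :> R by rewrite pnatr_eq0.
exists (4 * K) => [|n z]; first by rewrite mulr_ge0.
have [->|nz] := eqVneq (derive1 (step n) z) 0.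
  by rewrite mulr0 normr0 mulr0; split; rewrite ?divr_ge0 ?mulr_ge0.
have hz : `|z| <= 2 / n.+1%:R by apply: ker_supp; rewrite oppr_eq0.
have hs : `|derive1 (step n) z| <= n.+1%:R * K.
  by rewrite derive1_step normrM normrN (ger0_norm (x := n.+1%:R))// ler_wpM2l.
have h1 : `|z * derive1 (step n) z| <= 2 * K.
  rewrite normrM (le_trans (ler_pM _ _ hz hs))//.
  by rewrite (_ : 2 / n.+1%:R * (n.+1%:R * K) = 2 * K)//; have := n0 n => ?; field.
split.
  apply: le_trans (ler_pM _ _ hz h1) _ => //.
  by rewrite (_ : 2 / n.+1%:R * (2 * K) = 4 * K / n.+1%:R)//; have := n0 n => ?; field.
by apply: le_trans h1 _; rewrite ler_wpM2r// ler_nat.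
Qed.

Lemma bsm_nega n : bsm (nega n).
Proof.
have sn : smooth (nega n) by exact: smooth_mul (smooth_zstep n) (@smooth_chi R n).
have su : suppin (nega n) (3 * n.+1%:R).
  by move=> x /(@chi_suppin R n) h; rewrite /nega h mulr0.
split => //.
  by have [K _ hK] := smooth_suppin_bounded sn su; exists K.
by have [K _ hK] := smooth_suppin_bounded (smooth_derive1 sn) (smooth_suppin_derive1 sn su); exists K.
Qed.

Lemma derive1_nega_bound : exists2 K, 0 <= K & forall n z, `|derive1 (nega n) z| <= K.
Proof.
have [K1 K10 h1] := chi_part; have [K2 K20 h2] := step_part.
exists (K1 + (1 + K2)) => [|n z]; first by rewrite !addr_ge0.
rewrite derive1_nega; apply: le_trans (ler_normD _ _) _; apply: lerD.
  by rewrite normrM -[leRHS]mulr1 ler_pM ?step_norm.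
rewrite normrM -[leRHS]mulr1 ler_pM ?chi_norm//.
by apply: le_trans (ler_normD _ _) _; apply: lerD; [exact: step_norm|have [] := h2 n z].
Qed.

Lemma nega_cvg z : nega n z @[n --> \oo] --> z * bR (z < 0).
Proof.
rewrite -[X in _ --> X]mulr1; apply: cvgM; last exact: chi_cvg.
by apply: cvgM; [exact: cvg_cst|exact: step_cvg].
Qed.

Let zstep_cvg z : z * derive1 (step n) z @[n --> \oo] --> (0 : R).
Proof.
have [K K0 hK] := step_part.
have [->|nz] := eqVneq z 0; first by under eq_fun do rewrite mul0r; exact: cvg_cst.
have z0 : 0 < `|z| by rewrite normr_gt0.
have hb n : `|z * derive1 (step n) z| <= K / `|z| / n.+1%:R.
  by have [h _] := hK n z; rewrite mulrAC ler_pdivlMr// mulrC.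
apply: (@squeeze_cvgr _ _ _ _ (fun n => - (K / `|z| / n.+1%:R)) (fun n => K / `|z| / n.+1%:R)).
- by near=> n; rewrite -ler_norml.
- by rewrite -oppr0; apply: cvgN; exact: cvg_div_succ.
- exact: cvg_div_succ.
Unshelve. all: by end_near. Qed.

Lemma derive1_nega_cvg z : derive1 (nega n) z @[n --> \oo] --> (bR (z < 0) : R).
Proof.
under eq_fun do rewrite derive1_nega.
have h : z * derive1 (chi n) z * step n z + (step n z + z * derive1 (step n) z) * chi n z @[n --> \oo]
    --> z * 0 * bR (z < 0) + (bR (z < 0) + 0) * 1.
  apply: cvgD; apply: cvgM; [|exact: step_cvg| |exact: chi_cvg].
    by apply: cvgM; [exact: cvg_cst|exact: derive1_chi_cvg].
  by apply: cvgD; [exact: step_cvg|exact: zstep_cvg].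
by rewrite mulr0 mul0r add0r addr0 mulr1 in h.
Qed.

Lemma nega_lipschitz : exists2 K, 0 <= K & forall n x y, `|nega n y - nega n x| <= K * `|y - x|.
Proof.
have [K K0 hK] := derive1_nega_bound; exists K => // n x y.
by have [s _ _] := bsm_nega n; exact: smooth_lipschitz s (hK n) x y.
Qed.

Lemma neg_part_lipschitz (x y : R) : `|y * bR (y < 0) - x * bR (x < 0)| <= `|y - x|.
Proof.
have [y0|y0] := ltP y 0; have [x0|x0] := ltP x 0; rewrite /= ?mulr1 ?mulr0 ?subr0 ?sub0r//.
- by rewrite !ler0_norm ?subr_le0 ?(ltW y0)//; [rewrite lerN2 gerBl|rewrite (le_trans (ltW y0))].
- by rewrite normrN ltr0_norm// ger0_norm ?subr_ge0 ?(le_trans (ltW x0))// lerDr.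
by rewrite normr0.
Qed.

End negative_part.
#[global] Opaque nega.

Section neg_part_determines.
Context {R : realType}.
Notation leb := (@lebesgue_measure R).
Variables (M K : R) (Y1 Y2 : R -> R).
Notation D := (`]0%R, M[%classic : set R).
Hypotheses (m1 : measurable_fun D Y1) (m2 : measurable_fun D Y2).
Hypothesis Y12 : forall w, D w -> `|Y1 w - Y2 w| <= K.
Hypothesis eqL : forall x, \int[leb]_(w in D)
  ((Y1 w - x) * bR (Y1 w - x < 0) - (Y2 w - x) * bR (Y2 w - x < 0)) = 0.

Let fD : (leb D < +oo)%E := leb_itvoo_fin _ _.
Let mD : measurable D := measurable_itv _.

Let npart (z : R) : R := z * bR (z < 0).

Let mnpart : measurable_fun setT npart.
Proof.
apply: measurable_funM; first exact: measurable_id.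
have : bm setT (fun z : R => bR (z < 0) : R).
  by apply: bm_bool; apply: measurable_fun_ltr; [exact: measurable_id|exact: measurable_cst].
by case.
Qed.

Let quot n z := n.+1%:R * (npart (z + n.+1%:R^-1) - npart z).

Let quot_norm n z : `|quot n z| <= 1.
Proof.
rewrite /quot normrM (ger0_norm (x := n.+1%:R))// -ler_pdivlMl// mulr1.
by apply: le_trans (neg_part_lipschitz _ _) _; rewrite addrC addKr ger0_norm.
Qed.

Let bquot n (x : R) (Y : R -> R) : measurable_fun D Y -> bm D (fun w => quot n (Y w - x)).
Proof.
move=> mY; split; last by exists 1 => w _; exact: quot_norm.
have mq : measurable_fun setT (quot n).
  apply: measurable_funM; first exact: measurable_cst.
  apply: measurable_funB => //; apply: (measurableT_comp mnpart).
  by apply: measurable_funD; [exact: measurable_id|exact: measurable_cst].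
apply: (measurable_comp (F := setT) (f := quot n)) => //.
by apply: measurable_funB => //; exact: measurable_cst.
Qed.

Let quot_cvg z : quot n z @[n --> \oo] --> (bR (z < 0) : R).
Proof.
have [z0|z0] := ltP z 0; last first.
  rewrite (_ : (fun n => _) = fun=> 0); first exact: cvg_cst.
  apply/funext => n; rewrite /quot /npart !ltNge z0 addr_ge0//= !mulr0 subr0 mulr0//.
apply: (@cvg_near_cst _ _ _ _ \oo); near=> n.
have zn : z + n.+1%:R^-1 < 0.
  rewrite -ltrBrDl sub0r; near: n; have z0' : 0 < - z by rewrite oppr_gt0.
  exact: (near_infty_natSinv_lt (PosNum z0')).
by rewrite /quot /npart zn z0 /= !mulr1 addrC addKr mulfV// pnatr_eq0.
Unshelve. all: by end_near. Qed.

(** The indicator of z < 0 is the limit of difference quotients of min z 0. Only differences between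
    Y1 and Y2 are integrated, as each negative part alone may fail to be integrable. *)
Lemma neg_part_determines x :
  \int[leb]_(w in D) bR (Y1 w < x) = \int[leb]_(w in D) bR (Y2 w < x).
Proof.
have cv (Y : R -> R) : measurable_fun D Y -> \int[leb]_(w in D) quot n (Y w - x) @[n --> \oo] -->
    \int[leb]_(w in D) bR (Y w < x).
  move=> mY; apply: (@oint_cvg _ _ _ (fun n w => quot n (Y w - x)) _ 1).
  - by move=> n; have [] := bquot n x mY.
  - by move=> n w _; exact: quot_norm.
  - by move=> w _; rewrite -subr_lt0; exact: quot_cvg.
apply: (eq_cvg_unique _ (cv _ m1) (cv _ m2)) => n.
apply/eqP; rewrite -subr_eq0 -(ointB (bquot n x m1) (bquot n x m2)); apply/eqP.
pose d x0 w := npart (Y1 w - x0) - npart (Y2 w - x0).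
have bd x0 : bm D (d x0).
  split; last first.
    exists K => w Dw; apply: le_trans (neg_part_lipschitz _ _) _.
    by rewrite (_ : _ - _ = Y1 w - Y2 w) ?Y12//; ring.
  apply: measurable_funB; apply: (measurable_comp (F := setT) (f := npart)) => //.
    by apply: measurable_funB => //; exact: measurable_cst.
  by apply: measurable_funB => //; exact: measurable_cst.
have h := ointB (bd (x - n.+1%:R^-1)) (bd x).
have h2 := ointZ n.+1%:R (bmB (bd (x - n.+1%:R^-1)) (bd x)).
have e0 x0 : \int[leb]_(w in D) d x0 w = 0 := eqL x0.
transitivity (n.+1%:R * \int[leb]_(w in D) (d (x - n.+1%:R^-1) w - d x w)).
  have ed z : z - (x - n.+1%:R^-1) = z - x + n.+1%:R^-1 by ring.
  rewrite -h2; apply: eq_Rintegral => w _; rewrite /quot /d !ed.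
  by ring.
by rewrite h !e0 subrr mulr0.
Qed.

End neg_part_determines.

Lemma excess_gap (R : realType) (m e B a b v w : R) : m - B <= a -> b <= m + e - B ->
  - e <= a - v + w - (b - v + w).
Proof. by move=> h1 h2; lra. Qed.

Lemma gap_sum (R : realType) (g h p z : R) : - (z / 2) <= g - h -> - p <= h -> p <= z / 2 -> - g <= z.
Proof. by move=> h1 h2 h3; lra. Qed.

Section comparison.
Context {R : realType}.
Notation leb := (@lebesgue_measure R).
Variables (tau M C : R) (rho1 rho2 : R -> finmeas R) (G1 G2 : R * R -> R) (good : R -> Prop).
Hypotheses (F1 : flow tau M C rho1 G1 good) (F2 : flow tau M C rho2 G2 good).
Hypothesis tau0 : 0 < tau.
Variables (rho0 : finmeas R) (g0 : R -> R).
Hypotheses (I1 : flow_init M C rho1 G1 good rho0 g0) (I2 : flow_init M C rho2 G2 good rho0 g0).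
Notation D := (`]0%R, M[%classic : set R).
Notation X1 := (lab rho1).
Notation X2 := (lab rho2).
Implicit Types (r s t x w : R) (y : R -> R).

Let mD : measurable D := measurable_itv _.
Let fD : (leb D < +oo)%E := leb_itvoo_fin _ _.
Let M0 : 0 <= M := fl_M0 I1.
Let C0 : 0 <= C := fl_C0 F1.

(** Each negative part may have infinite integral. The difference is bounded by |X1 - X2| <= 2 C t,
    because both solutions start from the same labels. *)
Definition neg_gap t x := \int[leb]_(w in D)
  ((X1 t w - x) * bR (X1 t w - x < 0) - (X2 t w - x) * bR (X2 t w - x < 0)).

Lemma lab_gap t w : 0 < t -> D w -> `|X1 t w - X2 t w| <= 2 * C * t.
Proof.
move=> t0 Dw; apply: le_trans (ler_distD (qf rho0 w) _ _) _.
have h1 := lab_speed0 F1 I1 t0 Dw; have h2 := lab_speed0 F2 I2 t0 Dw.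
rewrite distrC in h2; apply: le_trans (lerD h1 h2) _.
by rewrite le_eqVlt; apply/orP; left; apply/eqP; ring.
Qed.

Lemma bm_neg_gap t x : 0 < t ->
  bm D (fun w => (X1 t w - x) * bR (X1 t w - x < 0) - (X2 t w - x) * bR (X2 t w - x < 0)).
Proof.
move=> t0; split; last first.
  exists (2 * C * t) => w Dw; apply: le_trans (neg_part_lipschitz _ _) _.
  by rewrite (_ : _ - _ = X1 t w - X2 t w) ?lab_gap//; ring.
have m1 : measurable_fun D (fun w => X1 t w - x).
  by apply: measurable_funB (measurable_lab_t F1 t0) _; exact: measurable_cst.
have m2 : measurable_fun D (fun w => X2 t w - x).
  by apply: measurable_funB (measurable_lab_t F2 t0) _; exact: measurable_cst.
have mb (Y : R -> R) : measurable_fun D Y -> measurable_fun D (fun w => bR (Y w < 0) : R).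
  move=> mY; have : bm D (fun w => bR (Y w < 0) : R).
    by apply: bm_bool; apply: measurable_fun_ltr => //; exact: measurable_cst.
  by case.
by apply: measurable_funB; apply: measurable_funM => //; exact: mb.
Qed.

Lemma neg_gap_bound t x : 0 < t -> `|neg_gap t x| <= 2 * C * t * M.
Proof.
move=> t0; have bd := bm_neg_gap x t0.
have := oint_bound bd (K := 2 * C * t); rewrite (fine_leb_itvoo M0) subr0; apply => w Dw.
apply: le_trans (neg_part_lipschitz _ _) _.
by rewrite (_ : _ - _ = X1 t w - X2 t w) ?lab_gap//; ring.
Qed.

Let below (rho : R -> finmeas R) (G : R * R -> R) y r :=
  \int[leb]_(w in D) (bR (lab rho r w - y r < 0) * (vel rho G r w - derive1 y r)).

Let bneg : bm setT (fun z : R => bR (z < 0) : R).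
Proof.
by apply: bm_bool; apply: measurable_fun_ltr; [exact: measurable_id|exact: measurable_cst].
Qed.

Let bbelow rho G y s t : flow tau M C rho G good -> smooth y -> 0 < s -> bm `[s, t] (below rho G y).
Proof.
move=> F sy s0.
have b1 := fl_lab_box F t s0 bneg sy; have b2 := fl_vel_box F t s0.
have b3 := fl_time_box M s t (smooth_derive1 sy).
exact: (fl_box_int (bmM b1 (bmB b2 b3))).
Qed.

Let rate_cvg rho G y s t : flow tau M C rho G good -> smooth y -> 0 < s -> s < t ->
  \int[leb]_(w in D) nega n (lab rho t w - y t) - \int[leb]_(w in D) nega n (lab rho s w - y s)
    @[n --> \oo] --> \int[leb]_(r in `[s, t]) below rho G y r.
Proof.
move=> F sy s0 st.
have [K K0 hK] := @derive1_nega_bound R.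
have [Q Q0 hQ] := smooth_bounded_itv s t (smooth_derive1 sy).
under eq_fun do rewrite (fl_transport F (bsm_nega _) sy s0 st).
apply: (double_cvg (K := K * (C + Q)) mD (measurable_itv `[s, t]) fD (leb_itv_fin s t)
  (F_ := fun n p => derive1 (nega n) (lab rho p.2 p.1 - y p.2) * (vel rho G p.2 p.1 - derive1 y p.2))
  (F := fun p => bR (lab rho p.2 p.1 - y p.2 < 0) * (vel rho G p.2 p.1 - derive1 y p.2))).
- move=> n; apply: bmM.
    exact: (fl_lab_box F t s0 (bsm_bm_derive1 (bsm_nega n)) sy).
  exact: (bmB (fl_vel_box F t s0) (fl_time_box M s t (smooth_derive1 sy))).
- move=> n [w r] [_ Jr]; rewrite normrM ler_pM//=.
  apply: le_trans (ler_normB _ _) _; apply: lerD; first exact: (fl_GC F).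
  by apply: hQ; move: Jr; rewrite /= in_itv.
- by move=> [w r] _; apply: cvgM; [exact: derive1_nega_cvg|exact: cvg_cst].
Qed.

Let gap_cvg y t : smooth y -> 0 < t ->
  \int[leb]_(w in D) nega n (X1 t w - y t) - \int[leb]_(w in D) nega n (X2 t w - y t)
    @[n --> \oo] --> neg_gap t (y t).
Proof.
move=> sy t0; have [K K0 hK] := @nega_lipschitz R.
have b1 n := fl_bm_lab F1 (y t) t0 (bsm_bm (bsm_nega n)).
have b2 n := fl_bm_lab F2 (y t) t0 (bsm_bm (bsm_nega n)).
rewrite (_ : (fun n => _) = fun n => \int[leb]_(w in D) (nega n (X1 t w - y t) - nega n (X2 t w - y t))); last first.
  by apply/funext => n; symmetry; exact: (ointB (b1 n) (b2 n)).
apply: (@oint_cvg _ _ _ (fun n w => nega n (X1 t w - y t) - nega n (X2 t w - y t)) _ (K * (2 * C * t))).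
- by move=> n; have [] := bmB (b1 n) (b2 n).
- move=> n w Dw; apply: le_trans (hK _ _ _) _; rewrite ler_wpM2l//.
  by rewrite (_ : _ - _ = X1 t w - X2 t w) ?lab_gap//; ring.
- by move=> w _; apply: cvgB; exact: nega_cvg.
Qed.

Lemma neg_gap_transport y s t : smooth y -> 0 < s -> s < t ->
  neg_gap t (y t) - neg_gap s (y s) =
  \int[leb]_(r in `[s, t]) (below rho1 G1 y r - below rho2 G2 y r).
Proof.
move=> sy s0 st; have t0 := lt_trans s0 st.
have swap (a b c d : R) : a - b - (c - d) = a - c - (b - d) by ring.
have h1 := cvgB (rate_cvg F1 sy s0 st) (rate_cvg F2 sy s0 st).
have h2 := cvgB (gap_cvg sy t0) (gap_cvg sy s0).
rewrite (cintB (bbelow t F1 sy s0) (bbelow t F2 sy s0)).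
by apply: (eq_cvg_unique _ (h2 _) (h1 _)) => n; exact: swap.
Qed.

(** The terms added to [excess] do not depend on the solution, so the difference of the two rates is
    the difference of the two excesses. *)
Let below_excess rho G y vf w0 r : flow tau M C rho G good -> good r ->
  vf r = gro tau r * derive1 y r ->
  gro tau r * below rho G y r = excess tau M rho G (gro tau) vf y w0 r - vf r * w0
    + tau * gro tau r * (w0 * (M - w0) / 2).
Proof.
move=> F gr vE; have r0 := fl_pos F gr; rewrite /excess vE.
have b1 : bm D (fun w => bR (lab rho r w < y r) : R) := bm_lab_lt F (y r) r0.
rewrite -(below_lab1 (fl_mass F r0)) /below.
have -> : \int[leb]_(w in D) (bR (lab rho r w - y r < 0) * (vel rho G r w - derive1 y r)) =
    \int[leb]_(w in D) (bR (lab rho r w < y r) * vel rho G r w) - derive1 y r * \int[leb]_(w in D) bR (lab rho r w < y r).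
  rewrite -(ointZ (derive1 y r) b1) -(ointB (bmM b1 (fl_bm_vel F r0)) (bmZ _ b1)).
  by apply: eq_Rintegral => w _; rewrite subr_lt0 mulrBr [X in _ - X]mulrC.
by ring.
Qed.

Hypothesis momentum1 : forall t x, good t ->
  gro tau t * \int[leb]_(w in D) (bR (X1 t w < x) * vel rho1 G1 t w) =
  mom0 M rho0 g0 (cdfl (rho1 t) x) + tau * (gro tau t - 1) * (cdfl (rho1 t) x * (M - cdfl (rho1 t) x) / 2).

Let neg_gap_rate t x e : good t -> 0 < e -> exists y, [/\ smooth y, y t = x &
  forall r, good r -> r <= t -> - e <= below rho1 G1 y r - below rho2 G2 y r].
Proof.
move=> gt e0; have t0 := fl_pos F1 gt.
pose w0 := cdfl (rho1 t) x.
have hw0 : 0 <= w0 <= M := cdfl_range (fl_mass F1 t0) x.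
have [vf [y [[[sv sy] dv vE] yt he]]] := good_path tau0 x (fi_mass I1) (fi_g I1) (fi_gC I1) t0 hw0 e0.
exists y; split => // r gr rt; have r0 := fl_pos F1 gr.
have ge0' := gro_gt0 tau r.
have ge1 : 1 <= gro tau r by exact: ltW (gro_gt1 tau0 r0).
have E1t : excess tau M rho1 G1 (gro tau) vf y w0 t = mom0 M rho0 g0 w0 - tau * (w0 * (M - w0) / 2).
  have w0E : w0 = cdfl (rho1 t) (y t) by rewrite yt.
  rewrite (excess_end tau M G1 vf t0 w0E) yt momentum1// -/w0; ring.
have E1 : excess tau M rho1 G1 (gro tau) vf y w0 t <= excess tau M rho1 G1 (gro tau) vf y w0 r.
  move: rt; rewrite le_eqVlt => /orP[/eqP ->//|rt].
  exact: (excess_le F1 tau0 (smooth_gro tau) (derive1_gro tau) (fun r => ltW (gro_gt0 tau r)) sv dv sy vE hw0 gr gt rt).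
have E2 : excess tau M rho2 G2 (gro tau) vf y w0 r <= excess0 tau M rho0 g0 (gro tau) vf y w0.
  exact: (excess_le0 F2 tau0 I2 (smooth_gro tau) (derive1_gro tau) (fun r => ltW (gro_gt0 tau r)) sv dv sy vE hw0 gr).
have h1 := below_excess w0 F1 gr (vE r); have h2 := below_excess w0 F2 gr (vE r).
have : - e <= gro tau r * (below rho1 G1 y r - below rho2 G2 y r).
  rewrite mulrBr h1 h2; rewrite E1t in E1.
  have := le_trans E2 he; move: E1; set a := excess _ _ _ _ _ _ _ _ _; set b := excess _ _ _ _ _ _ _ _ _.
  exact: excess_gap.
set d := below _ _ _ _ - _ => hd.
(* If d is negative, the factor [gro tau r] >= 1 only lowers it, so the lower bound carries over to
   d. *)
have [d0|d0] := leP 0 d; first by rewrite (le_trans _ d0)// oppr_le0 ltW.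
apply: le_trans hd _; rewrite -subr_ge0 -{1}[d]mul1r -mulrBl.
by apply: mulr_le0; [rewrite subr_le0|exact: ltW].
Qed.

Lemma neg_gap_ge0 t x : good t -> 0 <= neg_gap t x.
Proof.
move=> gt; have t0 := fl_pos F1 gt.
rewrite -oppr_le0; apply/ler_addgt0Pr => z z0; rewrite add0r.
have e0 : 0 < z / 2 / t by rewrite !divr_gt0.
have [y [sy yt hy]] := neg_gap_rate x gt e0.
(* The starting time s is so small that the gap there, at most 2 C M s, is below z / 2. The rate
   error z / (2 t) integrates to at most another z / 2. *)
pose q := 2 * C * M + 1; have q0 : 0 < q by rewrite ltr_wpDl// !mulr_ge0.
pose s := Num.min (t / 2) (z / 2 / q).
have s0 : 0 < s by rewrite lt_min !divr_gt0.
have st : s < t by rewrite gt_min ltr_pdivrMr// ltr_pMr// ltr1n.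
have sq : 2 * C * s * M <= z / 2.
  rewrite (_ : _ * M = 2 * C * M * s); last by ring.
  apply: (@le_trans _ _ (q * s)); first by rewrite ler_wpM2r ?ltW// ltrDl.
  by rewrite mulrC -ler_pdivlMr// ge_min lexx orbT.
have hT := neg_gap_transport sy s0 st; rewrite yt in hT.
have b1 := bbelow t F1 sy s0; have b2 := bbelow t F2 sy s0.
have h1 : - (z / 2 / t) * (t - s) <= neg_gap t x - neg_gap s (y s).
  rewrite hT -(fine_leb_itv (ltW st)) -(@Rintegral_cst _ _ _ leb `[s, t])// -subr_le0.
  rewrite -(cintB (bm_cst _ _) (bmB b1 b2)); apply: (int_le0_ae s0 (fl_good F1)) => r gr /andP[_ rt].
  by rewrite subr_le0; exact: hy.
have h2 : - (z / 2) <= - (z / 2 / t) * (t - s).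
  rewrite mulNr lerN2 mulrAC ler_pdivrMr// ler_wpM2l ?divr_ge0 ?ltW//.
  by rewrite gtrBl.
have h3 := neg_gap_bound (y s) s0.
move: h3; rewrite ler_norml => /andP[h3 _].
exact: gap_sum (le_trans h2 h1) h3 sq.
Qed.

End comparison.

Section determined_by_half_lines.
Context {R : realType}.
Notation leb := (@lebesgue_measure R).
Variables (nu : finmeas R) (g : R -> R).
Notation D := (`]0%R, total_mass nu[%classic : set R).
Notation X := (qf nu).
Hypothesis bg : bm setT g.
Hypothesis half : forall x, \int[leb]_(w in D) (bR (X w < x) * g (X w)) = 0.

Let fD : (leb D < +oo)%E := leb_itvoo_fin _ _.
Let mD : measurable D := measurable_itv _.
Let mX : measurable_fun D X := @measurable_qf R nu.
Let bgX : bm D (fun w => g (X w)) := bm_comp mX bg.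

Let vanish_Cc (a : R -> R) A : smooth a -> suppin a A -> \int[leb]_(w in D) (a (X w) * g (X w)) = 0.
Proof.
move=> sa /suppin_margin[B [B0 aB aB1 aB2]].
apply/eqP; rewrite -oppr_eq0; apply/eqP.
rewrite -(int_derive1_lab sa B0 aB aB1 aB2 bgX).
by apply: Rint_zero => x _; rewrite half mulr0.
Qed.

Let vanish_bsm (a : R -> R) : bsm a -> \int[leb]_(w in D) (a (X w) * g (X w)) = 0.
Proof.
move=> ba; have [a_ [K [sa_ supa_ boundK acvg]]] := bsm_cutoff ba.
have [_ [L gL]] := bgX.
have h : \int[leb]_(w in D) (a_ n (X w) * g (X w)) @[n --> \oo] --> \int[leb]_(w in D) (a (X w) * g (X w)).
  apply: (@oint_cvg _ _ _ (fun n w => a_ n (X w) * g (X w)) _ (K * L)).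
  - move=> n; have ba_ : bm setT (a_ n) := bm_smooth_bounded (sa_ n) (fun x => (boundK n x).1).
    by have [] := bmM (bm_comp mX ba_) bgX.
  - by move=> n w Dw; rewrite normrM ler_pM ?gL//; have [] := boundK n (X w).
  - by move=> w _; apply: cvgM; [have [] := acvg (X w)|exact: cvg_cst].
apply: (eq_cvg_unique _ h (cvg_cst (0 : R))) => n.
by have [A aA] := supa_ n; exact: vanish_Cc (sa_ n) aA.
Qed.

(** Orthogonality to half-lines gives orthogonality to smooth functions by an integration by parts.
    By density g is then orthogonal to itself, so its square has integral 0. *)
Lemma determined_by_half_lines : {ae nu, forall x, g x = 0}.
Proof.
have [_ [K0 gK0]] := bgX; pose K := `|K0|.
have gK w : D w -> `|g (X w)| <= K by move=> Dw; apply: le_trans (gK0 w Dw) (ler_norm _).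
have K1 : 0 < K + 1 by rewrite ltr_wpDl//; exact: normr_ge0.
have sq0 : \int[leb]_(w in D) (g (X w) ^+ 2) = 0.
  apply/eqP; rewrite -normr_le0; apply/ler_addgt0Pr => e e0; rewrite add0r.
  have [b bb hb] := smooth_density (mass_ge0 nu) mX bg (divr_gt0 e0 K1).
  have bbX := bm_comp mX (bsm_bm bb).
  have bd := bmM (bmB bgX bbX) bgX.
  have -> : \int[leb]_(w in D) (g (X w) ^+ 2) = \int[leb]_(w in D) ((g (X w) - b (X w)) * g (X w)).
    have := ointB (bmM bgX bgX) (bmM bbX bgX); rewrite (vanish_bsm bb) subr0 => h.
    rewrite (_ : \int[leb]_(w in D) (g (X w) ^+ 2) = \int[leb]_(w in D) (g (X w) * g (X w))).
      by rewrite -h; apply: eq_Rintegral => w _; rewrite mulrBl.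
    by apply: eq_Rintegral => w _; rewrite expr2.
  apply: le_trans (oint_norm bd) _.
  have bn := bm_norm (bmB bgX bbX).
  apply: (@le_trans _ _ (\int[leb]_(w in D) (K * `|g (X w) - b (X w)|))).
    apply: (oint_le (bm_norm bd) (bmZ K bn)) => w Dw.
    by rewrite normrM mulrC ler_wpM2r// gK.
  rewrite (ointZ K bn).
  apply: (@le_trans _ _ (K * (e / (K + 1)))); first by rewrite ler_wpM2l//; exact: normr_ge0.
  by rewrite mulrCA ler_piMr ?ltW// ltr_pdivrMr// mul1r ltrDl.
have bg2 : bm setT (fun x => g x ^+ 2) := bmX 2 bg.
have fin : (nu setT < +oo)%E by rewrite ltey_eq fin_num_measure.
have I0 : (\int[nu]_(x in setT) `|(g x ^+ 2)%:E|)%E = 0%E.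
  rewrite (_ : (\int[nu]_(x in setT) _)%E = (\int[nu]_(x in setT) (g x ^+ 2)%:E)%E); last first.
    by apply: eq_integral => x _; rewrite gee0_abs// lee_fin sqr_ge0.
  have := push_integral nu bg2; rewrite sq0 /Rintegral => h.
  have ig := @bm_integrable _ (measurableTypeR R) R nu setT measurableT fin _ bg2.
  rewrite -[LHS]fineK ?h//; exact: integrable_fin_num.
have mg2 : measurable_fun (setT : set (measurableTypeR R)) (EFin \o (fun x => g x ^+ 2)).
  by apply/measurable_EFinP; have [] := bg2.
have := (ae_eq_integral_abs nu measurableT mg2).1 I0.
by apply: ae_imp => x /(_ Logic.I) /= [] /eqP; rewrite sqrf_eq0 => /eqP.
Qed.

End determined_by_half_lines.

(** * Agreement of two solutions with the same initial data *)

Section agreement.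
Context {R : realType}.
Notation leb := (@lebesgue_measure R).
Variables (tau M C : R) (rho1 rho2 : R -> finmeas R) (G1 G2 : R * R -> R) (good : R -> Prop).
Hypotheses (F1 : flow tau M C rho1 G1 good) (F2 : flow tau M C rho2 G2 good).
Hypothesis tau0 : 0 < tau.
Variables (rho0 : finmeas R) (g0 : R -> R).
Hypotheses (I1 : flow_init M C rho1 G1 good rho0 g0) (I2 : flow_init M C rho2 G2 good rho0 g0).
Hypotheses (O1 : one_sided M C rho1 G1 good) (O2 : one_sided M C rho2 G2 good).
Notation D := (`]0%R, M[%classic : set R).

Let fD : (leb D < +oo)%E := leb_itvoo_fin _ _.
Let mD : measurable D := measurable_itv _.

Lemma flows_same_cdf t x : good t -> cdfl (rho1 t) x = cdfl (rho2 t) x.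
Proof.
move=> gt; have t0 := fl_pos F1 gt.
rewrite -(below_lab1 (fl_mass F1 t0)) -(below_lab1 (fl_mass F2 t0)).
apply: (neg_part_determines (K := 2 * C * t)).
- exact: (measurable_lab_t F1).
- exact: (measurable_lab_t F2).
- by move=> w Dw; exact: (lab_gap F1 F2 I1 I2).
move=> z; apply/eqP; rewrite eq_le.
rewrite (neg_gap_ge0 F1 F2 tau0 I1 I2 (fun s y => momentum_below F1 tau0 I1 O1 y) z gt) andbT.
have := neg_gap_ge0 F2 F1 tau0 I2 I1 (fun s y => momentum_below F2 tau0 I2 O2 y) z gt.
rewrite -oppr_le0 /neg_gap -(ointN (bm_neg_gap F2 F1 I2 I1 z t0)).
by under eq_Rintegral do rewrite opprB.
Qed.

Lemma flows_same_lab t : good t -> lab rho1 t = lab rho2 t.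
Proof.
move=> gt; have t0 := fl_pos F1 gt; apply/funext => w.
rewrite /lab /qf (fl_mass F1 t0) (fl_mass F2 t0).
case: ifP => // _; congr inf; apply/seteqP.
by split => x; rewrite /qset /= flows_same_cdf.
Qed.

Lemma flows_same_measure t (A : set R) : good t -> measurable A -> rho1 t A = rho2 t A.
Proof.
move=> gt mA; have t0 := fl_pos F1 gt.
rewrite !push_measure// (fl_mass F1 t0) (fl_mass F2 t0).
have := flows_same_lab gt; rewrite /lab => e; congr (leb _).
by apply/seteqP; split => w /= [Dw]; rewrite (congr1 (fun f => f w) e).
Qed.

Lemma flows_same_velocity t : good t -> {ae rho1 t, forall x, G1 (x, t) = G2 (x, t)}.
Proof.
move=> gt; have t0 := fl_pos F1 gt.
have bG (G : R * R -> R) : measurable_fun setT G -> (forall p, `|G p| <= C) -> bm setT (fun x : R => G (x, t)).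
  move=> mG GC; split; last by exists C => x _.
  by apply: (measurable_comp (F := setT) (f := G) (g := fun x => (x, t))).
have b1 := bG _ (fl_G F1) (fl_GC F1); have b2 := bG _ (fl_G F2) (fl_GC F2).
have := @determined_by_half_lines R (rho1 t) (fun x => G1 (x, t) - G2 (x, t)) (bmB b1 b2).
move=> h; suff : {ae rho1 t, forall x, G1 (x, t) - G2 (x, t) = 0}.
  by apply: ae_imp => x /eqP; rewrite subr_eq0 => /eqP.
apply: h => x; rewrite (fl_mass F1 t0).
have c1 := momentum_below F1 tau0 I1 O1 x gt; have c2 := momentum_below F2 tau0 I2 O2 x gt.
rewrite (flows_same_cdf x gt) -c2 in c1.
have g0n : gro tau t != 0 by rewrite gt_eqF// gro_gt0.
have {}c1 := mulfI g0n c1.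
have bl := bm_lab_lt F1 x t0.
have bl2 := bm_lab_lt F2 x t0.
have := ointB (bmM bl (fl_bm_vel F1 t0)) (bmM bl2 (fl_bm_vel F2 t0)).
rewrite c1 subrr => h'; etransitivity; last exact: h'.
apply: eq_Rintegral => w _.
rewrite /vel -(flows_same_lab gt) /lab.
by rewrite mulrBr.
Qed.

End agreement.

Lemma slice_of_Lfun (R : realType) (nu : finmeas R) (w : R -> R) : w \in Lfun nu +oo%E ->
  exists2 B, 0 <= B & forall C, B <= C -> slice nu w C.
Proof.
move=> /andP[/= mw]; rewrite inE /= /finite_norm => fw.
have {}mw : measurable_fun setT w by move: mw; rewrite inE.
have [B hB] : exists B, {ae nu, forall x, `|w x| <= B}.
  move: fw; rewrite unlock; case: ifPn => [_ h|h _].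
    have := @ess_sup_inf.ess_supr_bounded _ _ R nu (fun x => `|w x|).
    by apply; apply: le_lt_trans h.
  (* For the zero measure any bound holds almost everywhere. *)
  exists 0; exists setT; split => //.
  by apply/eqP; move: h; rewrite -leNgt => h; rewrite eq_le h measure_ge0.
exists `|B| => // C BC; have C0 : 0 <= C by exact: le_trans BC.
exists (fun x => clip C (w x)); split.
- exact: measurable_clip.
- by move=> x; exact: clip_norm.
- apply: ae_imp hB => x hx; rewrite clip_id//.
  by apply: le_trans hx (le_trans (ler_norm _) BC).
Qed.

Section initial_flow.
Context {R : realType}.
Notation leb := (@lebesgue_measure R).
Variables (tau : R) (rho0 : finmeas R) (u0 : R -> R) (rho : R -> finmeas R) (u : R -> R -> R).
Hypothesis es : entropy_solution tau rho0 u0 rho u.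
Variables (C : R) (G : R * R -> R) (good : R -> Prop) (g0 : R -> R).
Hypotheses (C0 : 0 <= C) (uC : forall x t, 0 < t -> `|u x t| <= C).
Hypotheses (mG : measurable_fun setT G) (GC : forall p, `|G p| <= C).
Hypotheses (mg : measurable_fun setT g0) (gC : forall x, `|g0 x| <= C)
  (ug : {ae rho0, forall x, u0 x = g0 x}).
Hypothesis good_repr : forall t, good t -> repr_at rho u G t.
Notation M := (total_mass rho0).
Notation D := (`]0%R, M[%classic : set R).

Let ws := es_weak es.
Let mass t : 0 < t -> total_mass (rho t) = M. Proof. exact: (mass_eq ws C0 uC). Qed.

Let slice_u t : 0 < t -> slice (rho t) (u ^~ t) C.
Proof. by move=> t0; apply: slice_wrt => //; [exact: (ws_slice ws)|move=> x; exact: uC]. Qed.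

Let slice_u0 : slice rho0 u0 C. Proof. by exists g0. Qed.

Let bphi (phi : R -> R) K : continuous phi -> (forall x, `|phi x| <= K) -> bm setT phi.
Proof. by move=> cphi phiK; split; [exact: continuous_measurable_fun|exists K => x _]. Qed.

Let bGt t : bm setT (fun x : R => G (x, t)).
Proof.
split; last by exists C => x _.
exact: (measurable_comp (F := setT) (f := G) (g := fun x => (x, t))).
Qed.

Let bg0 : bm setT g0. Proof. by split => //; exists C => x _. Qed.

Lemma flow_init_of_solution : flow_init M C rho G good rho0 g0.
Proof.
split => //.
- move=> phi K cphi phiK; have bp := bphi cphi phiK.
  have := narrow mass (ws_init_rho ws) (ws_init_rho ws) (fun t _ => slice_cst (rho t) 1) (slice_cst rho0 1) cphi phiK.
  have e nu : pairing nu (fun=> 1) phi = \int[leb]_(w in (`]0%R, total_mass nu[%classic : set R)) phi (qf nu w).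
    by rewrite -(push_integral nu bp); apply: eq_Rintegral => x _; rewrite mulr1.
  by rewrite e; apply: tends0_eq => t t0; rewrite e mass.
- move=> phi K cphi phiK; have bp := bphi cphi phiK.
  have := narrow mass (ws_init_rho ws) (ws_init_rhou ws) slice_u slice_u0 cphi phiK.
  rewrite (pairing_slice phi ug) (push_integral rho0 (bmM bp bg0)).
  move=> /(tends0_imp (fun t gt => (good_repr gt).1)); apply: tends0_eq => t gt.
  have [t0 ut] := good_repr gt.
  by rewrite (pairing_slice phi ut) (push_integral (rho t) (bmM bp (bGt t))) mass.
- move=> phi K cphi phiK; have bp := bphi cphi phiK.
  have := narrow mass (ws_init_rho ws) (es_init_rhou2 es) (fun t t0 => slice_sqr (slice_u t0)) (slice_sqr slice_u0) cphi phiK.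
  have ug2 : {ae rho0, forall x, u0 x ^+ 2 = g0 x ^+ 2} by apply: ae_imp ug => x ->.
  rewrite (pairing_slice phi ug2) (push_integral rho0 (bmM bp (bmX 2 bg0))).
  move=> /(tends0_imp (fun t gt => (good_repr gt).1)); apply: tends0_eq => t gt.
  have [t0 ut] := good_repr gt.
  have ut2 : {ae rho t, forall x, u x t ^+ 2 = G (x, t) ^+ 2} by apply: ae_imp ut => x ->.
  by rewrite (pairing_slice phi ut2) (push_integral (rho t) (bmM bp (bmX 2 (bGt t)))) mass.
Qed.

Hypothesis good_ol : forall t, good t -> forall x1 x2 : R, x1 < x2 -> (u x2 t - u x1 t) / (x2 - x1) <= 1 / t.

Lemma one_sided_of_solution : one_sided M C rho G good.
Proof.
move=> t gt; have [t0 [N [mN N0 hN]]] := good_repr gt; exists (u ^~ t); split.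
- by move=> x; exact: uC.
- move=> x y xy; have := good_ol gt xy.
  by rewrite ler_pdivrMr ?subr_gt0// div1r.
exists (D `&` [set w | N (qf (rho t) w)]); split.
- have mX : measurable_fun D (qf (rho t)) by rewrite -(mass t0); exact: (@measurable_qf R (rho t)).
  exact: (mX (measurable_itv _) N mN).
- by have := push_measure (rho t) mN; rewrite N0 mass// => <-.
- move=> w /= nw; split.
    by apply: contrapT => nD; apply: nw => /nD.
  by apply: hN => /= h; apply: nw => _; exact: h.
Qed.

End initial_flow.

Lemma ae_time_prod (R : realType) (P : R -> Prop) :
  {ae (@lebesgue_measure R), forall t, P t} ->
  {ae (@lebesgue_measure R \x @lebesgue_measure R)%E, forall p : R * R, P p.2}.
Proof.
move=> [N [mN N0 hN]]; exists (setT `*` N); split.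
- exact: measurableX.
- transitivity (lebesgue_measure (setT : set R) * lebesgue_measure N)%E; first exact: product_measure1E.
  by rewrite N0 mule0.
- by move=> [x t] /= nP; split => //; exact: hN.
Qed.

Theorem theorem2p4 (R : realType) (tau : R) (rho0 : finmeas R) (u0 : R -> R)
    (rho1 rho2 : R -> finmeas R) (u1 u2 : R -> R -> R) :
  0 < tau <= 1 ->
  u0 \in Lfun rho0 +oo%E ->
  entropy_solution tau rho0 u0 rho1 u1 ->
  entropy_solution tau rho0 u0 rho2 u2 ->
  [/\ {ae (lebesgue_measure \x lebesgue_measure)%E, forall p : R * R,
         0 < p.2 -> m_of rho1 p.1 p.2 = m_of rho2 p.1 p.2},
      forall A, measurable A -> m_x rho1 A = m_x rho2 A &
      {ae m_x rho1, forall p, u1 p.1 p.2 = u2 p.1 p.2}].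
Proof.
move=> /andP[tau0 _] hu0 es1 es2.
have [ws1 ol1 _] := es1; have [ws2 ol2 _] := es2.
have [C1 hC1] := ws_bounded ws1; have [C2 hC2] := ws_bounded ws2.
have [B B0 hB] := slice_of_Lfun hu0.
(* One constant bounds both velocities and the initial one, so the two flows share their
   parameters. *)
pose C := Num.max B (Num.max C1 C2).
have BC : B <= C by rewrite le_max lexx.
have C0 : 0 <= C := le_trans B0 BC.
have uC1 x t : 0 < t -> `|u1 x t| <= C.
  by move=> t0; rewrite (le_trans (hC1 x t t0))// /C !le_max lexx orbT.
have uC2 x t : 0 < t -> `|u2 x t| <= C.
  by move=> t0; rewrite (le_trans (hC2 x t t0))// /C !le_max lexx !orbT.
have [g0 [mg0 gC0 ug0]] := hB C BC.
have [G1 [mG1 GC1 uG1]] := velocity_representative ws1 C0 uC1.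
have [G2 [mG2 GC2 uG2]] := velocity_representative ws2 C0 uC2.
pose ol (u : R -> R -> R) t := forall x1 x2 : R, x1 < x2 -> (u x2 t - u x1 t) / (x2 - x1) <= 1 / t.
(* A common set of good times for both solutions, still of full measure. *)
pose good t := (repr_at rho1 u1 G1 t /\ ol u1 t) /\ (repr_at rho2 u2 G2 t /\ ol u2 t).
have ag : {ae (@lebesgue_measure R), forall t, 0 < t -> good t}.
  apply: ae_imp (ae_and (ae_and uG1 ol1) (ae_and uG2 ol2)) => t [[h1 h2] [h3 h4]] t0.
  by split; split; [split => //; exact: h1|exact: h2|split => //; exact: h3|exact: h4].
have r1 t : good t -> repr_at rho1 u1 G1 t by case=> -[].
have r2 t : good t -> repr_at rho2 u2 G2 t by case=> _ [].
have F1 := flow_of_weak_solution ws1 C0 uC1 mG1 GC1 r1 ag.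
have F2 := flow_of_weak_solution ws2 C0 uC2 mG2 GC2 r2 ag.
have I1 := flow_init_of_solution es1 C0 uC1 mG1 GC1 mg0 gC0 ug0 r1.
have I2 := flow_init_of_solution es2 C0 uC2 mG2 GC2 mg0 gC0 ug0 r2.
have O1 : one_sided (total_mass rho0) C rho1 G1 good.
  by apply: (one_sided_of_solution es1 C0 uC1 r1) => t [[]].
have O2 : one_sided (total_mass rho0) C rho2 G2 good.
  by apply: (one_sided_of_solution es2 C0 uC2 r2) => t [_ []].
have same_m t (A : set R) : good t -> measurable A -> rho1 t A = rho2 t A.
  exact: (flows_same_measure F1 F2 tau0 I1 I2 O1 O2).
have mxE A : measurable A -> m_x rho1 A = m_x rho2 A.
  move=> mA; apply: ae_eq_integral_nm; apply: ae_imp ag => t h.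
  rewrite /= in_itv/= andbT => t0; apply: same_m (h t0) _; exact: measurable_ysection.
split => //.
- apply: ae_imp (ae_time_prod ag) => -[x t] /= h t0.
  exact: (flows_same_cdf F1 F2 tau0 I1 I2 O1 O2 x (h t0)).
have [g1 [mg1 [N1 [mN1 N10 hN1]]]] := ws_measurable ws1.
have [g2 [mg2 [N2 [mN2 N20 hN2]]]] := ws_measurable ws2.
pose E : set (R * R) := [set p | g1 p - g2 p != 0].
have mE : measurable E.
  have md : measurable_fun setT (fun p : R * R => g1 p - g2 p) by exact: measurable_funB.
  have := md measurableT (~` [set 0]) (measurableC (measurable_set1 0)).
  rewrite setTI; congr (measurable _); apply/seteqP; split => p /=; first by move/eqP.
  by move=> /eqP.
(* [m_x] is a bare set function, so the nullity of this union is proved on its sections at almost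
   every time. *)
have mN : measurable (N1 `|` N2 `|` E) by apply: measurableU => //; exact: measurableU.
exists (N1 `|` N2 `|` E); split => //; last first.
  move=> p /= np; apply: contrapT => nN; apply: np.
  have [nN1 nN2 nE] : [/\ ~ N1 p, ~ N2 p & ~ E p].
    by split => h; apply: nN; [left; left|left; right|right].
  have -> : u1 p.1 p.2 = g1 p by apply: contrapT => /hN1.
  have -> : u2 p.1 p.2 = g2 p by apply: contrapT => /hN2.
  by apply/eqP; rewrite -subr_eq0; apply/negPn/negP.
have a1 := m_x_null_sections ws1 C0 uC1 mN1 N10.
have a2 := m_x_null_sections ws2 C0 uC2 mN2 N20.
rewrite /m_x -[RHS](@integral0 _ _ R (@lebesgue_measure R) `]0%R, +oo[%classic).
apply: ae_eq_integral_nm; apply: ae_imp (ae_and ag (ae_and a1 a2)) => t [h [h1 h2]].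
rewrite /= in_itv/= andbT => t0; have gt := h t0.
have {}h1 := h1 t0; have {}h2 := h2 t0.
have mS (S : set (R * R)) : measurable S -> measurable (ysection S t) by exact: measurable_ysection.
rewrite -(same_m t _ gt (mS _ mN2)) in h2.
have hG := flows_same_velocity F1 F2 tau0 I1 I2 O1 O2 gt.
have [_ hu1] := r1 t gt; have [_ hu2] := r2 t gt.
have {}hu2 : {ae rho1 t, forall x, u2 x t = G2 (x, t)}.
  have [N [mN' N0 hN]] := hu2; exists N; split => //.
  by rewrite (same_m t _ gt mN').
have [Q [mQ Q0 hQ]] := ae_and (ae_and hu1 hu2) hG.
have sub : ysection (N1 `|` N2 `|` E) t `<=` ysection N1 t `|` ysection N2 t `|` Q.
  move=> x; rewrite /ysection /= => /set_mem [[n1|n2]|e]; first by left; left; apply/mem_set.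
    by left; right; apply/mem_set.
  have [n1|n1] := pselect (N1 (x, t)); first by left; left; apply/mem_set.
  have [n2|n2] := pselect (N2 (x, t)); first by left; right; apply/mem_set.
  right; apply: hQ => /= -[[e1 e2] e3]; move: e; rewrite /E /=.
  have -> : g1 (x, t) = u1 x t by apply: contrapT => ne; apply: n1; apply: hN1 => /= e; apply: ne.
  have -> : g2 (x, t) = u2 x t by apply: contrapT => ne; apply: n2; apply: hN2 => /= e; apply: ne.
  by rewrite e1 e2 e3 subrr eqxx.
apply/eqP; rewrite eq_le measure_ge0 andbT.
have mU : measurable (ysection N1 t `|` ysection N2 t `|` Q).
  by apply: measurableU => //; apply: measurableU; exact: mS.
rewrite -[X in (_ <= X)%E](_ : rho1 t (ysection N1 t `|` ysection N2 t `|` Q) = 0%E).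
  by apply: le_measure; rewrite ?inE//; exact: mS.
rewrite null_set_setU//; last 2 first.
- by apply: measurableU; exact: mS.
- by rewrite null_set_setU//; exact: mS.
Qed.
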